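(* Fix any $\alpha>0$ and $T>0$. Then there exists a probability measure $\widehat\Theta_{\alpha,T}$ on the space $\widehat{\mathcal Y}$, namely $$\widehat\Theta_{\alpha,T}(d\hat\xi\,d\hat u)=\frac{e^{\alpha c(T)}}{Z_{\alpha,T}}\Big[\Big(\sqrt{\tfrac2\pi}\Big)^{n(\hat\xi)}\Phi(\hat\xi,\hat u)\,d\hat u\Big]\,\Gamma_{\alpha,T}(d\hat\xi),$$ such that $$\widehat{\mathbb P}_{\alpha,T}(\cdot)=\int_{\widehat{\mathcal Y}}\mathbf P_{\hat\xi,\hat u}(\cdot)\,\widehat\Theta_{\alpha,T}(d\hat\xi\,d\hat u),$$ where, for any $(\hat\xi,\hat u)\in\widehat{\mathcal Y}$, $\mathbf P_{\hat\xi,\hat u}$ is the centered Gaussian measure on increments described in the context.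
   Context: $\mathbb P$ is the law of three-dimensional Brownian motion on $C((-\infty,\infty);\mathbb R^3)$, considered only on the $\sigma$-field generated by the increments $\omega(t)-\omega(s)$, $-\infty<s<t<\infty$; $\mathbb E^{\mathbb P}$ is its expectation. The (finite-volume) Polaron measure is $$\widehat{\mathbb P}_{\alpha,T}(d\omega)=\frac1{Z_{\alpha,T}}\exp\Big\{\frac\alpha2\int_{-T}^T\int_{-T}^T\frac{e^{-|t-s|}}{|\omega(t)-\omega(s)|}\,dt\,ds\Big\}\,\mathbb P(d\omega),$$ regarded as a measure on increments over $[-T,T]$, where $Z_{\alpha,T}<\infty$ is the normalizing constant. $\mathcal X_n$ is the space of collections $\hat\xi=\{[s_1,t_1],\dots,[s_n,t_n]\}$ of $n$ (possibly overlapping) intervals; $n(\hat\xi)=n$; $\widehat{\mathcal X}=\bigcup_{n\ge0}\mathcal X_n$ and $\widehat{\mathcal Y}=\bigcup_{n\ge0}(\mathcal X_n\otimes(0,\infty)^n)$. $\Gamma_{\alpha,T}$ is the law (a probability measure on $\widehat{\mathcal X}$) of the Poisson point process of intervals $[s,t]$ with intensity measure $\gamma_{\alpha,T}(ds\,dt)=\alpha e^{-(t-s)}1_{-T\le s<t\le T}\,ds\,dt$, and $\alpha c(T)=\iint\gamma_{\alpha,T}(ds\,dt)$ is its total mass. For $(\hat\xi,\hat u)\in\widehat{\mathcal Y}$ with $\hat u=(u_1,\dots,u_n)$, $$\Phi(\hat\xi,\hat u)=\mathbb E^{\mathbb P}\Big[\exp\Big\{-\tfrac12\sum_{i=1}^nu_i^2|\omega(t_i)-\omega(s_i)|^2\Big\}\Big].$$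 Let $\mathcal M_0$ be the space of compactly supported signed measures $\mu$ on $\mathbb R$ with $\mu(\mathbb R)=0$, and for $\mu\in\mathcal M_0$ put $$\mathcal Q_{\hat\xi,\hat u}(\mu)=\sup_{\omega(\cdot)}\Big[2\int\omega(s)\mu(ds)-\int[\omega'(s)]^2ds-\sum_{i=1}^nu_i^2[\omega(t_i)-\omega(s_i)]^2\Big],$$ the supremum being over real-valued absolutely continuous $\omega$ with square integrable derivative. $P_{\hat\xi,\hat u}$ is the centered Gaussian law on increments of real-valued paths with $\mathbb E^{P_{\hat\xi,\hat u}}[(\int\omega(s)\mu(ds))^2]=\mathcal Q_{\hat\xi,\hat u}(\mu)$ for all $\mu\in\mathcal M_0$, and $\mathbf P_{\hat\xi,\hat u}$ is the three-dimensional version obtained from three independent copies of $P_{\hat\xi,\hat u}$ as the coordinates. *)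

(* Defs.v *)
From HB Require Import structures.
From mathcomp Require Import all_boot all_order all_algebra.
From mathcomp Require Import all_classical all_reals all_analysis.
Import Order.TTheory GRing.Theory Num.Theory.
Import numFieldNormedType.Exports.

Set Implicit Arguments.
Unset Strict Implicit.
Unset Printing Implicit Defensive.

Local Open Scope classical_set_scope.
Local Open Scope ring_scope.

(* The sigma-field on C(R; R) and C(R; R^3) is the one generated
   by the increments, not the full Borel sigma-field. *)
HB.instance Definition _ (X : topologicalType) (Y : ptopologicalType) :=
  isPointed.Build (continuousType X Y) (mkcts (@cst_continuous X Y point)).

Section paths.
Context (R : realType).

Definition coordinate (i : 'I_3) (w : continuousType R 'rV[R]_3) :
    continuousType R R :=
  mkcts (fun t : R =>
    continuous_comp (@cts_fun _ _ w t) (@coord_continuous R _ _ 0 i (w t))).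

Definition increment_events1 (I : set R) : set (set (continuousType R R)) :=
  [set A | exists s t (B : set R), [/\ I s, I t, s < t, measurable B &
    A = [set w : continuousType R R | B (w t - w s)]]].

Definition increment_events3 (I : set R) :
    set (set (continuousType R 'rV[R]_3)) :=
  [set A | exists i, exists2 B, increment_events1 I B &
    A = coordinate i @^-1` B].

Definition path1 := g_sigma_algebraType (increment_events1 [set: R]).
HB.instance Definition _ := Measurable.on path1.
Definition path3 := g_sigma_algebraType (increment_events3 [set: R]).
HB.instance Definition _ := Measurable.on path3.

End paths.

Section brownian.
Context (R : realType).

(* The norm of 'rV[R]_3 in the library is the sup norm. *)
Definition enorm (x : 'rV[R]_3) : R := Num.sqrt (\sum_(i < 3) x 0 i ^+ 2).

(* Increments over successive time intervals, and their three coordinates,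
   are independent and centered normal with variance the elapsed time. *)
Definition brownian_law (P : probability (path3 R) R) : Prop :=
  forall (t : nat -> R) (n : nat) (B : nat -> 'I_3 -> set R),
    {homo t : i j / (i < j)%N >-> i < j} ->
    (forall k i, measurable (B k i)) ->
    P [set w : path3 R |
        forall (k : 'I_n) (i : 'I_3), B k i ((w (t k.+1) - w (t k)) 0 i)] =
    (\prod_(k < n) \prod_(i < 3)
      normal_prob 0 (Num.sqrt (t k.+1 - t k)) (B k i))%E.

Definition polaron_weight (alpha T : R) (w : path3 R) : \bar R :=
  let I : set R := `[- T, T]%classic in
  expeR ((alpha / 2)%:E *
    \int[lebesgue_measure]_(t in I) \int[lebesgue_measure]_(s in I)
      ((expR (- `|t - s|))%:E / (enorm (w t - w s))%:E))%E.

Definition polaron_Z (alpha T : R) (P : probability (path3 R) R) : \bar R :=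
  (\int[P]_w polaron_weight alpha T w)%E.

Definition polaron (alpha T : R) (P : probability (path3 R) R)
    (A : set (path3 R)) : \bar R :=
  ((polaron_Z alpha T P)^-1 * \int[P]_(w in A) polaron_weight alpha T w)%E.

End brownian.

(* A finite collection of points of E, possibly with repetitions, is given by
   a listing of its points. The sigma-field is generated by the numbers of
   points in measurable sets, so that it does not see the order of listing. *)
Section configurations.
Context d (E : measurableType d).

HB.instance Definition _ := isPointed.Build (seq E) [::].

Definition npoints (A : set E) (x : seq E) : nat := count (mem A) x.

Definition count_events : set (set (seq E)) :=
  [set X | exists (A : set E) (k : nat),
    measurable A /\ X = [set x | npoints A x = k]].

Definition config := g_sigma_algebraType count_events.
HB.instance Definition _ := Measurable.on config.

(* For the law poisson_prob, the second argument is a dummy one. *)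
Definition poisson_process_law (R : realType) (m : set E -> \bar R)
    (G : probability config R) : Prop :=
  forall (n : nat) (A : 'I_n -> set E) (k : 'I_n -> nat),
    (forall i, measurable (A i)) -> trivIset [set: 'I_n] A ->
    G [set x : config | forall i, npoints (A i) x = k i] =
    (\prod_(i < n) poisson_prob (fine (m (A i))) 0%N [set k i])%E.

End configurations.

(* An interval [s, t] is the pair (s, t); an element (xi, u) of the space of
   marked collections is the listing of the triples (s_i, t_i, u_i). *)
Section marked_intervals.
Context (R : realType).

Definition marked_collections : set (config (R * R * R)%type) :=
  [set y | forall p, p \in (y : seq (R * R * R)) -> p.1.1 < p.1.2 /\ 0 < p.2].

Definition polaron_intensity (alpha T : R) (A : set (R * R)) : \bar R :=
  (\int[lebesgue_measure \x lebesgue_measure]_(p in A)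
    (if [&& - T <= p.1, p.1 < p.2 & p.2 <= T]
     then alpha * expR (- (p.2 - p.1)) else 0)%:E)%E.

(* Integral of f over the marks (u_1, ..., u_n) in (0, oo)^n attached to the
   n points of xi. *)
Fixpoint mark_integral (xi : seq (R * R)) (f : seq (R * R * R) -> \bar R) :
    \bar R :=
  if xi is p :: xi' then
    (\int[lebesgue_measure]_(u in `]0%R, +oo[)
      mark_integral xi' (fun y => f ((p, u) :: y)))%E
  else f [::].

Definition Phi (P : probability (path3 R) R) (y : seq (R * R * R)) : \bar R :=
  (\int[P]_w (expR (- 2^-1 *
    \sum_(p <- y) p.2 ^+ 2 * enorm (w p.1.2 - w p.1.1) ^+ 2))%:E)%E.

Definition polaron_mixing (alpha T : R) (P : probability (path3 R) R)
    (Gamma : probability (config (R * R)%type) R)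
    (B : set (config (R * R * R)%type)) : \bar R :=
  ((expR (fine (polaron_intensity alpha T [set: R * R])))%:E
     / polaron_Z alpha T P *
   \int[Gamma]_xi mark_integral xi (fun y =>
     (Num.sqrt (2 / pi) ^+ size y)%:E * Phi P y * (\1_B y)%:E))%E.

End marked_intervals.

Section gaussian.
Context (R : realType).

(* Integral against a signed measure; the result does not depend on the chosen
   Hahn decomposition. *)
Definition charge_integral (mu : {charge set (measurableTypeR R) -> \bar R})
    (f : R -> R) : R :=
  let: exist A hA := cid (Hahn_decomposition mu) in
  let: exist B hAB := cid hA in
  \int[jordan_pos hAB]_s f s - \int[jordan_neg hAB]_s f s.

Definition balanced_charge (mu : {charge set (measurableTypeR R) -> \bar R}) :
    Prop :=
  mu setT = 0%E /\
  exists r : R, forall A : set R, measurable A -> A `<=` ~` `[- r, r] ->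
    mu A = 0%E.

Definition abs_continuous_on (a b : R) (f : R -> R) : Prop :=
  forall e : R, 0 < e -> exists2 del : R, 0 < del &
    forall (n : nat) (s t : 'I_n -> R),
      (forall k, [/\ a <= s k, s k <= t k & t k <= b]) ->
      trivIset [set: 'I_n] (fun k => `]s k, t k[%classic) ->
      \sum_(k < n) (t k - s k) < del ->
      \sum_(k < n) `|f (t k) - f (s k)| < e.

Definition finite_energy : set (R -> R) :=
  [set f | (forall a b, a < b -> abs_continuous_on a b f) /\
    lebesgue_measure.-integrable [set: R] (fun s => (derive1 f s ^+ 2)%:E)].

Definition Qform (y : seq (R * R * R))
    (mu : {charge set (measurableTypeR R) -> \bar R}) : \bar R :=
  ereal_sup [set (2 * charge_integral mu f
      - \int[lebesgue_measure]_s (derive1 f s ^+ 2)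
      - \sum_(p <- y) p.2 ^+ 2 * (f p.1.2 - f p.1.1) ^+ 2)%:E
    | f in finite_energy].

(* normal_prob 0 0 is not the Dirac mass in the library. *)
Definition centered_normal (s : R) (B : set R) : \bar R :=
  if s == 0 then \d_(0 : R)%R B else normal_prob 0 s B.

Definition gaussian_law1 (y : seq (R * R * R)) (P : probability (path1 R) R) :
    Prop :=
  forall mu : {charge set (measurableTypeR R) -> \bar R}, balanced_charge mu ->
    (exists s : R, forall B : set R, measurable B ->
      P [set w : path1 R | B (charge_integral mu w)] = centered_normal s B) /\
    (\int[P]_w (charge_integral mu w ^+ 2)%:E)%E = Qform y mu.

(* The coordinates are independent with law P. *)
Definition three_copies (P : probability (path1 R) R)
    (P3 : probability (path3 R) R) : Prop :=
  forall A : 'I_3 -> set (path1 R), (forall i, measurable (A i)) ->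
    P3 [set w : path3 R | forall i, A i (coordinate i w)] =
    (\prod_(i < 3) P (A i))%E.

Definition gaussian_law3 (y : seq (R * R * R)) (P3 : probability (path3 R) R) :
    Prop :=
  exists2 P : probability (path1 R) R, gaussian_law1 y P & three_copies P P3.

End gaussian.

(* Main.v *)
Require Import Defs.
From HB Require Import structures.
From mathcomp Require Import all_boot all_order all_algebra.
From mathcomp Require Import all_classical all_reals all_analysis.
From mathcomp Require Import measurable_realfun.
From mathcomp Require Import ring lra.
Import Order.TTheory GRing.Theory Num.Theory.
Import numFieldNormedType.Exports.

Set Implicit Arguments.
Unset Strict Implicit.
Unset Printing Implicit Defensive.

Local Open Scope classical_set_scope.
Local Open Scope ring_scope.

(* Since [1 / r] is the integral of [sqrt (2 / pi) exp (- u^2 r^2 / 2)] over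
   [u > 0], and since [exp (int V dgamma)] is, up to the factor
   [exp (gamma setT)], the mean of the product of the values of [V] at the
   points of a Poisson process of intensity [gamma], the polaron weight is a
   superposition of the weights [exp (- sum_i u_i^2 |w t_i - w s_i|^2 / 2)],
   whose Brownian integrals are the values of [Phi].

   The Brownian law tilted by such a weight is Gaussian: writing each factor
   [exp (- u^2 x^2 / 2)] as the mean of [cos (u x z)] for a standard normal [z]
   leads to its characteristic function, whose covariance arises from that of
   Brownian motion by one rank one update per factor and solves the variational
   problem that defines [Qform].

   The partition function is finite because the n-th moment of [int V dgamma]
   is at most [b^n sqrt (n!)]. Indeed the n-th moment under a tilted law is
   obtained by adding n intervals [s, t] with marks [u], each at the cost
   [(1 + u^2 v)^(- 3 / 2)] where [v] is the variance of the increment over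
   [s, t] given the previous ones. If [d] is the distance from [t] to [s] and to
   the endpoints of the other intervals, then [v >= d / 2], as one sees by
   testing with a tent of width [2 d] around [t], which the other increments do
   not feel. Integration over [u], [s] and [t] turns the cost of the m-th
   interval into a multiple of [sqrt m]. *)

(** Two sigma-fields shape the proof. That of configurations does not see the order of listing,
    while [mark_integral] follows a listing; so measurability of a mark integral in the
    configuration cannot come from recursion and is won from multiplicative functionals, for which
    the order is irrelevant. That of paths sees only increments, so an integral of [w] against a
    balanced charge is first rewritten as a limit of sums of increments; minus the distribution
    function of the charge is then the vector of L2 that represents it, and all covariances are
    computed on such vectors. Laws are compared through the integrals of cos (x + t), the phase t
    doing the work of complex exponentials. As 1 + cos is nonnegative it can serve as a density, and
    uniqueness on the line then yields uniqueness for families of variables, and independence. The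
    Poisson formula is used for bounded functions, whereas 1 / |w t - w s| is unbounded; the marks
    are therefore cut at n, and n tends to infinity on both sides. *)

Section ge0_measurable_ind.
Local Open Scope ereal_scope.
Context d (T : measurableType d) (R : realType).
Import HBNNSimple.

(** Such a function is the increasing limit of simple ones, and a simple function is a finite sum of
    multiples of indicators of its level sets. The closure conditions hand over measurability and
    sign, so that additivity and monotone convergence of integrals apply in each case. *)
Lemma ge0_measurable_ind (K : (T -> \bar R) -> Prop) :
  (forall A, measurable A -> K (fun x => (\1_A x)%:E)) ->
  (forall (k : R) (f : T -> \bar R), (0 <= k)%R -> measurable_fun setT f ->
    (forall x, 0 <= f x) -> K f -> K (fun x => k%:E * f x)) ->
  (forall f g : T -> \bar R, measurable_fun setT f -> measurable_fun setT g ->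
    (forall x, 0 <= f x) -> (forall x, 0 <= g x) -> K f -> K g ->
    K (fun x => f x + g x)) ->
  (forall f_ : (T -> \bar R)^nat, (forall n, measurable_fun setT (f_ n)) ->
    (forall n x, 0 <= f_ n x) -> (forall x, nondecreasing_seq (f_ ^~ x)) ->
    (forall n, K (f_ n)) -> K (fun x => limn (f_ ^~ x))) ->
  forall f : T -> \bar R, measurable_fun setT f -> (forall x, 0 <= f x) -> K f.
Proof.
move=> Kind Kscale Kadd Klim f mf f0.
pose g := nnsfun_approx measurableT mf.
have -> : f = fun x => limn (fun n => (g n x)%:E).
  apply/funext => x; apply/esym/cvg_lim => //.
  exact: (cvg_nnsfun_approx measurableT mf (fun x _ => f0 x) Logic.I).
apply: Klim.
- by move=> n; apply/measurable_EFinP.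
- by move=> n x; rewrite lee_fin.
- by move=> x m n mn; rewrite lee_fin; exact/lefP/nd_nnsfun_approx.
move=> n.
rewrite (_ : (fun x => _) = (fun x => \sum_(y <- finmap.enum_fset (fset_set (range (g n))))
    (y%:E * (\1_(g n @^-1` [set y]) x)%:E))); last first.
  by apply/funext => x; rewrite fimfunE fsbig_finite//= -sumEFin.
have : forall y, y \in finmap.enum_fset (fset_set (range (g n))) -> (0 <= y)%R.
  by move=> y; rewrite in_fset_set// inE => -[x _ <-].
elim: (finmap.enum_fset (fset_set (range (g n)))) => [_|y s IH ys].
  (* The empty sum is the indicator of the empty set. *)
  rewrite (_ : (fun x => _) = (fun x => (\1_(set0 : set T) x)%:E)).
    exact: Kind.
  by apply/funext => x; rewrite big_nil indic0.
have y0 : (0 <= y)%R by apply: ys; rewrite inE eqxx.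
have ms : measurable_fun setT (fun x =>
    \sum_(y <- s) (y%:E * (\1_(g n @^-1` [set y]) x)%:E)).
  apply: emeasurable_sum => z; apply: measurable_funeM.
  by apply/measurable_EFinP; exact: measurable_indic.
have s0 x : 0 <= \sum_(y <- s) (y%:E * (\1_(g n @^-1` [set y]) x)%:E).
  rewrite big_seq; apply: sume_ge0 => z zs; apply: mule_ge0.
    by rewrite lee_fin; apply: ys; rewrite inE zs orbT.
  by rewrite lee_fin.
have m1 : measurable_fun setT (fun x => (\1_(g n @^-1` [set y]) x)%:E : \bar R).
  by apply/measurable_EFinP; exact: measurable_indic.
rewrite (_ : (fun x => _) = (fun x => y%:E * (\1_(g n @^-1` [set y]) x)%:E +
   \sum_(y <- s) (y%:E * (\1_(g n @^-1` [set y]) x)%:E))); last first.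
  by apply/funext => x; rewrite big_cons.
apply: Kadd => //.
- exact: measurable_funeM.
- by move=> x; rewrite mule_ge0// lee_fin.
- by apply: Kscale => //; exact: Kind.
- by apply: IH => z zs; apply: ys; rewrite inE zs orbT.
Qed.
End ge0_measurable_ind.

(** * Measurability on spaces of configurations *)

Arguments npoints : simpl never.

Section config_measurability.
Context d (E : measurableType d).

Lemma measurable_npoints_set (A : set E) (k : nat) : measurable A ->
  measurable ([set y | npoints A y = k] : set (config E)).
Proof. by move=> mA; apply: sub_sigma_algebra; exists A, k. Qed.

Lemma measurable_npoints (A : set E) : measurable A ->
  measurable_fun setT (npoints A : config E -> nat).
Proof.
move=> mA _ Y _; rewrite setTI.
rewrite (_ : _ @^-1` Y = \bigcup_(k in Y) [set y | npoints A y = k]).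
  by apply: bigcup_measurable => k _; exact: measurable_npoints_set.
by apply/seteqP; split=> [y /= Yy|y [k Yk /= Nk]]; [exists (npoints A y)|rewrite Nk].
Qed.

Lemma measurable_fun_config d' (X : measurableType d') (f : X -> config E) :
  (forall A k, measurable A -> measurable [set x | npoints A (f x) = k]) ->
  measurable_fun setT f.
Proof.
move=> mf; apply: (@measurability _ _ X (config E) setT f (@count_events d E)) => //.
move=> _ [_ [A [k [mA ->]] <-]]; rewrite setTI; exact: mf.
Qed.

Lemma npoints_cons (A : set E) p y : npoints A (p :: y) = ((p \in A) + npoints A y)%N.
Proof. by []. Qed.

(** Only counts have to be measured, and adding a point to a listing raises the count of [A] by one
    or by zero according to whether the point lies in [A]. *)
Lemma measurable_config_cons d' (X : measurableType d') (f : X -> E)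
    (g : X -> config E) : measurable_fun setT f -> measurable_fun setT g ->
  measurable_fun setT (fun x => f x :: g x : config E).
Proof.
move=> mf mg; apply: measurable_fun_config => A k mA.
have mN : measurable_fun setT (fun x => npoints A (g x)).
  by apply: (@measurableT_comp _ _ _ _ _ _ (npoints A : config E -> nat)) => //;
    exact: measurable_npoints.
have mfA : measurable (f @^-1` A) by rewrite -[X in measurable X]setTI; exact: mf.
have mNk j : measurable [set x | npoints A (g x) = j].
  by rewrite -[X in measurable X]setTI; exact: (mN measurableT [set j]).
(* The predecessor of [k] is written as a union over [j.+1 = k], which is empty when [k = 0]. *)
rewrite (_ : [set x | _] =
    (f @^-1` A `&` \bigcup_(j in [set j | j.+1 = k]) [set x | npoints A (g x) = j])
    `|` (~` (f @^-1` A) `&` [set x | npoints A (g x) = k])).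
  apply: measurableU; apply: measurableI => //.
  - by apply: bigcup_measurable => j _.
  - exact: measurableC.
apply/seteqP; split => x /=; rewrite npoints_cons.
  have [Afx <-|Afx <-] := boolP (f x \in A).
    by left; rewrite inE in Afx; split => //; exists (npoints A (g x)).
  by right; split => // /mem_set; exact/negP.
move=> [[Afx [j jk Nj]]|[nAfx Nk]].
  by rewrite mem_set// -jk -Nj.
by rewrite memNset.
Qed.

Lemma measurable_config_size : measurable_fun setT (size : config E -> nat).
Proof.
rewrite (_ : size = (npoints [set: E])); first exact: measurable_npoints.
apply/funext => y; rewrite /npoints -(@eq_count _ xpredT) ?count_predT// => p.
by apply/esym; exact: (mem_set Logic.I).
Qed.

End config_measurability.

(** * Counts and products over a configuration, jointly measurable with a parameter *)

Section prod_measurability.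
Context d (E : measurableType d) d' (X : measurableType d') (R : realType).
Import HBNNSimple.

(** Dynkin's argument starting from rectangles. The count is read as a real number so that
    complements become differences and disjoint unions become limits of sums. *)
Lemma measurable_count_section (C : set (X * E)) : measurable C ->
  measurable_fun setT
    (fun z : X * config E => (count (fun p => (z.1, p) \in C) z.2)%:R : R).
Proof.
pose G := [set A `*` B | A in @measurable _ X & B in @measurable _ E].
have GE : @measurable _ (X * E)%type = <<s G >> by exact: measurable_prod_measurableType.
rewrite GE; move: C.
apply: (dynkin_induction (P := fun C => measurable_fun setT
    (fun z : X * config E => (count (fun p => (z.1, p) \in C) z.2)%:R : R)) GE).
- move=> _ _ [A mA [B mB <-]] [A' mA' [B' mB' <-]]; rewrite -setXI.
  exists (A `&` A'); first exact: measurableI.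
  by exists (B `&` B') => //; exact: measurableI.
- apply: (eq_measurable_fun (fun z : X * config E => (size z.2)%:R : R)).
    move=> z _; rewrite (@eq_count _ _ xpredT) ?count_predT// => p.
    exact: (mem_set Logic.I).
  apply: (@measurableT_comp _ _ _ _ _ _ (fun n : nat => n%:R : R)) => //.
  apply: (@measurableT_comp _ _ _ _ _ _ (size : config E -> nat)) => //.
  exact: measurable_config_size.
- move=> _ [A mA [B mB <-]].
  apply: (eq_measurable_fun (fun z : X * config E =>
    \1_A z.1 * (npoints B z.2)%:R : R)).
    move=> z _; rewrite indicE; have [zA|zA] := boolP (z.1 \in A).
      rewrite mul1r; congr (_%:R); apply: eq_count => p /=.
      by apply/idP/idP; rewrite !inE/=; [split => //; rewrite inE in zA|case].
    rewrite mul0r (eq_count (a2 := xpred0)) ?count_pred0// => p.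
    by apply/negP; rewrite inE/= => -[/mem_set]; rewrite (negbTE zA).
  apply: measurable_funM.
    by apply: (@measurableT_comp _ _ _ _ _ _ (\1_A : X -> R)) => //; exact: measurable_indic.
  apply: (@measurableT_comp _ _ _ _ _ _ (fun n : nat => n%:R : R)) => //.
  apply: (@measurableT_comp _ _ _ _ _ _ (npoints B : config E -> nat)) => //.
  exact: measurable_npoints.
- move=> C mC IH.
  apply: (eq_measurable_fun (fun z : X * config E =>
    (size z.2)%:R - (count (fun p => (z.1, p) \in C) z.2)%:R : R)).
    move=> z _; rewrite -(count_predC (fun p => (z.1, p) \in C) z.2) natrD [X in X - _]addrC addrK.
    by congr (_%:R); apply: eq_count => p /=; rewrite in_setC.
  apply: measurable_funB => //.
  apply: (@measurableT_comp _ _ _ _ _ _ (fun n : nat => n%:R : R)) => //.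
  apply: (@measurableT_comp _ _ _ _ _ _ (size : config E -> nat)) => //.
  exact: measurable_config_size.
- move=> F mF tF IH.
  apply: (@measurable_fun_cvg _ _ _ _ (fun n (z : X * config E) =>
    \sum_(k < n) (count (fun p => (z.1, p) \in F k) z.2)%:R : R)).
    by move=> n; apply: measurable_sum => k; exact: IH.
  move=> z _; elim: z.2 => [|p s IHs].
    by under eq_fun do rewrite big1//; exact: cvg_cst.
  rewrite (_ : (fun n => _) = (fun n => \sum_(k < n) ((z.1, p) \in F k)%:R +
      \sum_(k < n) (count (fun p => (z.1, p) \in F k) s)%:R)); last first.
    apply/funext => n; rewrite -big_split/=; apply: eq_bigr => k _.
    by rewrite natrD.
  rewrite /= natrD; apply: cvgD => //.
  (* A point lies in at most one [F k], so its contributions are eventually constant in [n]. *)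
  have [/set_mem[k _ Fk]|nF] := boolP ((z.1, p) \in \bigcup_k F k).
    apply: cvg_near_cst; near=> n.
    have kn : (k < n)%N by near: n; exists k.+1.
    rewrite (bigD1 (Ordinal kn))//= mem_set// big1 ?addr0// => j jk.
    rewrite memNset// => Fj; move/negP: jk; apply; apply/eqP/val_inj => /=.
    by apply: (tF j k) => //; exists (z.1, p).
  apply: cvg_near_cst; near=> n.
  rewrite big1// => k _; rewrite memNset// => Fk; move/negP: nF; apply.
  by rewrite inE; exists k.
Unshelve. all: by end_near. Qed.

(** If [h] is simple, grouping the points by the value [c] of [h] gives a finite product of powers
    of [c] whose exponents are counts. The general case is a pointwise limit. *)
Lemma measurable_prod_section (h : X * E -> R) : measurable_fun setT h ->
  (forall z, 0 <= h z) ->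
  measurable_fun setT (fun z : X * config E => \prod_(p <- z.2) h (z.1, p)).
Proof.
move=> mh h0.
have mh' : measurable_fun setT (EFin \o h) by exact/measurable_EFinP.
pose g := nnsfun_approx measurableT mh'.
apply: (@measurable_fun_cvg _ _ _ _ (fun n (z : X * config E) =>
    \prod_(p <- z.2) g n (z.1, p))); last first.
  move=> z _; elim: z.2 => [|p s IH].
    by under eq_fun do rewrite big_nil; rewrite big_nil; exact: cvg_cst.
  under eq_fun do rewrite big_cons; rewrite big_cons; apply: cvgM => //.
  have /fine_cvgP[_] := @cvg_nnsfun_approx _ _ _ _ measurableT _ mh' (fun x _ => h0 x) (z.1, p) Logic.I.
  exact.
move=> n.
pose r := finmap.enum_fset (fset_set (range (g n))).
apply: (eq_measurable_fun (fun z : X * config E =>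
   \prod_(c <- r) c ^+ count (fun p => (z.1, p) \in g n @^-1` [set c]) z.2)).
  move=> z _; elim: z.2 => [|p s IH].
    by rewrite big_nil big1.
  rewrite big_cons -IH /=.
  have gr : g n (z.1, p) \in r.
    by rewrite /r in_fset_set//; rewrite inE; exists (z.1, p).
  rewrite (bigD1_seq _ gr) ?finmap.fset_uniq//= [in RHS](bigD1_seq _ gr) ?finmap.fset_uniq//=.
  rewrite mem_set//= exprS !mulrA; congr (_ * _).
  apply: eq_bigr => c cg; rewrite memNset//= => gc; move: cg.
  by rewrite -gc eqxx.
apply: measurable_prod => c _.
have := measurable_count_section (measurable_funP (g n) measurableT [set c] (measurable_set1 c)).
rewrite setTI => mc.
pose q := fun n : nat => c ^+ n.
have -> : (fun z : X * config E =>
    c ^+ count (fun p => (z.1, p) \in g n @^-1` [set c]) z.2) =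
  q \o (fun z : X * config E => count (fun p => (z.1, p) \in g n @^-1` [set c]) z.2) by [].
apply: measurableT_comp => //.
(* The count with values in the naturals is recovered from its real version by writing [Y] as a
   union of singletons. *)
move=> _ Y _; rewrite setTI.
rewrite (_ : _ @^-1` Y = (fun z : X * config E =>
   (count (fun p => (z.1, p) \in g n @^-1` [set c]) z.2)%:R : R) @^-1`
   (\bigcup_(k in Y) [set k%:R])).
  rewrite -[X in measurable X]setTI; apply: mc => //.
  by apply: bigcup_measurable => k _; exact: measurable_set1.
apply/seteqP; split => z /=; first by move=> Yz; eexists; [exact: Yz|].
by move=> [k Yk /eqP]; rewrite eqr_nat => /eqP ->.
Qed.

End prod_measurability.

(** * Integration over the marks *)

Section integral_param.
Local Open Scope ereal_scope.
Context d1 d2 (X : measurableType d1) (Y : measurableType d2) (R : realType).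
Implicit Types (f : X * Y -> \bar R).

Lemma integral_in_setX (m : {measure set Y -> \bar R}) (A : set X) (B : set Y) f x :
  (\int[m]_y ((f \_ (A `*` B)) (x, y))) =
  ((fun x => \int[m]_(y in B) f (x, y)) \_ A) x.
Proof.
rewrite [RHS]/patch; case: ifPn => xA; last first.
  rewrite integral0_eq// => y _; rewrite patchE ifF//.
  by apply/negbTE/negP; rewrite inE/= => -[/mem_set]; rewrite (negbTE xA).
rewrite [RHS]integral_mkcond; apply: eq_integral => y _; rewrite !patchE.
congr (if _ then _ else _); apply/idP/idP; rewrite !inE/=; last by move=> ?; split => //; rewrite inE in xA.
by case.
Qed.

Lemma measurable_fun_integral_param (m : {sigma_finite_measure set Y -> \bar R})
    (B : set Y) f : measurable B -> measurable_fun setT f -> (forall z, 0 <= f z) ->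
  measurable_fun setT (fun x => \int[m]_(y in B) f (x, y)).
Proof.
move=> mB mf f0.
rewrite (_ : (fun x => _) = fubini_F m (f \_ (setT `*` B))).
  apply: measurable_fun_fubini_tonelli_F.
    apply/(@measurable_restrictT _ _ _ _ (setT `*` B)); first exact: measurableX.
    exact: measurable_funTS.
  by move=> z; rewrite patchE; case: ifP.
by apply/funext => x; rewrite /fubini_F integral_in_setX patch_setT.
Qed.

(** Reduced to the whole product space by extending [f] by zero off [A x B]. *)
Lemma tonelli_in (m1 : {sigma_finite_measure set X -> \bar R})
    (m2 : {sigma_finite_measure set Y -> \bar R}) (A : set X) (B : set Y) f :
  measurable A -> measurable B -> measurable_fun setT f -> (forall z, 0 <= f z) ->
  \int[m1]_(x in A) \int[m2]_(y in B) f (x, y) =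
  \int[m2]_(y in B) \int[m1]_(x in A) f (x, y).
Proof.
move=> mA mB mf f0.
have := @fubini_tonelli _ _ _ _ _ m1 m2 (f \_ (A `*` B)).
rewrite (_ : (fun x => \int[m2]_y _) =
    (fun x => \int[m2]_(y in B) f (x, y)) \_ A); last first.
  by apply/funext => x; rewrite integral_in_setX.
rewrite (_ : (fun y => \int[m1]_x _) =
    (fun y => \int[m1]_(x in A) f (x, y)) \_ B); last first.
  apply/funext => y; rewrite [RHS]/patch; case: ifPn => yB; last first.
    rewrite integral0_eq// => x _; rewrite patchE ifF//.
    by apply/negbTE/negP; rewrite inE/= => -[_ /mem_set]; rewrite (negbTE yB).
  rewrite [RHS]integral_mkcond; apply: eq_integral => x _; rewrite !patchE.
  congr (if _ then _ else _); apply/idP/idP; rewrite !inE/=; last by move=> ?; split => //; rewrite inE in yB.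
  by case.
rewrite -!integral_mkcond; apply.
- apply/(@measurable_restrictT _ _ _ _ (A `*` B)); first exact: measurableX.
  exact: measurable_funTS.
- by move=> z; rewrite patchE; case: ifP.
Qed.

End integral_param.

Section mark_integral_theory.
Context (R : realType).
Local Notation mark := (R * R * R)%type.
Local Open Scope ereal_scope.
Implicit Types (xi : seq (R * R)) (f g : config mark -> \bar R).

Let mD : measurable (`]0%R, +oo[%classic : set R). Proof. exact: measurable_itv. Qed.

Lemma mark_integral_ge0 xi f : (forall y, 0 <= f y) -> 0 <= mark_integral xi f.
Proof.
elim: xi f => [|p xi IH] f f0 //=.
by apply: integral_ge0 => u _; exact: IH.
Qed.

(** The parameter space is arbitrary because the induction moves the mark of the first point into
    the parameter. *)
Lemma measurable_mark_integral_param d (X : measurableType d) xi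
    (f : X * config mark -> \bar R) : measurable_fun setT f ->
  (forall z, 0 <= f z) ->
  measurable_fun setT (fun x => mark_integral xi (fun y => f (x, y))).
Proof.
elim: xi d X f => [|p xi IH] d X f mf f0 /=.
  by apply: (measurableT_comp mf); exact: pair2_measurable.
apply: (@measurable_fun_integral_param _ _ X _ R lebesgue_measure _ (fun z : X * R =>
    mark_integral xi (fun y => f (z.1, (p, z.2) :: y)))) => //; last first.
  by move=> z; exact: mark_integral_ge0.
apply: (IH _ _ (fun z : (X * R) * config mark => f (z.1.1, (p, z.1.2) :: z.2))) => //.
apply: (measurableT_comp mf); apply: measurable_fun_pair.
  exact: measurableT_comp.
apply: measurable_config_cons => //.
by apply: measurable_fun_pair => //; exact: measurableT_comp.
Qed.

Lemma measurable_mark_integral_cons xi p f : measurable_fun setT f ->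
  (forall y, 0 <= f y) ->
  measurable_fun setT (fun u : R => mark_integral xi (fun y => f ((p, u) :: y))).
Proof.
move=> mf f0; apply: (@measurable_mark_integral_param _ R xi (fun z : R * config mark =>
  f ((p, z.1) :: z.2))) => //.
apply: (measurableT_comp mf); apply: measurable_config_cons => //.
exact: measurable_fun_pair.
Qed.

Lemma measurable_cons_section p (u : R) f : measurable_fun setT f ->
  measurable_fun setT (fun y : config mark => f ((p, u) :: y)).
Proof. by move=> mf; apply: (measurableT_comp mf); exact: measurable_config_cons. Qed.

Lemma le_mark_integral xi f g : measurable_fun setT f -> measurable_fun setT g ->
  (forall y, 0 <= f y) -> (forall y, f y <= g y) ->
  mark_integral xi f <= mark_integral xi g.
Proof.
elim: xi f g => [|p xi IH] f g mf mg f0 fg //=.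
have g0 y : 0 <= g y by exact: le_trans (fg y).
apply: ge0_le_integral => //.
- by move=> u _; exact: mark_integral_ge0.
- by apply: measurable_funTS; exact: measurable_mark_integral_cons.
- by apply: measurable_funTS; exact: measurable_mark_integral_cons.
- by move=> u _; apply: IH => //; exact: measurable_cons_section.
Qed.

Lemma mark_integralD xi f g : measurable_fun setT f -> measurable_fun setT g ->
  (forall y, 0 <= f y) -> (forall y, 0 <= g y) ->
  mark_integral xi (fun y => f y + g y) = mark_integral xi f + mark_integral xi g.
Proof.
elim: xi f g => [|p xi IH] f g mf mg f0 g0 //=.
rewrite -ge0_integralD//.
- apply: eq_integral => u _; rewrite (IH (fun y => f ((p, u) :: y)) (fun y => g ((p, u) :: y)))//;
  exact: measurable_cons_section.
- by move=> u _; exact: mark_integral_ge0.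
- by apply: measurable_funTS; exact: measurable_mark_integral_cons.
- by move=> u _; exact: mark_integral_ge0.
- by apply: measurable_funTS; exact: measurable_mark_integral_cons.
Qed.

Lemma mark_integralZl xi k f : 0 <= k -> measurable_fun setT f ->
  (forall y, 0 <= f y) ->
  mark_integral xi (fun y => k * f y) = k * mark_integral xi f.
Proof.
move=> k0; elim: xi f => [|p xi IH] f mf f0 //=.
rewrite -ge0_integralZl//.
- apply: eq_integral => u _; rewrite (IH (fun y => f ((p, u) :: y)))//.
  exact: measurable_cons_section.
- by apply: measurable_funTS; exact: measurable_mark_integral_cons.
- by move=> u _; exact: mark_integral_ge0.
Qed.

Lemma mark_integral_sum (I : Type) (s : seq I) (f_ : I -> config mark -> \bar R) xi :
  (forall i, measurable_fun setT (f_ i)) -> (forall i y, 0 <= f_ i y) ->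
  mark_integral xi (fun y => \sum_(i <- s) f_ i y) = \sum_(i <- s) mark_integral xi (f_ i).
Proof.
move=> mf f0; elim: s => [|i s IH].
  rewrite big_nil (_ : (fun y => _) = fun y => 0 * cst 0 y :> \bar R).
    by rewrite mark_integralZl// mul0e.
  by apply/funext => y; rewrite big_nil mul0e.
rewrite big_cons -IH -mark_integralD//.
- by congr mark_integral; apply/funext => y; rewrite big_cons.
- exact: emeasurable_sum.
- by move=> y; exact: sume_ge0.
Qed.

Lemma mark_integral_lim xi (f_ : (config mark -> \bar R)^nat) :
  (forall n, measurable_fun setT (f_ n)) -> (forall n y, 0 <= f_ n y) ->
  (forall y, nondecreasing_seq (f_ ^~ y)) ->
  mark_integral xi (fun y => limn (f_ ^~ y)) = limn (fun n => mark_integral xi (f_ n)).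
Proof.
elim: xi f_ => [|p xi IH] f_ mf f0 ndf //=.
rewrite -monotone_convergence//.
- apply: eq_integral => u _; rewrite (IH (fun n y => f_ n ((p, u) :: y)))// => n.
  exact: measurable_cons_section.
- by move=> n; apply: measurable_funTS; exact: measurable_mark_integral_cons.
- by move=> n u _; exact: mark_integral_ge0.
- move=> u _ m n mn; apply: le_mark_integral => //; try exact: measurable_cons_section.
  by move=> y; exact: ndf.
Qed.

Lemma mark_integral_tonelli d (X : measurableType d)
    (P : {sigma_finite_measure set X -> \bar R}) (A : set X) xi
    (f : X * config mark -> \bar R) :
  measurable A -> measurable_fun setT f -> (forall z, 0 <= f z) ->
  \int[P]_(x in A) mark_integral xi (fun y => f (x, y)) =
  mark_integral xi (fun y => \int[P]_(x in A) f (x, y)).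
Proof.
move=> mA; elim: xi f => [|p xi IH] f mf f0 //=.
rewrite (@tonelli_in _ _ X _ R P lebesgue_measure A _
  (fun z : X * measurableTypeR R => mark_integral xi (fun y => f (z.1, (p, z.2) :: y))))//.
- apply: eq_integral => u _.
  rewrite (IH (fun z => f (z.1, (p, u) :: z.2)))//.
  apply: (measurableT_comp mf); apply: measurable_fun_pair => //.
  exact: measurable_config_cons.
- apply: (@measurable_mark_integral_param _ (X * R)%type xi
    (fun z => f (z.1.1, (p, z.1.2) :: z.2))) => //.
  apply: (measurableT_comp mf); apply: measurable_fun_pair.
    exact: measurableT_comp.
  apply: measurable_config_cons => //.
  by apply: measurable_fun_pair => //; exact: measurableT_comp.
- by move=> z; exact: mark_integral_ge0.
Qed.

Lemma measurable_prod_config d (E : measurableType d) (phi : E -> R) :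
  measurable_fun setT phi -> (forall p, 0 <= phi p)%R ->
  measurable_fun setT (fun y : config E => (\prod_(p <- y) phi p)%R).
Proof.
move=> mphi phi0.
have := @measurable_prod_section _ E _ unit R (fun z => phi z.2).
move=> /(_ (measurableT_comp mphi measurable_snd) (fun z => phi0 z.2)) h.
have /(measurableT_comp h) := pair1_measurable tt : measurable_fun setT (pair tt : config E -> _).
exact.
Qed.

Lemma mark_integral_prod xi (phi : mark -> R) :
  measurable_fun setT phi -> (forall p, 0 <= phi p)%R ->
  mark_integral xi (fun y => (\prod_(p <- y) phi p)%:E) =
  \prod_(q <- xi) \int[lebesgue_measure]_(u in `]0%R, +oo[) (phi (q, u))%:E.
Proof.
move=> mphi phi0; elim: xi => [|q xi IH]; first by rewrite /= !big_nil.
have mp : measurable_fun setT (fun y : config mark => (\prod_(p <- y) phi p)%:E).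
  by apply/measurable_EFinP; exact: measurable_prod_config.
rewrite big_cons -IH -ge0_integralZr//.
- apply: eq_integral => u _ /=.
  rewrite -(@mark_integralZl _ _ (fun y => (\prod_(p <- y) phi p)%:E))//.
  + by congr mark_integral; apply/funext => y; rewrite big_cons EFinM.
  + by rewrite lee_fin.
  + by move=> y; rewrite lee_fin prodr_ge0.
- apply: measurable_funTS; apply/measurable_EFinP.
  by apply: (measurableT_comp mphi); exact: measurable_fun_pair.
- by move=> u _; rewrite lee_fin.
- by apply: mark_integral_ge0 => y; rewrite lee_fin prodr_ge0.
Qed.

(** Only listings as long as [xi] are ever evaluated; this bounds counts by the size of [xi]
    below. *)
Lemma eq_size_mark_integral xi f g :
  (forall y, size y = size xi -> f y = g y) ->
  mark_integral xi f = mark_integral xi g.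
Proof.
elim: xi f g => [|p xi IH] f g fg /=; first exact: fg.
by apply: eq_integral => u _; apply: IH => y ys; apply: fg; rewrite /= ys.
Qed.

End mark_integral_theory.

(** * Measurability of a mark integral in the configuration *)

Section mark_integral_measurable.
Context (R : realType).
Local Notation mark := (R * R * R)%type.
Local Notation point := (R * R)%type.
Local Open Scope ereal_scope.
Implicit Types (xi : seq point) (f g : config mark -> \bar R).

(** Marks above a threshold have weight zero, so that weighted mark integrals of bounded functions
    are finite and may be subtracted. *)
Definition bounded_weight (phi : mark -> R) : Prop :=
  [/\ measurable_fun setT phi, forall p, (0 <= phi p)%R &
    exists (C : R) (n : nat), forall p, (phi p <= C * (p.2 <= n%:R)%R%:R)%R].

Let weighted (phi : mark -> R) f : config mark -> \bar R :=
  fun y => (\prod_(p <- y) phi p)%:E * f y.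

Let measurable_weighted phi f : bounded_weight phi -> measurable_fun setT f ->
  measurable_fun setT (weighted phi f).
Proof.
move=> [mphi phi0 _] mf; apply: emeasurable_funM => //.
by apply/measurable_EFinP; exact: measurable_prod_config.
Qed.

Let weighted_ge0 phi f : bounded_weight phi -> (forall y, 0 <= f y) ->
  forall y, 0 <= weighted phi f y.
Proof. by move=> [_ phi0 _] f0 y; rewrite mule_ge0// lee_fin prodr_ge0. Qed.

Lemma integral_bounded_weight phi : bounded_weight phi -> forall q : point,
  0 <= \int[lebesgue_measure]_(u in `]0%R, +oo[) (phi (q, u))%:E < +oo.
Proof.
move=> [mphi phi0 [C [n phiC]]] q; apply/andP; split.
  by apply: integral_ge0 => u _; rewrite lee_fin.
have mphiq : measurable_fun setT (fun u : R => (phi (q, u))%:E).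
  by apply/measurable_EFinP; apply: (measurableT_comp mphi); exact: pair1_measurable.
apply: (@le_lt_trans _ _ (\int[lebesgue_measure]_(u in `[0%R, n%:R]) (cst C%:E u))).
  rewrite integral_mkcond [leRHS]integral_mkcond; apply: ge0_le_integral => //.
  - by move=> u _; rewrite patchE; case: ifP => // _; rewrite lee_fin.
  - apply/(measurable_restrictT _ _).1; first exact: measurable_itv.
    exact: measurable_funTS.
  - by apply/(measurable_restrictT _ _).1; first exact: measurable_itv.
  - move=> u _; rewrite !patchE; case: ifPn => [|_]; last first.
      case: ifPn => //= _; rewrite lee_fin; have := phiC (q, 0%R) => /=.
      by rewrite ler0n mulr1; exact: le_trans.
    rewrite inE/= in_itv/= andbT => u0.
    case: ifPn => [_|]; first by rewrite lee_fin (le_trans (phiC _))// ler_piMr ?lern1 ?leq_b1//;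
      (have := phiC (q, 0%R) => /=; rewrite ler0n mulr1; exact: le_trans).
    rewrite notin_setE/= in_itv/= ltW//= => /negP un.
    by have := phiC (q, u); rewrite /= (negbTE un) mulr0 lee_fin.
rewrite integral_cst//= lebesgue_measure_itv/=.
by case: ifP => _; rewrite ?mule0// -EFinB -EFinM ltry.
Qed.

Lemma mark_integral_bounded_weight phi xi : bounded_weight phi ->
  mark_integral xi (fun y => (\prod_(p <- y) phi p)%:E) =
  (\prod_(q <- xi) fine (\int[lebesgue_measure]_(u in `]0%R, +oo[) (phi (q, u))%:E))%:E.
Proof.
move=> wphi; have [mphi phi0 _] := wphi.
rewrite mark_integral_prod// -prodEFin; apply: eq_bigr => q _.
rewrite fineK//; have /andP[? ?] := integral_bounded_weight wphi q.
by rewrite ge0_fin_numE.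
Qed.

Lemma measurable_fine_integral_weight phi : bounded_weight phi ->
  measurable_fun setT (fun q : point =>
    fine (\int[lebesgue_measure]_(u in `]0%R, +oo[) (phi (q, u))%:E)).
Proof.
move=> [mphi phi0 _]; apply: measurableT_comp => //.
apply: (@measurable_fun_integral_param _ _ point _ R lebesgue_measure _
  (fun z => (phi z)%:E)) => //.
exact/measurable_EFinP.
Qed.

(** Required for all weights at once: inserting an indicator of a count event uses the property for
    weights multiplied by powers of z on a set of marks. *)
Let regular f : Prop := forall phi, bounded_weight phi ->
  measurable_fun setT (fun xi : config point => mark_integral xi (weighted phi f)).

Let regular1 : regular (cst 1).
Proof.
move=> phi wphi.
rewrite (_ : (fun xi => _) = (fun xi : config point => (\prod_(q <- xi)
    fine (\int[lebesgue_measure]_(u in `]0%R, +oo[) (phi (q, u))%:E))%:E)).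
  apply/measurable_EFinP; apply: measurable_prod_config.
    exact: measurable_fine_integral_weight.
  move=> q; rewrite fine_ge0//.
  by have /andP[] := integral_bounded_weight wphi q.
apply/funext => xi; rewrite -mark_integral_bounded_weight//.
by congr mark_integral; apply/funext => y; rewrite /weighted mule1.
Qed.

Let mark_integral_weighted_fin phi f xi : bounded_weight phi ->
  measurable_fun setT f -> (forall y, 0 <= f y <= 1) ->
  mark_integral xi (weighted phi f) \is a fin_num.
Proof.
move=> wphi mf f01.
have f0 y : 0 <= f y by have /andP[] := f01 y.
rewrite ge0_fin_numE; last by apply: mark_integral_ge0; exact: weighted_ge0.
apply: (@le_lt_trans _ _ (mark_integral xi (weighted phi (cst 1)))).
  apply: le_mark_integral; [exact: measurable_weighted|exact: measurable_weighted|exact: weighted_ge0|].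
  move=> y; rewrite /weighted lee_wpmul2l//; first by rewrite lee_fin prodr_ge0//; case: wphi.
  by have /andP[] := f01 y.
rewrite (_ : weighted _ _ = (fun y => (\prod_(p <- y) phi p)%:E)).
  by rewrite mark_integral_bounded_weight// ltry.
by apply/funext => y; rewrite /weighted mule1.
Qed.

Let count_indic (A : set mark) k : config mark -> \bar R :=
  fun y => (\1_[set y : config mark | npoints A y = k] y)%:E.

Let measurable_count_indic A k : measurable A -> measurable_fun setT (count_indic A k).
Proof.
move=> mA; apply/measurable_EFinP; apply: measurable_indic.
exact: measurable_npoints_set.
Qed.

(* On configurations of n points the indicator of {N_A = k} is recovered from
   the multiplicative functionals z^{N_A}, z = 1, ..., n + 1, by inverting a
   Vandermonde matrix. *)
Let regular_count f A k : measurable A -> measurable_fun setT f ->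
  (forall y, 0 <= f y <= 1) -> regular f ->
  regular (fun y => f y * count_indic A k y).
Proof.
move=> mA mf f01 rf phi wphi.
have f0 y : 0 <= f y by have /andP[] := f01 y.
pose fk k y := f y * count_indic A k y.
have mfk j : measurable_fun setT (fk j).
  by apply: emeasurable_funM => //; exact: measurable_count_indic.
have fk01 j y : 0 <= fk j y <= 1.
  rewrite /fk /count_indic indicE; case: (_ \in _) => /=; first by rewrite mule1.
  by rewrite mule0 lexx lee01.
have fk0 j y : 0 <= fk j y by have /andP[] := fk01 j y.
pose b j xi := mark_integral xi (weighted phi (fk j)).
have bfin j xi : b j xi \is a fin_num by exact: mark_integral_weighted_fin.
pose phiz (z : R) p := (phi p * z ^+ (p \in A))%R.
have wphiz (j : nat) : bounded_weight (phiz j.+1%:R).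
  have [mphi phi0 [C [m phiC]]] := wphi; split.
  - apply: measurable_funM => //.
    rewrite (_ : (fun p => _) = (fun p => \1_A p * j.+1%:R + (1 - \1_A p))%R).
      apply: measurable_funD; first by apply: measurable_funM => //; exact: measurable_indic.
      by apply: measurable_funB => //; exact: measurable_indic.
    by apply/funext => p; rewrite indicE; case: (p \in A); rewrite /= ?expr1 ?expr0 ?mul1r
        ?mul0r ?subrr ?subr0 ?addr0 ?add0r.
  - by move=> p; rewrite mulr_ge0// exprn_ge0.
  - exists (C * j.+1%:R)%R, m => p; rewrite /phiz [leRHS]mulrAC.
    apply: ler_pM; [by []|exact: exprn_ge0|exact: phiC|].
    by case: (p \in A); rewrite ?expr1// expr0 ler1n.
pose a (j : nat) xi := mark_integral xi (weighted (phiz j.+1%:R) f).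
have ma j : measurable_fun setT (a j : config point -> \bar R) by exact: rf.
have aE (j n : nat) xi : size xi = n ->
    a j xi = \sum_(i < n.+1) (j.+1%:R ^+ i)%:E * b i xi.
  move=> xin; transitivity (mark_integral xi (fun y => \sum_(i < n.+1)
      (j.+1%:R ^+ i)%:E * weighted phi (fk i) y)).
    apply: eq_size_mark_integral => y yxi.
    have Nn : (npoints A y < n.+1)%N by rewrite ltnS -xin -yxi count_size.
    rewrite (bigD1 (Ordinal Nn))//= big1 ?adde0; last first.
      move=> i iN; rewrite /weighted /fk /count_indic indicE memNset ?mule0//=.
      by move=> Ni; move/eqP: iN; apply; apply/val_inj.
    rewrite /weighted /fk /count_indic indicE mem_set//= mule1 muleA -EFinM; congr (_%:E * _).
    rewrite /phiz big_split/= mulrC; congr (_ * _)%R.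
    elim: y {yxi Nn} => [|p y IH]; first by rewrite big_nil.
    by rewrite big_cons IH npoints_cons exprD.
  rewrite mark_integral_sum; last 2 first.
  - by move=> i; apply: measurable_funeM; exact: measurable_weighted.
  - by move=> i y; rewrite mule_ge0 ?lee_fin ?exprn_ge0//; exact: weighted_ge0.
  apply: eq_bigr => i _; rewrite mark_integralZl//.
  - exact: measurable_weighted.
  - exact: weighted_ge0.
rewrite -/(b k).
(* The size of the linear system is the number of points plus one, so configurations are split by
   size. *)
have -> : [set: config point] = \bigcup_n [set xi : config point | size xi = n].
  by apply/seteqP; split => // xi _; exists (size xi).
have msz n : measurable [set xi : config point | size xi = n].
  rewrite -[X in measurable X]setTI.
  exact: (@measurable_config_size _ point measurableT [set n]).
apply/measurable_fun_bigcup => // n.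
have [nk|kn] := ltnP n k.
  apply: (eq_measurable_fun (cst 0)) => // xi; rewrite inE/= => xin.
  rewrite /b (eq_size_mark_integral (g := fun y => 0 * cst 0 y)).
    by rewrite mark_integralZl// mul0e.
  move=> y yxi; rewrite mul0e /weighted /fk /count_indic indicE memNset ?mule0//= => Nk.
  by move: nk; rewrite -xin -yxi -Nk ltnNge count_size.
pose V := Vandermonde n.+1 (\row_(j < n.+1) j.+1%:R : 'rV[R]_n.+1).
have Vu : V^T \in unitmx.
  rewrite unitmx_tr unitmxE det_Vandermonde unitfE prodf_seq_neq0.
  apply/allP => i _; apply/implyP => _; rewrite prodf_seq_neq0.
  apply/allP => j _; apply/implyP => ij; rewrite !mxE subr_eq0 eqr_nat eqSS.
  by rewrite neq_ltn ij orbT.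
have kn' : (k < n.+1)%N by rewrite ltnS.
apply: (eq_measurable_fun (fun xi : config point =>
   (\sum_(j < n.+1) invmx V^T (Ordinal kn') j * fine (a j xi))%:E)).
  move=> xi; rewrite inE/= => xin.
  pose bv := (\col_(i < n.+1) fine (b i xi))%R.
  pose av := (\col_(j < n.+1) fine (a j xi))%R.
  have avE : av = (V^T *m bv)%R.
    apply/colP => j; rewrite !mxE (aE j n)//.
    rewrite (_ : fine _ = (\sum_(i < n.+1) (j.+1%:R ^+ i * fine (b i xi))%R)%R).
      by apply: eq_bigr => i _; rewrite !mxE.
    rewrite (eq_bigr (fun i : 'I_n.+1 => (j.+1%:R ^+ i * fine (b i xi))%:E)).
      by rewrite sumEFin.
    by move=> i _; rewrite EFinM fineK.
  transitivity ((bv (Ordinal kn') 0%R)%:E); last by rewrite mxE fineK.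
  rewrite -[bv](mulKmx Vu) -avE mxE; congr EFin.
  by apply: eq_bigr => j _; rewrite mxE.
apply/measurable_EFinP; apply: measurable_sum => j.
apply: measurable_funM => //; apply: measurable_funTS.
by apply: measurableT_comp.
Qed.

(** [G] collects the events whose indicator may multiply a regular function without spoiling
    regularity. It is visibly stable under intersection and contains the count events, so Dynkin
    induction over [G] reaches the whole sigma-field. *)
Let regular_indic (B : set (config mark)) : measurable B ->
  regular (fun y => (\1_B y)%:E).
Proof.
pose G := [set B : set (config mark) | measurable B /\
  forall f, measurable_fun setT f -> (forall y, 0 <= f y <= 1) -> regular f ->
    regular (fun y => f y * (\1_B y)%:E)].
have i01 (C : set (config mark)) y : 0 <= (\1_C y : R)%:E <= 1.
  by rewrite indicE; case: (_ \in _); rewrite /= lexx lee01.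
have GE : @measurable _ (config mark) = <<s G >>.
  apply/seteqP; split; last first.
    by apply: smallest_sub; [exact: sigma_algebra_measurable|move=> C []].
  apply: smallest_sub; first exact: smallest_sigma_algebra.
  move=> _ [A [k [mA ->]]]; apply: sub_sigma_algebra; split.
    exact: measurable_npoints_set.
  by move=> f mf f01 rf; exact: regular_count.
rewrite GE; move: B.
apply: (dynkin_induction (P := fun B => regular (fun y => (\1_B y)%:E)) GE).
- move=> B C [mB rB] [mC rC]; split; first exact: measurableI.
  move=> f mf f01 rf; rewrite (_ : (fun y => _) = (fun y => f y * (\1_B y)%:E * (\1_C y)%:E)).
    apply: rC; last exact: rB.
      by apply: emeasurable_funM => //; apply/measurable_EFinP; exact: measurable_indic.
    move=> y; have /andP[f0 f1] := f01 y; rewrite indicE.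
    by case: (_ \in _); rewrite /= ?mule1 ?mule0 ?f0 ?f1 ?lexx ?lee01.
  by apply/funext => y; rewrite indicI EFinM muleA.
- by rewrite (_ : (fun y => _) = cst 1)//; apply/funext => y; rewrite indicT.
- move=> B [mB rB]; rewrite (_ : (fun y => _) = (fun y => cst 1 y * (\1_B y)%:E)).
    by apply: rB => // y; rewrite lee01 lexx.
  by apply/funext => y; rewrite mul1e.
- move=> B mB rB phi wphi.
  rewrite (_ : (fun xi => _) = (fun xi : config point =>
      mark_integral xi (weighted phi (cst 1)) - mark_integral xi (weighted phi (fun y => (\1_B y)%:E)))).
    by apply: emeasurable_funB; [exact: regular1|exact: rB].
  have mi C : measurable C -> measurable_fun setT (fun y : config mark => (\1_C y : R)%:E).
    by move=> mC; apply/measurable_EFinP; exact: measurable_indic.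
  have w0 C y : 0 <= weighted phi (fun y : config mark => (\1_C y : R)%:E) y.
    by apply: weighted_ge0 => // z; have /andP[] := i01 C z.
  apply/funext => xi.
  rewrite (_ : weighted phi (cst 1) = (fun y => weighted phi (fun y => (\1_(~` B) y)%:E) y +
      weighted phi (fun y => (\1_B y)%:E) y)).
    rewrite mark_integralD//; [|exact: measurable_weighted (mi _ (measurableC mB))
      |exact: measurable_weighted (mi _ mB)].
    by rewrite addeK// mark_integral_weighted_fin//; exact: mi.
  apply/funext => y; rewrite /weighted -ge0_muleDr ?lee_fin//; congr (_ * _).
  by rewrite !indicE in_setC; case: (_ \in _); rewrite /= ?add0e ?adde0.
- move=> F mF tF IH phi wphi.
  have mi C : measurable C -> measurable_fun setT (fun y : config mark => (\1_C y : R)%:E).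
    by move=> mC; apply/measurable_EFinP; exact: measurable_indic.
  have w0 C y : 0 <= weighted phi (fun y : config mark => (\1_C y : R)%:E) y.
    by apply: weighted_ge0 => // z; have /andP[] := i01 C z.
  pose f_ n y := \sum_(0 <= k < n) weighted phi (fun y => (\1_(F k) y)%:E) y.
  have mf_ n : measurable_fun setT (f_ n).
    by apply: emeasurable_sum => k; apply: measurable_weighted => //; exact: mi.
  have f_0 n y : 0 <= f_ n y by apply: sume_ge0.
  have ndf y : nondecreasing_seq (f_ ^~ y).
    by move=> m n mn; apply: lee_sum_nneg_natr.
  rewrite (_ : (fun xi => _) = (fun xi : config point =>
      limn (fun n => mark_integral xi (f_ n)))).
    apply: (emeasurable_fun_cvg (fun n (xi : config point) => mark_integral xi (f_ n))).
      move=> n; rewrite (_ : (fun xi => _) = (fun xi => \sum_(0 <= k < n)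
          mark_integral xi (weighted phi (fun y => (\1_(F k) y)%:E)))).
        by apply: emeasurable_sum => k; exact: IH.
      apply/funext => xi; rewrite -mark_integral_sum// => k.
      by apply: measurable_weighted => //; exact: mi.
    move=> xi _; apply: ereal_nondecreasing_is_cvgn => m n mn.
    by apply: le_mark_integral => // y; exact: ndf.
  apply/funext => xi; rewrite -mark_integral_lim//; congr mark_integral.
  apply/funext => y; apply/esym/cvg_lim => //; apply: cvg_near_cst.
  have [/set_mem[k _ Fk]|nF] := boolP (y \in \bigcup_k F k).
    near=> n.
    have kn : (k < n)%N by near: n; exists k.+1.
    rewrite /f_ big_mkord (bigD1 (Ordinal kn))//= big1 ?adde0.
      by rewrite /weighted !indicE !mem_set//; exists k.
    move=> j jk; rewrite /weighted indicE memNset ?mule0// => Fj.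
    move/negP: jk; apply; apply/eqP/val_inj => /=.
    by apply: (tF j k) => //; exists y.
  near=> n; rewrite /f_ big1; first by rewrite /weighted indicE (negbTE nF) mule0.
  move=> k _; rewrite /weighted indicE memNset ?mule0// => Fk; move/negP: nF; apply.
  by rewrite inE; exists k.
Unshelve. all: by end_near. Qed.

Let regular_ge0 f : measurable_fun setT f -> (forall y, 0 <= f y) -> regular f.
Proof.
move: f; apply: ge0_measurable_ind.
- exact: regular_indic.
- move=> k f k0 mf f0 rf phi wphi.
  rewrite (_ : (fun xi => _) = (fun xi : config point =>
    k%:E * mark_integral xi (weighted phi f))).
    by apply: measurable_funeM; exact: rf.
  apply/funext => xi; rewrite -mark_integralZl//.
  + by congr mark_integral; apply/funext => y; rewrite /weighted muleCA.
  + exact: measurable_weighted.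
  + exact: weighted_ge0.
- move=> f g mf mg f0 g0 rf rg phi wphi.
  rewrite (_ : (fun xi => _) = (fun xi : config point =>
    mark_integral xi (weighted phi f) + mark_integral xi (weighted phi g))).
    by apply: emeasurable_funD; [exact: rf|exact: rg].
  apply/funext => xi; rewrite -mark_integralD//; try exact: measurable_weighted;
    try exact: weighted_ge0.
  by congr mark_integral; apply/funext => y; rewrite /weighted ge0_muleDr.
- move=> f_ mf f0 ndf rf phi wphi.
  have ndw y : nondecreasing_seq (fun n => weighted phi (f_ n) y).
    move=> m n mn; rewrite /weighted lee_wpmul2l//; last exact: ndf.
    by rewrite lee_fin prodr_ge0//; case: wphi.
  rewrite (_ : (fun xi => _) = (fun xi : config point =>
      limn (fun n => mark_integral xi (weighted phi (f_ n))))).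
    apply: (emeasurable_fun_cvg (fun n (xi : config point) => mark_integral xi (weighted phi (f_ n)))).
      by move=> n; exact: rf.
    move=> xi _; apply: ereal_nondecreasing_is_cvgn => m n mn.
    apply: le_mark_integral; [exact: measurable_weighted|exact: measurable_weighted|exact: weighted_ge0|].
    by move=> y; exact: ndw.
  apply/funext => xi; rewrite -mark_integral_lim//.
  + congr mark_integral; apply/funext => y; rewrite /weighted limeMl//.
    by apply: ereal_nondecreasing_is_cvgn => m n mn; exact: ndf.
  + by move=> n; exact: measurable_weighted.
  + by move=> n; exact: weighted_ge0.
Qed.

(** The cutoffs [p.2 <= n] are bounded weights increasing to one: on a given listing their product
    equals one as soon as [n] exceeds all the marks. *)
Lemma measurable_mark_integral f : measurable_fun setT f -> (forall y, 0 <= f y) ->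
  measurable_fun setT (fun xi : config point => mark_integral xi f).
Proof.
move=> mf f0.
pose phi n (p : mark) : R := (p.2 <= n%:R)%R%:R.
have wphi n : bounded_weight (phi n).
  split; last by exists 1%R, n => p; rewrite mul1r.
    rewrite (_ : phi n = \1_[set p : mark | (p.2 <= n%:R)%R]).
      apply: measurable_indic; rewrite -[X in measurable X]setTI.
      rewrite (_ : [set p | _] = snd @^-1` `]-oo, n%:R]%classic).
        exact: (@measurable_snd _ _ (R * R)%type R measurableT _ (measurable_itv _)).
      by apply/seteqP; split => p /=; rewrite in_itv.
    apply/funext => p; rewrite indicE /phi; case: (boolP (p \in _)).
      by rewrite inE/= => ->.
    by rewrite notin_setE/= => /negP/negbTE ->.
  by move=> p; rewrite /phi.
have ndw y : nondecreasing_seq (fun n => weighted (phi n) f y).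
  move=> m n mn; rewrite /weighted lee_wpmul2r// lee_fin; apply: ler_prod => p _.
  rewrite /phi ler0n/= ler_nat; case: (leP p.2 m%:R) => // pm.
  by rewrite (le_trans pm)// ler_nat.
rewrite (_ : (fun xi => _) = (fun xi : config point =>
    limn (fun n => mark_integral xi (weighted (phi n) f)))).
  apply: (emeasurable_fun_cvg (fun n (xi : config point) => mark_integral xi (weighted (phi n) f))).
    by move=> n; exact: regular_ge0.
  move=> xi _; apply: ereal_nondecreasing_is_cvgn => m n mn.
  apply: le_mark_integral; [exact: measurable_weighted|exact: measurable_weighted|exact: weighted_ge0|].
  by move=> y; exact: ndw.
apply/funext => xi; rewrite -mark_integral_lim//.
- congr mark_integral; apply/funext => y; apply/esym/cvg_lim => //; apply: cvg_near_cst.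
  near=> n; rewrite /weighted big_seq big1 ?mul1e// => p py.
  rewrite /phi (_ : (p.2 <= n%:R)%R)//.
  apply: (@le_trans _ _ (\sum_(q <- y) `|q.2|)%R).
    rewrite (big_rem p)//= (le_trans (ler_norm _))// lerDl.
    by apply: sumr_ge0.
  by near: n; exact: nbhs_infty_ger.
- by move=> n; exact: measurable_weighted.
- by move=> n; exact: weighted_ge0.
Unshelve. all: by end_near. Qed.

End mark_integral_measurable.

(** * Multiplicative functionals of a Poisson process *)

(** The factor [b] may be infinite: then either every [a n] vanishes, or [a n] is eventually
    positive and the products are eventually infinite. *)
Lemma nondecreasing_limeMr (R : realType) (a : (\bar R)^nat) (b : \bar R) :
  (forall n, 0 <= a n)%E -> nondecreasing_seq a -> (0 <= b)%E ->
  (limn (fun n => a n * b) = limn a * b)%E.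
Proof.
move=> a0 nda; have ca : cvgn a by exact: ereal_nondecreasing_is_cvgn.
case: b => [b b0| _|//]; first exact: limeMr.
have [/eqP la0|la0] := eqVneq (limn a) 0%E.
  have an0 n : a n = 0%E.
    apply/eqP; rewrite eq_le a0 andbT -(eqP la0).
    apply: lime_ge => //; near=> m; apply: nda.
    by near: m; exact: nbhs_infty_ge.
  under eq_fun do rewrite an0 mul0e.
  by rewrite (eqP la0) mul0e lim_cst.
have la : (0 < limn a)%E.
  by rewrite lt0e la0; apply: lime_ge => //; exact: nearW.
rewrite gt0_muley//; apply/cvg_lim => //; apply: cvg_near_cst.
have [N aN] : exists n, (0 < a n)%E.
  apply/not_existsP => an; move: la; rewrite ltNge => /negP; apply.
  by apply: lime_le => //; apply: nearW => n; rewrite leNgt; exact/negP.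
near=> n; rewrite gt0_muley// (lt_le_trans aN)//; apply: nda.
by near: n; exact: nbhs_infty_ge.
Unshelve. all: by end_near. Qed.

(** * Measures given by a density *)

Section density_measure.
Local Open Scope ereal_scope.
Context d (T : measurableType d) (R : realType) (mu : {measure set T -> \bar R}).
Variables (f : T -> \bar R) (mf : measurable_fun setT f) (f0 : forall x, 0 <= f x).

(** Both proofs are arguments so that the structure of measure, which rests on them, is attached to
    the constant. The same device is used for the other measures defined below. *)
Definition density_measure of measurable_fun setT f & (forall x, 0 <= f x) :
  set T -> \bar R := fun A => \int[mu]_(x in A) f x.

Let m := density_measure mf f0.

Let m0 : m set0 = 0. Proof. exact: integral_set0. Qed.

Let m_ge0 A : 0 <= m A. Proof. exact: integral_ge0. Qed.

Let m_sigma_additive : semi_sigma_additive m.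
Proof.
move=> F mF tF mUF; rewrite /m /density_measure ge0_integral_bigcup//; last first.
  exact: measurable_funTS.
by apply: is_cvg_nneseries => n _ _; exact: integral_ge0.
Qed.

HB.instance Definition _ := isMeasure.Build _ _ _ m m0 m_ge0 m_sigma_additive.

Lemma ge0_integral_density g : measurable_fun setT g -> (forall x, 0 <= g x) ->
  \int[m]_x g x = \int[mu]_x (g x * f x).
Proof.
move: g; apply: ge0_measurable_ind.
- move=> A mA; rewrite integral_indic// setIT.
  transitivity (\int[mu]_(x in A) f x) => //.
  rewrite integral_mkcond; apply: eq_integral => x _.
  by rewrite patchE indicE; case: (_ \in _); rewrite /= ?mul1e ?mul0e.
- move=> k g k0 mg g0 IH; rewrite ge0_integralZl// IH -ge0_integralZl//.
  + by apply: eq_integral => x _; rewrite muleA.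
  + exact: emeasurable_funM.
  + by move=> x _; exact: mule_ge0.
- move=> g h mg mh g0 h0 IHg IHh; rewrite ge0_integralD// IHg IHh -ge0_integralD//.
  + by apply: eq_integral => x _; rewrite ge0_muleDl.
  + by move=> x _; exact: mule_ge0.
  + exact: emeasurable_funM.
  + by move=> x _; exact: mule_ge0.
  + exact: emeasurable_funM.
- move=> g_ mg g0 ndg IH; rewrite monotone_convergence//; last first.
  rewrite (_ : (fun n => _) = (fun n => \int[mu]_x (g_ n x * f x))).
    rewrite -monotone_convergence//.
    + by apply: eq_integral => x _; exact: nondecreasing_limeMr.
    + by move=> n; exact: emeasurable_funM.
    + by move=> n x _; exact: mule_ge0.
    + by move=> x _ a b ab; rewrite lee_wpmul2r//; exact: ndg.
  by apply/funext => n; exact: IH.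
Qed.

End density_measure.

Lemma nneseriesZr_ge0 (R : realType) (f : (\bar R)^nat) (x : \bar R) :
  (forall i, 0 <= f i)%E -> (0 <= x)%E ->
  (\sum_(i <oo) (f i * x) = (\sum_(i <oo) f i) * x)%E.
Proof.
move=> f0 x0; rewrite -nondecreasing_limeMr//.
- by apply/congr_lim/funext => n; rewrite ge0_sume_distrl.
- by move=> n; exact: sume_ge0.
- by move=> a b ab; exact: lee_sum_nneg_natr.
Qed.

(** * Expectations over a Poisson process *)

Section poisson_functional.
Import HBNNSimple.
Context d (E : measurableType d) (R : realType) (m : {measure set E -> \bar R})
  (Gamma : probability (config E) R).
Hypotheses (m_fin : (m setT < +oo)%E) (Gamma_poisson : poisson_process_law m Gamma).
Local Open Scope ereal_scope.

Let measurable_eval (F : nat -> \bar R) (A : set E) : measurable A ->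
  measurable_fun setT (fun xi : config E => F (npoints A xi)).
Proof.
move=> mA; apply: (@measurableT_comp _ _ _ _ _ _ F) => //.
exact: measurable_npoints.
Qed.

Let measurable_prod_eval n (A : 'I_n -> set E) (F : 'I_n -> nat -> \bar R) :
  (forall i, measurable (A i)) ->
  measurable_fun setT (fun xi : config E => \prod_(i < n) F i (npoints (A i) xi)).
Proof.
move=> mA; rewrite (_ : (fun xi => _) = \big[(fun f g x => f x * g x)/cst 1]_(i < n)
    (fun xi : config E => F i (npoints (A i) xi))).
  apply: (big_ind (fun f : config E -> \bar R => measurable_fun setT f)) => //.
  - by move=> f g mf mg; exact: emeasurable_funM.
  - by move=> i _; exact: measurable_eval.
apply/funext => xi; apply: (big_ind2 (fun (x : \bar R) (f : config E -> \bar R) => x = f xi)) => //.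
by move=> x f y g -> ->.
Qed.

(** The Poisson hypothesis gives the probabilities of exact counts, that is, the case where each
    [F i] is the indicator of one integer. A general [F i] is a series of such indicators, and the
    factors are expanded one at a time. *)
Lemma poisson_integral_prod n (A : 'I_n -> set E) (F : 'I_n -> nat -> \bar R) :
  (forall i, measurable (A i)) -> trivIset [set: 'I_n] A ->
  (forall i k, 0 <= F i k) ->
  \int[Gamma]_xi \prod_(i < n) F i (npoints (A i) xi) =
  \prod_(i < n) \sum_(k <oo) F i k * poisson_prob (fine (m (A i))) 0%N [set k].
Proof.
move=> mA tA.
pose p i k := poisson_prob (fine (m (A i))) 0%N [set k].
have p0 i k : 0 <= p i k by exact: measure_ge0.
pose delta (k0 k : nat) : \bar R := (k == k0)%:R%:E.
have delta0 k0 k : 0 <= delta k0 k by rewrite lee_fin.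
have sumd (f : nat -> \bar R) k0 : (forall k, 0 <= f k) ->
    \sum_(k <oo) delta k0 k * f k = f k0.
  move=> f0; rewrite (@nneseriesD1 _ _ k0)//.
    rewrite eseries0 ?adde0//; first by rewrite /delta eqxx mul1e.
    by move=> k _ /= /negbTE; rewrite /delta => ->; rewrite mul0e.
  by move=> k; rewrite mule_ge0.
(* Induction on the number [j] of leading factors that are arbitrary, the others being indicators of
   one integer. *)
suff H j : (j <= n)%N -> (forall i k, 0 <= F i k) ->
    (forall i : 'I_n, (j <= i)%N -> exists k0, F i = delta k0) ->
    \int[Gamma]_xi \prod_(i < n) F i (npoints (A i) xi) =
    \prod_(i < n) \sum_(k <oo) F i k * p i k.
  by move=> F0; apply: (H n) => // i; rewrite leqNgt ltn_ord.
elim: j F => [|j IH] F jn F0 Fd.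
  have /choice[k0 Fk0] : forall i, exists k, F i = delta k by move=> i; exact: Fd.
  under [RHS]eq_bigr do rewrite Fk0 sumd//.
  rewrite -Gamma_poisson//.
  have mev : measurable [set x : config E | forall i, npoints (A i) x = k0 i].
    rewrite (_ : [set x | _] = \bigcap_(i in [set: 'I_n])
        [set x : config E | npoints (A i) x = k0 i]).
      by apply: fin_bigcap_measurable => // i _; exact: measurable_npoints_set.
    by apply/seteqP; split => x /= xk i; [move=> _; exact: xk|exact: xk].
  rewrite -(setIT [set x | _]) -integral_indic//; apply: eq_integral => xi _.
  rewrite indicE; case: (boolP (xi \in _)) => [/set_mem xik|].
    by rewrite big1// => i _; rewrite Fk0 /delta xik eqxx.
  rewrite notin_setE => /existsNP[i /eqP Ni].
  by rewrite (bigD1 i)//= Fk0 /delta (negbTE Ni) mul0e.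
pose j' := Ordinal jn.
pose Fk k i := if i == j' then delta k else F i.
have Fk0 k i l : 0 <= Fk k i l by rewrite /Fk; case: ifP.
have prodD (G : 'I_n -> \bar R) : \prod_(i < n) G i = G j' * \prod_(i < n | i != j') G i.
  by rewrite (bigD1 j').
have restE k (c : 'I_n -> nat) :
    \prod_(i < n | i != j') F i (c i) = \prod_(i < n | i != j') Fk k i (c i).
  by apply: eq_bigr => i /negbTE ij; rewrite /Fk ij.
transitivity (\int[Gamma]_xi \sum_(k <oo) F j' k * \prod_(i < n) Fk k i (npoints (A i) xi)).
  apply: eq_integral => xi _.
  rewrite prodD (restE 0%N (fun i => npoints (A i) xi)).
  rewrite -[F j' _](sumd (F j') _)//.
  rewrite -nneseriesZr_ge0//; last 2 first.
  - by move=> k; rewrite mule_ge0.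
  - by apply: prode_ge0 => i _.
  apply: eq_eseriesr => k _; rewrite prodD {2}/Fk eqxx.
  rewrite -(restE k (fun i => npoints (A i) xi)) -(restE 0%N (fun i => npoints (A i) xi)).
  by rewrite /delta eq_sym [_ * F j' k]muleC muleA.
rewrite integral_nneseries//; last 2 first.
- by move=> k; apply: emeasurable_funM => //; exact: measurable_prod_eval.
- by move=> k xi _; rewrite mule_ge0//; apply: prode_ge0.
rewrite prodD -nneseriesZr_ge0//; last 2 first.
- by move=> k; rewrite mule_ge0.
- by apply: prode_ge0 => i _; apply: nneseries_ge0 => k _ _; rewrite mule_ge0.
apply: eq_eseriesr => k _; rewrite ge0_integralZl//; last 2 first.
- exact: measurable_prod_eval.
- by move=> xi _; apply: prode_ge0.
rewrite (IH (Fk k)) ?(ltnW jn)//; last first.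
  move=> i; rewrite leq_eqVlt => /orP[/eqP ji|ji].
    exists k; rewrite /Fk ifT//; exact/eqP/val_inj.
  have [l Fl] := Fd i ji; exists l; rewrite /Fk ifF//.
  by apply/negbTE; rewrite neq_ltn; apply/orP; right.
rewrite prodD {1}/Fk eqxx sumd// muleA; congr (_ * _).
by apply: eq_bigr => i /negbTE ij; rewrite /Fk ij.
Qed.

(** Term by term, c^k times the Poisson weight of rate r is exp (r (c - 1)) times the Poisson weight
    of rate c r, and the latter weights add up to one. Zero rates are treated apart because
    [poisson_prob] is then a Dirac mass. *)
Lemma sum_poisson_exprn (c r : R) : (0 <= c)%R -> (0 <= r)%R ->
  \sum_(k <oo) (c ^+ k)%:E * poisson_prob r 0%N [set k] = (expR (r * (c - 1)))%:E.
Proof.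
move=> c0 r0.
have sum1 : \sum_(k <oo) poisson_prob (c * r) 0%N [set k] = 1.
  rewrite -(probability_setT (poisson_prob (c * r) 0%N)).
  rewrite (_ : [set: nat] = \bigcup_k [set k]); last first.
    by apply/seteqP; split => // k _; exists k.
  rewrite measure_bigcup//.
    by apply/congr_lim/funext => n; apply: eq_bigl => k; rewrite in_setT.
  by apply/trivIsetP => i j _ _ ij; apply/seteqP; split => // k [-> /eqP]; rewrite (negbTE ij).
rewrite -[RHS]mule1 -sum1 -nneseriesZl; last by [].
apply: eq_eseriesr => k _; rewrite /poisson_prob.
have [->|c_neq0] := eqVneq c 0%R.
  rewrite mul0r ltxx sub0r mulrN1; case: ifPn => [r_gt0|].
    rewrite esum_set1 ?lee_fin ?poisson_pmf_ge0// /poisson_pmf r_gt0 !diracE.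
    case: k => [|k]; last by rewrite exprS mul0r mul0e memNset// mule0.
    by rewrite mem_set//= !expr0 !fact0 invr1 !mul1r mule1 mul1e.
  rewrite -leNgt => r_le0; have -> : r = 0%R by apply/eqP; rewrite eq_le r0 r_le0.
  rewrite oppr0 expR0 mul1e !diracE; case: k => [|k]; first by rewrite expr0 mul1e.
  by rewrite memNset// mule0.
have c_gt0 : (0 < c)%R by rewrite lt0r c_neq0.
rewrite pmulr_rgt0//; case: ifPn => [r_gt0|].
  rewrite !esum_set1 ?lee_fin ?poisson_pmf_ge0// /poisson_pmf pmulr_rgt0// r_gt0 -!EFinM.
  congr EFin; rewrite exprMn.
  have -> : expR (- r) = (expR (r * (c - 1)) * expR (- (c * r)))%R.
    by rewrite -expRD; congr expR; ring.
  ring.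
rewrite -leNgt => r_le0; have -> : r = 0%R by apply/eqP; rewrite eq_le r0 r_le0.
rewrite mul0r expR0 mul1e !diracE; case: k => [|k]; first by rewrite expr0 mul1e.
by rewrite memNset// mule0.
Qed.

Let m_fin_num A : measurable A -> m A \is a fin_num.
Proof.
move=> mA; rewrite ge0_fin_numE//; apply: le_lt_trans m_fin.
by apply: le_measure; rewrite ?inE.
Qed.

(** The level sets [A i] of [h] partition the space, so the product over the points is a product
    over the levels of powers with the counts as exponents; the counts are independent Poisson
    variables. *)
Let poisson_functional_nnsfun (h : {nnsfun E >-> R}) :
  \int[Gamma]_xi (\prod_(q <- xi) h q)%:E =
  (expR (fine (\int[m]_q (h q)%:E) - fine (m setT)))%:E.
Proof.
pose r := finmap.enum_fset (fset_set (range h)).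
have ur : uniq r by exact: finmap.fset_uniq.
have r0 i : (0 <= nth 0 r i)%R.
  have [ir|ir] := ltnP i (size r); last by rewrite nth_default.
  have : nth 0%R r i \in r by exact: mem_nth.
  by rewrite /r in_fset_set// inE => -[x _ <-].
pose A (i : 'I_(size r)) := h @^-1` [set nth 0%R r i].
have mA i : measurable (A i) by rewrite -[X in measurable X]setTI; exact: measurable_funP.
have tA : trivIset [set: 'I_(size r)] A.
  apply/trivIsetP => i j _ _ ij; apply/seteqP; split => // x [/= hi hj].
  by move: ij; rewrite -(inj_eq val_inj) /= -(nth_uniq 0%R _ _ ur)// -hi -hj eqxx.
have inA q : exists2 i : 'I_(size r), h q = nth 0%R r i & forall j, (q \in A j) = (j == i).
  have qr : h q \in r by rewrite /r in_fset_set// inE; exists q.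
  have ir : (index (h q) r < size r)%N by rewrite index_mem.
  exists (Ordinal ir) => /=; first by rewrite nth_index.
  move=> j; apply/idP/eqP => [|->]; last by rewrite inE /A/= nth_index.
  by rewrite inE /A/= => hj; apply/val_inj => /=; rewrite hj index_uniq.
transitivity (\int[Gamma]_xi \prod_(i < size r)
    ((nth 0%R r i) ^+ (npoints (A i) xi))%:E).
  apply: eq_integral => xi _; rewrite prodEFin; congr EFin.
  elim: xi => [|q xi IH]; first by rewrite big_nil big1.
  rewrite big_cons IH; have [i hi qA] := inA q.
  rewrite (bigD1 i)// [RHS](bigD1 i)//= hi npoints_cons qA eqxx exprS mulrA.
  congr (_ * _)%R; apply: eq_bigr => j /negbTE ji.
  by rewrite npoints_cons qA ji.
rewrite (@poisson_integral_prod _ A (fun i k => (nth 0%R r i ^+ k)%:E))//; last first.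
  by move=> i k; rewrite lee_fin exprn_ge0.
under eq_bigr => i _ do rewrite sum_poisson_exprn ?fine_ge0//.
rewrite prodEFin -expR_sum; congr (expR _)%:E.
(* Used twice: with the values of [h], and with the constant one for the total mass. *)
have sumA (c : nat -> R) : (forall i, 0 <= c i)%R ->
    fine (\int[m]_q (\sum_(i < size r) c i * \1_(A i) q)%:E) =
    (\sum_(i < size r) c i * fine (m (A i)))%R.
  move=> c0.
  have mi i : measurable_fun setT (fun q => (c (val i) * \1_(A i) q)%:E).
    by apply/measurable_EFinP; apply: measurable_funM => //; exact: measurable_indic.
  under eq_integral do rewrite -sumEFin.
  rewrite ge0_integral_sum//; last by move=> i q _; rewrite lee_fin mulr_ge0.
  transitivity (fine (\sum_(i < size r) (c i * fine (m (A i)))%:E)); last by rewrite sumEFin.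
  congr fine; apply: eq_bigr => i _; under eq_integral do rewrite EFinM.
  rewrite ge0_integralZl_EFin//; last by apply/measurable_EFinP; exact: measurable_indic.
  by rewrite integral_indic// setIT EFinM fineK// m_fin_num.
have sumI (c : nat -> R) q (i : 'I_(size r)) : h q = nth 0%R r i -> (forall j, (q \in A j) = (j == i)) ->
    (\sum_(i < size r) c i * \1_(A i) q = c i)%R.
  move=> hi qA; rewrite (bigD1 i)//= indicE qA eqxx mulr1 big1 ?addr0// => j /negbTE ji.
  by rewrite indicE qA ji mulr0.
have mE : fine (m setT) = (\sum_(i < size r) fine (m (A i)))%R.
  transitivity (\sum_(i < size r) (fun=> 1) (val i) * fine (m (A i)))%R; last first.
    by apply: eq_bigr => i _; rewrite mul1r.
  rewrite -(sumA (fun=> 1%R))// -[m setT]mul1e -integral_cst//.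
  congr fine; apply: eq_integral => q _; have [i hi qA] := inA q.
  by rewrite (sumI (fun=> 1%R) q i hi qA).
have hE : fine (\int[m]_q (h q)%:E) = (\sum_(i < size r) nth 0 r i * fine (m (A i)))%R.
  rewrite -(sumA (nth 0%R r))//; congr fine; apply: eq_integral => q _.
  by have [i hi qA] := inA q; rewrite (sumI (nth 0%R r) q i hi qA) hi.
rewrite mE hE -sumrB; apply: eq_bigr => i _; ring.
Qed.

(** The bound [C] and the finiteness of [m] make the integral of [h] finite, so the exponents of the
    simple approximations converge in the reals. *)
Lemma poisson_functional (h : E -> R) (C : R) : measurable_fun setT h ->
  (forall q, 0 <= h q <= C)%R ->
  \int[Gamma]_xi (\prod_(q <- xi) h q)%:E =
  (expR (fine (\int[m]_q (h q)%:E) - fine (m setT)))%:E.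
Proof.
move=> mh hC; have h0 q : (0 <= h q)%R by have /andP[] := hC q.
have mh' : measurable_fun setT (EFin \o h) by exact/measurable_EFinP.
pose g := nnsfun_approx measurableT mh'.
have gh q : (g n q)%:E @[n --> \oo] --> (h q)%:E.
  by apply: (cvg_nnsfun_approx measurableT mh') => // x _; rewrite lee_fin.
have ndg q : nondecreasing_seq (g ^~ q) by move=> a b ab; exact/lefP/nd_nnsfun_approx.
have ghr q : g n q @[n --> \oo] --> h q by have /fine_cvgP[_] := gh q; exact.
have lhs : (\int[Gamma]_xi (\prod_(q <- xi) g n q)%:E) @[n --> \oo] -->
    \int[Gamma]_xi (\prod_(q <- xi) h q)%:E.
  rewrite (_ : (fun xi : config E => (\prod_(q <- xi) h q)%:E) =
      fun xi : config E => limn (fun n => (\prod_(q <- xi) g n q)%:E)).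
    apply: cvg_monotone_convergence => //.
    - by move=> n; apply/measurable_EFinP; exact: measurable_prod_config.
    - by move=> n xi _; rewrite lee_fin prodr_ge0.
    - move=> xi _ a b ab; rewrite lee_fin; apply: ler_prod => q _.
      by rewrite fun_ge0/=; exact: ndg.
  apply/funext => xi; apply/esym/cvg_lim => //; apply/cvg_EFin.
    exact: nearW.
  elim: xi => [|q xi IH].
    by under eq_fun do rewrite big_nil; rewrite big_nil; exact: cvg_cst.
  by under eq_fun do rewrite big_cons; rewrite big_cons; apply: cvgM.
have finh : \int[m]_q (h q)%:E \is a fin_num.
  rewrite ge0_fin_numE; last by apply: integral_ge0 => q _; rewrite lee_fin.
  apply: (@le_lt_trans _ _ (\int[m]_q (cst C%:E q))).
    apply: ge0_le_integral => //.
    - by move=> q _; rewrite lee_fin.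
    - by move=> q _; rewrite lee_fin; have /andP[] := hC q.
  by rewrite integral_cst//= lte_mul_pinfty ?lee_fin//; [apply: le_trans (h0 point) _; have
      /andP[] := hC point].
have rhs : (expR (fine (\int[m]_q (g n q)%:E) - fine (m setT)))%:E @[n --> \oo] -->
    (expR (fine (\int[m]_q (h q)%:E) - fine (m setT)))%:E.
  apply/cvg_EFin; first exact: nearW.
  apply: continuous_cvg; first exact: continuous_expR.
  apply: cvgB; last exact: cvg_cst.
  apply: fine_cvg; rewrite fineK//.
  rewrite (_ : (fun q => (h q)%:E) = fun q => limn (fun n => (g n q)%:E)).
    apply: cvg_monotone_convergence => //.
    - by move=> n; apply/measurable_EFinP.
    - by move=> n q _; rewrite lee_fin.
    - by move=> q _ a b ab; rewrite lee_fin; exact: ndg.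
  by apply/funext => q; apply/esym/cvg_lim.
apply: (cvg_unique _ lhs) => //.
rewrite (_ : (fun n => _) = (fun n =>
  (expR (fine (\int[m]_q (g n q)%:E) - fine (m setT)))%:E))//.
by apply/funext => n; exact: poisson_functional_nnsfun.
Qed.

End poisson_functional.

(** * Absolutely continuous paths *)

Ltac case_minmax := rewrite /Num.min /Num.max;
  do ! (case: ifPn; rewrite -?leNgt => ?).

Section absolute_continuity.
Context (R : realType).
Implicit Types (F G f : R -> R) (a b : R).

Definition abs_cont F : Prop := forall e : R, 0 < e -> exists2 del : R, 0 < del &
  forall (n : nat) (s t : 'I_n -> R), (forall k, s k <= t k) ->
    trivIset [set: 'I_n] (fun k => `]s k, t k[%classic) ->
    \sum_(k < n) (t k - s k) < del -> \sum_(k < n) `|F (t k) - F (s k)| < e.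

(** The projection on [[a, b]]. Freezing a path outside [[a, b]] makes it absolutely continuous on
    the whole line, and later arguments need not follow the interval. *)
Definition clamp a b (x : R) : R := Num.min (Num.max a x) b.

Lemma clamp_itv a b x : a <= b -> a <= clamp a b x <= b.
Proof. by move=> ab; rewrite /clamp le_min le_max lexx ab/= ge_min lexx orbT. Qed.

Lemma clamp_id a b x : a <= x <= b -> clamp a b x = x.
Proof. by move=> /andP[ax xb]; rewrite /clamp (max_idPr ax) (min_idPl xb). Qed.

Lemma le_clamp a b x y : x <= y -> clamp a b x <= clamp a b y.
Proof. by move=> xy; rewrite /clamp; case: (leP a x) => ?; case: (leP a y) => ?; case_minmax; lra. Qed.

Lemma clamp_sub a b x y : a <= b -> x <= y -> clamp a b y - clamp a b x <= y - x.
Proof.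
by move=> ab xy; rewrite /clamp; case: (leP a x) => ?; case: (leP a y) => ?; case_minmax; lra.
Qed.

Lemma clamp_oo a b s t : a <= b -> `]clamp a b s, clamp a b t[%classic `<=` `]s, t[%classic.
Proof.
move=> ab x /=; rewrite !in_itv/= /clamp.
by case: (leP a s) => ?; case: (leP a t) => ?; case_minmax; move=> /andP[? ?]; apply/andP; split; lra.
Qed.

Lemma abs_cont_clamp a b f : a <= b -> abs_continuous_on a b f ->
  abs_cont (f \o clamp a b).
Proof.
move=> ab ACf e e0; have [del del0 H] := ACf e e0; exists del => // n s t st tst std.
apply: (H n (clamp a b \o s) (clamp a b \o t)).
- by move=> k; have /andP[-> _] := clamp_itv (s k) ab;
    have /andP[_ ->] := clamp_itv (t k) ab; split => //; exact: le_clamp.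
- move=> i j _ _ [x [xi xj]]; apply: tst => //; exists x; split; exact: (clamp_oo ab).
- by apply: le_lt_trans std; apply: ler_sum => k _; exact: clamp_sub.
Qed.

(** General index types are wanted for families of partitions, whose cells are indexed by dependent
    pairs. *)
Lemma abs_cont_finType F e : abs_cont F -> 0 < e -> exists2 del : R, 0 < del &
  forall (I : finType) (s t : I -> R), (forall k, s k <= t k) ->
    trivIset [set: I] (fun k => `]s k, t k[%classic) ->
    \sum_k (t k - s k) < del -> \sum_k `|F (t k) - F (s k)| < e.
Proof.
move=> AC e0; have [del del0 H] := AC e e0; exists del => // I s t st tst std.
have bij : {on predT, bijective (@enum_val I predT)} by apply: onW_bij; exact: enum_val_bij.
rewrite (reindex _ bij)/=; apply: (H _ (s \o @enum_val I predT) (t \o @enum_val I predT)).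
- by move=> k; exact: st.
- move=> i j _ _ ij; apply: enum_val_inj; exact: tst.
- by move: std; rewrite (reindex _ bij).
Qed.

Lemma abs_contD F G : abs_cont F -> abs_cont G -> abs_cont (F \+ G).
Proof.
move=> ACF ACG e e0.
have [d1 d10 H1] := ACF (e / 2) (divr_gt0 e0 (ltr0n _ 2)).
have [d2 d20 H2] := ACG (e / 2) (divr_gt0 e0 (ltr0n _ 2)).
exists (Num.min d1 d2); first by rewrite lt_min d10.
move=> n s t st tst; rewrite lt_min => /andP[std1 std2].
rewrite [ltRHS](splitr e); apply: le_lt_trans (ltrD (H1 _ _ _ st tst std1) (H2 _ _ _ st tst std2)).
rewrite -big_split/=; apply: ler_sum => k _.
by rewrite opprD addrACA ler_normD.
Qed.

Lemma abs_contN F : abs_cont F -> abs_cont (\- F).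
Proof.
move=> ACF e e0; have [d d0 H] := ACF e e0; exists d => // n s t st tst std.
rewrite (eq_bigr (fun k => `|F (t k) - F (s k)|)); first exact: H.
by move=> k _; rewrite /= -opprD normrN.
Qed.

Lemma abs_cont_near F e : abs_cont F -> 0 < e -> exists2 del : R, 0 < del &
  forall x y, `|x - y| < del -> `|F x - F y| < e.
Proof.
move=> AC e0; have [del del0 H] := AC e e0; exists del => // x y xy.
wlog yx : x y xy / y <= x.
  move=> h; have [/h|/ltW/h] := leP y x; first exact.
  by rewrite distrC [`|F x - _|]distrC; exact.
have := H 1%N (fun=> y) (fun=> x) (fun=> yx).
rewrite !big_ord1; apply; first by move=> i j _ _ _; rewrite !ord1.
by rewrite -(ger0_norm (_ : 0 <= x - y))// subr_ge0.
Qed.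

Lemma abs_cont_continuous F : abs_cont F -> continuous F.
Proof.
move=> AC x; apply/cvgrPdist_lt => e e0.
have [del del0 H] := abs_cont_near AC e0.
near=> y; apply: H; near: y; exact: cvgr_dist_lt.
Unshelve. all: by end_near. Qed.

Lemma itv_partition_nth_le_nth a b l i j : itv_partition a b l ->
  (i <= j <= size l)%N -> nth b (a :: l) i <= nth b (a :: l) j.
Proof.
move=> [pal _] /andP[ij jl].
rewrite (@lt_sorted_leq_nth _ _ b (a :: l) pal) ?inE//= ltnS//.
exact: leq_trans ij jl.
Qed.

Lemma itv_partition_trivIset a b l : itv_partition a b l ->
  trivIset [set: 'I_(size l)] (fun i : 'I_(size l) =>
    `]nth b (a :: l) i, nth b (a :: l) i.+1[%classic).
Proof.
move=> abl i j _ _ [x []] /=; rewrite !in_itv/= => /andP[ix xi] /andP[jx xj].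
apply/val_inj; case: (ltngtP j i) => // ij; exfalso.
- have : nth b (a :: l) j.+1 <= nth b (a :: l) i.
    by apply: itv_partition_nth_le_nth => //; rewrite ij ltnW.
  by move=> /le_lt_trans/(_ ix)/(lt_trans xj); rewrite ltxx.
- have : nth b (a :: l) i.+1 <= nth b (a :: l) j.
    by apply: itv_partition_nth_le_nth => //; rewrite ij ltnW.
  by move=> /(lt_le_trans xi)/lt_trans/(_ jx); rewrite ltxx.
Qed.

Lemma itv_partition_sum a b l : itv_partition a b l ->
  \sum_(i < size l) (nth b (a :: l) i.+1 - nth b (a :: l) i) = b - a.
Proof.
move=> abl; rewrite -(big_mkord xpredT (fun i => nth b (a :: l) i.+1 - nth b (a :: l) i)).
by rewrite telescope_sumr// (itv_partition_nth_size _ abl).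
Qed.

(** Cutting the intervals along partitions gives a longer disjoint family of the same total length,
    so the same [del] serves. *)
Lemma abs_cont_total_variation F (e : R) : abs_cont F -> 0 < e ->
  exists2 del : R, 0 < del & forall (n : nat) (s t : 'I_n -> R),
    (forall k, s k <= t k) -> trivIset [set: 'I_n] (fun k => `]s k, t k[%classic) ->
    \sum_(k < n) (t k - s k) < del ->
    forall l : 'I_n -> seq R, (forall k, itv_partition (s k) (t k) (l k)) ->
    \sum_(k < n) variation (s k) (t k) F (l k) < e.
Proof.
move=> AC e0; have [del del0 H] := abs_cont_finType AC e0; exists del => //.
move=> n s t st tst std l lP.
pose J := {k : 'I_n & 'I_(size (l k))}.
pose S (z : J) := nth (t (tag z)) (s (tag z) :: l (tag z)) (tagged z).
pose W (z : J) := nth (t (tag z)) (s (tag z) :: l (tag z)) (tagged z).+1.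
have E (f : forall k, 'I_(size (l k)) -> R) :
    \sum_(z : J) f (tag z) (tagged z) = \sum_k \sum_(i < size (l k)) f k i.
  by rewrite sig_big_dep.
have := H J S W.
rewrite (E (fun k i => nth (t k) (s k :: l k) i.+1 - nth (t k) (s k :: l k) i)).
rewrite (E (fun k i => `|F (nth (t k) (s k :: l k) i.+1) - F (nth (t k) (s k :: l k) i)|)).
rewrite (eq_bigr (fun k => t k - s k)); last by move=> k _; rewrite itv_partition_sum.
move=> h; apply: le_lt_trans (h _ _ std).
- by apply: ler_sum => k _; rewrite /variation big_mkord.
- move=> [k i]/=; apply: itv_partition_nth_le_nth => //.
  by rewrite leqnSn ltn_ord.
- move=> [k i] [k' i'] _ _ /=; have [kk'|kk'] := eqVneq k k'.
    by subst k' => ii'; congr existT; exact: (itv_partition_trivIset (lP k)).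
  move=> [x [/= xi xi']]; exfalso; move/eqP: kk'; apply; apply: tst => //.
  have sub (q : 'I_n) (p : 'I_(size (l q))) : x \in `](nth (t q) (s q :: l q) p),
      (nth (t q) (l q) p)[ -> x \in `](s q), (t q)[.
    rewrite !in_itv/= => /andP[px xp]; apply/andP; split.
      apply: le_lt_trans px; apply: itv_partition_nth_ge => //.
      by rewrite ltnS ltnW.
    apply: (lt_le_trans xp).
    by apply: (@itv_partition_nth_le _ _ (s q) (t q) (l q) p.+1) => //; rewrite ltnS.
  by exists x; split; [exact: (sub k i)|exact: (sub k' i')].
Qed.

(** On an interval shorter than [del] the variation is at most one, and finitely many steps of
    length [del / 2] lead from [a] to [x]. *)
Lemma abs_cont_TV_fin F a x : abs_cont F -> a <= x ->
  (total_variation a x F < +oo)%E.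
Proof.
move=> AC; have [del del0 H] := abs_cont_total_variation AC ltr01.
have small c d : c <= d -> d - c < del -> (total_variation c d F <= 1)%E.
  move=> cd cdd; apply: ge_ereal_sup => _ [_ [l lP <-] <-]; rewrite lee_fin.
  have := H 1%N (fun=> c) (fun=> d) (fun=> cd) _ _ (fun=> l) (fun=> lP).
  rewrite !big_ord1 => h; apply/ltW/h => //.
  by move=> i j _ _ _; rewrite !ord1.
suff K k y : a <= y -> y <= a + k%:R * (del / 2) -> (total_variation a y F <= k%:R%:E)%E.
  move=> ax; apply: (@le_lt_trans _ _ (Num.bound ((x - a) / (del / 2)))%:R%:E); last by rewrite ltry.
  apply: K => //; rewrite -lerBlDl -ler_pdivrMr ?divr_gt0//.
  by apply/ltW/archi_boundP; rewrite divr_ge0 ?subr_ge0// divr_ge0// ltW.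
elim: k y => [|k IH] y ay.
  rewrite mul0r addr0 => ya; have -> : y = a by apply/eqP; rewrite eq_le ya ay.
  by rewrite total_variationxx.
rewrite -natr1 mulrDl mul1r addrA => yk.
have [yak|/ltW yak] := leP y (a + k%:R * (del / 2)).
  by apply: (le_trans (IH _ ay yak)); rewrite lee_fin lerDl.
rewrite (@total_variationD _ a y (a + k%:R * (del / 2)))//; last first.
  by rewrite lerDl mulr_ge0// divr_ge0// ltW.
rewrite -natr1 EFinD leeD//; first by apply: IH => //; rewrite lerDl mulr_ge0// divr_ge0// ltW.
apply: small => //; rewrite ltrBlDl (le_lt_trans yk)// ltrD2l ltr_pdivrMr// ltr_pMr//.
by rewrite ltr1n.
Qed.

Section variation_function.
Variables (F : R -> R) (a : R).
Hypothesis AC : abs_cont F.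

(** Jordan's increasing majorant of the increments of [F] to the right of [a]; the maximum makes it
    constant to the left. *)
Definition variation_fun (x : R) : R := fine (total_variation a (Num.max a x) F).

Let TV_fin x y : x <= y -> total_variation x y F \is a fin_num.
Proof. by move=> xy; rewrite ge0_fin_numE ?abs_cont_TV_fin// total_variation_ge0. Qed.

Lemma variation_funB x y : x <= y -> variation_fun y - variation_fun x =
  fine (total_variation (Num.max a x) (Num.max a y) F).
Proof.
move=> xy; have mxy : Num.max a x <= Num.max a y by case_minmax; lra.
rewrite /variation_fun (@total_variationD _ a (Num.max a y) (Num.max a x))//.
  rewrite fineD; [|by apply: TV_fin; rewrite le_max lexx|exact: TV_fin].
  by rewrite addrC addKr.
by rewrite le_max lexx.
Qed.

Lemma variation_fun_nd x y : x <= y -> variation_fun x <= variation_fun y.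
Proof.
move=> xy; rewrite -subr_ge0 variation_funB// fine_ge0// total_variation_ge0//.
by case_minmax; lra.
Qed.

Lemma variation_fun_ge x y : a <= x -> x <= y ->
  `|F y - F x| <= variation_fun y - variation_fun x.
Proof.
move=> ax xy; rewrite variation_funB// (max_idPr ax) (max_idPr (le_trans ax xy)).
by rewrite -lee_fin fineK ?TV_fin// total_variation_ge.
Qed.

Lemma abs_cont_variation_fun : abs_cont variation_fun.
Proof.
move=> e e0; have e20 : 0 < e / 2 by rewrite divr_gt0.
have [del del0 H] := abs_cont_total_variation AC e20; exists del => // n s t st tst std.
pose s' k := Num.max a (s k); pose t' k := Num.max a (t k).
have st' k : s' k <= t' k by rewrite /s' /t'; have := st k; case_minmax; lra.
(* Each variation is attained up to [eta] by a partition; the [n] errors together stay below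
   [e / 2], and [n.+1] covers [n = 0]. *)
pose eta := e / 2 / n.+1%:R.
have eta0 : 0 < eta by rewrite divr_gt0.
have /choice[l lP] : forall k, exists l, itv_partition (s' k) (t' k) l /\
    fine (total_variation (s' k) (t' k) F) - eta < variation (s' k) (t' k) F l.
  move=> k; have := TV_fin (st' k); rewrite /total_variation => fin.
  have [_ [_ [l lP <-] <-] h] := ub_ereal_sup_adherent eta0 fin.
  by exists l; split => //; move: h; rewrite -lte_fin EFinB fineK.
rewrite (eq_bigr (fun k => fine (total_variation (s' k) (t' k) F))); last first.
  by move=> k _; rewrite ger0_norm ?variation_funB// fine_ge0// total_variation_ge0// st'.
apply: (@le_lt_trans _ _ (\sum_(k < n) (variation (s' k) (t' k) F (l k) + eta))).
  by apply: ler_sum => k _; rewrite -lerBlDr; apply/ltW; have [] := lP k.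
rewrite big_split/= sumr_const card_ord [ltRHS](splitr e) ltr_leD//; last first.
  have -> : e / 2 = eta *+ n.+1 by rewrite -[RHS]mulr_natr /eta divfK.
  by rewrite mulrS lerDr ltW.
apply: H => //.
- move=> i j _ _ [x [/= xi xj]]; apply: tst => //; exists x; split => /=.
    move: xi; rewrite /s' /t' !in_itv/=; case_minmax; move=> /andP[? ?]; apply/andP; split; lra.
  move: xj; rewrite /s' /t' !in_itv/=; case_minmax; move=> /andP[? ?]; apply/andP; split; lra.
- apply: le_lt_trans std; apply: ler_sum => k _; rewrite /s' /t'; have := st k.
  by case_minmax; lra.
- by move=> k; have [] := lP k.
Qed.

End variation_function.

Lemma interval_bounded_open (X : set R) (M : R) : open X -> is_interval X ->
  X `<=` `]- M, M[%classic -> exists s t, s <= t /\ X = `]s, t[%classic.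
Proof.
move=> oX iX XM; have [->|X0] := eqVneq X set0.
  by exists 0, 0; split=> //; rewrite set_itv_ge// bnd_simp ltxx.
have lX : has_lbound X by exists (- M) => x /XM/=; rewrite in_itv/= => /andP[/ltW].
have uX : has_ubound X by exists M => x /XM/=; rewrite in_itv/= => /andP[_ /ltW].
have XE := interval_bounded_interior iX lX uX.
rewrite (interior_id _).1// in XE.
exists (inf X), (sup X); split; last first.
  by rewrite {1}XE; apply/seteqP; split=> x /=; rewrite in_itv.
have [x Xx] : X !=set0 by exact/set0P.
by move: (Xx); rewrite {1}XE/= => /andP[iX' sX]; exact/ltW/(lt_trans iX').
Qed.

(** The density is the Radon-Nikodym derivative of the Stieltjes measure of [G], finite since [G] is
    bounded. Domination: a Lebesgue null set lies in an open set of measure below [del], whose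
    components are disjoint intervals over which [G] grows by less than [e] in total. *)
Lemma abs_cont_nd_density G (C : R) : abs_cont G -> {homo G : x y / x <= y} ->
  (forall x, `|G x| <= C) -> exists rho : R -> R,
    lebesgue_measure.-integrable [set: R] (EFin \o rho) /\
    forall x y, x <= y -> (\int[lebesgue_measure]_(z in `]x, y]) (rho z)%:E = (G y - G x)%:E)%E.
Proof.
move=> AC ndG GC.
have rcG : forall x, G @ at_right x --> G x.
  by apply: right_continuousW; exact: abs_cont_continuous.
pose Gc : cumulative R R := HB.pack G (isCumulative.Build R _ R G ndG rcG).
pose nu := lebesgue_stieltjes_measure Gc.
have nuE x y : x <= y -> nu `]x, y]%classic = (G y - G x)%:E.
  move=> xy; rewrite /nu /lebesgue_stieltjes_measure /measure_extension measurable_mu_extE/=.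
    by rewrite wlength_itv_bnd.
  exact: is_ocitv.
have nuT : (nu setT < +oo)%E.
  apply: (@le_lt_trans _ _ (2 * C)%:E); last by rewrite ltry.
  have -> : [set: R] = \bigcup_n `](- n%:R), n%:R]%classic.
    apply/seteqP; split => // x _; exists (Num.bound `|x|) => //=.
    by rewrite in_itv/=; have := archi_boundP (normr_ge0 x); rewrite ltr_norml => /andP[-> /ltW].
  have h : nu `](- n%:R), n%:R]%classic @[n --> \oo] --> nu (\bigcup_n `](- n%:R), n%:R]%classic).
    apply: nondecreasing_cvg_mu.
    - by move=> n; exact: measurable_itv.
    - by apply: bigcupT_measurable => n; exact: measurable_itv.
    - move=> m n mn; apply/subsetPset => x /=; rewrite !in_itv/= => /andP[mx xm].
      by rewrite (le_lt_trans _ mx) ?lerN2 ?ler_nat// (le_trans xm)// ler_nat.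
  rewrite -(cvg_lim _ h)//; apply: lime_le; first by apply/cvg_ex; eexists; exact: h.
  apply: nearW => n; rewrite nuE; last by rewrite (@le_trans _ _ 0)// oppr_le0.
  rewrite lee_fin (le_trans (ler_norm _))// (le_trans (ler_normB _ _))//.
  by have := GC n%:R; have := GC (- n%:R); lra.
pose nuf : {finite_measure set (measurableTypeR R) -> \bar R} :=
  HB.pack nu (Measure_isFinite.Build _ _ _ nu (lty_fin_num_fun nuT)).
have dom : nu `<< lebesgue_measure.
  apply/null_content_dominatesP => A mA A0.
  (* The restriction to a bounded window makes the components of the open set bounded, hence
     intervals with real endpoints. *)
  suff K (M : nat) : nu (A `&` `]- M%:R, M%:R[%classic) = 0%E.
    apply/eqP; rewrite eq_le measure_ge0 andbT.
    have AE : A = \bigcup_n (A `&` `](- n%:R), n%:R[%classic).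
      rewrite -setI_bigcupr; apply/esym/setIidl => x _.
      exists (Num.bound `|x|) => //=; rewrite in_itv/= -ltr_norml.
      exact: archi_boundP.
    rewrite AE; apply: (le_trans (@measure_sigma_subadditive _ _ _ nu _ _ _ _ (@subset_refl _ _))).
    - by move=> n; apply: measurableI => //; exact: measurable_itv.
    - by apply: bigcupT_measurable => n; apply: measurableI => //; exact: measurable_itv.
    - by rewrite eseries0// => n _ _; exact: K.
  apply/eqP; rewrite eq_le measure_ge0 andbT; apply/lee_addgt0Pr => e e0; rewrite add0e.
  have [del del0 H] := AC e e0.
  pose AM := A `&` `]- M%:R, M%:R[%classic.
  have mAM : measurable AM by apply: measurableI => //; exact: measurable_itv.
  have AM0 : lebesgue_measure AM = 0%E.
    by apply: subset_measure0 A0 => //; exact: subIsetl.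
  have [U0 [oU0 AU0 U0d]] : exists U : set R, [/\ open U, AM `<=` U &
      (lebesgue_measure (U `\` AM) < del%:E)%E].
    have AMlt : (lebesgue_measure AM < +oo)%E by rewrite AM0 ltry.
    by apply: lebesgue_regularity_outer; [exact: mAM|exact: AMlt|].
  pose U := U0 `&` `]- M%:R, M%:R[%classic.
  have oU : open U by apply: openI => //; exact: interval_open.
  have mU : measurable U by exact: open_measurable.
  have Ud : (lebesgue_measure U < del%:E)%E.
    apply: le_lt_trans U0d.
    rewrite (@measureDI _ _ _ lebesgue_measure U AM mU mAM) [X in (_ + X)%E](_ : _ = 0%E) ?adde0.
      apply: le_measure; rewrite ?inE.
      + exact: measurableD.
      + by apply: measurableD => //; exact: open_measurable.
      + by apply: setSD; exact: subIsetl.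
    apply: subset_measure0 AM0 => //; exact: measurableI.
  apply: (@le_trans _ _ (nu U)).
    apply: le_measure; rewrite ?inE//; move=> x [Ax xM]; split => //; exact: AU0.
  pose I := open_disjoint_itv oU.
  have IU : U = \bigcup_q I q by exact: open_disjoint_itv_bigcup.
  have /choice[s /choice[t st]] : forall q, exists s t, s <= t /\ I q = `]s, t[%classic.
    move=> q; apply: (@interval_bounded_open _ M%:R).
    - exact: open_disjoint_itv_open.
    - exact: open_disjoint_itv_is_interval.
    - move=> x Iqx; have : U x by rewrite IU; exists q.
      by move=> [].
  have tI : trivIset setT I by exact: open_disjoint_itv_trivIset.
  have mI q : measurable (I q) by rewrite (st q).2; exact: measurable_itv.
  have muU (m : {measure set (measurableTypeR R) -> \bar R}) : (m U = \sum_(k <oo) m (I k))%E.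
    rewrite IU (@measure_bigcup _ _ _ m setT I (fun i _ => mI i) tI).
    by apply/congr_lim/funext => n; apply: eq_bigl => k; rewrite in_setT.
  have -> : (nu U = \sum_(k <oo) nu (I k))%E by exact: (muU nu).
  apply: lime_le; first exact: is_cvg_nneseries.
  apply: nearW => n; apply: (@le_trans _ _ (\sum_(k < n) `|G (t k) - G (s k)|)%:E).
    rewrite big_mkord -sumEFin.
    apply: lee_sum => k _; have [stk Ik] := st k.
    rewrite ger0_norm ?subr_ge0 ?ndG// -nuE// Ik; apply: le_measure; rewrite ?inE; try exact: measurable_itv.
    exact: subset_itv_oo_oc.
  rewrite lee_fin ltW//; apply: H => //.
  - by move=> k; have [] := st k.
  - move=> i j _ _ [x [xi xj]]; apply/val_inj; apply: tI => //; exists x.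
    by rewrite (st i).2 (st j).2.
  - rewrite -lte_fin; apply: le_lt_trans Ud; rewrite -sumEFin.
    have -> : (lebesgue_measure U = \sum_(k <oo) lebesgue_measure (I k))%E by exact: muU.
    apply: (@le_trans _ _ (\sum_(0 <= k < n) lebesgue_measure (I k))%E); last first.
      exact: nneseries_lim_ge.
    rewrite big_mkord.
    apply: lee_sum => k _; have [stk ->] := st k; rewrite lebesgue_measure_itv/= lte_fin.
    by case: ltP => // tsk; rewrite lee_fin subr_le0.
pose f := Radon_Nikodym_SigmaFinite.f nuf lebesgue_measure.
have ffin : forall x, f x \is a fin_num by exact: Radon_Nikodym_SigmaFinite.f_fin_num.
have fint : lebesgue_measure.-integrable setT f by exact: Radon_Nikodym_SigmaFinite.f_integrable.
have fE : forall A, measurable A -> nuf A = (\int[lebesgue_measure]_(x in A) f x)%E.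
  exact: Radon_Nikodym_SigmaFinite.f_integral.
exists (fine \o f); split.
  by apply: eq_integrable fint => // x _ /=; rewrite fineK.
move=> x y xy; rewrite -nuE// -[RHS]/(nuf _) fE; last exact: measurable_itv.
by apply: eq_integral => z _ /=; rewrite fineK.
Qed.

Lemma finite_energy_density f a b : a < b -> abs_continuous_on a b f ->
  exists rho : R -> R,
  [/\ lebesgue_measure.-integrable [set: R] (EFin \o rho),
    forall x y, a <= x -> x <= y -> y <= b ->
      (\int[lebesgue_measure]_(z in `]x, y]) (rho z)%:E = (f y - f x)%:E)%E &
    {ae lebesgue_measure, forall x, a < x < b -> derive1 f x = rho x}].
Proof.
move=> ab ACf.
pose F := f \o clamp a b; have ACF : abs_cont F by exact: abs_cont_clamp (ltW ab) ACf.
pose V := variation_fun F a; have ACV : abs_cont V by exact: abs_cont_variation_fun.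
have on_ab G : abs_cont G -> abs_continuous_on a b G.
  move=> AC e e0; have [del del0 H] := AC e e0; exists del => // n s t st; apply: H.
  by move=> k; have [] := st k.
pose G1 := V \o clamp a b; pose G2 := G1 \- F.
have AC1 : abs_cont G1 by apply: abs_cont_clamp (ltW ab) (on_ab _ ACV).
have AC2 : abs_cont G2 by apply: abs_contD => //; exact: abs_contN.
have nd1 x y : x <= y -> G1 x <= G1 y.
  by move=> xy; apply: variation_fun_nd => //; exact: le_clamp.
have nd2 x y : x <= y -> G2 x <= G2 y.
  move=> xy; have /andP[ax _] := clamp_itv x (ltW ab).
  have := @variation_fun_ge F a ACF (clamp a b x) (clamp a b y) ax (le_clamp a b xy).
  have cF z : F (clamp a b z) = F z by rewrite /F/= (clamp_id (clamp_itv _ (ltW ab))).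
  rewrite !cF => h; have {}h : `|F y - F x| <= G1 y - G1 x := h.
  by have := le_trans (ler_norm _) h; rewrite /G2 /=; lra.
have cc G x : (forall x, G x = G (clamp a b x)) -> {homo G : x y / x <= y} ->
    `|G x| <= `|G a| + `|G b|.
  move=> Gc ndG; rewrite Gc; have /andP[ax xb] := clamp_itv x (ltW ab).
  have := ndG _ _ ax; have := ndG _ _ xb; move: (G _) (G a) (G b) => u v w uw vu.
  rewrite ler_norml; have := ler_norm w; have := ler_norm (- v); rewrite normrN.
  have := normr_ge0 v; have := normr_ge0 w; lra.
have clc x : clamp a b (clamp a b x) = clamp a b x by rewrite (clamp_id (clamp_itv _ (ltW ab))).
have [r1 [i1 E1]] := @abs_cont_nd_density G1 (`|G1 a| + `|G1 b|) AC1 nd1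
  (fun x => cc G1 x (fun x => congr1 V (esym (clc x))) nd1).
have [|r2 [i2 E2]] := @abs_cont_nd_density G2 (`|G2 a| + `|G2 b|) AC2 nd2.
  by move=> x; apply: cc => // y; rewrite /G2/= /G1 /F/= clc.
pose rho := r1 \- r2.
have irho : lebesgue_measure.-integrable [set: R] (EFin \o rho).
  rewrite (_ : _ \o _ = (EFin \o r1) \- (EFin \o r2))%E; first exact: integrableB.
  by apply/funext => x /=; rewrite EFinB.
have rhoE x y : a <= x -> x <= y -> y <= b ->
    (\int[lebesgue_measure]_(z in `]x, y]) (rho z)%:E = (f y - f x)%:E)%E.
  move=> ax xy yb; under eq_integral do rewrite EFinB.
  rewrite integralB//=; last 2 first.
  - by apply: integrableS i1 => //; exact: measurable_itv.
  - by apply: integrableS i2 => //; exact: measurable_itv.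
  rewrite E1// E2// -EFinB; congr EFin; rewrite /G2 /= /F/= !clamp_id ?ax ?(le_trans xy yb)
      ?(le_trans ax xy)//; ring.
exists rho; split => //.
have irhoy y : lebesgue_measure.-integrable `]-oo, y] (EFin \o rho).
  by apply: integrableS irho => //; exact: measurable_itv.
have := FTC1Ny irhoy (open_integrable_locally openT irho).
pose Fr y := \int[lebesgue_measure]_(t in `]-oo, y]) rho t; rewrite -/Fr.
apply: filterS; first exact: (ae_filter_ringOfSetsType lebesgue_measure).
move=> x [dx Dx] /andP[ax xb].
rewrite -Dx !derive1E.
transitivity ('D_1 (Fr \+ cst (f a - Fr a) : R^o -> R^o) x); last first.
  by rewrite deriveD// derive_cst addr0.
(* Near [x] the path differs from the primitive [Fr] of the density by the constant [f a - Fr a],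
   and [Fr] is differentiable almost everywhere with derivative [rho]. *)
apply: near_eq_derive.
have : \forall y \near x, y \in `]a, b[ by apply: near_in_itvoo; rewrite in_itv/= ax.
apply: filterS => y; rewrite in_itv/= => /andP[ay yb].
have := @Rintegral_itvB _ rho -oo%O (BRight y) a (irhoy y).
move=> /(_ isT); rewrite bnd_simp ltW// => /(_ isT).
rewrite [in RHS]/Rintegral rhoE// ?ltW//= -/(Fr y) -/(Fr a) => E.
rewrite /cst /=; lra.
Qed.

End absolute_continuity.

(** * Gaussian integrals *)

Section real_integral_tools.
Context d (T : measurableType d) (R : realType).

Lemma Rdominated_cvg (mu : {measure set T -> \bar R}) (f_ : (T -> R)^nat) (f g : T -> R) :
  (forall n, measurable_fun setT (f_ n)) -> measurable_fun setT f ->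
  mu.-integrable setT (EFin \o g) ->
  (forall x, f_ n x @[n --> \oo] --> f x) -> (forall n x, `|f_ n x| <= g x) ->
  \int[mu]_x f_ n x @[n --> \oo] --> \int[mu]_x f x.
Proof.
move=> mf_ mf ig fcvg fg.
have [|||||i1 _ c] := @dominated_convergence _ T R mu setT measurableT
  (fun n x => (f_ n x)%:E) (EFin \o f) (EFin \o g) => //.
- by move=> n; exact/measurable_EFinP.
- exact/measurable_EFinP.
- by apply: aeW => x _; apply/cvg_EFin; [exact: nearW|exact: fcvg].
- by apply: aeW => x n _; rewrite /= lee_fin.
apply: fine_cvg; rewrite fineK//; exact: integrable_fin_num.
Qed.

Lemma bounded_integrable (mu : {finite_measure set T -> \bar R}) (f : T -> R) (C : R) :
  measurable_fun setT f -> (forall x, `|f x| <= C) -> mu.-integrable setT (EFin \o f).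
Proof.
move=> mf fC; apply: measurable_bounded_integrable => //.
  by rewrite ltey_eq fin_num_measure.
exists C; split; first exact: num_real.
by move=> y Cy x _; apply: (le_trans (fC x)); exact: ltW.
Qed.

Lemma Rbounded_cvg (mu : {finite_measure set T -> \bar R}) (f_ : (T -> R)^nat) (f : T -> R) (C : R) :
  (forall n, measurable_fun setT (f_ n)) -> measurable_fun setT f ->
  (forall x, f_ n x @[n --> \oo] --> f x) -> (forall n x, `|f_ n x| <= C) ->
  \int[mu]_x f_ n x @[n --> \oo] --> \int[mu]_x f x.
Proof.
move=> mf_ mf fcvg fg; apply: (@Rdominated_cvg _ _ _ (cst C)) => //.
by apply: (@bounded_integrable _ _ `|C|) => // x; rewrite lexx.
Qed.

Lemma EFin_Rintegral (mu : {measure set T -> \bar R}) (f : T -> R) :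
  mu.-integrable setT (EFin \o f) -> (\int[mu]_x (f x)%:E)%E = (\int[mu]_x f x)%:E.
Proof. by move=> fi; rewrite /Rintegral fineK//; exact: integrable_fin_num. Qed.

End real_integral_tools.

Section gaussian_integrals.
Context (R : realType).
Local Notation mu := (@lebesgue_measure R).

Lemma Rintegral_derive_eq0 (F h : R -> R) : continuous h ->
  (forall x : R, is_derive x (1 : R) (F : R -> R) (h x)) -> mu.-integrable setT (EFin \o h) ->
  F n%:R @[n --> \oo] --> 0 -> F (- n%:R) @[n --> \oo] --> 0 ->
  \int[mu]_x h x = 0.
Proof.
move=> ch dF ih F1 F2.
pose h_ n := h \* \1_`[- n%:R, n%:R].
have mh : measurable_fun setT h by exact: continuous_measurable_fun.
have c1 : \int[mu]_x h_ n x @[n --> \oo] --> \int[mu]_x h x.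
  apply: (@Rdominated_cvg _ _ _ mu _ _ (fun x => `|h x|)) => //.
  - move=> n; apply: measurable_funM => //; apply: measurable_indic.
  - have := integrable_abse ih; exact.
  - move=> x; apply: cvg_near_cst; near=> n.
    rewrite /h_/= indicE mem_set ?mulr1//= in_itv/= -ler_norml.
    by near: n; exact: nbhs_infty_ger.
  - by move=> n x; rewrite /h_ normrM indicE; case: (_ \in _); rewrite ?normr1 ?normr0 ?mulr1 ?mulr0.
have h_E n : (0 < n)%N -> \int[mu]_x h_ n x = F n%:R - F (- n%:R).
  move=> n0; have nn : (- n%:R < n%:R :> R).
    by rewrite gtrN// ltr0n.
  have := @continuous_FTC2 R h F _ _ nn.
  have dc x : {for x, continuous F}.
    by apply: differentiable_continuous; apply/derivable1_diffP; have [] := dF x.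
  have -> : \int[mu]_x h_ n x = \int[mu]_(x in `[- n%:R, n%:R]) h x.
    rewrite [RHS]Rintegral_mkcond; apply: eq_Rintegral => x _.
    rewrite /h_ patchE /= indicE; case: (_ \in _); rewrite ?mulr1 ?mulr0//.
  rewrite /Rintegral => -> //; first exact: continuous_subspaceT.
  - split; first by move=> x _; have [] := dF x.
    + by apply: cvg_at_right_filter; exact: dc.
    + by apply: cvg_at_left_filter; exact: dc.
  - by move=> x _; rewrite derive1E; have [_ ->] := dF x.
have c2 : \int[mu]_x h_ n x @[n --> \oo] --> (0 : R).
  have : F n%:R - F (- n%:R) @[n --> \oo] --> 0 - (0 : R) by apply: cvgB.
  rewrite subr0; apply: cvg_trans; apply: near_eq_cvg; near=> n.
  by apply/esym/h_E; near: n; exact: nbhs_infty_gt.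
exact: (cvg_unique _ c1 c2).
Unshelve. all: by end_near. Qed.

Variable s : R.
Hypothesis s0 : 0 < s.
Let pdf := normal_pdf 0 s.

Let pdfE x : pdf x = normal_peak s * expR (- x ^+ 2 / (s ^+ 2 *+ 2)).
Proof. by rewrite /pdf normal_pdfE ?gt_eqF// /normal_fun subr0. Qed.

Let is_derive_pdf (x : R) : is_derive x (1 : R) (pdf : R -> R) (- (x / s ^+ 2) * pdf x).
Proof.
rewrite (_ : pdf = (fun x => normal_peak s * expR (- x ^+ 2 / (s ^+ 2 *+ 2)))); last first.
  by apply/funext => y; rewrite pdfE.
apply: is_derive_eq; rewrite /GRing.scale /=.
have : s != 0 by rewrite gt_eqF.
by move: (expR _) => w sn0; field.
Qed.

Let sn0 : s != 0. Proof. by rewrite gt_eqF. Qed.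

(** With y = x^2 / (8 s^2) the exponents for deviations s and 2 s are - 4 y and - y, and (1 + y) exp
    (- 4 y) <= exp (- y). The bound serves as an integrable majorant and as a tail estimate. *)
Lemma normal_pdf_le x : (1 + x ^+ 2 / (8 * s ^+ 2)) * pdf x <=
  normal_peak s / normal_peak (2 * s) * normal_pdf 0 (2 * s) x.
Proof.
have s2 : 2 * s != 0 by rewrite mulf_neq0.
rewrite (normal_pdfE _ s2) /normal_fun subr0 pdfE.
have p0 : 0 < normal_peak (2 * s) by exact: normal_peak_gt0.
have p1 : 0 < normal_peak s by apply: normal_peak_gt0.
rewrite -[leRHS]mulrA [_^-1 * (_ * _)]mulrA mulVf ?gt_eqF// mul1r [leLHS]mulrCA ler_pM2l//.
set y := x ^+ 2 / (8 * s ^+ 2).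
have -> : - x ^+ 2 / (s ^+ 2 *+ 2) = - y *+ 4 by rewrite /y; field.
have -> : - x ^+ 2 / ((2 * s) ^+ 2 *+ 2) = - y by rewrite /y; field.
have y0 : 0 <= y by rewrite divr_ge0 ?sqr_ge0// mulr_ge0 ?sqr_ge0.
have := expR_ge1Dx y => h; apply: (@le_trans _ _ (expR y * expR (- y *+ 4))).
  by rewrite ler_wpM2r ?expR_ge0.
by rewrite -expRD ler_expR; lra.
Qed.

Let pdf_ub x : pdf x * (1 + x ^+ 2 / (2 * s ^+ 2)) <= normal_peak s.
Proof.
rewrite pdfE -mulrA -[leRHS]mulr1 ler_pM2l ?normal_peak_gt0//.
set y := x ^+ 2 / (2 * s ^+ 2).
have -> : - x ^+ 2 / (s ^+ 2 *+ 2) = - y by rewrite /y; field.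
by rewrite expRN ler_pdivrMl ?expR_gt0// mulr1 expR_ge1Dx.
Qed.

Lemma integrable_mul_pdf (f : R -> R) (C : R) : measurable_fun setT f ->
  (forall x, `|f x| <= C * (1 + x ^+ 2)) ->
  mu.-integrable setT (EFin \o (fun x => f x * pdf x)).
Proof.
move=> mf fC.
have C0 : 0 <= C.
  by have := le_trans (normr_ge0 _) (fC 0); rewrite expr0n/= addr0 mulr1.
pose D := C * (1 + 8 * s ^+ 2) * (normal_peak s / normal_peak (2 * s)).
have mpdf : measurable_fun setT pdf by exact: measurable_normal_pdf.
apply: (@le_integrable _ _ _ mu _ measurableT _ (fun x => (D * normal_pdf 0 (2 * s) x)%:E)).
- by apply/measurable_EFinP; exact: measurable_funM.
- move=> x _; rewrite /= lee_fin.
  rewrite [leRHS]ger0_norm; last first.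
    by rewrite mulr_ge0 ?normal_pdf_ge0// !mulr_ge0 ?invr_ge0 ?normal_peak_ge0 ?addr_ge0// mulr_ge0 ?sqr_ge0.
  rewrite normrM (ger0_norm (normal_pdf_ge0 _ _ _)).
  have D0 : 0 <= C * (1 + 8 * s ^+ 2) by rewrite mulr_ge0// addr_ge0// mulr_ge0 ?sqr_ge0.
  apply: (@le_trans _ _ (C * (1 + 8 * s ^+ 2) * ((1 + x ^+ 2 / (8 * s ^+ 2)) * pdf x))); last first.
    by rewrite /D -[leRHS]mulrA ler_wpM2l// normal_pdf_le.
  rewrite mulrA ler_wpM2r ?normal_pdf_ge0//; apply: (le_trans (fC x)).
  rewrite -mulrA ler_wpM2l//.
  have -> : (1 + 8 * s ^+ 2) * (1 + x ^+ 2 / (8 * s ^+ 2)) =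
    1 + x ^+ 2 + (8 * s ^+ 2 + x ^+ 2 / (8 * s ^+ 2)) by field.
  by rewrite lerDl; apply: addr_ge0; [rewrite mulr_ge0// sqr_ge0|rewrite divr_ge0
      ?sqr_ge0// mulr_ge0// sqr_ge0].
- under eq_fun do rewrite EFinM; apply: integrableZl => //.
  apply: (integrable_normal_pdf 0 (2 * s)).
Qed.

(** The integrand is the derivative of [g * pdf], which vanishes at infinity because [g] grows at
    most linearly. *)
Lemma normal_by_parts (g g' : R -> R) (C : R) : continuous g' ->
  (forall x : R, is_derive x (1 : R) (g : R -> R) (g' x)) ->
  (forall x, `|g x| <= C * (1 + `|x|)) -> (forall x, `|g' x| <= C) ->
  \int[mu]_x ((g' x - x / s ^+ 2 * g x) * pdf x) = 0.
Proof.
move=> cg' dg gC g'C.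
have C0 : 0 <= C by exact: le_trans (normr_ge0 _) (g'C 0).
have cg x : {for x, continuous g}.
  by apply: differentiable_continuous; apply/derivable1_diffP; have [] := dg x.
have cpdf : continuous pdf by exact: continuous_normal_pdf.
pose h x := (g' x - x / s ^+ 2 * g x).
have ch : continuous h.
  move=> x; apply: cvgB; first exact: cg'.
  by apply: cvgM; [apply: cvgM; [exact: cvg_id|exact: cvg_cst]|exact: cg].
pose F x := g x * pdf x.
have sxx x : (1 + `|x|) * `|x| <= (1 + 4 * s ^+ 2) * (1 + x ^+ 2 / (2 * s ^+ 2)).
  have -> : (1 + 4 * s ^+ 2) * (1 + x ^+ 2 / (2 * s ^+ 2)) =
    1 + 2 * x ^+ 2 + (4 * s ^+ 2 + x ^+ 2 / (2 * s ^+ 2)) by field.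
  have : 0 <= 4 * s ^+ 2 + x ^+ 2 / (2 * s ^+ 2).
    by apply: addr_ge0; [rewrite mulr_ge0// sqr_ge0|rewrite divr_ge0 ?sqr_ge0// mulr_ge0// sqr_ge0].
  rewrite -[x ^+ 2]real_normK ?num_real//.
  by have := sqr_ge0 (`|x| - 1); nra.
have Fx x : `|F x| * `|x| <= C * (1 + 4 * s ^+ 2) * normal_peak s.
  rewrite /F normrM (ger0_norm (normal_pdf_ge0 _ _ _)).
  have h1 := ler_wpM2l (_ : 0 <= C * (1 + 4 * s ^+ 2)) (pdf_ub x).
  apply: le_trans (h1 _); last first.
    by rewrite mulr_ge0// addr_ge0// mulr_ge0 ?sqr_ge0.
  rewrite mulrAC [pdf x * _]mulrC mulrA ler_wpM2r ?normal_pdf_ge0//.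
  apply: (@le_trans _ _ (C * (1 + `|x|) * `|x|)); first by rewrite ler_wpM2r.
  by rewrite -2!mulrA ler_wpM2l.
have Fcvg (x_ : R^nat) : (forall n, `|x_ n| = n%:R) -> F (x_ n) @[n --> \oo] --> (0 : R).
  move=> xn; apply/cvgrPdist_le => e e0; near=> n.
  rewrite sub0r normrN.
  have n0 : 0 < n%:R :> R by rewrite ltr0n; near: n; exact: nbhs_infty_gt.
  rewrite -(ler_pM2r n0) -{1}(xn n); apply: (le_trans (Fx _)).
  rewrite -ler_pdivrMl//; near: n; exact: nbhs_infty_ger.
apply: (@Rintegral_derive_eq0 F).
- by move=> x; apply: cvgM; [exact: ch|exact: cpdf].
- move=> x; have dgx := dg x.
  have := is_derive_pdf x => dpx.
  apply: (@is_derive_eq _ _ _ _ _ _ _ _ (is_deriveM _ _)).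
  by rewrite /GRing.scale /= /h; ring.
- apply: (@integrable_mul_pdf _ (C * (1 + 2 / s ^+ 2))).
    exact: continuous_measurable_fun.
  move=> x; apply: (le_trans (ler_normB _ _)).
  have h1 := g'C x; have h2 := gC x.
  rewrite normrM normrM (ger0_norm (_ : 0 <= (s ^+ 2)^-1)) ?invr_ge0 ?sqr_ge0//.
  have i0 : 0 <= (s ^+ 2)^-1 by rewrite invr_ge0 ?sqr_ge0.
  move: (s ^+ 2)^-1 i0 => i i0.
  have h3 : `|x| * i * `|g x| <= `|x| * i * (C * (1 + `|x|)) by rewrite ler_wpM2l// mulr_ge0.
  apply: (le_trans (lerD h1 h3)).
  have h4 : `|x| * (1 + `|x|) <= 2 * (1 + x ^+ 2).
    rewrite -[x ^+ 2]real_normK ?num_real//.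
    by have := sqr_ge0 (`|x| - 1); nra.
  have h5 := ler_wpM2l (mulr_ge0 C0 i0) h4.
  have h6 : 0 <= C * x ^+ 2 by rewrite mulr_ge0 ?sqr_ge0.
  by move: h5 h6; nra.
- by apply: (Fcvg (fun n => n%:R)) => n; rewrite ger0_norm.
- by apply: (Fcvg (fun n => - n%:R)) => n; rewrite normrN ger0_norm.
Unshelve. all: by end_near. Qed.

(** Integration by parts with g = sin (l x + t) gives phi' = - s^2 l phi for the left-hand side phi
    as a function of l, so phi times exp (l^2 s^2 / 2) is constant, equal to its value cos t at l =
    0. *)
Lemma normal_cos_pdf (t l : R) :
  \int[mu]_x (cos (l * x + t) * pdf x) = cos t * expR (- (l ^+ 2 * s ^+ 2 / 2)).
Proof.
have mpdf : measurable_fun setT pdf by exact: measurable_normal_pdf.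
pose phi l := \int[mu]_x (cos (l * x + t) * pdf x).
have dfx (y x : R) : is_derive y (1 : R) (fun l => cos (l * x + t) * pdf x : R)
    (- (x * sin (y * x + t) * pdf x)).
  by apply: is_derive_eq; rewrite /GRing.scale/=; ring.
have mcos (a b : R) : measurable_fun setT (fun x => cos (a * x + b)).
  apply: measurableT_comp; last by apply: measurable_funD => //; apply: measurable_funM.
  by apply: continuous_measurable_fun; exact: continuous_cos.
have msin (a b : R) : measurable_fun setT (fun x => sin (a * x + b)).
  apply: measurableT_comp; last by apply: measurable_funD => //; apply: measurable_funM.
  by apply: continuous_measurable_fun; exact: continuous_sin.
have icos a : mu.-integrable setT (EFin \o (fun x => cos (a * x + t) * pdf x)).
  apply: (@integrable_mul_pdf _ 1) => // x; rewrite mul1r.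
  by rewrite (le_trans (_ : _ <= 1)) ?lerDl ?sqr_ge0// ler_norml cos_geN1 cos_le1.
have isin a : mu.-integrable setT (EFin \o (fun x => x * sin (a * x + t) * pdf x)).
  apply: (@integrable_mul_pdf _ 1) => [|x]; first exact: measurable_funM.
  rewrite mul1r normrM; apply: (@le_trans _ _ `|x|).
    by rewrite ler_piMr// ler_norml sin_geN1 sin_le1.
  rewrite -[x ^+ 2]real_normK ?num_real//.
  by have := sqr_ge0 (`|x| - 1); nra.
have iG : mu.-integrable setT (EFin \o (fun x => `|x| * pdf x)).
  apply: (@integrable_mul_pdf _ 1) => [|x]; first exact: normr_measurable.
  rewrite mul1r normr_id -[x ^+ 2]real_normK ?num_real//.
  by have := sqr_ge0 (`|x| - 1); nra.
have p1E (x y : R) : partial1of2 (fun l x => cos (l * x + t) * pdf x) x y = - (y * sin (x * y + t) * pdf y).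
  by rewrite partial1of2E; have [_ ->] := dfx x y.
have dphi l0 : is_derive l0 (1 : R) (phi : R -> R) (- (s ^+ 2 * l0) * phi l0).
  have [dp dpE] : derivable phi l0 1 /\ derive1 phi l0 =
      \int[mu]_x (partial1of2 (fun l x => cos (l * x + t) * pdf x) l0 x).
    split.
      apply: (@derivable_under_integral R _ _ mu (fun l x => cos (l * x + t) * pdf x) setT
          measurableT l0 (l0 - 1) (l0 + 1) _ _ _ (fun x => `|x| * pdf x)) => //.
      - by rewrite /= in_itv/=; apply/andP; split; lra.
      - by move=> y; rewrite mulr_ge0 ?normal_pdf_ge0.
      - move=> x y _ _; rewrite p1E normrN !normrM (ger0_norm (normal_pdf_ge0 _ _ _)).
        by rewrite ler_wpM2r ?normal_pdf_ge0// ler_piMr// ler_norml sin_geN1 sin_le1.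
    apply: (@differentiation_under_integral R _ _ mu (fun l x => cos (l * x + t) * pdf x)
        setT measurableT l0 (l0 - 1) (l0 + 1) _ _ _ (fun x => `|x| * pdf x)) => //.
      - by rewrite /= in_itv/=; apply/andP; split; lra.
      - by move=> y; rewrite mulr_ge0 ?normal_pdf_ge0.
      - move=> x y _ _; rewrite p1E normrN !normrM (ger0_norm (normal_pdf_ge0 _ _ _)).
        by rewrite ler_wpM2r ?normal_pdf_ge0// ler_piMr// ler_norml sin_geN1 sin_le1.
  apply: DeriveDef => //; rewrite -derive1E dpE.
  have cl (a b : R) : continuous (fun x : R => a * x + b).
    by move=> x; apply: cvgD; [apply: cvgM; [exact: cvg_cst|exact: cvg_id]|exact: cvg_cst].
  have H := @normal_by_parts (fun x => sin (l0 * x + t)) (fun x => l0 * cos (l0 * x + t)) (1 + `|l0|).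
  have e : l0 * phi l0 = (s ^+ 2)^-1 * \int[mu]_x (x * sin (l0 * x + t) * pdf x).
    apply/eqP; rewrite -subr_eq0 -!RintegralZl// -RintegralB//; last 2 first.
    - by have := integrableZl measurableT l0 (icos l0); apply: eq_integrable.
    - by have := integrableZl measurableT (s ^+ 2)^-1 (isin l0); apply: eq_integrable.
    apply/eqP; rewrite -[RHS]H.
    - by apply: eq_Rintegral => x _; ring.
    - move=> x; apply: cvgM; first exact: cvg_cst.
      by apply: (continuous_comp (cl l0 t x)); exact: continuous_cos.
    - by move=> x; apply: is_derive_eq; rewrite /GRing.scale/=; ring.
    - move=> x; apply: (@le_trans _ _ 1); first by rewrite ler_norml sin_geN1 sin_le1.
      by rewrite -[leLHS]mulr1 ler_pM// lerDl.
    - move=> x; rewrite normrM; apply: (@le_trans _ _ `|l0|); last by rewrite lerDr.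
      by rewrite ler_piMr// ler_norml cos_geN1 cos_le1.
  have -> : \int[mu]_x partial1of2 (fun l x => cos (l * x + t) * pdf x) l0 x =
    - \int[mu]_x (x * sin (l0 * x + t) * pdf x).
    under eq_Rintegral do rewrite p1E -mulN1r.
    by rewrite RintegralZl// mulN1r.
  apply/eqP; rewrite mulNr eqr_opp -mulrA e.
  by rewrite mulrA divff ?mul1r// expf_neq0.
pose psi l := phi l * expR (l ^+ 2 * s ^+ 2 / 2).
have dpsi l0 : is_derive l0 (1 : R) (psi : R -> R) 0.
  have dp := dphi l0.
  by apply: is_derive_eq; rewrite /GRing.scale/=; field.
have psi0 : psi l = cos t.
  rewrite (is_derive_0_is_cst l 0 dpsi) /psi /phi expr0n/= mul0r mul0r expR0 mulr1.
  under eq_Rintegral do rewrite mul0r add0r.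
  rewrite RintegralZl//; last exact: integrable_normal_pdf.
  by rewrite /Rintegral integral_normal_pdf//= mulr1.
by rewrite -psi0 /psi -[RHS]mulrA -expRD addrN expR0 mulr1.
Qed.

Lemma normal_variance_pdf : \int[mu]_x (x ^+ 2 * pdf x) = s ^+ 2.
Proof.
have mpdf : measurable_fun setT pdf by exact: measurable_normal_pdf.
have i2 : mu.-integrable setT (EFin \o (fun x => x ^+ 2 * pdf x)).
  apply: (@integrable_mul_pdf _ 1); first exact: measurable_funX.
  by move=> x; rewrite mul1r ger0_norm ?sqr_ge0// lerDr.
have ip : mu.-integrable setT (EFin \o pdf) by exact: integrable_normal_pdf.
have H := @normal_by_parts id (fun=> 1) 1 _ _ _ _.
have {}H : \int[mu]_x (pdf x) - (s ^+ 2)^-1 * \int[mu]_x (x ^+ 2 * pdf x) = 0.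
  rewrite -RintegralZl// -RintegralB//; last first.
    by have := integrableZl measurableT (s ^+ 2)^-1 i2; apply: eq_integrable.
  rewrite -[RHS]H.
  - by apply: eq_Rintegral => x _; ring.
  - by move=> x; exact: cvg_cst.
  - by move=> x; rewrite mul1r lerDr.
  - by move=> x; rewrite normr1.
move: H; rewrite {1}/Rintegral integral_normal_pdf//= => /eqP.
rewrite subr_eq0 => /eqP e.
by rewrite -[RHS]mulr1 e mulrA divff ?mul1r// expf_neq0.
Qed.

End gaussian_integrals.

Section normal_prob_integrals.
Context (R : realType).
Local Notation mu := (@lebesgue_measure R).

Lemma normal_pdf_expE (m s x : R) : s != 0 ->
  normal_pdf m s x = normal_peak s * expR (- (x - m) ^+ 2 / (s ^+ 2 *+ 2)).
Proof. by move=> s0; rewrite normal_pdfE. Qed.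

Lemma normal_peakE (s : R) : 0 < s -> normal_peak s = s^-1 / Num.sqrt (pi *+ 2).
Proof.
by move=> s0; rewrite /normal_peak -mulrnAr sqrtrM ?sqr_ge0// sqrtr_sqr ger0_norm ?ltW// invfM.
Qed.

Lemma ge0_integral_normal (m s : R) (g : R -> \bar R) : measurable_fun setT g ->
  (forall x, 0 <= g x)%E ->
  (\int[normal_prob m s]_x g x = \int[mu]_x (g x * (normal_pdf m s x)%:E))%E.
Proof.
move=> mg g0.
have mp : measurable_fun setT (EFin \o normal_pdf m s).
  by apply/measurable_EFinP; exact: measurable_normal_pdf.
have p0 x : (0 <= (EFin \o normal_pdf m s) x)%E by rewrite lee_fin normal_pdf_ge0.
exact: (@ge0_integral_density _ _ R mu _ mp p0 g mg g0).
Qed.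

Lemma integral_normal (m s : R) (f : R -> R) : measurable_fun setT f ->
  (\int[normal_prob m s]_x (f x)%:E = \int[mu]_x (f x * normal_pdf m s x)%:E)%E.
Proof.
move=> mf; rewrite integralE [RHS]integralE.
congr (_ - _)%E; rewrite ge0_integral_normal//.
- apply: eq_integral => x _; rewrite !funeposE -!EFin_max -EFinM; congr (_%:E).
  by rewrite maxr_pMl ?mul0r// normal_pdf_ge0.
- by apply: measurable_funepos; exact/measurable_EFinP.
- apply: eq_integral => x _; rewrite !funenegE -!EFinN -!EFin_max -EFinM; congr (_%:E).
  by rewrite maxr_pMl ?mul0r ?mulNr// normal_pdf_ge0.
- by apply: measurable_funeneg; exact/measurable_EFinP.
Qed.

Lemma Rintegral_normal (m s : R) (f : R -> R) : measurable_fun setT f ->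
  \int[normal_prob m s]_x f x = \int[mu]_x (f x * normal_pdf m s x).
Proof. by move=> mf; rewrite /Rintegral integral_normal. Qed.

Lemma measurable_cos_affine (a b : R) : measurable_fun setT (fun x => cos (a * x + b)).
Proof.
apply: measurableT_comp; last by apply: measurable_funD => //; apply: measurable_funM.
by apply: continuous_measurable_fun; exact: continuous_cos.
Qed.

Lemma normal_cos (s t l : R) : 0 < s ->
  \int[normal_prob 0 s]_x cos (l * x + t) = cos t * expR (- (l ^+ 2 * s ^+ 2 / 2)).
Proof.
by move=> s0; rewrite Rintegral_normal ?normal_cos_pdf//; exact: measurable_cos_affine.
Qed.

Lemma normal_second_moment (s : R) : 0 < s ->
  (\int[normal_prob 0 s]_x (x ^+ 2)%:E = (s ^+ 2)%:E)%E.
Proof.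
move=> s0; rewrite integral_normal; last exact: measurable_funX.
rewrite EFin_Rintegral ?normal_variance_pdf//.
apply: (@integrable_mul_pdf _ _ s0 _ 1); first exact: measurable_funX.
by move=> x; rewrite mul1r ger0_norm ?sqr_ge0// lerDr.
Qed.

(* Completing the square turns the integrand into a multiple of the density of
   the normal law with variance [(1 + a)^-1] and mean [- b / (1 + a)]. *)
Lemma normal_exp_quadratic (a b : R) : 0 <= a ->
  (\int[normal_prob 0 1]_z (expR (- (a * z ^+ 2 + 2 * b * z) / 2))%:E =
   ((Num.sqrt (1 + a))^-1 * expR (b ^+ 2 / (1 + a) / 2))%:E)%E.
Proof.
move=> a0; have a1 : 0 < 1 + a by rewrite ltr_pwDl.
set s := (Num.sqrt (1 + a))^-1.
have s0 : 0 < s by rewrite invr_gt0 sqrtr_gt0.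
have s2 : s ^+ 2 = (1 + a)^-1 by rewrite /s exprVn sqr_sqrtr// ltW.
set k := s * expR (b ^+ 2 / (1 + a) / 2).
have k0 : 0 <= k by rewrite mulr_ge0 ?expR_ge0// ltW.
have me : measurable_fun setT (fun z : R => expR (- (a * z ^+ 2 + 2 * b * z) / 2)).
  apply: measurableT_comp => //; apply: measurable_funM => //; apply: measurableT_comp => //.
  by apply: measurable_funD; apply: measurable_funM => //; exact: measurable_funX.
rewrite integral_normal//.
under eq_integral => z _.
  rewrite (_ : _ * _ = k * normal_pdf (- b / (1 + a)) s z); first over.
  rewrite (normal_pdf_expE _ _ (oner_neq0 _)) (normal_pdf_expE _ _ (lt0r_neq0 s0)) /k /normal_peak.
  rewrite [RHS]mulrACA [LHS]mulrCA -!expRD s2; congr (_ * expR _); last by field; rewrite gt_eqF.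
  rewrite expr1n mul1r -mulrnAr sqrtrM ?invr_ge0 ?ltW// sqrtrV ?ltW// invfM invrK mulrA.
  by rewrite /s mulVf ?mul1r// gt_eqF// sqrtr_gt0.
under eq_integral do rewrite EFinM.
rewrite ge0_integralZl//; last 2 first.
- by apply/measurable_EFinP; exact: measurable_normal_pdf.
- by move=> x _; rewrite lee_fin normal_pdf_ge0.
by rewrite integral_normal_pdf ?mule1// gt_eqF.
Qed.

(** For [r > 0] the integrand is [2 / r] times the density of the normal law of deviation [r^-1],
    half of whose mass lies on the positive axis. For [r = 0] both sides are infinite. *)
Lemma inv_mixture (r : R) : 0 <= r ->
  (\int[mu]_(u in `]0%R, +oo[) (Num.sqrt (2 / pi) * expR (- (u ^+ 2 * r ^+ 2 / 2)))%:E =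
   (r%:E)^-1)%E.
Proof.
move=> r0; have c0 : 0 < Num.sqrt (2 / pi) :> R by rewrite sqrtr_gt0 divr_gt0 ?pi_gt0.
move: r0; rewrite le_eqVlt => /predU1P[<-|r0].
  rewrite inve0; under eq_integral do rewrite expr0n/= mulr0 mul0r oppr0 expR0 mulr1.
  by rewrite integral_cst//= lebesgue_measure_itv/= ltry addye// gt0_muley// lte_fin.
have ri : 0 < r^-1 by rewrite invr_gt0.
have e x : Num.sqrt (2 / pi) * expR (- (x ^+ 2 * r ^+ 2 / 2)) = 2 / r * normal_pdf 0 r^-1 x.
  rewrite normal_pdf_expE ?gt_eqF// subr0 [RHS]mulrA; congr (_ * expR _); last first.
    by field; rewrite gt_eqF.
  rewrite normal_peakE// invrK.
  rewrite -[pi *+ 2]mulr_natl !sqrtrM ?pi_ge0// sqrtrV ?pi_ge0//.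
  have h2 : 2 = Num.sqrt 2 ^+ 2 :> R by rewrite sqr_sqrtr.
  have p0 : Num.sqrt pi != 0 :> R by rewrite gt_eqF// sqrtr_gt0 pi_gt0.
  have p2 : Num.sqrt 2 != 0 :> R by rewrite gt_eqF// sqrtr_gt0.
  rewrite [X in X / r]h2; move: p0 p2; move: (Num.sqrt pi) (Num.sqrt 2) => p q p0 p2.
  by field; rewrite p0 p2 gt_eqF.
under eq_integral do rewrite e EFinM.
rewrite ge0_integralZl//; last 3 first.
- by apply/measurable_EFinP/measurable_funTS; exact: measurable_normal_pdf.
- by move=> x _; rewrite lee_fin normal_pdf_ge0.
- by rewrite lee_fin divr_ge0// ltW.
have := integral_normal_pdf 0 r^-1.
rewrite ge0_symfun_integralT; last 3 first.
- by move=> x; rewrite normal_pdf_ge0.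
- by apply: continuous_normal_pdf; rewrite gt_eqF.
- by move=> x /=; rewrite !normal_pdfE ?gt_eqF// /normal_fun !subr0 sqrrN.
rewrite -set_itvcy integral_itv_obnd_cbnd//; last first.
  by apply/measurable_EFinP/measurable_funTS; exact: measurable_normal_pdf.
rewrite [(2 / r)%R]mulrC EFinM -muleA => ->.
by rewrite mule1 inver gt_eqF.
Qed.

Lemma integral_inv1sqr (w : R) : 0 < w ->
  (\int[mu]_(u in `]0%R, +oo[) ((1 + (u * w) ^+ 2)^-1)%:E = (pi / 2 / w)%:E)%E.
Proof.
move=> w0.
have cden (x : R) : {for x, continuous (fun u : R => (1 + (u * w) ^+ 2)^-1)}.
  apply: cvgV; first by rewrite gt_eqF// ltr_pwDl// sqr_ge0.
  apply: cvgD; first exact: cvg_cst.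
  have cm : {for x, continuous (fun u : R => u * w)} by apply: cvgM; [exact: cvg_id|exact: cvg_cst].
  exact: (continuous_comp cm (@exprn_continuous R 2 _)).
rewrite integral_itv_obnd_cbnd; last first.
  by apply/measurable_EFinP/measurable_funTS; exact: continuous_measurable_fun.
have dF (x : R) : is_derive x (1 : R) (fun u : R => atan (u * w) / w : R) (1 + (x * w) ^+ 2)^-1.
  apply: is_derive_eq; rewrite /GRing.scale/=.
  have h1 : 1 + (x * w) ^+ 2 != 0 by rewrite gt_eqF// ltr_pwDl// sqr_ge0.
  by field; rewrite h1 gt_eqF.
rewrite (@ge0_continuous_FTC2y R _ (fun u : R => atan (u * w) / w) _ (pi / 2 / w)).
- by rewrite mul0r atan0 mul0r sube0.
- by move=> x _; rewrite invr_ge0 addr_ge0// sqr_ge0.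
- exact: continuous_subspaceT.
- apply: cvgMl; have -> : atan (u * w) @[u --> +oo] = (@atan R \o (fun u => u * w)) u @[u --> +oo] by [].
  apply: (@cvg_comp _ _ _ (fun u => u * w) atan _ +oo%R); last exact: cvgy_atan.
  by apply: gt0_cvgMly.
- by move=> x _; have [] := dF x.
- apply: cvg_at_right_filter; have [dF0 _] := dF 0.
  by move/derivable1_diffP/differentiable_continuous : dF0.
- by move=> x _; rewrite derive1E; have [_ ->] := dF x.
Qed.

End normal_prob_integrals.

(** * Uniqueness on the line from characteristic functions *)

Section charfn_unique.
Context (R : realType).
Local Notation mu := (@lebesgue_measure R).
Local Notation borel := (measurableTypeR R).
Implicit Types m : {finite_measure set borel -> \bar R}.

(** On [C] the density of deviation [s] is at most [2 / (1 + c)] times that of deviation [2 * s],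
    where 2 is the ratio of the peaks. *)
Let tail_le (x s c : R) (C : set R) : 0 < s -> 0 <= c -> measurable C ->
  (forall a, C a -> c <= (a - x) ^+ 2 / (8 * s ^+ 2)) ->
  (normal_prob x s C <= (2 / (1 + c))%:E)%E.
Proof.
move=> s0 c0 mC Cc.
have s20 : 0 < 2 * s by rewrite mulr_gt0.
have ms z : measurable_fun setT (fun y => (normal_pdf x z y)%:E).
  by apply/measurable_EFinP; exact: measurable_normal_pdf.
apply: (@le_trans _ _ (\int[mu]_(y in C) ((2 / (1 + c)) * normal_pdf x (2 * s) y)%:E)%E).
  apply: ge0_le_integral => //.
  - by move=> y _; rewrite lee_fin normal_pdf_ge0.
  - by apply: measurable_funTS; exact: ms.
  - apply: measurable_funTS; under eq_fun do rewrite EFinM.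
    by apply: emeasurable_funM => //; exact: ms.
  move=> y Cy; rewrite lee_fin mulrAC ler_pdivlMr ?ltr_pwDl//.
  have := normal_pdf_le s0 (y - x).
  rewrite !normal_pdf_expE ?gt_eqF// !subr0.
  have -> : normal_peak s / normal_peak (2 * s) = 2 :> R.
    have : Num.sqrt (pi *+ 2) != 0 :> R by rewrite gt_eqF// sqrtr_gt0 mulrn_wgt0// pi_gt0.
    by rewrite !normal_peakE// => h; field; rewrite h gt_eqF.
  apply: le_trans; rewrite mulrC ler_wpM2r ?mulr_ge0 ?expR_ge0 ?normal_peak_ge0//.
  by rewrite lerD2l Cc.
under eq_integral do rewrite EFinM.
rewrite ge0_integralZl//; last 3 first.
- by apply: measurable_funTS; exact: ms.
- by move=> y _; rewrite lee_fin normal_pdf_ge0.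
- by rewrite lee_fin divr_ge0// addr_ge0.
rewrite -[leRHS]mule1 lee_pmul2l//; last by rewrite lte_fin divr_gt0// ltr_pwDl.
exact: (probability_le1 (normal_prob x (2 * s))).
Qed.

(** A Gaussian smoothing of the indicator of []-oo, c[]. The shift 1 / (n + 1) exceeds the deviation
    (n + 1)^-2 by a growing factor, so the limit at [x = c] is 0 and not 1 / 2. *)
Let step (c : R) n x := fine (normal_prob x (n.+1%:R ^- 2) `]-oo, (c - n.+1%:R^-1)[%classic).

Let cvg_inv_affine (u : R^nat) (k : R) : 0 < k ->
  (\forall n \near \oo, 0 <= u n <= 2 / (1 + k * n.+1%:R)) -> u n @[n --> \oo] --> 0.
Proof.
move=> k0 uk; apply/cvgrPdist_le => e e0; near=> n.
have /andP[u0 un] : 0 <= u n <= 2 / (1 + k * n.+1%:R) by near: n.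
rewrite sub0r normrN ger0_norm// (le_trans un)// ler_pdivrMr ?ltr_pwDl ?mulr_ge0 ?ltW//.
have : 2 / (e * k) <= n%:R by near: n; exact: nbhs_infty_ger.
rewrite ler_pdivrMr ?mulr_gt0// => h; rewrite -natr1; nra.
Unshelve. all: by end_near. Qed.

Let step_bounds c n x : 0 <= step c n x <= 1.
Proof.
have mC : measurable (`]-oo, (c - n.+1%:R^-1)[%classic : set R) by exact: measurable_itv.
rewrite fine_ge0//= -lee_fin fineK ?fin_num_measure//.
exact: (probability_le1 (normal_prob x (n.+1%:R ^- 2))).
Qed.

Let step_cvg c x : step c n x @[n --> \oo] --> (\1_(`]-oo, c[%classic : set R) x : R).
Proof.
have sn0 n : 0 < n.+1%:R ^- 2 :> R by rewrite invr_gt0 exprn_gt0.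
have mC n : measurable (`]-oo, (c - n.+1%:R^-1)[%classic : set R) by exact: measurable_itv.
have fin n : normal_prob x (n.+1%:R ^- 2) `]-oo, (c - n.+1%:R^-1)[%classic \is a fin_num.
  by rewrite fin_num_measure.
(* For the deviation (n + 1)^-2 this makes the parameter [c] of [tail_le] grow linearly in [n], as
   [cvg_inv_affine] expects. *)
have sq (n : nat) (k a : R) : k <= a ^+ 2 * n.+1%:R ^+ 3 ->
    k / 8 * n.+1%:R <= a ^+ 2 / (8 * (n.+1%:R ^- 2) ^+ 2).
  have -> : a ^+ 2 / (8 * (n.+1%:R ^- 2) ^+ 2) = a ^+ 2 * n.+1%:R ^+ 3 / 8 * n.+1%:R by field.
  by move=> h; rewrite ler_wpM2r// ler_wpM2r.
rewrite indicE; have [xc|cx] := ltP x c.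
- rewrite mem_set /= ?in_itv//=.
  pose d := (c - x) / 2; have d0 : 0 < d by rewrite divr_gt0// subr_gt0.
  have h : (1 - step c n x) @[n --> \oo] --> (0 : R).
    apply: (@cvg_inv_affine _ (d ^+ 2 / 8)); first by rewrite divr_gt0// exprn_gt0.
    near=> n; have /andP[_ h1] := step_bounds c n x.
    rewrite subr_ge0 h1/= -lee_fin EFinB fineK//.
    rewrite -probability_setC//.
    apply: tail_le => //.
    + by rewrite mulr_ge0// divr_ge0// sqr_ge0.
    + exact: measurableC.
    move=> a /=; rewrite in_itv/= => /negP; rewrite -leNgt => ac; apply: sq.
    have dn : n.+1%:R^-1 <= d.
      rewrite invf_ple ?posrE//; apply: le_trans (_ : n%:R <= _); last by rewrite ler_nat.
      by near: n; exact: nbhs_infty_ger.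
    have da : d <= a - x.
      have dd : c = x + d + d by rewrite /d; field.
      by move: dn ac; rewrite {1}dd; move: (n.+1%:R^-1) => y dn ac; lra.
    have N1 : 1 <= n.+1%:R ^+ 3 :> R by rewrite exprn_ege1// ler1n.
    have ax0 : 0 <= a - x := le_trans (ltW d0) da.
    by rewrite -[leLHS]mulr1 ler_pM ?sqr_ge0// ler_sqr// nnegrE ltW.
  have : (1 - (1 - step c n x)) @[n --> \oo] --> (1 - 0 : R).
    by apply: cvgB => //; exact: cvg_cst.
  by rewrite subr0; under eq_fun do rewrite subKr.
- rewrite memNset; last by rewrite /= in_itv/= ltNge cx.
  apply: (@cvg_inv_affine _ (1 / 8)) => //; near=> n.
  rewrite fine_ge0//= -lee_fin fineK//.
  apply: tail_le => // a /=; rewrite in_itv/= => ac; apply: sq.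
  have ax : n.+1%:R^-1 <= x - a.
    by rewrite lerBrDl -lerBrDr (le_trans (ltW ac))// lerD2r.
  have N0 : 0 < n.+1%:R :> R by [].
  rewrite -ler_pdivrMr ?exprn_gt0// -sqrrN opprB.
  apply: (@le_trans _ _ (n.+1%:R^-1 ^+ 2)); last by rewrite ler_sqr ?nnegrE ?(le_trans _ ax).
  by rewrite div1r exprVn lef_pV2 ?posrE ?exprn_gt0// ler_weXn2l// ler1n.
Unshelve. all: by end_near. Qed.

Let measurable_step c n : measurable_fun setT (step c n).
Proof.
apply: measurableT_comp => //.
rewrite /normal_prob.
apply: (@measurable_fun_integral_param _ _ _ borel R mu _ (fun z => (normal_pdf z.1 (n.+1%:R ^- 2) z.2)%:E)).
- exact: measurable_itv.
- apply/measurable_EFinP.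
  under eq_fun do rewrite normal_pdf_expE ?gt_eqF ?invr_gt0 ?exprn_gt0//.
  apply: measurable_funM => //; apply: measurableT_comp => //.
  apply: measurable_funM => //; apply: measurableT_comp => //.
  by apply: measurable_funX; apply: measurable_funB.
- by move=> z; rewrite lee_fin normal_pdf_ge0.
Qed.

(** The test functions 1 + cos are nonnegative, so Tonelli's theorem applies. Averaging cos (l (x -
    a)) over a normal [l] of deviation [s^-1] gives the Gaussian kernel [gs]; integrating the kernel
    over [a] gives the functions [step], which tend to indicators of half-lines, and these form a
    generating class stable under intersection. *)
Lemma finite_measure_charfn_unique m1 m2 :
  (forall l t : R, \int[m1]_x (1 + cos (l * x + t))%:E = \int[m2]_x (1 + cos (l * x + t))%:E)%E ->
  forall A, measurable A -> m1 A = m2 A.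
Proof.
move=> ecos.
have icos m l t : m.-integrable setT (fun x => (cos (l * x + t))%:E).
  apply: (@bounded_integrable _ _ _ m _ 1); first exact: measurable_cos_affine.
  by move=> x; rewrite ler_norml cos_geN1 cos_le1.
have icst m : m.-integrable setT (fun=> 1%:E).
  by apply: (@bounded_integrable _ _ _ m (fun=> 1) 1) => // x; rewrite normr1.
pose gs (s a x : R) := expR (- (a - x) ^+ 2 / (s ^+ 2 *+ 2)).
have mgs s : measurable_fun setT (fun z : R * R => gs s z.1 z.2).
  apply: measurableT_comp => //; apply: measurable_funM => //; apply: measurableT_comp => //.
  by apply: measurable_funX; apply: measurable_funB.
have egs s a : 0 < s -> (\int[m1]_x (gs s a x)%:E = \int[m2]_x (gs s a x)%:E)%E.
  move=> s0; have si0 : 0 < s^-1 by rewrite invr_gt0.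
  have mc2 : measurable_fun setT (fun z : borel * borel => (1 + cos (z.2 * z.1 + - (z.2 * a)))%:E).
    apply/measurable_EFinP; apply: measurable_funD => //.
    apply: measurableT_comp; first by apply: continuous_measurable_fun; exact: continuous_cos.
    apply: measurable_funD; first exact: measurable_funM.
    by apply: measurableT_comp => //; exact: measurable_funM.
  have c0 (x : R) : (0 <= (1 + cos x)%:E)%E.
    by have := cos_geN1 x; rewrite lee_fin; lra.
  have e m : (\int[m]_x (1 + gs s a x)%:E = m setT + \int[m]_x (gs s a x)%:E)%E.
    under eq_integral do rewrite EFinD.
    rewrite ge0_integralD//; last 2 first.
    - by move=> x _; rewrite lee_fin expR_ge0.
    - apply/measurable_EFinP; exact: (measurableT_comp (mgs s) (measurable_pair1 a)).
    by rewrite integral_cst// mul1e.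
  have e2 m : (\int[m]_x (1 + gs s a x)%:E =
      \int[normal_prob 0 s^-1]_l \int[m]_x (1 + cos (l * x + - (l * a)))%:E)%E.
    rewrite -(@fubini_tonelli _ _ borel borel R m (normal_prob 0 s^-1) (fun z => (1 + cos
        (z.2 * z.1 + - (z.2 * a)))%:E))//.
    apply: eq_integral => x _ /=.
    have -> : (fun y : R => (1 + cos (y * x + - (y * a)))%:E) =
        (fun y : R => (1%:E + (cos ((x - a) * y + 0))%:E)%E).
      by apply/funext => y; rewrite EFinD; congr (_ + (cos _)%:E)%E; ring.
    have ic : (normal_prob 0 s^-1).-integrable setT (fun y : R => (cos ((x - a) * y + 0))%:E).
      exact: icos.
    rewrite (integralD measurableT (icst _) ic) (integral_cst _ measurableT 1) mul1e.
    rewrite [X in (X + _)%E]probability_setT EFin_Rintegral// normal_cos//.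
    rewrite cos0 mul1r EFinD /gs; congr (_ + (expR _)%:E)%E.
    by field; rewrite gt_eqF.
  have : (\int[m1]_x (1 + gs s a x)%:E = \int[m2]_x (1 + gs s a x)%:E)%E.
    by rewrite !e2; apply: eq_integral => l _; rewrite ecos.
  have mT : m1 setT = m2 setT.
    have := ecos 0 0; under eq_integral do rewrite mul0r add0r cos0.
    under [in X in _ = X]eq_integral do rewrite mul0r add0r cos0.
    rewrite !integral_cst//= -(fineK (fin_num_measure m1 _ measurableT)) -(fineK
        (fin_num_measure m2 _ measurableT)).
    by move=> -[] /(mulfI _) ->//; rewrite gt_eqF.
  move=> h; rewrite !e mT in h; move/(congr1 (fun z => (z - m2 setT)%E)) : h.
  by rewrite ![(m2 setT + _)%E]addeC !addeK// fin_num_measure.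
have estep c n : (\int[m1]_x (step c n x)%:E = \int[m2]_x (step c n x)%:E)%E.
  have sn0 : 0 < n.+1%:R ^- 2 :> R by rewrite invr_gt0 exprn_gt0.
  have mC : measurable (`]-oo, (c - n.+1%:R^-1)[%classic : set R) by exact: measurable_itv.
  have e m : (\int[m]_x (step c n x)%:E = \int[mu]_(a in `]-oo, (c - n.+1%:R^-1)%R[)
      ((normal_peak (n.+1%:R ^- 2))%:E * \int[m]_x (gs (n.+1%:R ^- 2) a x)%:E))%E.
    transitivity (\int[mu]_(a in `]-oo, (c - n.+1%:R^-1)%R[) \int[m]_x (normal_pdf x (n.+1%:R ^- 2) a)%:E)%E.
      rewrite -(@tonelli_in _ _ borel borel R m mu setT _ (fun z => (normal_pdf z.1
          (n.+1%:R ^- 2) z.2)%:E))//.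
      - by apply: eq_integral => x _; rewrite fineK// fin_num_measure.
      - apply/measurable_EFinP; under eq_fun do rewrite normal_pdf_expE ?gt_eqF//.
        apply: measurable_funM => //.
        exact: (measurableT_comp (mgs (n.+1%:R ^- 2)) (@measurable_swap _ _ R R)).
      - by move=> z; rewrite lee_fin normal_pdf_ge0.
    apply: eq_integral => a _; rewrite -ge0_integralZl//.
    - by apply: eq_integral => x _; rewrite normal_pdf_expE ?gt_eqF// EFinM.
    - apply/measurable_EFinP; exact: (measurableT_comp (mgs _) (measurable_pair1 a)).
    - by move=> x _; rewrite lee_fin expR_ge0.
    - by rewrite lee_fin normal_peak_ge0.
  by rewrite !e; apply: eq_integral => a _; rewrite egs.
have Rm c (m : {finite_measure set borel -> \bar R}) :
    \int[m]_x step c n x @[n --> \oo] --> fine (m `]-oo, c[%classic).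
  have <- : \int[m]_x (\1_(`]-oo, c[%classic : set R) x) = fine (m `]-oo, c[%classic).
    by rewrite /Rintegral integral_indic ?setIT.
  apply: (@Rbounded_cvg _ _ _ m _ _ 1); first exact: measurable_step.
  - by apply: measurable_indic; exact: measurable_itv.
  - exact: step_cvg.
  - by move=> n x; have /andP[? ?] := step_bounds c n x; rewrite ger0_norm.
have eqc (c : R) : m1 `]-oo, c[%classic = m2 `]-oo, c[%classic.
  have h1 := Rm c m1; have h2 := Rm c m2.
  have mC : measurable (`]-oo, c[%classic : set R) by exact: measurable_itv.
  rewrite -(fineK (fin_num_measure m1 _ mC)) -(fineK (fin_num_measure m2 _ mC)).
  congr (_%:E); move: h1; rewrite /Rintegral; under eq_fun do rewrite estep.
  by move=> h1; exact: (cvg_unique _ h1 h2).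
move=> A mA.
apply: (@g_sigma_algebra_measure_unique _ R borel (@RGenInftyO.G R) _ (fun n => `]-oo, n%:R[%classic)) => //.
- by move=> _ [c ->]; exact: measurable_itv.
- by move=> n; exists n%:R.
- rewrite -subTset => x _; exists (Num.bound `|x|) => //=; rewrite in_itv/=.
  by rewrite (le_lt_trans (ler_norm x))// archi_boundP.
- move=> _ _ [c ->] [d ->]; exists (Num.min c d).
  by apply/seteqP; split => x/=; rewrite !in_itv/= lt_min => /andP.
- by move=> _ [c ->]; exact: eqc.
- by move=> n; rewrite -ge0_fin_numE// fin_num_measure//; exact: measurable_itv.
- by have := mA; rewrite {1}RGenInftyO.measurableE.
Qed.

End charfn_unique.

(** * Measures determined by characteristic functions *)

Section weighted_law.
Context d d' (T : measurableType d) (T' : measurableType d') (R : realType).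
Variables (m : {finite_measure set T -> \bar R}) (f : T -> R) (C : R) (Y : T -> T').
Hypotheses (mf : measurable_fun setT f) (fC : forall w, 0 <= f w <= C).
Hypothesis mY : measurable_fun setT Y.

Let f0 w : (0 <= (EFin \o f) w)%E.
Proof. by rewrite lee_fin; have /andP[] := fC w. Qed.

Let mf' : measurable_fun setT (EFin \o f).
Proof. exact/measurable_EFinP. Qed.

Let rho := [the {measure set T -> \bar R} of @density_measure _ T R m _ mf' f0].

Definition weighted_law of measurable_fun setT Y : set T' -> \bar R :=
  fun A => rho (Y @^-1` A).

Let nu := weighted_law mY.

Let mpre A : measurable A -> measurable (Y @^-1` A).
Proof. by move=> mA; rewrite -[X in measurable X]setTI; exact: mY. Qed.

Let nu0 : (nu set0 = 0)%E.
Proof. by rewrite /nu /weighted_law preimage_set0 measure0. Qed.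

Let nu_ge0 A : (0 <= nu A)%E. Proof. exact: measure_ge0. Qed.

Let nu_sigma_additive : semi_sigma_additive nu.
Proof.
move=> F mF tF mUF; rewrite /nu /weighted_law preimage_bigcup.
apply: measure_semi_sigma_additive => [n||]; first exact: mpre.
- apply/trivIsetP => /= i j _ _ ij; rewrite -preimage_setI.
  by move/trivIsetP : tF => /(_ _ _ _ _ ij) ->//; rewrite preimage_set0.
- by rewrite -preimage_bigcup; exact: mpre.
Qed.

HB.instance Definition _ := isMeasure.Build _ _ _ nu nu0 nu_ge0 nu_sigma_additive.

Let nuT : fin_num_fun nu.
Proof.
apply: lty_fin_num_fun.
suff : (\int[m]_w (f w)%:E < +oo)%E by rewrite /= /nu /weighted_law preimage_setT.
apply: (@le_lt_trans _ _ (\int[m]_w C%:E)%E).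
  apply: ge0_le_integral => //.
  - by move=> w _; have := f0 w.
  - by move=> w _; rewrite lee_fin; have /andP[] := fC w.
by rewrite integral_cst// ltey_eq fin_numM// fin_num_measure.
Qed.

HB.instance Definition _ := Measure_isFinite.Build _ _ _ nu nuT.

Lemma ge0_integral_weighted_law g : measurable_fun setT g -> (forall x, 0 <= g x)%E ->
  (\int[nu]_x g x = \int[m]_w (g (Y w) * (f w)%:E))%E.
Proof.
move=> mg g0.
have -> : (\int[nu]_x g x = \int[pushforward rho Y]_x g x)%E by [].
rewrite ge0_integral_pushforward// preimage_setT.
exact: (@ge0_integral_density _ T R m _ mf' f0 _ (measurableT_comp mg mY) (fun w => g0 (Y w))).
Qed.

End weighted_law.

Section charfn_measure_unique.
Context d (T : measurableType d) (R : realType) (I : Type) (X : I -> T -> R).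
Hypothesis mX : forall i, measurable_fun setT (X i).
Variables m1 m2 : {finite_measure set T -> \bar R}.

Definition lincomb (s : seq (R * I)) (w : T) : R := \sum_(p <- s) p.1 * X p.2 w.

Hypothesis charfn_eq : forall (s : seq (R * I)) t,
  \int[m1]_w cos (lincomb s w + t) = \int[m2]_w cos (lincomb s w + t).

(** Constraints are added one at a time, which is the induction by which cosines are replaced with
    indicators. *)
Inductive cylinder : set T -> Prop :=
| cylinderT : cylinder setT
| cylinderI i (B : set R) A : measurable B -> cylinder A ->
    cylinder (X i @^-1` B `&` A).

Lemma setI_closed_cylinder : setI_closed cylinder.
Proof.
move=> A B cA cB; elim: cA => [|i C A' mC _ IH]; first by rewrite setTI.
by rewrite -setIA; constructor.
Qed.

Lemma measurable_cylinder A : cylinder A -> measurable A.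
Proof.
elim=> // i B A' mB _ mA'; apply: measurableI => //.
by rewrite -[X in measurable X]setTI; exact: mX.
Qed.

Lemma measurable_lincomb s : measurable_fun setT (lincomb s).
Proof. by apply: measurable_sum => p; exact: measurable_funM. Qed.

Let agree (f : T -> R) := [/\ m1.-integrable setT (EFin \o f), m2.-integrable setT (EFin \o f) &
  \int[m1]_w f w = \int[m2]_w f w].

Let agreeD f g : agree f -> agree g -> agree (fun w => f w + g w).
Proof.
move=> [f1 f2 e] [g1 g2 e']; split.
- have := integrableD measurableT f1 g1; exact: eq_integrable.
- have := integrableD measurableT f2 g2; exact: eq_integrable.
- by rewrite !RintegralD// e e'.
Qed.

Let agreeZ k f : agree f -> agree (fun w => k * f w).
Proof.
move=> [f1 f2 e]; split.
- have := integrableZl measurableT k f1; exact: eq_integrable.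
- have := integrableZl measurableT k f2; exact: eq_integrable.
- by rewrite !RintegralZl// e.
Qed.

Let mcos s t : measurable_fun setT (fun w => cos (lincomb s w + t)).
Proof.
apply: (@measurableT_comp _ _ _ _ _ _ (@cos R)).
  by apply: continuous_measurable_fun; exact: continuous_cos.
by apply: measurable_funD => //; exact: measurable_lincomb.
Qed.

Let cos1 (x : R) : `|cos x| <= 1. Proof. by rewrite ler_norml cos_geN1 cos_le1. Qed.

(* The test functions [cos] are traded one at a time for indicators: the law of
   [X i] under the measure with density [1_A * (1 + cos)] is determined by its
   characteristic function. *)
Let agree_cylinder A : cylinder A ->
  forall s t, agree (fun w => \1_A w * cos (lincomb s w + t)).
Proof.
elim=> [s t|i B {}A mB cA IH s t].
  have b (m : {finite_measure set T -> \bar R}) :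
      m.-integrable setT (EFin \o (fun w => \1_setT w * cos (lincomb s w + t))).
    apply: (@bounded_integrable _ _ _ m _ 1); first exact: measurable_funM.
    by move=> w; rewrite indicT mul1r.
  split => //; under eq_Rintegral do rewrite indicT mul1r.
  by under [RHS]eq_Rintegral do rewrite indicT mul1r.
have mA : measurable (A : set T) := measurable_cylinder cA.
have m1A : measurable_fun setT (\1_A : T -> R) by exact: measurable_indic.
pose f s t w : R := \1_A w * (1 + cos (lincomb s w + t)).
have f0 s' t' w : 0 <= f s' t' w.
  by rewrite mulr_ge0//; have := cos_geN1 (lincomb s' w + t'); lra.
have mf s' t' : measurable_fun setT (f s' t').
  by apply: measurable_funM => //; exact: measurable_funD.
have fle s' t' w : f s' t' w <= 2.
  have := cos_le1 (lincomb s' w + t'); have := cos_geN1 (lincomb s' w + t').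
  by rewrite /f indicE; case: (_ \in _) => /=; rewrite ?mul1r ?mul0r; lra.
have nu s' t' : (\int[m1]_w (\1_B (X i w) * f s' t' w)%:E = \int[m2]_w (\1_B (X i w) * f s' t' w)%:E)%E.
  have fC w : 0 <= f s' t' w <= 2 by rewrite f0 fle.
  pose n1 := @weighted_law _ _ T (measurableTypeR R) R m1 _ _ (X i) (mf s' t') fC (mX i).
  have n1E := @ge0_integral_weighted_law _ _ T (measurableTypeR R) R m1 _ _ (X i) (mf s' t') fC (mX i).
  pose n2 := @weighted_law _ _ T (measurableTypeR R) R m2 _ _ (X i) (mf s' t') fC (mX i).
  have n2E := @ge0_integral_weighted_law _ _ T (measurableTypeR R) R m2 _ _ (X i) (mf s' t') fC (mX i).
  have n12 : n1 B = n2 B.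
    apply: (@finite_measure_charfn_unique R [the {finite_measure set _ -> \bar R} of n1]
        [the {finite_measure set _ -> \bar R} of n2]) => // l u.
    have mc : measurable_fun setT (fun x : R => (1 + cos (l * x + u))%:E).
      by apply/measurable_EFinP; apply: measurable_funD => //; exact: measurable_cos_affine.
    have c0 x : (0 <= (1 + cos (l * x + u))%:E)%E.
      by have := cos_geN1 (l * x + u); rewrite lee_fin; lra.
    rewrite n1E// n2E//.
    (* (1 + cos p) (1 + cos q) = 1 + cos p + cos q + cos (p + q) / 2 + cos (p - q) / 2, and each
       term is again the cosine of a linear combination, the last one with the coefficients of [s']
       negated. *)
    have -> : (fun w => (1 + cos (l * X i w + u))%:E * (f s' t' w)%:E)%E =
        EFin \o (fun w => \1_A w * cos (lincomb [::] w + 0) +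
          (\1_A w * cos (lincomb [:: (l, i)] w + u) + (\1_A w * cos (lincomb s' w + t') +
          (2^-1 * (\1_A w * cos (lincomb ((l, i) :: s') w + (u + t'))) +
           2^-1 * (\1_A w * cos (lincomb ((l, i) :: [seq (- p.1, p.2) | p <- s']) w + (u - t'))))))).
      apply/funext => w; rewrite -EFinM /f /=; congr (_%:E).
      rewrite /lincomb !big_cons !big_nil !addr0 cos0 big_map/=.
      have -> : \sum_(j <- s') - j.1 * X j.2 w = - \sum_(j <- s') j.1 * X j.2 w.
        by rewrite -sumrN; apply: eq_bigr => j _; rewrite mulNr.
      set b := \sum_(_ <- _) _; set a := l * X i w.
      rewrite (_ : a + b + (u + t') = (a + u) + (b + t')); last by ring.
      rewrite (_ : a + - b + (u - t') = (a + u) - (b + t')); last by ring.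
      move: (a + u) (b + t') => p q; rewrite cosD cosB; by field.
    have [i1 i2 e] := agreeD (IH [::] 0) (agreeD (IH [:: (l, i)] u) (agreeD (IH s' t')
      (agreeD (agreeZ 2^-1 (IH ((l, i) :: s') (u + t')))
        (agreeZ 2^-1 (IH ((l, i) :: [seq (- p.1, p.2) | p <- s']) (u - t')))))).
    by apply: etrans (EFin_Rintegral i1) _; rewrite e; exact/esym/EFin_Rintegral.
  have BE (n : {finite_measure set (measurableTypeR R) -> \bar R}) : n B = (\int[n]_x (\1_B x)%:E)%E.
    by rewrite integral_indic ?setIT.
  have mB1 : measurable_fun setT (EFin \o (\1_B : R -> R)).
    by apply/measurable_EFinP; exact: measurable_indic.
  have b0 x : (0 <= (EFin \o (\1_B : R -> R)) x)%E by rewrite lee_fin.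
  apply: etrans (esym (n1E _ mB1 b0)) _; apply: etrans _ (n2E _ mB1 b0).
  apply: etrans (esym (BE [the {finite_measure set _ -> \bar R} of n1])) _.
  exact: etrans n12 (BE [the {finite_measure set _ -> \bar R} of n2]).
pose g s' t' w := \1_B (X i w) * f s' t' w.
have mB1 : measurable_fun setT (fun w => \1_B (X i w) : R).
  by apply: measurableT_comp => //; exact: measurable_indic.
have ag s' t' : agree (g s' t').
  have ig (m : {finite_measure set T -> \bar R}) : m.-integrable setT (EFin \o g s' t').
    apply: (@bounded_integrable _ _ _ m _ 2); first exact: measurable_funM.
    move=> w; rewrite /g indicE; case: (_ \in _); rewrite ?mul1r ?mul0r ?normr0// ger0_norm//.
  by split=> //; rewrite /Rintegral nu.
(* For the empty combination and phase 0 the factor 1 + cos is 2; subtracting half of that term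
   leaves the bare cosine. *)
have := agreeD (ag s t) (agreeZ (- 2^-1) (ag [::] 0)).
congr agree; apply/funext => w; rewrite /g /f /lincomb big_nil addr0 cos0 indicI.
by rewrite /= (_ : \1_(X i @^-1` B) w = \1_B (X i w))//=; field.
Qed.

Lemma charfn_measure_unique A :
  <<s [set A | exists i (B : set R), measurable B /\ A = X i @^-1` B] >> A -> m1 A = m2 A.
Proof.
move=> sA.
have mE (m : {finite_measure set T -> \bar R}) C : measurable C -> m C = (\int[m]_w \1_C w)%:E.
  move=> mC; rewrite -EFin_Rintegral; last first.
    apply: (@bounded_integrable _ _ _ m _ 1); first exact: measurable_indic.
    by move=> w; rewrite indicE; case: (_ \in _); rewrite ?normr1 ?normr0.
  by rewrite integral_indic ?setIT.
apply: (@g_sigma_algebra_measure_unique _ R T cylinder _ (fun=> setT)) => //.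
- exact: measurable_cylinder.
- by move=> n; exact: cylinderT.
- by rewrite -subTset => x _; exists 0%N.
- exact: setI_closed_cylinder.
- move=> C cC; have mC := measurable_cylinder cC.
  have [_ _ e] := agree_cylinder cC [::] 0.
  apply: etrans (mE m1 _ mC) _; apply: etrans _ (esym (mE m2 _ mC)); move: e; rewrite /lincomb.
  under eq_Rintegral do rewrite big_nil addr0 cos0 mulr1.
  by under [RHS]eq_Rintegral do rewrite big_nil addr0 cos0 mulr1; move=> ->.
- by move=> n; rewrite ltey_eq fin_num_measure.
- apply: (sub_smallest2r _ _ sA); first exact: smallest_sigma_algebra.
  move=> _ [i [B [mB ->]]].
  by rewrite -[X in cylinder X]setIT; constructor => //; exact: cylinderT.
Qed.

End charfn_measure_unique.

(** * Characteristic function of a sum of independent variables *)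

Section independent_cos.
Context d (T : measurableType d) (R : realType) (J : finType).
Variables (P : probability T R) (X : J -> T -> R).
Variables (nu : J -> probability (measurableTypeR R) R) (a phi : J -> R).
Hypothesis mX : forall j, measurable_fun setT (X j).
Hypothesis indep : forall B : J -> set R, (forall j, measurable (B j)) ->
  P [set w | forall j, B j (X j w)] = (\prod_j nu j (B j))%E.
Hypothesis nu_cos : forall j t, \int[nu j]_x cos (a j * x + t) = cos t * phi j.

Let A (B : J -> set R) : set T := [set w | forall j, B j (X j w)].
Let S s w : R := \sum_(j <- s) a j * X j w.
Let p (B : J -> set R) : R := \prod_j fine (nu j (B j)).

Let mA B : (forall j, measurable (B j)) -> measurable (A B).
Proof.
move=> mB; rewrite (_ : A B = \bigcap_(j in [set: J]) (X j @^-1` B j)); last first.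
  by apply/seteqP; split => w /= Bw j => [_|]; exact: Bw.
apply: fin_bigcap_measurable => [|j _]; first exact: finite_finset.
by rewrite -[X in measurable X]setTI; exact: mX.
Qed.

Let mS s : measurable_fun setT (S s).
Proof. by apply: measurable_sum => j; exact: measurable_funM. Qed.

Let mcos (f : T -> R) t : measurable_fun setT f -> measurable_fun setT (fun w => cos (f w + t)).
Proof.
move=> mf; apply: (@measurableT_comp _ _ _ _ _ _ (@cos R)); last exact: measurable_funD.
by apply: continuous_measurable_fun; exact: continuous_cos.
Qed.

Let cos1 (x : R) : `|cos x| <= 1. Proof. by rewrite ler_norml cos_geN1 cos_le1. Qed.

Let integrable1 (f : T -> R) : measurable_fun setT f -> (forall w, `|f w| <= 1) ->
  P.-integrable setT (EFin \o f).
Proof. by move=> mf f1; exact: (@bounded_integrable _ _ _ P _ 1). Qed.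

(** The variables of [s] enter through the cosine and are unconstrained, while the others are still
    tested on events; the variables are moved into [s] one by one. *)
Let D s := forall B, (forall j, measurable (B j)) -> (forall j, j \in s -> B j = setT) ->
  forall t, \int[P]_w (\1_(A B) w * cos (S s w + t)) = cos t * (\prod_(j <- s) phi j) * p B.

Let PA B : (forall j, measurable (B j)) -> P (A B) = (p B)%:E.
Proof.
move=> mB; rewrite indep// /p -prodEFin; apply: eq_bigr => j _.
by rewrite fineK//; exact: (fin_num_measure (nu j) _ (mB j)).
Qed.

Let indicI01 (B : set T) w : 0 <= (\1_B w : R) <= 1.
Proof. by rewrite indicE; case: (_ \in _); rewrite ?lexx ?ler01. Qed.

Let D0 : D [::].
Proof.
move=> B mB _ t; rewrite big_nil mulr1 mulrC.
under eq_Rintegral do rewrite /S big_nil add0r.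
rewrite RintegralZr//; last first.
  apply: integrable1; first by apply: measurable_indic; exact: mA.
  by move=> w; have /andP[? ?] := indicI01 (A B) w; rewrite ger0_norm.
by rewrite /Rintegral integral_indic ?setIT//; [rewrite [X in fine X](PA mB) mulrC|exact: mA].
Qed.

(** Under the density [f t], built from the events on the other variables and from the cosine over
    [s], the law of [X j] is [K t] times [nu j]; this is the induction hypothesis with a constraint
    on [X j] added. Hence the cosine of [a j * X j] may be integrated. *)
Let DS j s : j \notin s -> D s -> D (j :: s).
Proof.
move=> js IH B mB BT t0.
have Bj : B j = setT by apply: BT; rewrite mem_head.
pose B' C i := if i == j then C else B i.
have mB' C : measurable C -> forall i, measurable (B' C i).
  by move=> mC i; rewrite /B'; case: ifP.
have B's C i : i \in s -> B' C i = setT.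
  move=> is_; rewrite /B' ifN; first by apply: BT; rewrite in_cons is_ orbT.
  by apply: contraNneq js => <-.
have AB' C : A (B' C) = A B `&` (X j @^-1` C).
  apply/seteqP; split => [w Bw|w [Bw Cw] i]; last by rewrite /B'; case: eqP => // ->.
  split => [i|]; last by have := Bw j; rewrite /B' eqxx.
  by have := Bw i; rewrite /B'; case: eqP => // -> _; rewrite Bj.
have pB' C : p (B' C) = fine (nu j C) * p B.
  rewrite /p (bigD1 j)//= [in RHS](bigD1 j)//= Bj probability_setT /= mul1r.
  rewrite /B' eqxx; congr (_ * _); apply: eq_bigr => i /negbTE ij; by rewrite ij.
set q := \prod_(j <- s) phi j in IH.
have p0 : 0 <= p B by apply: prodr_ge0 => i _; rewrite fine_ge0.
have mAB := mA mB.
have mI : measurable_fun setT (\1_(A B) : T -> R) by exact: measurable_indic.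
pose f t w : R := \1_(A B) w * (1 + cos (S s w + t)).
have mf t : measurable_fun setT (f t).
  by apply: measurable_funM => //; apply: measurable_funD => //; exact: mcos.
have f02 t w : 0 <= f t w <= 2.
  have /andP[i0 i1] := indicI01 (A B) w; rewrite /f.
  have := cos_geN1 (S s w + t); have := cos_le1 (S s w + t); nra.
pose K t : R := p B + cos t * q * p B.
have intA t : \int[P]_w (\1_(A B) w * cos (S s w + t)) = cos t * q * p B.
  by apply: IH => // i is_; apply: BT; rewrite in_cons is_ orbT.
have intf t C : measurable C -> (\int[P]_w (\1_C (X j w) * f t w)%:E = (fine (nu j C) * K t)%:E)%E.
  move=> mC; have mC' := mB' _ mC.
  have i1 : P.-integrable setT (EFin \o (\1_(A (B' C)) : T -> R)).
    apply: integrable1; first by apply: measurable_indic; exact: mA.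
    by move=> w; have /andP[? ?] := indicI01 (A (B' C)) w; rewrite ger0_norm.
  have i2 : P.-integrable setT (EFin \o (fun w => \1_(A (B' C)) w * cos (S s w + t))).
    apply: integrable1.
      by apply: measurable_funM; [apply: measurable_indic; exact: mA|exact: mcos].
    move=> w; have /andP[? ?] := indicI01 (A (B' C)) w.
    by rewrite normrM (ger0_norm (_ : 0 <= \1_(A (B' C)) w))// -[leRHS]mulr1 ler_pM.
  have -> : (fun w => (\1_C (X j w) * f t w)%:E) = 
      (fun w => (\1_(A (B' C)) w)%:E + (\1_(A (B' C)) w * cos (S s w + t))%:E)%E.
    apply/funext => w; rewrite -EFinD AB' indicI /f /=; congr (_%:E).
    by rewrite (_ : \1_(X j @^-1` C) w = \1_C (X j w))//; ring.
  rewrite integralD// EFin_Rintegral// EFin_Rintegral// (IH _ mC' (B's C)).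
  rewrite {1}/Rintegral integral_indic ?setIT//; last exact: mA.
  by rewrite [X in fine X](PA mC')/= -EFinD pB' /K -/q; congr (_%:E); ring.
have K0 t : 0 <= K t.
  have := intf t setT measurableT; rewrite probability_setT/= mul1r => e.
  by rewrite -lee_fin -e; apply: integral_ge0 => w _; rewrite lee_fin mulr_ge0//; have /andP[] := f02 t w.
have mc u : measurable_fun setT (fun w => cos (a j * X j w + u)).
  by apply: mcos; exact: measurable_funM.
have E1 t u : \int[P]_w ((1 + cos (a j * X j w + u)) * f t w) = K t * (1 + cos u * phi j).
  pose n1 := @weighted_law _ _ T (measurableTypeR R) R P _ _ (X j) (mf t) (f02 t) (mX j).
  have n1E := @ge0_integral_weighted_law _ _ T (measurableTypeR R) R P _ _ (X j) (mf t) (f02 t) (mX j).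
  have mg : measurable_fun setT (fun x : R => (1 + cos (a j * x + u))%:E).
    by apply/measurable_EFinP; apply: measurable_funD => //; exact: measurable_cos_affine.
  have g0 (x : R) : (0 <= (1 + cos (a j * x + u))%:E)%E.
    by have := cos_geN1 (a j * x + u); rewrite lee_fin; lra.
  have e : (\int[n1]_x (1 + cos (a j * x + u))%:E = \int[mscale (NngNum (K0 t)) (nu j)]_x
      (1 + cos (a j * x + u))%:E)%E.
    apply: eq_measure_integral => /= C mC _.
    have b0 x : (0 <= (EFin \o (\1_C : R -> R)) x)%E by rewrite lee_fin.
    have mC1 : measurable_fun setT (EFin \o (\1_C : R -> R)).
      by apply/measurable_EFinP; exact: measurable_indic.
    transitivity (\int[n1]_x (\1_C x)%:E)%E; first by rewrite integral_indic ?setIT.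
    rewrite (n1E _ mC1 b0) /mscale/= -[X in (_ * X)%E]fineK ?fin_num_measure// -EFinM mulrC -intf//.
  have := n1E _ mg g0; rewrite e ge0_integral_mscale//=.
  have i1 : (nu j).-integrable setT (fun=> 1%:E).
    by apply: (@bounded_integrable _ _ _ (nu j) (fun=> 1) 1) => // x; rewrite normr1.
  have i2 : (nu j).-integrable setT (EFin \o (fun x => cos (a j * x + u))).
    by apply: (@bounded_integrable _ _ _ (nu j) _ 1) => // x; exact: measurable_cos_affine.
  have -> : (\int[nu j]_x (1 + cos (a j * x + u))%:E = (1 + cos u * phi j)%:E)%E.
    under eq_integral do rewrite EFinD.
    rewrite (integralD measurableT i1 i2) (integral_cst _ measurableT 1) mul1e.
    by rewrite [X in (X + _)%E]probability_setT EFin_Rintegral// nu_cos.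
  by move=> e2; rewrite /Rintegral; under eq_integral do rewrite EFinM; rewrite -e2.
have ibd (g h : T -> R) : measurable_fun setT g -> measurable_fun setT h -> (forall w, `|g w| <= 2) ->
    (forall w, `|h w| <= 2) -> P.-integrable setT (EFin \o (fun w => g w * h w)).
  move=> mg mh g2 h2; apply: (@bounded_integrable _ _ _ P _ (2 * 2)); first exact: measurable_funM.
  by move=> w; rewrite normrM ler_pM.
have f2 t w : `|f t w| <= 2 by have /andP[? ?] := f02 t w; rewrite ger0_norm.
have c2 u w : `|1 + cos (a j * X j w + u)| <= 2.
  rewrite ger0_norm; first by have := cos_le1 (a j * X j w + u); lra.
  by have := cos_geN1 (a j * X j w + u); lra.
have i2 w : `|\1_(A B) w : R| <= 2.
  by have /andP[? ?] := indicI01 (A B) w; rewrite ger0_norm//; lra.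
have cc2 (g : T -> R) w : `|cos (g w)| <= 2 by rewrite (le_trans (cos1 _))// ler1n.
have m1c u : measurable_fun setT (fun w => 1 + cos (a j * X j w + u)) by exact: measurable_funD.
(* A shift of the phase by pi changes the sign of the cosine, so [f t - f (t + pi)] is twice the
   indicator times the cosine. *)
have star t u : \int[P]_w (\1_(A B) w * (cos (S s w + t) * cos (a j * X j w + u))) =
    cos t * q * p B * (cos u * phi j).
  have e : \int[P]_w (\1_(A B) w * (cos (S s w + t) * cos (a j * X j w + u))) =
    2^-1 * (\int[P]_w ((1 + cos (a j * X j w + u)) * f t w) -
      \int[P]_w ((1 + cos (a j * X j w + u)) * f (t + pi) w)) -
    \int[P]_w (\1_(A B) w * cos (S s w + t)).
    have h1 := ibd _ _ (m1c u) (mf t) (c2 u) (f2 t).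
    have h2 := ibd _ _ (m1c u) (mf (t + pi)) (c2 u) (f2 (t + pi)).
    have h3 := ibd _ _ mI (mcos t (mS s)) i2 (cc2 _).
    rewrite -RintegralB// -RintegralZl//; last first.
      by have := integrableB measurableT h1 h2; apply: eq_integrable.
    rewrite -RintegralB//; last first.
      have := integrableZl measurableT 2^-1 (integrableB measurableT h1 h2).
      exact: eq_integrable.
    apply: eq_Rintegral => w _; rewrite /f addrA cosDpi; by field.
  by rewrite e !E1 intA /K cosDpi; field.
rewrite big_cons -/q.
(* This is cos (x + y) = cos y cos x + cos (y + pi / 2) cos (x - pi / 2), both terms being of the
   form treated by [star]; the second has mean zero. *)
have -> : cos t0 * (phi j * q) * p B = cos t0 * q * p B * (cos 0 * phi j) +
   cos (t0 + pi / 2) * q * p B * (cos (- (pi / 2)) * phi j).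
  by rewrite cos0 cosN cos_pihalf; ring.
rewrite -!star -RintegralD//; last 2 first.
- apply: ibd => //; first by apply: measurable_funM; [exact: mcos|exact: mc].
  by move=> w; rewrite normrM (le_trans (ler_pM _ _ (cos1 _) (cos1 _)))// mulr1 ler1n.
- apply: ibd => //; first by apply: measurable_funM; [exact: mcos|exact: mc].
  by move=> w; rewrite normrM (le_trans (ler_pM _ _ (cos1 _) (cos1 _)))// mulr1 ler1n.
apply: eq_Rintegral => w _; rewrite -mulrDr /S big_cons; congr (_ * _).
rewrite -[a j * _ + _ + _]addrA addr0 [_ + (t0 + _)]addrA.
move: (\sum_(_ <- _) _ + t0) (a j * X j w) => y x.
rewrite !cosD sinN cosN cos_pihalf sin_pihalf; by ring.
Qed.

Lemma independent_cos t :
  \int[P]_w cos (\sum_j a j * X j w + t) = cos t * \prod_j phi j.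
Proof.
have h s : uniq s -> D s.
  by elim: s => [_|j s IH /= /andP[js us]]; [exact: D0|exact: DS (IH us)].
have := h (index_enum J) (index_enum_uniq J) (fun=> setT) (fun=> measurableT) (fun _ _ => erefl) t.
have -> : p (fun=> setT) = 1.
  by rewrite /p big1// => j _; rewrite [X in fine X](probability_setT (nu j)).
rewrite mulr1.
move=> <-; apply: eq_Rintegral => w _; rewrite (_ : A _ = setT) ?indicT ?mul1r//.
by apply/seteqP; split.
Qed.

End independent_cos.

(** * Linear functionals of continuous paths *)

Section stieltjes.
Context (R : realType).
Local Notation mu := (@lebesgue_measure R).
Implicit Types (G w f rho : R -> R).

(** The mesh 1 / (n + 1) shrinks while the window [- (n + 1), n + 1] grows, whence the number
    [ngrid n] of cells. *)
Definition grid (n k : nat) : R := - n.+1%:R + k%:R / n.+1%:R.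

Definition ngrid n := (2 * n.+1 ^ 2)%N.

Definition stieltjes_sum G w n : R :=
  \sum_(k < ngrid n) G (grid n k.+1) * (w (grid n k.+1) - w (grid n k)).

(** Right continuity, the regularity of distribution functions; it is what evaluation at right ends
    of cells requires. *)
Definition right_seq_continuous G := forall (u : R^nat) x,
  (forall n, x <= u n) -> u n @[n --> \oo] --> x -> G (u n) @[n --> \oo] --> G x.

(** A class of integrands that contains the distribution functions of balanced charges and is closed
    under sums, multiples and products. *)
Definition tame G := [/\ right_seq_continuous G,
  exists C, forall x, `|G x| <= C & exists r, forall x, r < `|x| -> G x = 0].

Definition grid_step G n x : R :=
  \sum_(k < ngrid n) G (grid n k.+1) * \1_(`]grid n k, grid n k.+1]%classic : set R) x.

Lemma gridS n k : grid n k.+1 = grid n k + n.+1%:R^-1.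
Proof. by rewrite /grid -addrA -[k.+1%:R]natr1 mulrDl mul1r. Qed.

Lemma grid0 n : grid n 0 = - n.+1%:R. Proof. by rewrite /grid mul0r addr0. Qed.

Lemma grid_last n : grid n (ngrid n) = n.+1%:R.
Proof. by rewrite /grid /ngrid natrM natrX; field. Qed.

Lemma le_grid n : {homo grid n : i j / (i <= j)%N >-> i <= j}.
Proof. by move=> i j ij; rewrite /grid lerD2l ler_wpM2r ?ler_nat. Qed.

Lemma lt_grid n : {homo grid n : i j / (i < j)%N >-> i < j}.
Proof. by move=> i j ij; rewrite /grid ltrD2l ltr_pM2r ?ltr_nat// invr_gt0. Qed.

Lemma grid_cell n x : - n.+1%:R < x <= n.+1%:R ->
  exists k : 'I_(ngrid n), grid n k < x <= grid n k.+1.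
Proof.
move=> /andP[nx xn].
have n0 : (0 < ngrid n)%N by rewrite muln_gt0 expn_gt0.
have ex : exists k, x <= grid n k.+1.
  by exists (ngrid n).-1; rewrite prednK// grid_last.
have [k xk kmin] := ex_minnP ex.
have kn : (k < ngrid n)%N by rewrite -[ngrid n]prednK// ltnS kmin// prednK// grid_last.
exists (Ordinal kn); rewrite xk andbT /=.
case: k xk kmin {kn} => [|k] xk kmin; first by rewrite grid0.
by rewrite ltNge; apply/negP => /kmin; rewrite ltnn.
Qed.

Lemma grid_stepE G n x (k : 'I_(ngrid n)) : grid n k < x <= grid n k.+1 ->
  grid_step G n x = G (grid n k.+1).
Proof.
move=> xk; rewrite /grid_step (bigD1 k)//= big1 => [|j jk].
  by rewrite addr0 indicE mem_set ?mulr1//= in_itv.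
rewrite indicE memNset ?mulr0//= in_itv/= => /andP[jx xj]; case/andP: xk => kx xk.
have [jk'|kj'|/val_inj /eqP] := ltngtP j k; last by rewrite (negbTE jk).
- by have := le_grid n jk'; rewrite leNgt (lt_le_trans kx xj).
- by have := le_grid n kj'; rewrite leNgt (lt_le_trans jx xk).
Qed.

Lemma grid_step_out G n x : ~~ (- n.+1%:R < x <= n.+1%:R) -> grid_step G n x = 0.
Proof.
move=> xn; rewrite /grid_step big1// => j _.
rewrite indicE memNset ?mulr0//= in_itv/= => /andP[jx xj].
move/negP : xn; apply; rewrite -grid0 -grid_last.
rewrite (le_lt_trans _ jx) ?(le_trans xj)//; exact: le_grid.
Qed.

Lemma grid_step_bound G C n x : (forall x, `|G x| <= C) -> `|grid_step G n x| <= C.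
Proof.
move=> GC; have [/grid_cell[k xk]|xn] := boolP (- n.+1%:R < x <= n.+1%:R).
  by rewrite (grid_stepE _ xk).
by rewrite grid_step_out// normr0 (le_trans _ (GC 0)).
Qed.

Lemma measurable_grid_step G n : measurable_fun setT (grid_step G n).
Proof.
by apply: measurable_sum => k; apply: measurable_funM.
Qed.

(* The right end of the cell containing [x] tends to [x] from the right. *)
Lemma cvg_grid_step G x : right_seq_continuous G -> grid_step G n x @[n --> \oo] --> G x.
Proof.
move=> rG.
have ex n : exists y, x <= y <= x + n.+1%:R^-1 /\ (`|x| < n.+1%:R -> grid_step G n x = G y).
  have [/grid_cell[k xk]|xn] := boolP (- n.+1%:R < x <= n.+1%:R).
    exists (grid n k.+1); split; last by move=> _; exact: grid_stepE.
    case/andP: (xk) => kx ->/=.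
    by rewrite gridS lerD2r ltW.
  exists x; rewrite lexx lerDl invr_ge0 ler0n; split=> // xn'; exfalso; move/negP: xn; apply.
  by move: xn'; rewrite ltr_norml => /andP[-> /ltW].
have [u uE] := choice ex.
have ux : u n @[n --> \oo] --> x.
  apply/cvgrPdist_le => e e0; near=> n.
  have [/andP[xu ux] _] := uE n; rewrite distrC ger0_norm ?subr_ge0// lerBlDl.
  apply: (le_trans ux); rewrite lerD2l ltW//; near: n.
  exact: (near_infty_natSinv_lt (PosNum e0)).
have := rG u x (fun n => _) ux.
have h n : x <= u n by have [/andP[]] := uE n.
move=> /(_ h); apply: cvg_trans; apply: near_eq_cvg; near=> n.
have [_ ->//] := uE n; apply: (@lt_trans _ _ n%:R); last by rewrite ltr_nat.
by near: n; exact: nbhs_infty_gtr.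
Unshelve. all: by end_near. Qed.

Lemma measurable_tame G : tame G -> measurable_fun setT G.
Proof.
move=> [rG _ _]; apply: (@measurable_fun_cvg _ _ _ _ (grid_step G)).
- by move=> n; exact: measurable_grid_step.
- by move=> x _; exact: cvg_grid_step.
Qed.

(** The sum is the integral of [rho] against the step function [grid_step G n], and dominated
    convergence applies. The density is needed one unit beyond the support because a cell whose
    right end is in the support has length at most one. *)
Lemma stieltjes_sum_cvg G f rho r : tame G -> (forall x, r < `|x| -> G x = 0) ->
  mu.-integrable setT (EFin \o rho) ->
  (forall x y, - r - 1 <= x -> x <= y -> y <= r + 1 ->
    (\int[mu]_(z in `]x, y]) (rho z)%:E)%E = (f y - f x)%:E) ->
  stieltjes_sum G f n @[n --> \oo] --> \int[mu]_x (G x * rho x).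
Proof.
move=> tG Gr irho frho; have [rG [C GC] _] := tG.
have mrho : measurable_fun setT rho.
  by move/integrableP : irho => [/measurable_EFinP].
have sumE n : stieltjes_sum G f n = \int[mu]_x (grid_step G n x * rho x).
  rewrite /Rintegral.
  have -> : (fun x => (grid_step G n x * rho x)%:E) =
     (fun x => (\sum_(k < ngrid n) (G (grid n k.+1) * (rho x * \1_(`]grid n k, grid n
         k.+1]%classic : set R) x))%:E)%E).
    apply/funext => x; rewrite sumEFin /grid_step mulr_suml; congr (_%:E).
    by apply: eq_bigr => k _; ring.
  have irk (k : 'I_(ngrid n)) : mu.-integrable setT (fun x => (rho x * \1_(`]grid n k, grid
      n k.+1]%classic : set R) x)%:E).
    apply: (@le_integrable _ _ _ mu _ measurableT _ _ _ _ irho).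
      by apply/measurable_EFinP; apply: measurable_funM.
    move=> x _; rewrite lee_fin normrM indicE.
    by case: (_ \in _); rewrite ?normr1 ?normr0 ?mulr1 ?mulr0.
  rewrite integral_sum//; last first.
    by move=> k; have := integrableZl measurableT (G (grid n k.+1)) (irk k); apply: eq_integrable.
  have -> : (\sum_(k < ngrid n) \int[mu]_x (G (grid n k.+1) * (rho x * \1_(`]grid n k, grid
      n k.+1]%classic : set R) x))%:E =
     \sum_(k < ngrid n) (G (grid n k.+1) * (f (grid n k.+1) - f (grid n k)))%:E)%E.
    apply: eq_bigr => k _; under eq_integral do rewrite EFinM.
    rewrite integralZl// EFinM.
    have [->|Gk] := eqVneq (G (grid n k.+1)) 0; first by rewrite !mul0e.
    have gr : `|grid n k.+1| <= r.
      by rewrite leNgt; apply/negP => /Gr e; rewrite e eqxx in Gk.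
    have n1 : n.+1%:R^-1 <= 1 :> R by rewrite invf_le1// ler1n.
    move: gr; rewrite ler_norml gridS => /andP[gr rg].
    congr (_ * _)%E; rewrite -gridS -frho; last 3 first.
    - by move: n1 gr; move: (n.+1%:R^-1) => z; lra.
    - exact: le_grid.
    - by rewrite gridS (le_trans rg)// lerDl.
    rewrite [RHS]integral_mkcond; apply: eq_integral => x _; rewrite patchE indicE.
    by case: (_ \in _); rewrite ?mulr1 ?mulr0.
  by rewrite sumEFin.
rewrite (_ : stieltjes_sum G f = fun n => \int[mu]_x (grid_step G n x * rho x)); last exact/funext.
apply: (@Rdominated_cvg _ _ _ mu _ _ (fun x => C * `|rho x|)).
- by move=> n; apply: measurable_funM => //; exact: measurable_grid_step.
- by apply: measurable_funM => //; exact: measurable_tame.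
- have := integrableZl measurableT C (integrable_norm irho); exact: eq_integrable.
- by move=> x; apply: cvgMl; exact: cvg_grid_step.
- by move=> n x; rewrite normrM ler_wpM2r//; exact: grid_step_bound.
Qed.

Lemma right_seq_continuousM G H : right_seq_continuous G -> right_seq_continuous H ->
  right_seq_continuous (fun x => G x * H x).
Proof. by move=> cG cH u x xu ux; apply: cvgM; [exact: cG|exact: cH]. Qed.

Lemma tameM G H : tame G -> tame H -> tame (fun x => G x * H x).
Proof.
move=> [cG [C GC] [r Gr]] [cH [D HD] _]; split; first exact: right_seq_continuousM.
- exists (C * D) => x; rewrite normrM ler_pM//.
- by exists r => x /Gr ->; rewrite mul0r.
Qed.

Lemma tameD G H : tame G -> tame H -> tame (fun x => G x + H x).
Proof.
move=> [cG [C GC] [r Gr]] [cH [D HD] [q Hq]]; split.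
- by move=> u x xu ux; apply: cvgD; [exact: cG|exact: cH].
- by exists (C + D) => x; rewrite (le_trans (ler_normD _ _))// lerD.
- exists (Num.max r q) => x; rewrite gt_max => /andP[rx qx].
  by rewrite Gr// Hq// addr0.
Qed.

Lemma tameZ k G : tame G -> tame (fun x => k * G x).
Proof.
move=> [cG [C GC] [r Gr]]; split.
- by move=> u x xu ux; apply: cvgMr; exact: cG.
- by exists (`|k| * C) => x; rewrite normrM ler_wpM2l.
- by exists r => x /Gr ->; rewrite mulr0.
Qed.

Lemma tame0 : tame (fun=> 0).
Proof.
split; [by move=> u x _ _; exact: cvg_cst|by exists 0 => x; rewrite normr0|by exists 0].
Qed.

Lemma tame_integrable G : tame G -> mu.-integrable setT (EFin \o G).
Proof.
move=> tG; have mG := measurable_tame tG; have [_ [C GC] [r Gr]] := tG.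
pose r' := Num.max r 0.
apply: (@le_integrable _ _ _ mu _ measurableT _ (fun x => (C * \1_(`[- r', r']%classic : set R) x)%:E)).
- exact/measurable_EFinP.
- move=> x _; rewrite lee_fin.
  have C0 : 0 <= C by exact: le_trans (normr_ge0 _) (GC 0).
  rewrite [leRHS]ger0_norm ?mulr_ge0//.
  have [xr|rx] := leP `|x| r'.
    by rewrite indicE mem_set ?mulr1//= in_itv/= -ler_norml.
  by rewrite /= Gr ?normr0 ?mulr_ge0// (le_lt_trans _ rx)// le_max lexx.
- under eq_fun do rewrite EFinM; apply: integrableZl => //.
  apply: integrable_indic_itv.
Qed.

Definition ip G H : R := \int[mu]_x (G x * H x).

Lemma ipC G H : ip G H = ip H G.
Proof. by apply: eq_Rintegral => x _; rewrite mulrC. Qed.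

Lemma ipDl G G' H : tame G -> tame G' -> tame H ->
  ip (fun x => G x + G' x) H = ip G H + ip G' H.
Proof.
move=> tG tG' tH; rewrite /ip -RintegralD//; try by apply: tame_integrable; exact: tameM.
by apply: eq_Rintegral => x _; rewrite mulrDl.
Qed.

Lemma ipZl k G H : tame G -> tame H -> ip (fun x => k * G x) H = k * ip G H.
Proof.
move=> tG tH; rewrite /ip -RintegralZl//; last by apply: tame_integrable; exact: tameM.
by apply: eq_Rintegral => x _; rewrite mulrA.
Qed.

(** Says that [l w] is the integral of [G] against dw. Paths being merely continuous, the integral
    has a meaning only as a limit of sums, which also shows that [l] depends on increments. *)
Definition represents (l : (R -> R) -> R) G := tame G /\
  forall w, continuous w -> stieltjes_sum G w n @[n --> \oo] --> l w.

Lemma representsD l l' G G' : represents l G -> represents l' G' ->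
  represents (fun w => l w + l' w) (fun x => G x + G' x).
Proof.
move=> [tG lG] [tG' lG']; split; first exact: tameD.
move=> w cw.
rewrite (_ : stieltjes_sum _ w = stieltjes_sum G w \+ stieltjes_sum G' w).
  by apply: cvgD; [exact: lG|exact: lG'].
by apply/funext => n; rewrite /stieltjes_sum /= -big_split/=; apply: eq_bigr => k _; rewrite mulrDl.
Qed.

Lemma representsZ k l G : represents l G -> represents (fun w => k * l w) (fun x => k * G x).
Proof.
move=> [tG lG]; split; first exact: tameZ.
move=> w cw.
rewrite (_ : stieltjes_sum _ w = fun n => k * stieltjes_sum G w n).
  by apply: cvgMr; exact: lG.
by apply/funext => n; rewrite /stieltjes_sum mulr_sumr; apply: eq_bigr => j _; rewrite mulrA.
Qed.

Lemma represents0 : represents (fun=> 0) (fun=> 0).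
Proof.
split; first exact: tame0.
move=> w cw; apply: cvg_near_cst; apply: nearW => n.
by rewrite /stieltjes_sum big1// => k _; rewrite mul0r.
Qed.

Lemma eq_represents l l' G : (forall w, continuous w -> l w = l' w) ->
  represents l G -> represents l' G.
Proof. by move=> ll' [tG lG]; split => // w cw; rewrite -ll'//; exact: lG. Qed.

Lemma represents_sum (I : Type) (s : seq I) (l : I -> (R -> R) -> R) (G : I -> R -> R) :
  (forall i, represents (l i) (G i)) ->
  represents (fun w => \sum_(i <- s) l i w) (fun x => \sum_(i <- s) G i x).
Proof.
move=> lG; elim: s => [|i s IH].
  have := represents0; congr represents; apply/funext => x; by rewrite big_nil.
have := representsD (lG i) IH; congr represents; apply/funext => x; by rewrite big_cons.
Qed.

(** These are the Stieltjes sums of [G * G] along the identity path, whose density 1 is cut off away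
    from the support to become integrable. *)
Lemma grid_sqr_cvg G : tame G ->
  \sum_(k < ngrid n) G (grid n k.+1) ^+ 2 * (grid n k.+1 - grid n k) @[n --> \oo] --> ip G G.
Proof.
move=> tG; have [_ _ [r Gr]] := tG.
pose r' := Num.max r 0.
have Gr' x : r' < `|x| -> G x * G x = 0.
  by move=> rx; rewrite Gr ?mul0r// (le_lt_trans _ rx)// le_max lexx.
pose rho : R -> R := \1_(`[- r' - 1, r' + 1]%classic : set R).
have irho : mu.-integrable setT (EFin \o rho) by exact: integrable_indic_itv.
have := @stieltjes_sum_cvg _ id rho r' (tameM tG tG) Gr' irho.
have -> : \int[mu]_x (G x * G x * rho x) = ip G G.
  apply: eq_Rintegral => x _; have [xr|rx] := leP `|x| r'; last by rewrite Gr'// mul0r.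
  rewrite /rho indicE mem_set ?mulr1//= in_itv/=.
  by move: xr; rewrite ler_norml => /andP[? ?]; apply/andP; split; lra.
apply => x y rx xy yr.
rewrite integral_indic//=.
rewrite (_ : _ `&` _ = `]x, y]%classic); last first.
  apply/setIidPr => z /=; rewrite !in_itv/= => /andP[xz zy].
  by rewrite (le_trans rx (ltW xz)) (le_trans zy).
rewrite lebesgue_measure_itv/= lte_fin.
by move: xy; rewrite le_eqVlt => /predU1P[->|xy]; rewrite ?ltxx ?subrr// xy EFinB.
Qed.

Lemma finite_energy_continuous f : finite_energy f -> continuous f.
Proof.
move=> [acf _] x; apply/cvgrPdist_lt => e e0.
have [|del del0 h] := acf (x - 1) (x + 1) _ _ e0; first lra.
have m0 : 0 < Num.min 1 del by rewrite lt_min ltr01 del0.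
near=> y.
have yx : `|x - y| < Num.min 1 del.
  by near: y; apply/nbhs_ballP; exists (Num.min 1 del).
move: yx; rewrite lt_min ltr_distl => /andP[/andP[xy yx] xydel].
have hh (s t : R) : x - 1 <= s -> s <= t -> t <= x + 1 -> t - s < del -> `|f t - f s| < e.
  move=> xs st tx std.
  have := h 1%N (fun=> s) (fun=> t); rewrite !big_ord1; apply => //.
  by move=> i j _ _ _; rewrite !ord1.
have [yx'|xy'] := leP y x.
- apply: hh => //; try lra; by rewrite (le_lt_trans (ler_norm _)).
- rewrite distrC; apply: hh; try lra; by rewrite (le_lt_trans (ler_norm _))// distrC.
Unshelve. all: by end_near. Qed.

(* The substitute [h] for the derivative is measurable and vanishes outside a
   bounded interval. *)
Lemma finite_energy_truncation f r : finite_energy f -> exists h : R -> R,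
  [/\ mu.-integrable setT (EFin \o h),
      mu.-integrable setT (fun x => (h x ^+ 2)%:E),
      \int[mu]_x (h x ^+ 2) <= \int[mu]_x (derive1 f x ^+ 2) &
      forall l G, represents l G -> (forall x, r < `|x| -> G x = 0) -> l f = ip G h].
Proof.
move=> fe; have [acf if2] := fe; have cf := finite_energy_continuous fe.
(* The extra unit is the margin required by [stieltjes_sum_cvg]. *)
pose r' := Num.max r 0 + 1.
have r'0 : 0 < r' by rewrite /r' ltr_wpDl// le_max lexx orbT.
have r'r' : - r' < r' by lra.
have [rho [irho rhoE frho]] := finite_energy_density r'r' (acf _ _ r'r').
pose h := fun x => rho x * \1_(`](- r'), r'[%classic : set R) x.
have mrho : measurable_fun setT rho by move/integrableP : irho => [/measurable_EFinP].
have mh : measurable_fun setT h by exact: measurable_funM.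
have ih : mu.-integrable setT (EFin \o h).
  apply: (@le_integrable _ _ _ mu _ measurableT _ _ _ _ irho); first exact/measurable_EFinP.
  move=> x _; rewrite lee_fin normrM indicE.
  by case: (_ \in _); rewrite ?normr1 ?normr0 ?mulr1 ?mulr0.
have [i2 le2] : mu.-integrable setT (fun x => (h x ^+ 2)%:E) /\
  \int[mu]_x (h x ^+ 2) <= \int[mu]_x (derive1 f x ^+ 2).
  have ae : {ae mu, forall x, [set: R] x -> ((h x ^+ 2)%:E <= (derive1 f x ^+ 2)%:E)%E}.
    move: frho; apply: filterS; first exact: (ae_filter_ringOfSetsType lebesgue_measure).
    move=> x fx _; rewrite lee_fin /h indicE.
    case: (boolP (_ \in _)) => [|_]; last by rewrite mulr0 expr0n/= sqr_ge0.
    by rewrite inE/= in_itv/= mulr1 => /fx ->.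
  have mh2 : measurable_fun setT (fun x => (h x ^+ 2)%:E).
    by apply/measurable_EFinP; exact: measurable_funX.
  have le : (\int[mu]_x (h x ^+ 2)%:E <= \int[mu]_x (derive1 f x ^+ 2)%:E)%E.
    apply: ae_ge0_le_integral => //.
    - by move=> x _; rewrite lee_fin sqr_ge0.
    - by move=> x _; rewrite lee_fin sqr_ge0.
    - by move/integrableP : if2 => [].
  have i2 : mu.-integrable setT (fun x => (h x ^+ 2)%:E).
    apply/integrableP; split => //.
    under eq_integral do rewrite gee0_abs ?lee_fin ?sqr_ge0//.
    apply: (le_lt_trans le); rewrite EFin_Rintegral ?ltry//.
  split => //; rewrite -lee_fin -!EFin_Rintegral//.
exists h; split => // l G [tG lG] Gr.
have Gr' x : Num.max r 0 < `|x| -> G x = 0.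
  by move=> rx; rewrite Gr// (le_lt_trans _ rx)// le_max lexx.
have := @stieltjes_sum_cvg G f rho (Num.max r 0) tG Gr' irho.
have -> : \int[mu]_x (G x * rho x) = ip G h.
  apply: eq_Rintegral => x _; have [xr|rx] := leP `|x| (Num.max r 0); last by rewrite Gr'// !mul0r.
  rewrite /h indicE mem_set ?mulr1//= in_itv/= /r'.
  by move: xr; rewrite ler_norml => /andP[? ?]; apply/andP; split; lra.
move=> H; apply: (cvg_unique _ (lG f cf)) => //; apply: H => x y rx xy yr; apply: rhoE => //.
by rewrite /r' opprD.
Qed.

End stieltjes.

(** * Integrals of paths against balanced charges *)

Section mass_functions.
Context (R : realType).
Local Notation borel := (measurableTypeR R).
Implicit Types (m : {finite_measure set borel -> \bar R}) (w : R -> R).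

Definition mass m (x : R) : R := fine (m `]-oo, x]%classic).

(** The Stieltjes sum for the unit mass at [y]. It telescopes to w (n + 1) - w p with p the grid
    point just below [y], which is summation by parts. *)
Let half_sum w n y : R := \sum_(k < ngrid n)
  \1_(`]-oo, grid R n k.+1]%classic : set R) y * (w (grid R n k.+1) - w (grid R n k)).

Let mhalf_sum w n : measurable_fun setT (half_sum w n).
Proof. by apply: measurable_sum => k; exact: measurable_funM. Qed.

Let fin m (A : set R) : measurable (A : set borel) -> m A \is a fin_num.
Proof. exact: fin_num_measure. Qed.

Let integrable_mass_indic m (x : R) : m.-integrable setT (EFin \o (\1_(`]-oo, x]%classic : set R) : R -> R)).
Proof.
apply: (@bounded_integrable _ _ _ m _ 1) => // y.
by rewrite indicE; case: (_ \in _); rewrite ?normr1 ?normr0.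
Qed.

Let massE m x : mass m x = \int[m]_y \1_(`]-oo, x]%classic : set R) y.
Proof. by rewrite /Rintegral integral_indic ?setIT. Qed.

Let integrable_half_sum m w n : m.-integrable setT (EFin \o half_sum w n).
Proof.
rewrite (_ : EFin \o half_sum w n = fun y => (\sum_(k < ngrid n)
  (\1_(`]-oo, grid R n k.+1]%classic : set R) y * (w (grid R n k.+1) - w (grid R n k)))%:E)%E); last first.
  by apply/funext => y; rewrite /= sumEFin.
apply: integrable_sum => // k _.
by have := integrableZr measurableT (w (grid R n k.+1) - w (grid R n k))
    (integrable_mass_indic m (grid R n k.+1)); apply: eq_integrable.
Qed.

Let stieltjes_sum_mass m w n : stieltjes_sum (mass m) w n = \int[m]_y half_sum w n y.
Proof.
apply: EFin_inj; rewrite -EFin_Rintegral; last exact: integrable_half_sum.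
under [RHS]eq_integral do rewrite /half_sum -sumEFin.
rewrite integral_sum//; last first.
  move=> k; by have := integrableZr measurableT (w (grid R n k.+1) - w (grid R n k))
      (integrable_mass_indic m (grid R n k.+1)); apply: eq_integrable.
rewrite /stieltjes_sum -sumEFin; apply: eq_bigr => k _.
under [RHS]eq_integral do rewrite EFinM.
have := integrableZr measurableT (w (grid R n k.+1) - w (grid R n k))
    (integrable_mass_indic m (grid R n k.+1)) => _.
rewrite integralZr//; last exact: integrable_mass_indic.
by rewrite EFin_Rintegral ?massE//; exact: integrable_mass_indic.
Qed.

Let half_sum_cell w n y : `|y| < n.+1%:R -> exists p, y - n.+1%:R^-1 <= p <= y /\
  half_sum w n y - w n.+1%:R = - w p.
Proof.
move=> yn; have [|k /andP[ky yk]] := @grid_cell R n y.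
  by move: yn; rewrite ltr_norml => /andP[-> /ltW].
exists (grid R n k); split.
  by rewrite (ltW ky) andbT lerBlDr -gridS.
rewrite /half_sum; under eq_bigr => j _.
  rewrite indicE (_ : (y \in _) = (k <= j)%N); first over.
  apply/idP/idP; rewrite inE/= in_itv/=.
    move=> yj; rewrite leqNgt; apply/negP => jk.
    by have := le_grid R n jk; rewrite leNgt (lt_le_trans ky yj).
  by move=> kj; rewrite (le_trans yk)// le_grid.
rewrite (eq_bigr (fun j : 'I_(ngrid n) => if (k <= j)%N then w (grid R n j.+1) - w (grid R
    n j) else 0)); last first.
  by move=> j _; case: ifP; rewrite ?mul1r ?mul0r.
rewrite -(big_mkord xpredT (fun j => if (k <= j)%N then w (grid R n j.+1) - w (grid R n j) else 0)).
rewrite (@big_cat_nat _ _ _ (k : nat))//=; last exact: ltnW.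
rewrite big_nat big1 ?add0r; last by move=> j /andP[_ jk]; rewrite leqNgt jk.
rewrite (@telescope_sumr_eq _ _ _ (fun j => w (grid R n j))); last 2 first.
- exact: ltnW.
- by move=> j /andP[-> _].
by rewrite grid_last addrAC subrr add0r.
Qed.

Let Rintegral_support m r (f : R -> R) : measurable_fun setT f ->
  m (~` `[- r, r]%classic) = 0%E ->
  \int[m]_y f y = \int[m]_y (f y * \1_(`[- r, r]%classic : set R) y).
Proof.
move=> mf m0; rewrite /Rintegral; congr fine.
apply: ae_eq_integral => //.
- exact/measurable_EFinP.
- by apply/measurable_EFinP; exact: measurable_funM.
exists (~` `[- r, r]%classic); split => //; first exact: measurableC.
move=> y /= fy yr; apply: fy => _; rewrite indicE mem_set ?mulr1//.
Qed.

Let mass_cvg m r w : continuous w -> m (~` `[- r, r]%classic) = 0%E ->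
  \int[m]_y (half_sum w n y - w n.+1%:R) @[n --> \oo] --> - \int[m]_y w y.
Proof.
move=> cw m0.
have mw : measurable_fun setT w by exact: continuous_measurable_fun.
pose r' := Num.max r 0.
have rr : - r' - 1 <= r' + 1.
  have : 0 <= r' by rewrite le_max lexx orbT.
  lra.
have [C wC] : exists C, forall t, t \in `[- r' - 1, r' + 1] -> `|w t| <= C.
  have cn : {within `[- r' - 1, r' + 1], continuous (fun t => `|w t|)}.
    apply: continuous_subspaceT => t; exact: (continuous_comp (cw t) (@norm_continuous _ _ _)).
  by have [c _ wc] := EVT_max rr cn; exists `|w c|.
have C0 : 0 <= C.
  apply: le_trans (normr_ge0 (w (- r' - 1))) (wC _ _).
  by rewrite in_itv/= lexx.
pose I : R -> R := \1_(`[- r, r]%classic : set R).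
have mI : measurable_fun setT I by exact: measurable_indic.
(* The telescoping is available once the window contains the support; the earlier terms are set to
   zero to keep a uniform bound. *)
pose V n y := if r' < n.+1%:R then (half_sum w n y - w n.+1%:R) * I y else 0.
have mV n : measurable_fun setT (V n).
  rewrite (_ : V n = if r' < n.+1%:R then (fun y => (half_sum w n y - w n.+1%:R) * I y) else fun=> 0).
    by case: ifP => _ //; apply: measurable_funM => //; exact: measurable_funB.
  by apply/funext => y; rewrite /V; case: ifP.
have Iy (y : R) : (r < `|y|)%R \/ (`|y| <= r' /\ `|y| <= r).
  have [yr|ry] := leP `|y| r; [right|by left].
  by split => //; rewrite le_max yr.
have I0 y : r < `|y| -> I y = 0.
  move=> ry; rewrite /I indicE memNset//= in_itv/= -ler_norml.
  by rewrite leNgt ry.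
have cV : \int[m]_y V n y @[n --> \oo] --> \int[m]_y (- w y * I y).
  apply: (@Rbounded_cvg _ _ _ m _ _ C) => //.
  - by apply: measurable_funM => //; exact: (measurable_funN mw).
  - move=> y; have [ry|[yr' yr]] := Iy y.
      apply: cvg_near_cst; apply: nearW => n.
      by rewrite /V I0// !mulr0; case: ifP.
    have ex n : exists p, y - n.+1%:R^-1 <= p <= y /\
        (r' < n.+1%:R -> V n y = - w p * I y).
      have [rn|nr] := ltP r' n.+1%:R.
        have [p [py e]] := @half_sum_cell w n y (le_lt_trans yr' rn).
        by exists p; split => // _; rewrite /V rn e.
      by exists y; rewrite lexx andbT lerBlDr lerDl invr_ge0 ler0n.
    have [u uE] := choice ex.
    have ux : u n @[n --> \oo] --> y.
      apply/cvgrPdist_le => e e0; near=> n.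
      have [/andP[xu ux] _] := uE n; rewrite ger0_norm ?subr_ge0//.
      move: xu; rewrite lerBlDr -lerBlDl => /le_trans; apply.
      by rewrite ltW//; near: n; exact: (near_infty_natSinv_lt (PosNum e0)).
    have : - w (u n) * I y @[n --> \oo] --> - w y * I y.
      apply: cvgMl; apply: cvgN.
      exact: (cvg_comp _ _ ux (cw y)).
    apply: cvg_trans; apply: near_eq_cvg; near=> n.
    have [_ ->//] := uE n; apply: (@lt_trans _ _ n%:R); last by rewrite ltr_nat.
    by near: n; exact: nbhs_infty_gtr.
  - move=> n y; rewrite /V; case: ifPn => [rn|_]; last by rewrite normr0.
    have [ry|[yr' yr]] := Iy y; first by rewrite I0// mulr0 normr0.
    have [p [/andP[yp py] ->]] := @half_sum_cell w n y (le_lt_trans yr' rn).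
    rewrite normrM normrN -[leRHS]mulr1 ler_pM//.
      apply: wC; rewrite in_itv/=; have n1 : n.+1%:R^-1 <= 1 :> R by rewrite invf_le1// ler1n.
      by move: yr' yp py n1; rewrite ler_norml; move: (n.+1%:R^-1) => z /andP[? ?]; lra.
    by rewrite /I indicE; case: (_ \in _); rewrite ?normr1 ?normr0.
have -> : - (\int[m]_y w y) = \int[m]_y (- w y * I y).
  rewrite (Rintegral_support mw m0).
  rewrite -mulN1r -RintegralZl//; last first.
    have iC : forall y, `|w y * I y| <= C.
      move=> y; have [ry|[yr' yr]] := Iy y; first by rewrite I0// mulr0 normr0.
      rewrite normrM -[leRHS]mulr1 ler_pM//.
        apply: wC; rewrite in_itv/=.
        by move: yr'; rewrite ler_norml => /andP[? ?]; lra.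
      by rewrite /I indicE; case: (_ \in _); rewrite ?normr1 ?normr0.
    by apply: (@bounded_integrable _ _ _ m _ C) => //; exact: measurable_funM.
  by apply: eq_Rintegral => y _; rewrite mulN1r mulNr.
apply: cvg_trans cV; apply: near_eq_cvg; near=> n.
rewrite [RHS](Rintegral_support _ m0); last exact: measurable_funB.
apply: eq_Rintegral => y _; rewrite /V ifT//.
by apply: (@lt_trans _ _ n%:R); [near: n; exact: nbhs_infty_gtr|rewrite ltr_nat].
Unshelve. all: by end_near. Qed.

Lemma right_seq_continuous_mass m : right_seq_continuous (mass m).
Proof.
move=> u x xu ux; rewrite massE; under eq_fun do rewrite massE.
apply: (@Rbounded_cvg _ _ _ m _ _ 1); [by move=> n; exact: measurable_indic|exact:
    measurable_indic|move=> y|move=> n y]; last first.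
  by rewrite indicE; case: (_ \in _); rewrite ?normr1 ?normr0.
apply: cvg_near_cst; have [yx|xy] := leP y x.
  by apply: nearW => n; rewrite !indicE !mem_set//= in_itv/= (le_trans yx).
have /cvgrPdist_lt/(_ (y - x)) := ux; rewrite subr_gt0 => /(_ xy) h.
near=> n; rewrite !indicE !memNset//= in_itv/= leNgt ?xy//=.
apply/negP; rewrite negbK.
have : `|x - u n| < y - x by near: n.
by rewrite distrC => /(le_lt_trans (ler_norm _)); rewrite ltrD2r.
Unshelve. all: by end_near. Qed.

(** Integration by parts, whence the reversed order of the difference. Equality of the masses
    cancels the boundary term at n + 1 and makes the difference vanish to the right of the
    support. *)
Lemma represents_mass m1 m2 r : m1 setT = m2 setT ->
  m1 (~` `[- r, r]%classic) = 0%E -> m2 (~` `[- r, r]%classic) = 0%E ->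
  represents (fun w => \int[m1]_x w x - \int[m2]_x w x) (fun x => mass m2 x - mass m1 x).
Proof.
move=> m12 m1r m2r; split; last first.
  move=> w cw.
  have -> : (\int[m1]_x w x) - (\int[m2]_x w x) = - (\int[m2]_x w x) - (- (\int[m1]_x w x)).
    by rewrite opprK addrC.
  have e m n : \int[m]_y (half_sum w n y - w n.+1%:R) = stieltjes_sum (mass m) w n - w
      n.+1%:R * fine (m setT).
    rewrite RintegralB//; last 2 first.
    - exact: integrable_half_sum.
    - by apply: (@bounded_integrable _ _ _ m (fun=> w n.+1%:R) `|w n.+1%:R|).
    rewrite -stieltjes_sum_mass; congr (_ - _).
    by rewrite /Rintegral integral_cst// fineM// fin_num_measure.
  rewrite (_ : stieltjes_sum _ w = fun n => \int[m2]_y (half_sum w n y - w n.+1%:R) -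
      \int[m1]_y (half_sum w n y - w n.+1%:R)).
    by apply: cvgB; [exact: (mass_cvg cw m2r)|exact: (mass_cvg cw m1r)].
  apply/funext => n; rewrite /= !e m12 opprB addrA subrK /stieltjes_sum -sumrB.
  by apply: eq_bigr => k _; rewrite mulrBl.
have mT m x : mass m x <= fine (m setT).
  by apply: fine_le; rewrite ?fin// ?le_measure ?inE//.
have m0 m x : 0 <= mass m x by rewrite fine_ge0.
split.
- by move=> u x xu ux; apply: cvgB; exact: right_seq_continuous_mass ux.
- exists (fine (m2 setT) + fine (m1 setT)) => x.
  by rewrite (le_trans (ler_normB _ _))// !ger0_norm// lerD.
exists r => x rx.
have h m : m (~` `[- r, r]%classic) = 0%E -> mass m x = if 0 <= x then fine (m setT) else 0.
  move=> mr; case: ifPn => [x0|]; last rewrite -ltNge => x0.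
    congr fine; apply/eqP; rewrite eq_le le_measure ?inE//=.
    rewrite -(setvU `]-oo, x]%classic) (le_trans (measureU2 m _ _))//=.
      exact: measurableC.
    rewrite [X in (X + _)%E](_ : _ = 0%E) ?add0e//.
    apply: (subset_measure0 _ _ _ mr); [exact: measurableC|exact: measurableC|].
    move=> y /=; rewrite !in_itv/= => /negP; rewrite -ltNge => xy; apply/negP.
    rewrite negb_and -!ltNge; apply/orP; right.
    by rewrite (le_lt_trans _ xy)// -(ger0_norm x0) ltW.
  suff -> : mass m x = fine (0 : \bar R)%E by [].
  congr fine; apply/eqP; rewrite eq_le measure_ge0 andbT -mr le_measure ?inE//.
    exact: measurableC.
  move=> y /=; rewrite !in_itv/= => yx; apply/negP; rewrite negb_and -!ltNge.
  apply/orP; left; rewrite (le_lt_trans yx)// ltrNr -(ltr0_norm x0)//.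
by rewrite !h// m12 subrr.
Qed.

End mass_functions.

Section represented_functionals.
Context (R : realType).
Local Notation borel := (measurableTypeR R).

(** The indicator of [[s, t[], or minus that of [[t, s[] when [t < s], so that no order of the
    endpoints has to be assumed. *)
Definition incr (s t x : R) : R := (s <= x)%R%:R - (t <= x)%R%:R.

(** An increment is the integral of the path against the unit mass at [t] minus the unit mass at
    [s]. *)
Lemma represents_incr s t : represents (fun w => w t - w s) (incr s t).
Proof.
pose r := Num.max `|s| `|t|.
have out (a : R) : `|a| <= r -> dirac a (~` `[- r, r]%classic) = 0%E :> \bar R.
  move=> ar; rewrite diracE memNset//= => -[]; rewrite /= in_itv/= -ler_norml.
  by [].
have mE (a x : R) : mass [the {finite_measure set borel -> \bar R} of dirac (a : borel)] x = (a <= x)%R%:R.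
  transitivity (fine (\d_a (`]-oo, x]%classic : set R) : \bar R)) => //.
  rewrite diracE; congr (_%:R); congr nat_of_bool.
  by apply/idP/idP; rewrite inE/= in_itv.
have sr : `|s| <= r by rewrite le_max lexx.
have tr : `|t| <= r by rewrite le_max lexx orbT.
have h := @represents_mass R [the {finite_measure set borel -> \bar R} of dirac (t : borel)]
  [the {finite_measure set borel -> \bar R} of dirac (s : borel)] r _ (out _ tr) (out _ sr).
have {}h := h _; rewrite (_ : incr s t = fun x => mass [the {finite_measure set borel ->
    \bar R} of dirac (s : borel)] x -
    mass [the {finite_measure set borel -> \bar R} of dirac (t : borel)] x).
  apply: (eq_represents _ (h _)) => [w cw|].
    have mw : measurable_fun setT (EFin \o w).
      by apply/measurable_EFinP; exact: continuous_measurable_fun.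
    by rewrite /Rintegral !integral_dirac// !diracT !mul1e.
  by rewrite /= !diracT.
by apply/funext => x; rewrite !mE.
Qed.

(** The Jordan parts of [mu] have equal mass since [mu] is balanced, and they inherit its bounded
    support. *)
Lemma represents_charge (mu : {charge set borel -> \bar R}) : balanced_charge mu ->
  exists G, represents (charge_integral mu) G.
Proof.
move=> [mu0 [r mur]].
have [P [N [hPN E]]] : exists P N (hPN : hahn_decomposition mu P N), forall f,
    charge_integral mu f = (\int[jordan_pos hPN]_s f s) - (\int[jordan_neg hPN]_s f s).
  rewrite /charge_integral; case: (cid _) => P hP; case: (cid hP) => N hPN.
  by exists P, N, hPN.
have [[mP _] [mN _] _ _] := hPN.
pose m1 := [the {finite_measure set borel -> \bar R} of jordan_pos hPN].
pose m2 := [the {finite_measure set borel -> \bar R} of jordan_neg hPN].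
have mr : measurable (~` `[- r, r]%classic : set borel) by apply: measurableC; exact: measurable_itv.
have h : represents (fun w => (\int[m1]_s w s) - (\int[m2]_s w s)) (fun x => mass m2 x - mass m1 x).
  apply: (@represents_mass R m1 m2 r).
  - have : (0 = m1 setT - m2 setT)%E.
      by rewrite -[LHS]mu0 (jordan_decomp hPN measurableT) /cadd/= cscaleN1.
    rewrite -(fineK (fin_num_measure m1 _ measurableT)) -(fineK (fin_num_measure m2 _ measurableT)).
    by rewrite -EFinB => -[] /esym/eqP; rewrite subr_eq0 => /eqP ->.
  - rewrite /m1 /= jordan_posE cjordan_posE /crestr0 mem_set// /crestr mur//.
    by exact: measurableI.
  - rewrite /m2 /= jordan_negE cjordan_negE /crestr0 mem_set// /crestr mur ?oppe0//.
    by exact: measurableI.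
by exists (fun x => mass m2 x - mass m1 x); rewrite (_ : charge_integral mu = fun w =>
    (\int[m1]_s w s) - (\int[m2]_s w s))//; exact/funext.
Qed.

End represented_functionals.

(** * Covariance of the tilted laws *)

Section tilted_covariance.
Context (R : realType).
Local Notation mu := (@lebesgue_measure R).
Implicit Types (G H : R -> R) (p q : R * R * R) (y : seq (R * R * R)).

Definition mincr p : R -> R := incr p.1.1 p.1.2.

(* The covariance of [int G dw] and [int H dw] under the law with density
   proportional to [exp (- sum_p u_p^2 (w t_p - w s_p)^2 / 2)] with respect to
   the Brownian law: a rank one update for each factor. *)
Fixpoint covar y G H : R := if y is p :: y' then
    covar y' G H - p.2 ^+ 2 * covar y' G (mincr p) * covar y' H (mincr p) /
      (1 + p.2 ^+ 2 * covar y' (mincr p) (mincr p))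
  else ip G H.

(** The same rank one updates applied to the function: it inverts the identity plus the sum of the
    projections u_p^2 (mincr p) (mincr p)^T, and is the derivative of the optimal path in
    [Qform]. *)
Fixpoint resolvent y G : R -> R := if y is p :: y' then
    fun x => resolvent y' G x + - (p.2 ^+ 2 * covar y' G (mincr p) /
      (1 + p.2 ^+ 2 * covar y' (mincr p) (mincr p))) * resolvent y' (mincr p) x
  else G.

Lemma tame_mincr p : tame (mincr p).
Proof. by have [] := @represents_incr R p.1.1 p.1.2. Qed.
Hint Resolve tame_mincr : core.

Lemma covarC y G H : covar y G H = covar y H G.
Proof.
elim: y G H => [|p y IH] G H /=; first exact: ipC.
by rewrite (IH G H); ring.
Qed.

Lemma covarDl y G G' H : tame G -> tame G' -> tame H ->
  covar y (fun x => G x + G' x) H = covar y G H + covar y G' H.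
Proof.
move=> tG tG'; elim: y H => [|p y IH] H tH /=; first exact: ipDl.
by rewrite !IH//; ring.
Qed.

Lemma covarZl y k G H : tame G -> tame H ->
  covar y (fun x => k * G x) H = k * covar y G H.
Proof.
move=> tG; elim: y H => [|p y IH] H tH /=; first exact: ipZl.
by rewrite !IH//; ring.
Qed.

Lemma covar_sqr y k G H : tame G -> tame H ->
  covar y (fun x => G x + k * H x) (fun x => G x + k * H x) =
  covar y G G + 2 * k * covar y G H + k ^+ 2 * covar y H H.
Proof.
move=> tG tH; have tk := tameZ k tH; have t := tameD tG tk.
rewrite (covarDl y tG tk t) (covarZl y k tH t) (covarC y G) (covarC y H).
rewrite !(covarDl y tG tk)// !(covarZl y k tH)// (covarC y H G); ring.
Qed.

Lemma tame_resolvent y G : tame G -> tame (resolvent y G).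
Proof.
elim: y G => [//|p y IH] G tG /=.
by apply: tameD; [exact: IH|apply: tameZ; exact: IH].
Qed.

Lemma covarE y G H : tame G -> tame H -> covar y G H = ip (resolvent y G) H.
Proof.
elim: y G H => [//|p y IH] G H tG tH /=.
have tR K : tame K -> tame (resolvent y K) by exact: tame_resolvent.
rewrite ipDl//; [|exact: tR|by apply: tameZ; exact: tR].
rewrite ipZl//; last exact: tR.
by rewrite -!IH// (covarC y H); ring.
Qed.

Definition square_integrable (h : R -> R) := mu.-integrable setT (EFin \o h) /\
  mu.-integrable setT (fun x => (h x ^+ 2)%:E).

Lemma square_integrable_tame G : tame G -> square_integrable G.
Proof. by move=> tG; split; [exact: tame_integrable|exact: (tame_integrable (tameM tG tG))]. Qed.

Let integrable_tame_mul G (h : R -> R) : tame G -> mu.-integrable setT (EFin \o h) ->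
  mu.-integrable setT (EFin \o (fun x => G x * h x)).
Proof.
move=> tG ih; have [_ [C GC] _] := tG.
have mh : measurable_fun setT h by move/integrableP : ih => [/measurable_EFinP].
have C0 : 0 <= C by exact: le_trans (normr_ge0 _) (GC 0).
apply: (@le_integrable _ _ _ mu _ measurableT _ (fun x => (C * h x)%:E)).
- by apply/measurable_EFinP; apply: measurable_funM => //; exact: measurable_tame.
- by move=> x _; rewrite lee_fin !normrM ler_wpM2r// (le_trans (GC x))// ler_norm.
- have := integrableZl measurableT C ih; exact: eq_integrable.
Qed.

Lemma ip_sub_scale k G H (h : R -> R) : tame G -> tame H -> mu.-integrable setT (EFin \o h) ->
  ip (fun x => G x + k * H x) h = ip G h + k * ip H h.
Proof.
move=> tG tH ih.
have iG := integrable_tame_mul tG ih; have iH := integrable_tame_mul tH ih.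
rewrite /ip -RintegralZl// -RintegralD//; last first.
  by have := integrableZl measurableT k iH; apply: eq_integrable.
by apply: eq_Rintegral => x _; ring.
Qed.

(** The negative part of the functional maximized in [Qform], written in terms of the derivative [h]
    of the path. *)
Definition energy y (h : R -> R) : R :=
  \int[mu]_x (h x ^+ 2) + \sum_(p <- y) p.2 ^+ 2 * ip (mincr p) h ^+ 2.

Lemma energy0 y : energy y (fun=> 0) = 0.
Proof.
have i0 : \int[mu]_x (0 : R) = 0 by rewrite /Rintegral integral0.
rewrite /energy; under eq_Rintegral do rewrite expr0n/=.
rewrite i0 add0r big1// => p _.
by rewrite /ip; under eq_Rintegral do rewrite mulr0; rewrite i0 expr0n/= mulr0.
Qed.

Lemma ip0r G : ip G (fun=> 0) = 0.
Proof. by rewrite /ip; under eq_Rintegral do rewrite mulr0; rewrite /Rintegral integral0. Qed.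

(* For [c] the optimal multiplier, [- u^2 x^2 <= c^2 / u^2 - 2 c x] reduces the
   bound for [p :: y] at [G] to the bound for [y] at [G - c (mincr p)]. *)
Lemma le_covar y G (h : R -> R) : tame G -> square_integrable h ->
  2 * ip G h - energy y h <= covar y G G.
Proof.
elim: y G h => [|p y IH] G h tG [ih ih2].
  rewrite /energy big_nil addr0 /=.
  have iGh := integrable_tame_mul tG ih.
  have iGG := tame_integrable (tameM tG tG).
  have : 0 <= \int[mu]_x ((G x * G x + (- 2) * (G x * h x)) + h x ^+ 2).
    apply: Rintegral_ge0 => x _.
    have -> : G x * G x + -2 * (G x * h x) + h x ^+ 2 = (G x - h x) ^+ 2 by ring.
    exact: sqr_ge0.
  have i2 : mu.-integrable setT (EFin \o (fun x => - 2 * (G x * h x))).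
    by have := integrableZl measurableT (- 2) iGh; apply: eq_integrable.
  rewrite RintegralD//; last first.
    by have := integrableD measurableT iGG i2; apply: eq_integrable.
  rewrite RintegralD// RintegralZl// -/(ip G G) -/(ip G h).
  lra.
have ge0 K : tame K -> 0 <= covar y K K.
  move=> tK; have := IH K _ tK (square_integrable_tame (@tame0 R)).
  by rewrite ip0r energy0 mulr0 subr0.
rewrite /energy big_cons /=.
set v := covar y (mincr p) (mincr p); set c0 := covar y G (mincr p); set u := p.2.
have v0 : 0 <= v := ge0 _ (tame_mincr p).
have d0 : 0 < 1 + u ^+ 2 * v by rewrite ltr_pwDl// mulr_ge0// sqr_ge0.
pose k := c0 / (1 + u ^+ 2 * v); pose c := u ^+ 2 * k.
have tc := tameZ (- c) (tame_mincr p).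
have := IH (fun x => G x + - c * mincr p x) h (tameD tG tc) (conj ih ih2).
rewrite ip_sub_scale// covar_sqr// -/v -/c0 /energy.
have kE : k * (1 + u ^+ 2 * v) = c0 by rewrite /k divfK// gt_eqF.
have -> : u ^+ 2 * c0 * c0 / (1 + u ^+ 2 * v) = u ^+ 2 * (k * c0) by rewrite /k; ring.
set x := ip (mincr p) h; set e := \int[mu]_x _; set s := \sum_(_ <- _) _.
have := mulr_ge0 (sqr_ge0 u) (sqr_ge0 (k - x)).
rewrite /c -kE; move: (ip G h) (covar y G G) => g V; nra.
Qed.

Lemma covar_ge0 y G : tame G -> 0 <= covar y G G.
Proof.
move=> tG; have := le_covar y tG (square_integrable_tame (@tame0 R)).
by rewrite ip0r energy0 mulr0 subr0.
Qed.

Lemma tilt_den_gt0 y p : 0 < 1 + p.2 ^+ 2 * covar y (mincr p) (mincr p).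
Proof. by rewrite ltr_pwDl// mulr_ge0 ?sqr_ge0// covar_ge0. Qed.

(** The Euler-Lagrange equation of the variational problem. *)
Lemma resolventE y G : tame G -> forall x,
  G x = resolvent y G x + \sum_(p <- y) p.2 ^+ 2 * ip (mincr p) (resolvent y G) * mincr p x.
Proof.
elim: y G => [|p y IH] G tG x; first by rewrite big_nil addr0.
have tR K : tame K -> tame (resolvent y K) by exact: tame_resolvent.
rewrite big_cons /=.
have d0 := tilt_den_gt0 y p.
set v := covar y (mincr p) (mincr p) in d0 *; set c0 := covar y G (mincr p).
set u := p.2 in d0 *; set k := u ^+ 2 * c0 / (1 + u ^+ 2 * v).
have ipE q : ip (mincr q) (fun x => resolvent y G x + - k * resolvent y (mincr p) x) =
    ip (mincr q) (resolvent y G) + - k * ip (mincr q) (resolvent y (mincr p)).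
  rewrite ipC ipDl//; [|exact: tR|by apply: tameZ; exact: tR].
  by rewrite ipZl//; [rewrite ![ip _ (mincr q)]ipC|exact: tR].
rewrite ipE; under eq_bigr do rewrite ipE.
have -> : \sum_(j <- y) j.2 ^+ 2 * (ip (mincr j) (resolvent y G) +
      - k * ip (mincr j) (resolvent y (mincr p))) * mincr j x =
    \sum_(j <- y) j.2 ^+ 2 * ip (mincr j) (resolvent y G) * mincr j x -
    k * \sum_(j <- y) j.2 ^+ 2 * ip (mincr j) (resolvent y (mincr p)) * mincr j x.
  by rewrite mulr_sumr -sumrB; apply: eq_bigr => j _; ring.
have e1 := IH G tG x; have e2 := IH (mincr p) (tame_mincr p) x.
rewrite [ip (mincr p) (resolvent y G)]ipC [ip (mincr p) (resolvent y (mincr p))]ipC.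
rewrite -!covarE// -/v -/c0.
set S1 := \sum_(_ <- _) _ in e1 *; set S2 := \sum_(_ <- _) _ in e2 *.
have kE : u ^+ 2 * (c0 + - k * v) = k by rewrite /k; field; rewrite gt_eqF.
rewrite kE e1 e2; ring.
Qed.

(** Pairing [resolventE] with the resolvent shows that its energy equals [ip G (resolvent y G)], so
    the bound [le_covar] is attained. *)
Lemma covar_resolvent y G : tame G ->
  2 * ip G (resolvent y G) - energy y (resolvent y G) = covar y G G.
Proof.
move=> tG; have tR := tame_resolvent y tG.
rewrite /energy.
have : ip G (resolvent y G) = ip (resolvent y G) (resolvent y G) +
    \sum_(p <- y) p.2 ^+ 2 * ip (mincr p) (resolvent y G) ^+ 2.
  set r := resolvent y G in tR *.
  have lin (s : seq (R * R * R)) K : tame K ->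
      ip (fun x => K x + \sum_(p <- s) p.2 ^+ 2 * ip (mincr p) r * mincr p x) r =
      ip K r + \sum_(p <- s) p.2 ^+ 2 * ip (mincr p) r ^+ 2.
    elim: s K => [|p s IH] K tK.
      rewrite big_nil addr0; apply: eq_Rintegral => x _; by rewrite big_nil addr0.
    have tp := tameZ (p.2 ^+ 2 * ip (mincr p) r) (tame_mincr p).
    transitivity (ip (fun x => (K x + p.2 ^+ 2 * ip (mincr p) r * mincr p x) +
        \sum_(p <- s) p.2 ^+ 2 * ip (mincr p) r * mincr p x) r).
      by apply: eq_Rintegral => x _; rewrite big_cons addrA.
    by rewrite (IH _ (tameD tK tp)) (ipDl tK tp tR) (ipZl _ (tame_mincr p) tR) big_cons; ring.
  by rewrite -lin//; apply: eq_Rintegral => x _; rewrite {1}(resolventE y tG).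
have -> : \int[mu]_x (resolvent y G x ^+ 2) = ip (resolvent y G) (resolvent y G) by [].
move=> e; rewrite (covarE y tG tG) [in RHS]ipC; lra.
Qed.

Lemma tame_support y G : tame G -> exists r, (forall x, r < `|x| -> G x = 0) /\
  forall p, p \in y -> forall x, r < `|x| -> mincr p x = 0.
Proof.
move=> tG; elim: y => [|p y [r [Gr yr]]].
  by have [_ _ [r Gr]] := tG; exists r.
have [_ _ [q pq]] := tame_mincr p.
exists (Num.max r q); split => [x|p' p'y x]; rewrite gt_max => /andP[rx qx].
  exact: Gr.
by move: p'y; rewrite in_cons => /predU1P[->|p'y]; [exact: pq|exact: (yr _ p'y)].
Qed.

Definition primitive (g : R -> R) (x : R) : R := \int[mu]_(z in `]-oo, x]) g z.

Lemma primitiveB g (a b : R) : tame g -> a <= b ->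
  (\int[mu]_(z in `]a, b]) (g z)%:E = (primitive g b - primitive g a)%:E)%E.
Proof.
move=> tg ab; have ig := tame_integrable tg.
have igS (A : set R) : measurable A -> mu.-integrable A (EFin \o g).
  by move=> mA; apply: integrableS ig.
rewrite /primitive Rintegral_itvB ?bnd_simp//; last by apply: igS; exact: measurable_itv.
rewrite /Rintegral fineK//; apply: integrable_fin_num => //.
by apply: igS; exact: measurable_itv.
Qed.

(** With [c = 0] this is a Lipschitz bound; with [c] a value of [g] it controls averages of [g] near
    a point. *)
Lemma primitive_bound g (c K a b : R) : tame g ->
  (forall z, a < z <= b -> `|g z - c| <= K) -> a <= b ->
  `|primitive g b - primitive g a - c * (b - a)| <= K * (b - a).
Proof.
move=> tg gK ab; have ig := tame_integrable tg.
have mI : measurable (`]a, b]%classic : set (measurableTypeR R)) by exact: measurable_itv.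
have igS : mu.-integrable `]a, b]%classic (EFin \o g) by apply: integrableS ig.
have muI : mu `]a, b]%classic = (b - a)%:E.
  rewrite lebesgue_measure_itv/= lte_fin.
  by move: ab; rewrite le_eqVlt => /predU1P[->|ab]; rewrite ?ltxx ?subrr// ab EFinB.
have ic : mu.-integrable `]a, b]%classic (EFin \o (fun=> c)).
  apply: measurable_bounded_integrable => //; [|exact: bounded_cst].
  exact: (eq_ind_r (fun z => (z < +oo)%E) (ltry _) muI).
have igc : mu.-integrable `]a, b]%classic (fun z => (g z - c)%:E).
  by have := integrableB mI igS ic; apply: eq_integrable.
have -> : primitive g b - primitive g a - c * (b - a) = \int[mu]_(z in `]a, b]) (g z - c).
  rewrite RintegralB//; congr (_ - _).
    by rewrite /Rintegral primitiveB.
  by rewrite /Rintegral integral_cst// [X in (_ * X)%E]muI.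
rewrite -lee_fin -abse_EFin /Rintegral fineK; last exact: integrable_fin_num.
apply: (le_trans (le_abse_integral mu mI _)); first by move/integrableP : igc => [].
apply: (@le_trans _ _ (\int[mu]_(z in `]a, b]) (K%:E))%E).
  apply: ge0_le_integral => //.
  by apply: measurableT_comp => //; move/integrableP : igc => [].
by rewrite integral_cst// [X in (_ * X)%E]muI.
Qed.

Lemma primitive_lipschitz g (C a b : R) : tame g -> (forall x, `|g x| <= C) -> a <= b ->
  `|primitive g b - primitive g a| <= C * (b - a).
Proof.
move=> tg gC ab; have := @primitive_bound g 0 C a b tg _ ab.
by rewrite mul0r subr0; apply => z _; rewrite subr0.
Qed.

Lemma primitive_continuous g : tame g -> continuous (primitive g).
Proof.
move=> tg x; have [_ [C gC] _] := tg.
have C0 : 0 <= C by exact: le_trans (normr_ge0 _) (gC 0).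
apply/cvgrPdist_lt => e e0.
have d0 : 0 < e / (C + 1) by rewrite divr_gt0// ltr_wpDl.
near=> y.
have yx : `|x - y| < e / (C + 1) by near: y; apply/nbhs_ballP; exists (e / (C + 1)).
have le : `|primitive g x - primitive g y| <= C * `|x - y|.
  have [xy|yx'] := leP x y.
    rewrite distrC [`|x - y|]distrC [`|y - x|]ger0_norm ?subr_ge0//.
    exact: primitive_lipschitz.
  rewrite [`|x - y|]ger0_norm ?subr_ge0 ?(ltW yx')//.
  by apply: primitive_lipschitz => //; exact: ltW.
apply: (le_lt_trans le); move: yx; rewrite ltr_pdivlMr ?ltr_wpDl// => yx.
by apply: le_lt_trans yx; rewrite mulrC ler_wpM2l// lerDl.
Unshelve. all: by end_near. Qed.

Lemma finite_energy_primitive g : continuous g -> tame g ->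
  finite_energy (primitive g) /\ derive1 (primitive g) = g.
Proof.
move=> cg tg; have [_ [C gC] _] := tg.
have C0 : 0 <= C by exact: le_trans (normr_ge0 _) (gC 0).
have dE : derive1 (primitive g) = g.
  apply/funext => x.
  have xx : x < x + 1 by rewrite ltrDl.
  have ig : mu.-integrable `]-oo, x + 1]%classic (EFin \o g).
    by apply: integrableS (tame_integrable tg) => //; exact: measurable_itv.
  have [|_ ->//] := @continuous_FTC1 R g -oo%O x (x + 1) xx ig _ (cg x).
  exact: ltNyr.
split=> //; split; last by rewrite dE; have [] := square_integrable_tame tg.
move=> a b ab e e0; exists (e / (C + 1)); first by rewrite divr_gt0// ltr_wpDl.
move=> n s t st _ std.
apply: (@le_lt_trans _ _ (C * \sum_(k < n) (t k - s k))).
  rewrite mulr_sumr; apply: ler_sum => k _; have [_ ? _] := st k.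
  exact: primitive_lipschitz.
move: std; rewrite ltr_pdivlMr ?ltr_wpDl// => std.
apply: le_lt_trans std; rewrite mulrC ler_wpM2l// ?lerDl//.
by apply: sumr_ge0 => k _; rewrite subr_ge0; have [] := st k.
Qed.

Lemma represents_primitive l G g : represents l G -> continuous g -> tame g ->
  l (primitive g) = ip G g.
Proof.
move=> [tG lG] cg tg; have [_ _ [r Gr]] := tG.
apply: (cvg_unique _ (lG _ (primitive_continuous tg))) => //.
apply: (stieltjes_sum_cvg tG Gr (tame_integrable tg)) => x y _ xy _.
exact: primitiveB.
Qed.

(** The averages of [G] over [[x, x + 1 / (n + 1)]]: they are continuous, so their primitives have
    them as derivatives everywhere, and right continuity of [G] makes them converge at every
    point. *)
Lemma tame_approx G : tame G -> exists (g : nat -> R -> R) (C r : R),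
  [/\ forall n, continuous (g n), forall n, tame (g n), forall n x, `|g n x| <= C,
      forall n x, r < `|x| -> g n x = 0 & forall x, g n x @[n --> \oo] --> G x].
Proof.
move=> tG; have [rG [C GC] [r Gr]] := tG.
pose g n x := n.+1%:R * (primitive G (x + n.+1%:R^-1) - primitive G x).
have inv0 n : 0 <= n.+1%:R^-1 :> R by rewrite invr_ge0.
have cg n : continuous (g n).
  move=> x; apply: cvgMr; apply: cvgB; last exact: (primitive_continuous tG).
  apply: (@cvg_comp _ _ _ (fun x => x + n.+1%:R^-1) (primitive G)); last exact: (primitive_continuous tG).
  by apply: cvgD; [exact: cvg_id|exact: cvg_cst].
have gC n x : `|g n x| <= C.
  rewrite /g normrM ger0_norm// mulrC -ler_pdivlMr//.
  have := @primitive_lipschitz G C x (x + n.+1%:R^-1) tG GC.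
  by rewrite lerDl => /(_ (inv0 n)); rewrite addrAC subrr add0r.
have gr n x : r + 1 < `|x| -> g n x = 0.
  move=> rx; have n1 : n.+1%:R^-1 <= 1 :> R by rewrite invf_le1// ler1n.
  have xi : x <= x + n.+1%:R^-1 by rewrite lerDl.
  have h (k : forall z, x < z <= x + n.+1%:R^-1 -> `|G z - 0| <= 0) := primitive_bound tG k xi.
  have {}h : (forall z, x < z <= x + n.+1%:R^-1 -> `|G z - 0| <= 0) ->
      primitive G (x + n.+1%:R^-1) - primitive G x == 0.
    by move=> /h; rewrite !mul0r subr0 normr_le0.
  rewrite /g (eqP (h _)) ?mulr0// => z /andP[xz zx]; rewrite subr0 Gr ?normr0//.
  move: rx n1 zx; move: (n.+1%:R^-1) (inv0 n) => i i0.
  have [x0|x0] := leP 0 x; first by rewrite !ger0_norm//; lra.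
  rewrite ltr0_norm// => rx i1 zx; rewrite -normrN (lt_le_trans _ (ler_norm _))//; lra.
exists g, C, (r + 1); split => // [n|x].
  split; [|by exists C|by exists (r + 1); exact: gr].
  by move=> u x _ ux; exact: (cvg_comp _ _ ux (cg n x)).
(* An average is no farther from [G x] than some averaged value, up to a small slack; otherwise the
   distance of [g n x] to [G x] would be smaller than itself. *)
have ex n : exists z, x <= z <= x + n.+1%:R^-1 /\ `|G x - g n x| <= `|G x - G z| + n.+1%:R^-1.
  have [[z [xz zx]]|] := pselect (exists z, (x < z <= x + n.+1%:R^-1) /\ `|G x - g n x| <=
      `|G x - G z| + n.+1%:R^-1).
    by exists z; split => //; case/andP: xz => /ltW -> ->.
  move=> /forallNP h; exfalso.
  have := @primitive_bound G (G x) (`|G x - g n x| - n.+1%:R^-1) x (x + n.+1%:R^-1) tG.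
  have e1 : x + n.+1%:R^-1 - x = n.+1%:R^-1 by rewrite addrAC subrr add0r.
  rewrite lerDl (inv0 n) e1 => H.
  have gE : primitive G (x + n.+1%:R^-1) - primitive G x = g n x * n.+1%:R^-1 by rewrite /g; field.
  rewrite gE -mulrBl normrM [`|n.+1%:R^-1|]ger0_norm// in H.
  have i0 : 0 < n.+1%:R^-1 :> R by rewrite invr_gt0.
  move: H; rewrite ler_pM2r// => H.
  have : `|g n x - G x| <= `|G x - g n x| - n.+1%:R^-1.
    apply: H => // z xz; rewrite distrC.
    by have /not_andP[//|/negP] := h z; rewrite -ltNge lerBrDr => /ltW.
  by rewrite distrC lerBrDr gerDl leNgt i0.
have [z zE] := choice ex.
have zx : z n @[n --> \oo] --> x.
  apply/cvgrPdist_le => e e0; near=> n.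
  have [/andP[xz xn] _] := zE n; rewrite distrC ger0_norm ?subr_ge0// lerBlDl.
  apply: (le_trans xn); rewrite lerD2l ltW//; near: n.
  exact: (near_infty_natSinv_lt (PosNum e0)).
have Gz : G (z n) @[n --> \oo] --> G x by apply: rG zx => n; have [/andP[]] := zE n.
apply/cvgrPdist_le => e e0; have e20 : 0 < e / 2 by rewrite divr_gt0.
near=> n; have [_ le] := zE n; apply: (le_trans le).
rewrite (splitr e) lerD//.
  by near: n; move/cvgrPdist_le : Gz; exact.
rewrite ltW//; near: n; exact: (near_infty_natSinv_lt (PosNum e20)).
Unshelve. all: by end_near. Qed.

(** Upper bound: [le_covar] applied to the truncated derivative of a path. Lower bound: the optimal
    derivative, the resolvent, may jump, so the supremum is approached along primitives of its
    continuous approximations. *)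
Lemma Qform_covar y (m : {charge set (measurableTypeR R) -> \bar R}) G :
  represents (charge_integral m) G -> Qform y m = (covar y G G)%:E.
Proof.
move=> lG; have [tG _] := lG.
apply/eqP; rewrite eq_le; apply/andP; split.
  apply: ge_ereal_sup => _ [f fe <-]; rewrite lee_fin.
  have [r [Gr yr]] := tame_support y tG.
  have [h [ih ih2 hf fG]] := finite_energy_truncation r fe.
  apply: le_trans (le_covar y tG (conj ih ih2)).
  rewrite (fG _ _ lG Gr) /energy.
  rewrite (_ : \sum_(p <- y) p.2 ^+ 2 * (f p.1.2 - f p.1.1) ^+ 2 =
    \sum_(p <- y) p.2 ^+ 2 * ip (mincr p) h ^+ 2); first by lra.
  apply: eq_big_seq => p py; congr (_ * _ ^+ 2).
  exact: (fG _ _ (represents_incr p.1.1 p.1.2) (yr _ py)).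
have tR := tame_resolvent y tG.
have [g [C [r [cg tg gC gr gR]]]] := tame_approx tR.
pose val n := 2 * ip G (g n) - energy y (g n).
have ipg H : tame H -> ip H (g n) @[n --> \oo] --> ip H (resolvent y G).
  move=> tH; apply: (@Rdominated_cvg _ _ _ mu _ _ (fun x => C * `|H x|)).
  - by move=> n; apply: measurable_funM; exact: measurable_tame.
  - by apply: measurable_funM; exact: measurable_tame.
  - by have := integrableZl measurableT C (integrable_norm (tame_integrable tH)); apply: eq_integrable.
  - by move=> x; apply: cvgMr; exact: gR.
  - by move=> n x; rewrite normrM mulrC ler_wpM2r.
have sqg : \int[mu]_x (g n x ^+ 2) @[n --> \oo] --> \int[mu]_x (resolvent y G x ^+ 2).
  have C0 : 0 <= C by exact: le_trans (normr_ge0 _) (gC 0%N 0).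
  apply: (@Rdominated_cvg _ _ _ mu _ _ (fun x => C ^+ 2 * \1_(`[- r, r]%classic : set R) x)).
  - by move=> n; apply: measurable_funX; exact: measurable_tame.
  - by apply: measurable_funX; exact: measurable_tame.
  - by have := integrableZl measurableT (C ^+ 2) (integrable_indic_itv (- r) r true false);
      apply: eq_integrable.
  - by move=> x; apply: cvgM; exact: gR.
  - move=> n x; have [xr|rx] := leP `|x| r.
      rewrite indicE mem_set/= ?in_itv/= -?ler_norml// mulr1 normrX.
      by rewrite ler_sqr ?nnegrE.
    by rewrite gr// expr0n/= normr0 mulr_ge0// sqr_ge0.
have cval : val n @[n --> \oo] --> covar y G G.
  rewrite -covar_resolvent//; apply: cvgB; first by apply: cvgMr; exact: ipg.
  apply: cvgD => //.
  have cs (s : seq (R * R * R)) : \sum_(p <- s) p.2 ^+ 2 * ip (mincr p) (g n) ^+ 2 @[n --> \oo] -->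
      \sum_(p <- s) p.2 ^+ 2 * ip (mincr p) (resolvent y G) ^+ 2.
    elim: s => [|p s IH].
      by rewrite big_nil; apply: cvg_near_cst; apply: nearW => n; rewrite big_nil.
    rewrite (_ : (fun n => _) = (fun n => p.2 ^+ 2 * ip (mincr p) (g n) ^+ 2 +
        \sum_(q <- s) q.2 ^+ 2 * ip (mincr q) (g n) ^+ 2)); last first.
      by apply/funext => n; rewrite big_cons.
    by rewrite big_cons; apply: cvgD => //; apply: cvgMr; apply: cvgM; exact: ipg.
  exact: cs.
have : (val n)%:E @[n --> \oo] --> (covar y G G)%:E by exact: (cvg_comp _ _ cval).
move=> /[dup] /cvg_lim <-//; move=> cv; apply: lime_le; first by apply/cvg_ex; eexists; exact: cv.
apply: nearW => n; apply: ereal_sup_ubound.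
have [fe dE] := finite_energy_primitive (cg n) (tg n).
exists (primitive (g n)) => //; congr (_%:E).
rewrite dE (represents_primitive lG (cg n) (tg n)) /val /energy opprD addrA; congr (_ - _).
apply: eq_bigr => p _; congr (_ * _ ^+ 2).
exact: (represents_primitive (represents_incr p.1.1 p.1.2) (cg n) (tg n)).
Qed.

End tilted_covariance.

(** * Gaussianity of the tilted laws *)

Section brownian_charfn.
Context (R : realType).

Lemma measurable_path_increment (s t : R) :
  measurable_fun setT (fun w : path1 R => w t - w s).
Proof.
have lt (a b : R) : a < b -> measurable_fun setT (fun w : path1 R => w b - w a).
  by move=> ab _ B mB; rewrite setTI; apply: sub_sigma_algebra; exists a, b, B; split.
have [st|ts|->] := ltgtP s t; first exact: lt.
  rewrite (_ : (fun w => _) = (fun w : path1 R => - (w s - w t))).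
    exact: (measurable_funN (lt _ _ ts)).
  by apply/funext => w; rewrite opprB.
by rewrite (_ : (fun w => _) = fun=> 0)//; apply/funext => w; rewrite subrr.
Qed.

Lemma measurable_coordinate (i : 'I_3) :
  measurable_fun setT (coordinate i : path3 R -> path1 R).
Proof.
apply: (@measurability _ _ (path3 R) (path1 R) setT (coordinate i) (increment_events1 [set: R])) => //.
move=> _ [B incB <-]; rewrite setTI; apply: sub_sigma_algebra.
by exists i; exists B.
Qed.

Lemma measurable_coordinate_increment (i : 'I_3) (s t : R) :
  measurable_fun setT (fun w : path3 R => coordinate i w t - coordinate i w s).
Proof. exact: (measurableT_comp (measurable_path_increment s t) (measurable_coordinate i)). Qed.

Lemma measurable_represented l (G : R -> R) : represents l G ->
  measurable_fun setT (l : path1 R -> R).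
Proof.
move=> [_ lG].
apply: (@measurable_fun_cvg _ _ _ _ (fun n (w : path1 R) => stieltjes_sum G w n)).
- move=> n; apply: measurable_sum => k; apply: measurable_funM => //.
  exact: measurable_path_increment.
- by move=> w _; apply: lG; exact: cts_fun.
Qed.

(** One functional per coordinate, so that its cosines determine the joint law of the three
    coordinates. *)
Definition functional (l : 'I_3 -> (R -> R) -> R) (w : path3 R) : R :=
  \sum_i l i (coordinate i w).

Lemma measurable_functional l (G : 'I_3 -> R -> R) : (forall i, represents (l i) (G i)) ->
  measurable_fun setT (functional l).
Proof.
move=> lG; apply: measurable_sum => i.
exact: (measurableT_comp (measurable_represented (lG i)) (measurable_coordinate i)).
Qed.

Lemma measurable_cos_functional l (G : 'I_3 -> R -> R) t : (forall i, represents (l i) (G i)) ->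
  measurable_fun setT (fun w => cos (functional l w + t)).
Proof.
move=> lG; apply: (@measurableT_comp _ _ _ _ _ _ (@cos R)).
  by apply: continuous_measurable_fun; exact: continuous_cos.
by apply: measurable_funD => //; exact: measurable_functional lG.
Qed.

Variable P : probability (path3 R) R.
Hypothesis BP : brownian_law P.

Let grid_charfn (G : 'I_3 -> R -> R) n t :
  \int[P]_w cos (\sum_i stieltjes_sum (G i) (coordinate i w) n + t) =
  cos t * expR (- (\sum_i \sum_(k < ngrid n) G i (grid R n k.+1) ^+ 2 *
    (grid R n k.+1 - grid R n k)) / 2).
Proof.
pose J := ('I_(ngrid n) * 'I_3)%type.
pose X (j : J) (w : path3 R) := coordinate j.2 w (grid R n j.1.+1) - coordinate j.2 w (grid R n j.1).
pose s (j : J) := Num.sqrt (grid R n j.1.+1 - grid R n j.1).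
pose a (j : J) := G j.2 (grid R n j.1.+1).
pose phi (j : J) := expR (- (a j ^+ 2 * s j ^+ 2 / 2)).
have s0 j : 0 < s j by rewrite sqrtr_gt0 subr_gt0 lt_grid.
have s2 j : s j ^+ 2 = grid R n j.1.+1 - grid R n j.1.
  by rewrite sqr_sqrtr// ltW// subr_gt0 lt_grid.
have mX j : measurable_fun setT (X j) by exact: measurable_coordinate_increment.
have indep (B : J -> set R) : (forall j, measurable (B j)) ->
    P [set w | forall j, B j (X j w)] = (\prod_j normal_prob 0 (s j) (B j))%E.
  (* [brownian_law] indexes time intervals by all naturals; beyond the grid the constraint is
     trivial. *)
  move=> mB; pose B' (k : nat) i := if insub k is Some k' then B (k', i) else setT.
  have mB' k i : measurable (B' k i) by rewrite /B'; case: insub.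
  have B'E (k : 'I_(ngrid n)) i : B' k i = B (k, i) by rewrite /B' valK.
  have := BP (ngrid n) (@lt_grid R n) mB'.
  rewrite (_ : [set w : path3 R | _] = [set w | forall j, B j (X j w)]); last first.
    apply/seteqP; split => [w Bw [k i]|w Bw k i].
      by have := Bw k i; rewrite B'E !mxE.
    by rewrite B'E !mxE; exact: (Bw (k, i)).
  move=> ->; rewrite pair_bigA/=; apply: eq_bigr => -[k i] _ /=; by rewrite B'E.
have hcos j u : \int[normal_prob 0 (s j)]_x cos (a j * x + u) = cos u * phi j by rewrite normal_cos.
have phiE : \prod_j phi j = expR (- (\sum_i \sum_(k < ngrid n) G i (grid R n k.+1) ^+ 2 *
    (grid R n k.+1 - grid R n k)) / 2).
  rewrite /phi -expR_sum; congr expR.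
  rewrite exchange_big pair_bigA/= mulNr mulr_suml -sumrN; apply: eq_bigr => -[k i] _.
  by rewrite s2.
rewrite -phiE -(independent_cos mX indep hcos t).
apply: eq_Rintegral => w _; congr (cos (_ + _)).
by rewrite /stieltjes_sum exchange_big pair_bigA.
Qed.

Lemma brownian_charfn l (G : 'I_3 -> R -> R) t : (forall i, represents (l i) (G i)) ->
  \int[P]_w cos (functional l w + t) = cos t * expR (- (\sum_i ip (G i) (G i)) / 2).
Proof.
move=> lG.
have cvg3 (u : 'I_3 -> R^nat) (v : 'I_3 -> R) : (forall i, u i n @[n --> \oo] --> v i) ->
    \sum_i u i n @[n --> \oo] --> \sum_i v i.
  move=> uv; rewrite (_ : (fun n => _) = fun n => u ord0 n + (u (lift ord0 ord0) n + u
      (lift ord0 (lift ord0 ord0)) n)).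
    rewrite !big_ord_recl big_ord0 addr0.
    by apply: cvgD; [exact: uv|apply: cvgD; exact: uv].
  by apply/funext => n; rewrite !big_ord_recl big_ord0 addr0.
have c1 : \int[P]_w cos (\sum_i stieltjes_sum (G i) (coordinate i w) n + t) @[n --> \oo] -->
    \int[P]_w cos (functional l w + t).
  apply: (@Rbounded_cvg _ _ _ P _ _ 1).
  - move=> n; apply: (@measurableT_comp _ _ _ _ _ _ (@cos R)).
      by apply: continuous_measurable_fun; exact: continuous_cos.
    apply: measurable_funD => //; apply: measurable_sum => i.
    apply: measurable_sum => k; apply: measurable_funM => //.
    exact: measurable_coordinate_increment.
  - exact: measurable_cos_functional.
  - move=> w; apply: continuous_cvg; first exact: continuous_cos.
    apply: cvgD; last exact: cvg_cst.
    by apply: cvg3 => i; have [_ h] := lG i; apply: h; exact: cts_fun.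
  - by move=> n w; rewrite ler_norml cos_geN1 cos_le1.
apply: (cvg_unique _ c1) => //.
rewrite (_ : (fun n => _) = (fun n => cos t * expR (- (\sum_i \sum_(k < ngrid n)
  G i (grid R n k.+1) ^+ 2 * (grid R n k.+1 - grid R n k)) / 2))); last first.
  by apply/funext => n; rewrite grid_charfn.
apply: cvgMr; apply: continuous_cvg; first exact: continuous_expR.
apply: cvgMl; apply: cvgN; apply: cvg3 => i; apply: grid_sqr_cvg.
by have [] := lG i.
Qed.

End brownian_charfn.

(** * Characteristic functions of the tilted laws *)

Section tilted_charfn.
Context (R : realType).
Implicit Types (p : R * R * R) (y : seq (R * R * R)) (ys : 'I_3 -> seq (R * R * R)).

Definition tilt y (w : R -> R) : R :=
  \prod_(p <- y) expR (- (p.2 ^+ 2 * (w p.1.2 - w p.1.1) ^+ 2 / 2)).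

(** A separate list for each coordinate: the exponential of the squared Euclidean norm splits into
    three factors, which are added one at a time. *)
Definition tilt3 ys (w : path3 R) : R := \prod_i tilt (ys i) (coordinate i w).

(* The normalization is [E (tilt y)] for a one-dimensional Brownian motion. *)
Fixpoint tilt_norm y : R := if y is p :: y' then
    tilt_norm y' / Num.sqrt (1 + p.2 ^+ 2 * covar y' (mincr p) (mincr p))
  else 1.

Lemma tilt_gt0 y w : 0 < tilt y w.
Proof. by apply: prodr_gt0 => p _; rewrite expR_gt0. Qed.

Lemma tilt_le1 y w : tilt y w <= 1.
Proof.
apply: prodr_ile1 => p _; rewrite expR_ge0/= -expR0 ler_expR oppr_le0.
by rewrite divr_ge0// mulr_ge0 ?sqr_ge0.
Qed.

Lemma tilt3_gt0 ys w : 0 < tilt3 ys w.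
Proof. by apply: prodr_gt0 => i _; exact: tilt_gt0. Qed.

Lemma tilt3_le1 ys w : tilt3 ys w <= 1.
Proof. by apply: prodr_ile1 => i _; rewrite ltW ?tilt_gt0//= tilt_le1. Qed.

Lemma measurable_tilt y i : measurable_fun setT (fun w : path3 R => tilt y (coordinate i w)).
Proof.
apply: measurable_prod => p _; apply: measurableT_comp => //; apply: measurableT_comp => //.
apply: measurable_funM => //; apply: measurable_funM => //; apply: measurable_funX.
exact: measurable_coordinate_increment.
Qed.

Lemma measurable_tilt3 ys : measurable_fun setT (tilt3 ys).
Proof. by apply: measurable_prod => i _; exact: measurable_tilt. Qed.

Lemma tilt_norm_gt0 y : 0 < tilt_norm y.
Proof. by elim: y => //= p y IH; rewrite divr_gt0// sqrtr_gt0 tilt_den_gt0. Qed.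

Variable P : probability (path3 R) R.
Hypothesis BP : brownian_law P.

Let charfn_at ys := forall l (G : 'I_3 -> R -> R) t, (forall i, represents (l i) (G i)) ->
  \int[P]_w (tilt3 ys w * cos (functional l w + t)) =
  cos t * (\prod_i tilt_norm (ys i)) * expR (- (\sum_i covar (ys i) (G i) (G i)) / 2).

Let push ys i p j := if j == i then p :: ys j else ys j.

(* [exp (- u^2 X^2 / 2)] is the average of [cos (u z X)] over a standard normal [z]. *)
Let charfn_at_push ys i p : charfn_at ys -> charfn_at (push ys i p).
Proof.
move=> IH l G t lG.
set u := p.2; pose X (w : path3 R) := coordinate i w p.1.2 - coordinate i w p.1.1.
have mX : measurable_fun setT X by exact: measurable_coordinate_increment.
have tE w : tilt3 (push ys i p) w = tilt3 ys w * expR (- (u ^+ 2 * X w ^+ 2 / 2)).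
  rewrite /tilt3 (bigD1 i)//= [in RHS](bigD1 i)//= /push eqxx {1}/tilt big_cons.
  rewrite -/(tilt _ _) -!mulrA mulrC -!mulrA; congr (_ * (_ * _)).
  by apply: eq_bigr => j /negbTE ji; rewrite ji.
set c := covar (ys i) (G i) (mincr p); set v := covar (ys i) (mincr p) (mincr p).
set S := \sum_j covar (ys j) (G j) (G j); set N := \prod_j tilt_norm (ys j).
have v0 : 0 <= u ^+ 2 * v by rewrite mulr_ge0 ?sqr_ge0// covar_ge0//; exact: tame_mincr.
(* The increment [X] is absorbed into the functional of coordinate [i], which turns [G i] into
   [G i + k * mincr p]. *)
have IHk k : \int[P]_w (tilt3 ys w * cos (functional l w + k * X w + t)) =
    cos t * N * expR (- (S + 2 * k * c + k ^+ 2 * v) / 2).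
  pose l' j := if j == i then fun w : R -> R => l j w + k * (w p.1.2 - w p.1.1) else l j.
  pose G' j := if j == i then fun x => G j x + k * mincr p x else G j.
  have lG' j : represents (l' j) (G' j).
    rewrite /l' /G'; case: ifP => // _.
    by apply: representsD => //; apply: representsZ; exact: represents_incr.
  have := IH l' G' t lG'.
  have -> : \sum_j covar (ys j) (G' j) (G' j) = S + 2 * k * c + k ^+ 2 * v.
    rewrite /S (bigD1 i)//= [in RHS](bigD1 i)//= {1 2}/G' eqxx.
    rewrite covar_sqr; [|by have [] := lG i|exact: tame_mincr].
    rewrite (eq_bigr (fun j => covar (ys j) (G j) (G j))); last first.
      by move=> j /negbTE ji; rewrite /G' ji.
    by rewrite -/c -/v; ring.
  move=> <-; apply: eq_Rintegral => w _; congr (_ * cos (_ + _)).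
  rewrite /functional (bigD1 i)//= [in RHS](bigD1 i)//= /l' eqxx addrAC; congr (_ + _).
  by apply: eq_bigr => j /negbTE ji; rewrite ji.
have mL := measurable_cos_functional t lG.
have mt := measurable_tilt3 ys.
pose f (wz : path3 R * measurableTypeR R) : R :=
  tilt3 ys wz.1 * cos (functional l wz.1 + t) * cos (u * X wz.1 * wz.2 + 0).
have mf : measurable_fun setT f.
  apply: measurable_funM; first apply: measurable_funM.
  - exact: (measurableT_comp mt).
  - exact: (measurableT_comp mL).
  - apply: (@measurableT_comp _ _ _ _ _ _ (@cos R)).
      by apply: continuous_measurable_fun; exact: continuous_cos.
    apply: measurable_funD => //; apply: measurable_funM => //; apply: measurable_funM => //.
    exact: (measurableT_comp mX).
have cos1 (x : R) : `|cos x| <= 1 by rewrite ler_norml cos_geN1 cos_le1.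
have f1 wz : `|f wz| <= 1.
  have tt : `|tilt3 ys wz.1| <= 1 by rewrite ger0_norm ?tilt3_le1// ltW// tilt3_gt0.
  rewrite /f !normrM -[leRHS]mulr1 ler_pM// ?mulr_ge0//.
  by rewrite -[leRHS]mulr1 ler_pM.
have ifp : (P \x normal_prob 0 1)%E.-integrable setT (EFin \o f).
  apply/integrableP; split; first exact/measurable_EFinP.
  apply: (@le_lt_trans _ _ (\int[P \x normal_prob 0 1]_wz (cst 1%E wz))%E).
    apply: ge0_le_integral => //.
    - by apply: measurableT_comp => //; exact/measurable_EFinP.
    - by move=> wz _; rewrite /= lee_fin f1.
  rewrite integral_cst//= mul1e -setXTT.
  have PN : (P setT * normal_prob 0 1 setT < +oo)%E by rewrite !probability_setT mul1e ltry.
  apply: le_lt_trans PN; rewrite le_eqVlt; apply/orP; left; apply/eqP.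
  exact: product_measure1E.
have FU := @Fubini _ _ (path3 R) (measurableTypeR R) R P (normal_prob 0 1) (EFin \o f) ifp.
have Lw w : (\int[normal_prob 0 1]_z (f (w, z))%:E =
    (tilt3 (push ys i p) w * cos (functional l w + t))%:E)%E.
  rewrite (_ : (fun z => _) = (fun z => (tilt3 ys w * cos (functional l w + t))%:E *
    (cos (u * X w * z + 0))%:E)%E); last by apply/funext => z; rewrite -EFinM.
  have mc : measurable_fun setT (fun z : R => cos (u * X w * z + 0)) by exact: measurable_cos_affine.
  have ic : (normal_prob 0 1).-integrable setT (fun z => (cos (u * X w * z + 0))%:E).
    exact: (@bounded_integrable _ _ _ (normal_prob 0 1) _ 1).
  rewrite integralZl// EFin_Rintegral// normal_cos// cos0 mul1r expr1n mulr1 exprMn tE -EFinM.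
  by congr (_%:E); ring.
(* The product of cosines is the mean of the cosines of sum and difference, so [IHk] is used at
   [u * z] and at its opposite. Integration over [z] then gives the same value for both signs. *)
have Rz z : (\int[P]_w (f (w, z))%:E = (cos t * N * expR (- S / 2) / 2 *
    (expR (- (u ^+ 2 * v * z ^+ 2 + 2 * (u * c) * z) / 2) +
     expR (- (u ^+ 2 * v * z ^+ 2 + 2 * (- (u * c)) * z) / 2)))%:E)%E.
  have ik k : P.-integrable setT (EFin \o (fun w => tilt3 ys w * cos (functional l w + k * X w + t))).
    apply: (@bounded_integrable _ _ _ P _ 1).
      apply: measurable_funM => //; apply: (@measurableT_comp _ _ _ _ _ _ (@cos R)).
        by apply: continuous_measurable_fun; exact: continuous_cos.
      apply: measurable_funD => //; apply: measurable_funD; last exact: measurable_funM.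
      exact: measurable_functional lG.
    move=> w; rewrite normrM -[leRHS]mulr1 ler_pM//.
    by rewrite ger0_norm ?tilt3_le1// ltW// tilt3_gt0.
  rewrite (_ : (fun w => _) = (fun w => ((2^-1)%:E * ((tilt3 ys w * cos (functional l w +
      (u * z) * X w + t))%:E +
     (tilt3 ys w * cos (functional l w + (- (u * z)) * X w + t))%:E))%E)); last first.
    apply/funext => w; rewrite -EFinD -EFinM /f /= addr0; congr (_%:E).
    rewrite (_ : functional l w + u * z * X w + t = (functional l w + t) + u * X w * z); last by ring.
    rewrite (_ : functional l w + - (u * z) * X w + t = (functional l w + t) - u * X w * z); last by ring.
    move: (functional l w + t) (u * X w * z) => A B.
    by rewrite cosD cosB; field.
  rewrite integralZl//; last by have := integrableD measurableT (ik (u * z)) (ik (- (u *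
      z))); apply: eq_integrable.
  rewrite integralD//; [|exact: ik|exact: ik].
  rewrite !EFin_Rintegral; [|exact: ik|exact: ik].
  rewrite !IHk -EFinD -EFinM; congr (_%:E).
  have -> : expR (- (S + 2 * (u * z) * c + (u * z) ^+ 2 * v) / 2) =
      expR (- S / 2) * expR (- (u ^+ 2 * v * z ^+ 2 + 2 * (u * c) * z) / 2).
    by rewrite -expRD; congr expR; field.
  have -> : expR (- (S + 2 * (- (u * z)) * c + (- (u * z)) ^+ 2 * v) / 2) =
      expR (- S / 2) * expR (- (u ^+ 2 * v * z ^+ 2 + 2 * (- (u * c)) * z) / 2).
    by rewrite -expRD; congr expR; field.
  by field.
apply: EFin_inj; rewrite -EFin_Rintegral; last first.
  apply: (@bounded_integrable _ _ _ P _ 1).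
    by apply: measurable_funM => //; exact: measurable_tilt3.
  move=> w; rewrite normrM -[leRHS]mulr1 ler_pM//.
  by rewrite ger0_norm ?tilt3_le1// ltW// tilt3_gt0.
under eq_integral do rewrite -Lw.
apply: etrans FU _.
transitivity (\int[normal_prob 0 1]_z ((cos t * N * expR (- S / 2) / 2)%:E *
  ((expR (- (u ^+ 2 * v * z ^+ 2 + 2 * (u * c) * z) / 2))%:E +
   (expR (- (u ^+ 2 * v * z ^+ 2 + 2 * (- (u * c)) * z) / 2))%:E)))%E.
  by apply: eq_integral => z _; rewrite -EFinD -EFinM; exact: Rz.
have ie b : (normal_prob 0 1).-integrable setT (fun z => (expR (- (u ^+ 2 * v * z ^+ 2 + 2 * b * z) / 2))%:E).
  apply/integrableP; split.
    apply/measurable_EFinP; apply: measurableT_comp => //; apply: measurable_funM => //.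
    by apply: measurableT_comp => //; apply: measurable_funD; apply: measurable_funM.
  under eq_integral do rewrite gee0_abs ?lee_fin ?expR_ge0//.
  by rewrite normal_exp_quadratic// ltry.
rewrite integralZl//; last by apply: integrableD => //; exact: ie.
rewrite integralD//.
rewrite !normal_exp_quadratic// sqrrN -EFinD -EFinM; congr (_%:E).
have -> : \prod_j tilt_norm (push ys i p j) = N / Num.sqrt (1 + u ^+ 2 * v).
  rewrite /N (bigD1 i)//= [in RHS](bigD1 i)//= /push eqxx /= -/v -/u mulrAC; congr (_ * _ / _).
  by apply: eq_bigr => j /negbTE ji; rewrite ji.
have -> : \sum_j covar (push ys i p j) (G j) (G j) = S - (u * c) ^+ 2 / (1 + u ^+ 2 * v).
  rewrite /S (bigD1 i)//= [in RHS](bigD1 i)//= /push eqxx /= -/c -/v -/u addrAC; congr (_ + _ - _).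
    by apply: eq_bigr => j /negbTE ji; rewrite ji.
  by rewrite exprMn -[c ^+ 2]/(c * c) mulrA.
rewrite opprB mulrDl expRD.
by field; rewrite gt_eqF// sqrtr_gt0 ltr_pwDl.
Qed.

(** Induction on the total number of factors over the three coordinates, removing one from any
    nonempty list. *)
Lemma tilted_charfn ys : charfn_at ys.
Proof.
have [n] := ubnP (\sum_i size (ys i)); elim: n ys => // n IH ys sn.
have [ys0|/existsNP[i /eqP yi]] := pselect (forall i, ys i = [::]).
  have -> : ys = fun=> [::] by apply/funext.
  move=> l G t lG; rewrite big1 ?mulr1// -(brownian_charfn BP t lG).
  by apply: eq_Rintegral => w _; rewrite /tilt3 big1 ?mul1r// => i _; rewrite /tilt big_nil.
case yE : (ys i) yi => [//|p y] _.
pose ys' j := if j == i then y else ys j.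
have -> : ys = push ys' i p.
  by apply/funext => j; rewrite /push /ys'; case: eqP => // ->.
apply: charfn_at_push; apply: IH.
rewrite -ltnS; apply: leq_trans sn.
rewrite (bigD1 i)//= [in X in (_ < X)%N](bigD1 i)//= /ys' eqxx yE /= addSn !ltnS.
by rewrite leq_add2l leq_sum// => j /negbTE ->.
Qed.

End tilted_charfn.

Section weighted_law_bounded.
Context d d' (T : measurableType d) (T' : measurableType d') (R : realType).
Variables (m : {finite_measure set T -> \bar R}) (f : T -> R) (C : R) (Y : T -> T').
Hypotheses (mf : measurable_fun setT f) (fC : forall w, 0 <= f w <= C).
Hypothesis mY : measurable_fun setT Y.

(** Adding the constant [D] makes [g] nonnegative, and the formula for nonnegative functions applies
    to [g + D] and to [D]. *)
Lemma Rintegral_weighted_law (g : T' -> R) D : measurable_fun setT g -> (forall x, `|g x| <= D) ->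
  \int[@weighted_law _ _ _ _ _ m _ _ _ mf fC mY]_x g x = \int[m]_w (g (Y w) * f w).
Proof.
move=> mg gD; set n := weighted_law m mf fC mY.
have fabs w : `|f w| <= C by have /andP[f0 ?] := fC w; rewrite ger0_norm.
have mgf : measurable_fun setT (fun w => g (Y w) * f w).
  by apply: measurable_funM => //; exact: measurableT_comp.
have igf : m.-integrable setT (EFin \o (fun w => g (Y w) * f w)).
  by apply: (@bounded_integrable _ _ _ m _ (D * C)) => // w; rewrite normrM ler_pM.
have iDf : m.-integrable setT (EFin \o (fun w => D * f w)).
  apply: (@bounded_integrable _ _ _ m _ (`|D| * C)); first exact: measurable_funM.
  by move=> w; rewrite normrM ler_pM.
have ig : n.-integrable setT (EFin \o g) by exact: (@bounded_integrable _ _ _ [the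
    {finite_measure set _ -> \bar R} of n] _ D).
have iD : n.-integrable setT (EFin \o (fun=> D)).
  by apply: (@bounded_integrable _ _ _ [the {finite_measure set _ -> \bar R} of n] _ `|D|).
have shift (h : T' -> R) : measurable_fun setT h -> (forall x, 0 <= h x) ->
    \int[n]_x h x = \int[m]_w (h (Y w) * f w).
  move=> mh h0; rewrite /Rintegral ge0_integral_weighted_law//; exact/measurable_EFinP.
have D0 : 0 <= D by apply: le_trans (gD point).
have gD0 x : 0 <= g x + D by have := gD x; rewrite ler_norml => /andP[]; lra.
have := shift (fun x => g x + D); rewrite RintegralD// (shift (fun=> D))//.
move=> /(_ (measurable_funD mg (measurable_cst _)) gD0).
under [in X in _ = X -> _]eq_Rintegral do rewrite mulrDl.
by rewrite RintegralD// => /addIr.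
Qed.

End weighted_law_bounded.

Lemma covar0 (R : realType) (y : seq (R * R * R)) : covar y (fun=> 0) (fun=> 0) = 0.
Proof. by have := @covarZl R y 0 (fun=> 0) (fun=> 0) (@tame0 R) (@tame0 R); rewrite !mul0r. Qed.

(** * From the characteristic function to the Gaussian law and independent coordinates *)

Section gaussian_of_charfn.
Context (R : realType).
Variables (y : seq (R * R * R)) (Q : probability (path3 R) R).
Hypothesis charfnQ : forall l (G : 'I_3 -> R -> R) t, (forall i, represents (l i) (G i)) ->
  \int[Q]_w cos (functional l w + t) =
  cos t * expR (- (\sum_i covar y (G i) (G i)) / 2).

HB.instance Definition _ (i : 'I_3) := isMeasurableFun.Build _ _ _ _
  (coordinate i : path3 R -> path1 R) (@measurable_coordinate R i).

(** Coordinate 0 stands for all three: [charfnQ] is symmetric in the coordinates. *)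
Definition coordinate_law : probability (path1 R) R :=
  distribution Q [the {mfun path3 R >-> path1 R} of coordinate ord0].

Let single (i : 'I_3) (l : (R -> R) -> R) (j : 'I_3) := if j == i then l else fun=> 0.
Let singleG (i : 'I_3) (G : R -> R) (j : 'I_3) := if j == i then G else fun=> 0.

Let represents_single i l G : represents l G ->
  forall j, represents (single i l j) (singleG i G j).
Proof. by move=> lG j; rewrite /single /singleG; case: ifP => // _; exact: represents0. Qed.

Let functional_single i l w : functional (single i l) w = l (coordinate i w).
Proof.
rewrite /functional (bigD1 i)//= /single eqxx big1 ?addr0// => j /negbTE ji.
by rewrite ji.
Qed.

Let covar_single i G : \sum_j covar y (singleG i G j) (singleG i G j) = covar y G G.
Proof.
rewrite (bigD1 i)//= /singleG eqxx big1 ?addr0// => j /negbTE ->.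
exact: covar0.
Qed.

Let charfn1 i l G t : represents l G ->
  \int[Q]_w cos (l (coordinate i w) + t) = cos t * expR (- covar y G G / 2).
Proof.
move=> lG; rewrite -(covar_single i) -(charfnQ t (represents_single i lG)).
by apply: eq_Rintegral => w _; rewrite functional_single.
Qed.

Let one01 (w : path3 R) : 0 <= (1 : R) <= 1. Proof. by rewrite ler01 lexx. Qed.

Let cos1 (x : R) : `|cos x| <= 1. Proof. by rewrite ler_norml cos_geN1 cos_le1. Qed.

Lemma represented_law l G : represents l G -> forall B : set R, measurable B ->
  coordinate_law [set w : path1 R | B (l w)] = centered_normal (Num.sqrt (covar y G G)) B.
Proof.
move=> lG B mB; have [tG _] := lG.
set V := covar y G G; have V0 : 0 <= V by exact: covar_ge0.
have mL : measurable_fun setT (fun w : path3 R => l (coordinate ord0 w)).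
  exact: (measurableT_comp (measurable_represented lG) (measurable_coordinate ord0)).
have mLB : measurable ((fun w : path3 R => l (coordinate ord0 w)) @^-1` B).
  by rewrite -[X in measurable X]setTI; exact: mL.
have m1 : measurable_fun setT (fun _ : path3 R => 1 : R) by [].
pose n1 := @weighted_law _ _ (path3 R) (measurableTypeR R) R Q _ _ _ m1 one01 mL.
have n1E := @ge0_integral_weighted_law _ _ (path3 R) (measurableTypeR R) R Q _ _ _ m1 one01 mL.
have n1B : n1 B = coordinate_law [set w : path1 R | B (l w)].
  by rewrite /n1 /weighted_law /= /density_measure integral_cst ?mul1e//; exact: mLB.
have n1c k t : (\int[n1]_x (1 + cos (k * x + t))%:E = (1 + cos t * expR (- (k ^+ 2 * V) / 2))%:E)%E.
  rewrite n1E; last 2 first.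
    by apply/measurable_EFinP; apply: measurable_funD => //; exact: measurable_cos_affine.
    by move=> x; have := cos_geN1 (k * x + t); rewrite lee_fin; lra.
  have kG := represents_single ord0 (representsZ k lG).
  have mc : measurable_fun setT (fun w : path3 R => cos (k * l (coordinate ord0 w) + t)).
    apply: (@measurableT_comp _ _ _ _ _ _ (@cos R)).
      by apply: continuous_measurable_fun; exact: continuous_cos.
    by apply: measurable_funD => //; exact: measurable_funM.
  under eq_integral do rewrite mule1 EFinD.
  have ic : Q.-integrable setT (EFin \o (fun w : path3 R => cos (k * l (coordinate ord0 w) + t))).
    exact: (@bounded_integrable _ _ _ Q _ 1).
  have i1 : Q.-integrable setT (fun=> 1%E) by exact: finite_measure_integrable_cst.
  have e1 : (\int[Q]_w 1 = 1)%E by rewrite integral_cst// mul1e; exact: probability_setT.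
  rewrite integralD// e1 EFin_Rintegral//.
  rewrite -EFinD; congr ((1 + _)%:E).
  rewrite (charfn1 ord0 t (representsZ k lG)) covarZl//; last exact: tameZ.
  by rewrite covarC covarZl// mulrA.
(* A vanishing variance gives the Dirac mass at 0, as prescribed by [centered_normal]. *)
rewrite -n1B /centered_normal sqrtr_eq0; case: ifPn => [Vle|]; last rewrite -ltNge => Vgt.
  have {Vle} VE : V = 0 by apply/eqP; rewrite eq_le Vle V0.
  apply: (@finite_measure_charfn_unique R [the {finite_measure set _ -> \bar R} of n1]
    [the {finite_measure set _ -> \bar R} of @dirac _ (measurableTypeR R) (0 : R) R]) => // k t.
  rewrite n1c VE mulr0 oppr0 mul0r expR0 mulr1 integral_dirac ?diracT ?mul1e ?mulr0 ?add0r//.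
  by apply/measurable_EFinP; apply: measurable_funD => //; exact: measurable_cos_affine.
have s0 : 0 < Num.sqrt V by rewrite sqrtr_gt0.
apply: (@finite_measure_charfn_unique R [the {finite_measure set _ -> \bar R} of n1]
    [the {finite_measure set _ -> \bar R} of normal_prob 0 (Num.sqrt V)]) => // k t.
rewrite n1c; under eq_integral do rewrite EFinD.
have ic : (normal_prob 0 (Num.sqrt V)).-integrable setT (fun x => (cos (k * x + t))%:E).
  by apply: (@bounded_integrable _ _ _ (normal_prob 0 (Num.sqrt V)) _ 1) => //; exact: measurable_cos_affine.
have i1 : (normal_prob 0 (Num.sqrt V)).-integrable setT (fun=> 1%E) by exact: finite_measure_integrable_cst.
have e1 : (\int[normal_prob 0 (Num.sqrt V)]_w 1 = 1)%E.
  by rewrite integral_cst// mul1e; exact: probability_setT.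
rewrite integralD// e1 EFin_Rintegral// normal_cos// sqr_sqrtr//.
by rewrite -EFinD; congr ((1 + _ * expR _)%:E); rewrite mulNr.
Qed.

Lemma gaussian_law1_coordinate : gaussian_law1 y coordinate_law.
Proof.
move=> mu balmu; have [G lG] := represents_charge balmu.
have [tG _] := lG; split.
  by exists (Num.sqrt (covar y G G)) => B mB; exact: represented_law lG _ mB.
rewrite (Qform_covar y lG).
set l := charge_integral mu; set V := covar y G G; have V0 : 0 <= V by exact: covar_ge0.
have mL : measurable_fun setT (l : path1 R -> R) by exact: measurable_represented lG.
have one1 (w : path1 R) : 0 <= (1 : R) <= 1 by rewrite ler01 lexx.
have mLB B : measurable B -> measurable ((l : path1 R -> R) @^-1` B).
  by move=> mB; rewrite -[X in measurable X]setTI; exact: mL.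
have m1 : measurable_fun setT (fun _ : path1 R => 1 : R) by [].
pose n1 := @weighted_law _ _ (path1 R) (measurableTypeR R) R coordinate_law _ _ _ m1 one1 mL.
have n1E := @ge0_integral_weighted_law _ _ (path1 R) (measurableTypeR R) R coordinate_law _ _ _ m1 one1 mL.
have n1B B : measurable B -> n1 B = centered_normal (Num.sqrt V) B.
  move=> mB; rewrite -(represented_law lG mB).
  by rewrite /n1 /weighted_law /= /density_measure integral_cst ?mul1e//; exact: mLB.
have m2 : measurable_fun setT (fun x : R => (x ^+ 2)%:E) by apply/measurable_EFinP.
transitivity (\int[n1]_x (x ^+ 2)%:E)%E.
  rewrite n1E//; last by move=> x; rewrite lee_fin sqr_ge0.
  by apply: eq_integral => w _; rewrite mule1.
have [VE|Vn0] := eqVneq V 0.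
  have VB B : measurable B -> B `<=` setT -> n1 B = @dirac _ (measurableTypeR R) (0 : R) R B.
    by move=> mB _; rewrite n1B// /centered_normal VE sqrtr0 eqxx.
  rewrite (@eq_measure_integral _ _ _ _ [the {measure set _ -> \bar R} of @dirac _
      (measurableTypeR R) (0 : R) R] [the {measure set _ -> \bar R} of n1] _ VB).
  by rewrite integral_dirac// diracT mul1e expr0n VE.
have s0 : 0 < Num.sqrt V by rewrite sqrtr_gt0 lt_neqAle eq_sym Vn0.
have VB B : measurable B -> B `<=` setT -> n1 B = normal_prob 0 (Num.sqrt V) B.
  by move=> mB _; rewrite n1B// /centered_normal gt_eqF.
rewrite (@eq_measure_integral _ _ _ _ [the {measure set _ -> \bar R} of normal_prob 0
    (Num.sqrt V)] [the {measure set _ -> \bar R} of n1] _ VB).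
by rewrite normal_second_moment// sqr_sqrtr.
Qed.

(* [f] is a function of the first [k] coordinates. *)
Let free (k : nat) (f : path3 R -> R) (c : R) := forall l (G : 'I_3 -> R -> R) t,
  (forall i, represents (l i) (G i)) ->
  (forall i : 'I_3, (i < k)%N -> l i =1 (fun=> 0) /\ G i =1 (fun=> 0)) ->
  \int[Q]_w (f w * cos (functional l w + t)) = c * (cos t * expR (- (\sum_i covar y (G i) (G i)) / 2)).

(** Both sides are measures in [A]: the law of coordinate [k] under the density [f * (1 + cos)], and
    a multiple of [coordinate_law]. Their characteristic functions agree because [l] does not
    involve coordinate [k], so that the covariances add up. *)
Let free_weighted (k : 'I_3) (f : path3 R -> R) (c : R) (A : set (path1 R)) l (G : 'I_3 -> R -> R) t :
  measurable_fun setT f -> (forall w, 0 <= f w <= 1) ->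
  measurable A -> 0 <= c -> free k f c -> (forall i, represents (l i) (G i)) ->
  (forall i : 'I_3, (i < k.+1)%N -> l i =1 (fun=> 0) /\ G i =1 (fun=> 0)) ->
  \int[Q]_w (\1_A (coordinate k w) * (f w * (1 + cos (functional l w + t)))) =
  fine (coordinate_law A) * (c * (1 + cos t * expR (- (\sum_i covar y (G i) (G i)) / 2))).
Proof.
move=> mf f01 mA c0 fk lG l0.
set S := \sum_i _.
have S0 : 0 <= S by apply: sumr_ge0 => i _; apply: covar_ge0; have [] := lG i.
have f0 w : 0 <= f w by have /andP[] := f01 w.
have f1 w : f w <= 1 by have /andP[] := f01 w.
have mcos l' G' t' := @measurable_cos_functional R l' G' t'.
pose f' w := f w * (1 + cos (functional l w + t)).
have mf' : measurable_fun setT f'.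
  by apply: measurable_funM => //; apply: measurable_funD => //; exact: mcos lG.
have f'2 w : 0 <= f' w <= 2.
  have := cos_geN1 (functional l w + t); have := cos_le1 (functional l w + t) => h1 h2.
  have c1 : 0 <= 1 + cos (functional l w + t) by lra.
  rewrite /f' mulr_ge0//=.
  by rewrite -[leRHS]mul1r ler_pM//; lra.
pose c' := c * (1 + cos t * expR (- S / 2)).
have c'0 : 0 <= c'.
  rewrite mulr_ge0//.
  have e1 : expR (- S / 2) <= 1 by rewrite -[leRHS]expR0 ler_expR; lra.
  have := cos_geN1 t; have := expR_ge0 (- S / 2); nra.
have c'c (w : path3 R) : 0 <= c' <= c' by rewrite c'0 lexx.
have mc' : measurable_fun setT (fun _ : path3 R => c') by [].
have mA0 : measurable (coordinate ord0 @^-1` A : set (path3 R)).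
  by rewrite -[X in measurable X]setTI; exact: measurable_coordinate.
have mk := @measurable_coordinate R k; have m0 := @measurable_coordinate R ord0.
pose n1 := @weighted_law _ _ _ (path1 R) R Q _ _ _ mf' f'2 mk.
pose n2 := @weighted_law _ _ _ (path1 R) R Q _ _ _ mc' c'c m0.
have n1E := @Rintegral_weighted_law _ _ _ (path1 R) R Q _ _ _ mf' f'2 mk.
have n2E := @Rintegral_weighted_law _ _ _ (path1 R) R Q _ _ _ mc' c'c m0.
pose X (p : R * R) (w : path1 R) := w p.2 - w p.1.
have mX p : measurable_fun setT (X p) by exact: measurable_path_increment.
have n12 : n1 A = n2 A.
  apply: (@charfn_measure_unique _ (path1 R) R _ X mX [the {finite_measure set _ -> \bar R} of n1]
    [the {finite_measure set _ -> \bar R} of n2]) => [s u|]; last first.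
    apply: (sub_smallest2r _ _ mA); first exact: smallest_sigma_algebra.
    move=> _ [a [b [B [_ _ ab mB ->]]]].
    by exists (a, b), B.
  pose ls (w : R -> R) := \sum_(p <- s) p.1 * (w p.2.2 - w p.2.1).
  pose Gs x := \sum_(p <- s) p.1 * incr p.2.1 p.2.2 x.
  have lGs : represents ls Gs.
    apply: (@represents_sum R _ s (fun p w => p.1 * (w p.2.2 - w p.2.1))) => p.
    by apply: representsZ; exact: represents_incr.
  have mls : measurable_fun setT (fun w : path1 R => cos (ls w + u)).
    apply: (@measurableT_comp _ _ _ _ _ _ (@cos R)).
      by apply: continuous_measurable_fun; exact: continuous_cos.
    by apply: measurable_funD => //; exact: measurable_represented lGs.
  set V := covar y Gs Gs.
  have mix e v : e ^+ 2 = 1 ->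
      \int[Q]_w (f w * cos (e * functional l w + ls (coordinate k w) + v)) =
      c * (cos v * expR (- (S + V) / 2)) /\
      Q.-integrable setT (EFin \o (fun w => f w * cos (e * functional l w + ls (coordinate k w) + v))).
    move=> e2.
    pose l' j := fun w => e * l j w + single k ls j w.
    pose G' j := fun x => e * G j x + singleG k Gs j x.
    have lG' j : represents (l' j) (G' j).
      by apply: representsD; [exact: representsZ|exact: represents_single].
    have l'E w : e * functional l w + ls (coordinate k w) = functional l' w.
      by rewrite -[in LHS](functional_single k ls) /functional mulr_sumr -big_split.
    split; last first.
      apply: (@bounded_integrable _ _ _ Q _ 1).
        apply: measurable_funM => //; under eq_fun do rewrite l'E; exact: mcos lG'.
      by move=> w; rewrite normrM -[leRHS]mulr1 ler_pM// ger0_norm.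
    under eq_Rintegral do rewrite l'E.
    rewrite (fk l' G' v lG'); last first.
      move=> i ik; have [li Gi] := l0 i (ltnW ik).
      have ni : (i == k) = false by apply/negbTE; apply: contraTneq ik => ->; rewrite ltnn.
      by split=> x; rewrite /l' /G' /single /singleG ni ?li ?Gi mulr0 addr0.
    congr (_ * (_ * expR (- _ / 2))).
    have [_ Gk] := l0 k (ltnSn k).
    rewrite /S (bigD1 k)//= [in RHS](bigD1 k)//=.
    have -> : G' k = Gs by apply/funext => x; rewrite /G' /singleG eqxx Gk mulr0 add0r.
    have -> : covar y (G k) (G k) = 0 by rewrite (_ : G k = (fun=> 0)) ?covar0//; exact/funext.
    rewrite add0r addrC; congr (_ + _); apply: eq_bigr => j /negbTE jk.
    have -> : G' j = (fun x => e * G j x) by apply/funext => x; rewrite /G' /singleG jk addr0.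
    have [tj _] := lG j.
    by rewrite covarZl//; [rewrite covarC covarZl// mulrA -expr2 e2 mul1r|exact: tameZ].
  have base : \int[Q]_w (f w * cos (ls (coordinate k w) + u)) = c * (cos u * expR (- V / 2)).
    rewrite /V -(covar_single k Gs) -(fk _ _ u (represents_single k lGs)).
      by apply: eq_Rintegral => w _; rewrite functional_single.
    move=> i ik; have ni : (i == k) = false by apply/negbTE; apply: contraTneq ik => ->; rewrite ltnn.
    by split=> x; rewrite /single /singleG ni.
  have ibase : Q.-integrable setT (EFin \o (fun w => f w * cos (ls (coordinate k w) + u))).
    apply: (@bounded_integrable _ _ _ Q _ 1).
      by apply: measurable_funM => //; exact: (measurableT_comp mls mk).
    by move=> w; rewrite normrM -[leRHS]mulr1 ler_pM// ger0_norm.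
  have [e1 i1] := mix 1 (u + t) (expr1n _ _).
  have [e2 i2] := mix (-1) (u - t) (etrans (sqrrN 1) (expr1n _ 2)).
  have lsE w : lincomb X s w = ls w by [].
  apply: etrans (n1E (fun w => cos (ls w + u)) 1 mls (fun w => cos1 _)) _.
  apply: etrans _ (esym (n2E (fun w => cos (ls w + u)) 1 mls (fun w => cos1 _))).
  transitivity (\int[Q]_w (f w * cos (ls (coordinate k w) + u) +
      2^-1 * (f w * cos (1 * functional l w + ls (coordinate k w) + (u + t)) +
       f w * cos (-1 * functional l w + ls (coordinate k w) + (u - t))))).
    apply: eq_Rintegral => w _; rewrite /f' mul1r mulN1r.
    set a := ls _; set b := functional l w.
    rewrite (_ : b + a + (u + t) = (a + u) + (b + t)); last by ring.
    rewrite (_ : - b + a + (u - t) = (a + u) - (b + t)); last by ring.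
    by move: (a + u) (b + t) => p q; rewrite cosD cosB; field.
  have i12 := integrableD measurableT i1 i2.
  have iZ := integrableZl measurableT 2^-1 i12.
  rewrite RintegralD//.
  rewrite RintegralZl//.
  rewrite RintegralD// e1 e2 base.
  have -> : \int[Q]_w (cos (ls (coordinate ord0 w) + u) * c') = c' * \int[Q]_w cos (ls
      (coordinate ord0 w) + u).
    rewrite -RintegralZl//; last by apply: (@bounded_integrable _ _ _ Q _ 1) => //; exact:
        (measurableT_comp mls m0).
    by apply: eq_Rintegral => w _; rewrite mulrC.
  rewrite (charfn1 ord0 u lGs) -/V /c'.
  rewrite (_ : - (S + V) / 2 = - S / 2 + - V / 2); last by ring.
  by rewrite expRD cosD cosB; field.
have iE (n : {finite_measure set (path1 R) -> \bar R}) : n A = (\int[n]_w \1_A w)%:E.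
  rewrite -EFin_Rintegral; last first.
    apply: (@bounded_integrable _ _ _ n _ 1); first exact: measurable_indic.
    by move=> w; rewrite indicE; case: (_ \in _); rewrite ?normr1 ?normr0.
  by rewrite integral_indic ?setIT.
have m1A : measurable_fun setT (\1_A : path1 R -> R) by exact: measurable_indic.
have A1 (w : path1 R) : `|\1_A w : R| <= 1.
  by rewrite indicE; case: (_ \in _); rewrite ?normr1 ?normr0.
have e12 : \int[n1]_w \1_A w = \int[n2]_w \1_A w.
  apply: EFin_inj; apply: etrans (esym (iE [the {finite_measure set _ -> \bar R} of n1])) _.
  exact: etrans n12 (iE [the {finite_measure set _ -> \bar R} of n2]).
apply: etrans (esym (n1E _ 1 m1A A1)) _; rewrite e12.
apply: etrans (n2E _ 1 m1A A1) _; rewrite -/c'.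
have iA : Q.-integrable setT (EFin \o (fun w => \1_A (coordinate ord0 w))).
  by apply: (@bounded_integrable _ _ _ Q _ 1) => //; exact: (measurableT_comp m1A m0).
rewrite RintegralZr//; congr (_ * _).
rewrite /Rintegral; congr fine.
rewrite (_ : (fun w => _) = EFin \o \1_(coordinate ord0 @^-1` A))//.
by rewrite integral_indic ?setIT.
Qed.

(** The cosine is recovered from 1 + cos by subtracting half of the instance with zero
    functional. *)
Let free_step (k : 'I_3) (f : path3 R -> R) (c : R) (A : set (path1 R)) :
  measurable_fun setT f -> (forall w, 0 <= f w <= 1) ->
  measurable A -> 0 <= c -> free k f c ->
  free k.+1 (fun w => f w * \1_A (coordinate k w)) (c * fine (coordinate_law A)).
Proof.
move=> mf f01 mA c0 fk l G t lG l0.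
have r0 (i : 'I_3) : represents (fun=> 0) (fun=> 0 : R) := represents0 R.
have e1 := free_weighted t mf f01 mA c0 fk lG l0.
have e0 := free_weighted 0 mf f01 mA c0 fk r0 (fun i _ => conj (fun=> erefl) (fun=> erefl)).
have f0 w : 0 <= f w by have /andP[] := f01 w.
have f1 w : f w <= 1 by have /andP[] := f01 w.
have mA1 : measurable_fun setT (fun w : path3 R => \1_A (coordinate k w) : R).
  by apply: (measurableT_comp _ (@measurable_coordinate R k)); exact: measurable_indic.
have A1 (w : path1 R) : `|\1_A w : R| <= 1.
  by rewrite indicE; case: (_ \in _); rewrite ?normr1 ?normr0.
have i l' (G' : 'I_3 -> R -> R) u : (forall i, represents (l' i) (G' i)) ->
    Q.-integrable setT (EFin \o (fun w => \1_A (coordinate k w) * (f w * (1 + cos (functional l' w + u))))).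
  move=> lG'; apply: (@bounded_integrable _ _ _ Q _ (1 * (1 * 2))).
    apply: measurable_funM => //; apply: measurable_funM => //; apply: measurable_funD => //.
    exact: measurable_cos_functional lG'.
  move=> w; rewrite !normrM ler_pM ?mulr_ge0// ler_pM//; first by rewrite ger0_norm.
  by apply: le_trans (ler_normD _ _) _; rewrite normr1 lerD2l.
transitivity (\int[Q]_w (\1_A (coordinate k w) * (f w * (1 + cos (functional l w + t))) -
   2^-1 * (\1_A (coordinate k w) * (f w * (1 + cos (functional (fun=> fun=> 0) w + 0)))))).
  apply: eq_Rintegral => w _.
  have -> : functional (fun=> fun=> 0) w = 0 by rewrite /functional big1.
  rewrite addr0 cos0.
  by field.
have iZ : Q.-integrable setT (EFin \o (fun w => 2^-1 *
    (\1_A (coordinate k w) * (f w * (1 + cos (functional (fun=> fun=> 0) w + 0)))))).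
  by have := integrableZl measurableT 2^-1 (i _ _ 0 r0); exact: eq_integrable.
rewrite RintegralB//; last exact: i lG.
rewrite RintegralZl//; last exact: i r0.
have s0 : \sum_(i < 3) covar y (fun=> 0) (fun=> 0) = 0 by rewrite big1// => j _; exact: covar0.
rewrite e1 e0 s0 oppr0 mul0r expR0 cos0 mulr1.
by field.
Qed.

Lemma three_copies_coordinate : three_copies coordinate_law Q.
Proof.
move=> A mA.
have mi i : measurable_fun setT (fun w : path3 R => \1_(A i) (coordinate i w) : R).
  by apply: (measurableT_comp _ (@measurable_coordinate R i)); exact: measurable_indic.
have A01 i (w : path3 R) : 0 <= (\1_(A i) (coordinate i w) : R) <= 1.
  by rewrite indicE; case: (_ \in _); rewrite ?ler01 ?lexx.
have M01 (a b : R) : 0 <= a <= 1 -> 0 <= b <= 1 -> 0 <= a * b <= 1.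
  by move=> /andP[a0 a1] /andP[b0 b1]; rewrite mulr_ge0// mulr_ile1.
have c0 i : 0 <= fine (coordinate_law (A i)) by rewrite fine_ge0.
pose f0 (w : path3 R) : R := 1.
have fr0 : free 0 f0 1.
  move=> l G t lG _; rewrite mul1r -(charfnQ t lG).
  by apply: eq_Rintegral => w _; rewrite mul1r.
have mf0 : measurable_fun setT f0 by exact: measurable_cst.
have f01 w : 0 <= f0 w <= 1 by rewrite ler01 lexx.
(* [free_step] is applied to the coordinates 0, 1 and 2 in turn, the constraint of each joining the
   weight for the next. *)
have k0 : nat_of_ord (inord 0 : 'I_3) = 0%N by rewrite inordK.
have k1 : nat_of_ord (inord 1 : 'I_3) = 1%N by rewrite inordK.
have k2 : nat_of_ord (inord 2 : 'I_3) = 2%N by rewrite inordK.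
have fr1 := @free_step (inord 0) f0 1 (A (inord 0)) mf0 f01 (mA _) ler01.
rewrite k0 in fr1; move: fr1 => /(_ fr0) fr1.
have mf1 := measurable_funM mf0 (mi (inord 0)).
have f11 w := M01 _ _ (f01 w) (A01 (inord 0) w).
have c1 := mulr_ge0 ler01 (c0 (inord 0)).
have fr2 := @free_step (inord 1) _ _ (A (inord 1)) mf1 f11 (mA _) c1.
rewrite k1 in fr2; move: fr2 => /(_ fr1) fr2.
have mf2 := measurable_funM mf1 (mi (inord 1)).
have f21 w := M01 _ _ (f11 w) (A01 (inord 1) w).
have c2 := mulr_ge0 c1 (c0 (inord 1)).
have fr3 := @free_step (inord 2) _ _ (A (inord 2)) mf2 f21 (mA _) c2.
rewrite k2 in fr3; move: fr3 => /(_ fr2) fr3.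
have r0 (i : 'I_3) : represents (fun=> 0) (fun=> 0 : R) := represents0 R.
have := fr3 _ _ 0 r0 (fun i _ => conj (fun=> erefl) (fun=> erefl)).
rewrite [\sum_i _]big1; last by move=> i _; exact: covar0.
rewrite oppr0 mul0r expR0 cos0 !mulr1 mul1r => e.
have sum0 w : functional (fun=> fun=> 0) w + 0 = 0 :> R by rewrite addr0 /functional big1.
have i0 : inord 0 = ord0 :> 'I_3 by apply: val_inj; exact: k0.
have i1 : inord 1 = lift ord0 ord0 :> 'I_3 by apply: val_inj; exact: k1.
have i2 : inord 2 = lift ord0 (lift ord0 ord0) :> 'I_3 by apply: val_inj; exact: k2.
transitivity (\int[Q]_w (\1_[set w : path3 R | forall i, A i (coordinate i w)] w : R))%:E.
  have mE : measurable [set w : path3 R | forall i, A i (coordinate i w)].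
    rewrite (_ : [set w | _] = \bigcap_(i in setT) (coordinate i @^-1` A i)).
      apply: fin_bigcap_measurable => // i _.
      by rewrite -[X in measurable X]setTI; exact: measurable_coordinate.
    by apply/seteqP; split => [w Aw i _|w Aw i]; [exact: Aw|exact: (Aw i I)].
  rewrite -EFin_Rintegral; first by rewrite integral_indic ?setIT.
  apply: (@bounded_integrable _ _ _ Q _ 1); first exact: measurable_indic.
  by move=> w; rewrite indicE; case: (_ \in _); rewrite ?normr1 ?normr0.
rewrite !big_ord_recl big_ord0 mule1 -i2 -i1 -i0.
rewrite -[coordinate_law (A (inord 0))]fineK ?fin_num_measure//.
rewrite -[coordinate_law (A (inord 1))]fineK ?fin_num_measure//.
rewrite -[coordinate_law (A (inord 2))]fineK ?fin_num_measure//.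
rewrite -!EFinM mulrA -e; congr (_%:E); apply: eq_Rintegral => w _.
rewrite sum0 cos0 mulr1 /= /f0 mul1r !indicE -!natrM !mulnb; congr ((nat_of_bool _)%:R).
apply/idP/andP => [/set_mem Aw|[/andP[/set_mem A0 /set_mem A1] /set_mem A2]].
  by split; [apply/andP; split|]; apply/mem_set; exact: Aw.
apply/mem_set => i; have := ltn_ord i; case: i => -[|[|[|//]]] h _.
- by rewrite (_ : Ordinal h = inord 0)//; apply: val_inj; rewrite /= k0.
- by rewrite (_ : Ordinal h = inord 1)//; apply: val_inj; rewrite /= k1.
- by rewrite (_ : Ordinal h = inord 2)//; apply: val_inj; rewrite /= k2.
Qed.

Lemma gaussian_law3_charfn : gaussian_law3 y Q.
Proof.
exists coordinate_law; first exact: gaussian_law1_coordinate.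
exact: three_copies_coordinate.
Qed.

End gaussian_of_charfn.

(** * The normalized tilted laws *)

Section tilted_law.
Context (R : realType).
Variable P : probability (path3 R) R.
Hypothesis BP : brownian_law P.
Implicit Types y : seq (R * R * R).

Lemma tilt3_phi y w : tilt3 (fun=> y) w =
  expR (- 2^-1 * \sum_(p <- y) p.2 ^+ 2 * enorm (w p.1.2 - w p.1.1) ^+ 2).
Proof.
rewrite /tilt3 /tilt exchange_big/= mulr_sumr expR_sum; apply: eq_bigr => p _.
rewrite -expR_sum; congr expR; rewrite /enorm sqr_sqrtr; last first.
  by apply: sumr_ge0 => i _; exact: sqr_ge0.
rewrite !mulr_sumr; apply: eq_bigr => i _; rewrite !mxE.
have -> : coordinate i w p.1.2 - coordinate i w p.1.1 = w p.1.2 0 i - w p.1.1 0 i by [].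
by field.
Qed.

(** The characteristic function at the zero functional; each coordinate contributes one factor
    [tilt_norm y]. *)
Lemma Phi_tilt_norm y : Phi P y = (tilt_norm y ^+ 3)%:E.
Proof.
transitivity (\int[P]_w (tilt3 (fun=> y) w)%:E)%E.
  by apply: eq_integral => w _; rewrite tilt3_phi.
rewrite EFin_Rintegral; last first.
  apply: (@bounded_integrable _ _ _ P _ 1); first exact: measurable_tilt3.
  by move=> w; rewrite ger0_norm ?tilt3_le1// ltW// tilt3_gt0.
have := tilted_charfn BP (fun=> y) 0 (fun=> represents0 R).
rewrite cos0 mul1r big_const_ord iter_mulr_1 big1 ?oppr0 ?mul0r ?expR0 ?mulr1; last by
    move=> i _; exact: covar0.
move=> <-; congr (_%:E); apply: eq_Rintegral => w _.
by rewrite /functional big1// addr0 cos0 mulr1.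
Qed.

Definition tilt_density y (w : path3 R) : R := tilt3 (fun=> y) w / tilt_norm y ^+ 3.

Lemma measurable_tilt_density y : measurable_fun setT (tilt_density y).
Proof. by apply: measurable_funM => //; exact: measurable_tilt3. Qed.

Lemma tilt_density_bounds y w : 0 <= tilt_density y w <= (tilt_norm y ^+ 3)^-1.
Proof.
have N0 : 0 < tilt_norm y ^+ 3 by rewrite exprn_gt0// tilt_norm_gt0.
rewrite divr_ge0 ?(ltW N0) ?(ltW (tilt3_gt0 _ _))//= /tilt_density.
by rewrite ler_pdivrMr// mulVf ?gt_eqF// tilt3_le1.
Qed.

(** A weighted law along the identity map. The Brownian hypothesis is an argument because total mass
    one rests on it. *)
Definition tilted_law y of brownian_law P := @weighted_law _ _ _ _ _ P _ _ _
  (@measurable_tilt_density y) (@tilt_density_bounds y) (@measurable_id _ _ setT).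

Local Notation Q y := (tilted_law y BP).

HB.instance Definition _ y := Measure.on (Q y).

Let tilted_lawT y : Q y setT = 1%E.
Proof.
rewrite /tilted_law /weighted_law /= /density_measure preimage_setT.
under eq_integral do rewrite /= /tilt_density EFinM.
have m0 : measurable_fun setT (fun w => (tilt3 (fun=> y) w)%:E).
  by apply/measurable_EFinP; exact: measurable_tilt3.
have t0 w : setT w -> (0 <= (tilt3 (fun=> y) w)%:E)%E by rewrite lee_fin ltW// tilt3_gt0.
have N0 : (0 <= (tilt_norm y ^- 3)%:E)%E.
  by rewrite lee_fin invr_ge0 exprn_ge0// ltW// tilt_norm_gt0.
rewrite (ge0_integralZr P measurableT m0 t0 N0).
have -> : (\int[P]_w (tilt3 (fun=> y) w)%:E = Phi P y)%E.
  by apply: eq_integral => w _; rewrite tilt3_phi.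
by rewrite Phi_tilt_norm -EFinM mulfV// gt_eqF// exprn_gt0// tilt_norm_gt0.
Qed.

HB.instance Definition _ y := Measure_isProbability.Build _ _ _ (Q y) (tilted_lawT y).

Lemma tilted_lawE y A : Q y A = (\int[P]_(w in A) (tilt_density y w)%:E)%E.
Proof. by []. Qed.

Lemma gaussian_law3_tilted y : gaussian_law3 y (Q y).
Proof.
apply: gaussian_law3_charfn => l G t lG.
have mc := measurable_cos_functional t lG.
have c1 (w : path3 R) : `|cos (functional l w + t)| <= 1 by rewrite ler_norml cos_geN1 cos_le1.
apply: etrans (@Rintegral_weighted_law _ _ (path3 R) (path3 R) R P _ _ _
  (@measurable_tilt_density y) (@tilt_density_bounds y) (@measurable_id _ _ setT) _ 1 mc c1) _.
have := tilted_charfn BP (fun=> y) t lG.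
rewrite big_const_ord iter_mulr_1.
set N := tilt_norm y ^+ 3 => e.
have N0 : N != 0 by rewrite gt_eqF// exprn_gt0// tilt_norm_gt0.
rewrite (_ : cos t * _ = N^-1 * (cos t * N * expR (- (\sum_i covar y (G i) (G i)) / 2))); last by field.
rewrite -e -RintegralZl//; last first.
  apply: (@bounded_integrable _ _ _ P _ 1).
    by apply: measurable_funM => //; exact: measurable_tilt3.
  by move=> w; rewrite normrM -[leRHS]mulr1 ler_pM// ger0_norm ?tilt3_le1// ltW// tilt3_gt0.
by apply: eq_Rintegral => w _; rewrite /tilt_density -/N; ring.
Qed.

End tilted_law.

(** * Finiteness of the partition function *)

Section covar_gap.
Context (R : realType).
Implicit Types (y : seq (R * R * R)).

(** The signed length of the overlap of two intervals; the formula with maxima holds for every order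
    of the endpoints and is visibly measurable in them. *)
Lemma ip_incr (a b c d : R) : ip (incr a b) (incr c d) =
  Num.max a d + Num.max b c - Num.max a c - Num.max b d.
Proof.
have incrN (s t : R) : incr s t = (fun x => -1 * incr t s x).
  by apply/funext => x; rewrite /incr mulN1r opprB.
have tincr (s t : R) : tame (incr s t) by have [] := represents_incr s t.
wlog ab : a b / a <= b => [hw|].
  have [/hw //|/ltW ba] := leP a b.
  by rewrite (incrN a b) ipZl// (hw _ _ ba); ring.
wlog cd : c d / c <= d => [hw|].
  have [/hw //|/ltW dc] := leP c d.
  by rewrite ipC (incrN c d) ipZl// ipC (hw _ _ dc); ring.
have incrE (s t x : R) : s <= t -> incr s t x = \1_(`[s, t[%classic) x.
  move=> st; rewrite /incr indicE mem_setE in_itv/=.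
  have [sx|xs] := leP s x; have [tx|xt] := leP t x; rewrite ?subrr ?subr0//=.
  by have := le_lt_trans (le_trans st tx) xs; rewrite ltxx.
rewrite /ip.
under eq_Rintegral => x _ do rewrite !incrE// -[_ * _]/((\1_(`[a, b[%classic) \* \1_(`[c,
    d[%classic) : R -> R) x) -indicI.
have -> : `[a, b[%classic `&` `[c, d[%classic = `[Num.max a c, Num.min b d[%classic.
  apply/seteqP; split => x /=; rewrite !in_itv/= ge_max lt_min.
    by move=> [/andP[-> ->] /andP[-> ->]].
  by move=> /andP[/andP[-> ->] /andP[-> ->]].
rewrite /Rintegral integral_indic ?setIT//=.
rewrite [lebesgue_measure _]lebesgue_measure_itv /= lte_fin.
have [h|h] := ltP; rewrite -?EFinB /=; move: h;
  case: (leP a c) => ?; case: (leP b d) => ?; case: (leP a d) => ?; case: (leP b c) => ? h; lra.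
Qed.

Lemma covar_gap y (s t d : R) : 0 < d -> s <= t - d ->
  (forall p, p \in y -> d <= `|t - p.1.1| /\ d <= `|t - p.1.2|) ->
  d / 2 <= covar y (incr s t) (incr s t).
Proof.
move=> d0 st yd.
have tincr (a b : R) : tame (incr a b) by have [] := represents_incr a b.
(* The derivative of the tent around [t] with slope c has increment c d over [[s, t]] and energy 2
   c^2 d; the bound 2 c d - 2 c^2 d is largest at c = 1 / 2, where it is d / 2. *)
pose h x := 2^-1 * incr (t - d) t x + - 2^-1 * incr t (t + d) x.
have t1 := tameZ 2^-1 (tincr (t - d) t); have t2 := tameZ (- 2^-1) (tincr t (t + d)).
have th : tame h by exact: tameD.
have hE (a b : R) : ip (incr a b) h =
    2^-1 * ip (incr a b) (incr (t - d) t) - 2^-1 * ip (incr a b) (incr t (t + d)).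
  by rewrite ipC /h ipDl// !ipZl// ![ip _ (incr a b)]ipC mulNr.
apply: le_trans (le_covar y (tincr s t) (square_integrable_tame th)).
have h0 p : p \in y -> ip (mincr p) h = 0.
  (* The tent vanishes at points at distance at least [d] from its centre. *)
  have far e : d <= `|t - e| -> 2 * Num.max e t = Num.max e (t - d) + Num.max e (t + d).
    by rewrite ler_normr => /orP[] ?; rewrite /Order.max; do ![case: ltP => ?]; lra.
  by move=> /yd[/far a /far b]; rewrite /mincr hE !ip_incr; lra.
have e1 : Num.max (t - d) t = t by rewrite max_r//; lra.
have e2 : Num.max t (t - d) = t by rewrite max_l//; lra.
have e3 : Num.max t (t + d) = t + d by rewrite max_r//; lra.
have e4 : Num.max (t + d) t = t + d by rewrite max_l//; lra.
have st_h : ip (incr s t) h = d / 2.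
  rewrite hE !ip_incr (max_r (_ : s <= t - d))// (max_r (_ : s <= t)); last lra.
  by rewrite (max_r (_ : s <= t + d)) ?maxxx ?e1 ?e2 ?e3 ?e4; lra.
have hh : ip h h = d / 2.
  rewrite {1}/h ipDl// !ipZl// !hE !ip_incr !maxxx e1 e2 e3 e4 (max_l (_ : t - d <= t + d))
      ?(max_r (_ : t - d <= t + d)); lra.
rewrite /energy big_seq big1 ?addr0; last by move=> p /h0 ->; rewrite expr0n mulr0.
have -> : \int[lebesgue_measure]_x (h x ^+ 2) = ip h h.
  by apply: eq_Rintegral => x _; rewrite expr2.
rewrite hh st_h; lra.
Qed.

End covar_gap.

(** * A dyadic majorant for the inverse root of the distance to a finite set *)

Section singular.
Context (R : realType).
Local Notation mu := (@lebesgue_measure R).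

(* Dyadic substitute for [A + \sum_(f <- F) `|t - f| ^ (- 1 / 2)], whose
   integral is a geometric series. *)
Definition singular (F : seq R) (A t : R) : \bar R :=
  (A%:E + \sum_(f <- F) \sum_(k <oo)
    (A * 2 ^+ k.+1 * (`|t - f| <= (A * 2 ^+ k) ^- 2)%R%:R)%:E)%E.

Let term_ge0 A (t f : R) (k : nat) : 0 < A ->
  (0 <= (A * 2 ^+ k.+1 * (`|t - f| <= (A * 2 ^+ k) ^- 2)%R%:R)%:E)%E.
Proof. by move=> A0; rewrite lee_fin mulr_ge0// mulr_ge0 ?exprn_ge0// ltW. Qed.

Lemma singular_ge (F : seq R) (A t : R) : 0 < A -> (A%:E <= singular F A t)%E.
Proof.
move=> A0; rewrite leeDl//; apply: sume_ge0 => g _.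
by apply: nneseries_ge0 => k _ _; exact: term_ge0.
Qed.

(** Take the first scale with (A 2^k)^-2 below the distance. The term of the preceding scale, or the
    constant [A] when k = 0, is present in the sum and shows A 2^k <= D. *)
Lemma singular_dist (F : seq R) (A t D : R) f : 0 < A ->
  (singular F A t <= D%:E)%E -> f \in F -> D ^- 2 <= `|t - f|.
Proof.
move=> A0 sD fF.
have AD : A <= D.
  by rewrite -lee_fin; apply: le_trans sD; exact: singular_ge.
have D0 : 0 < D by exact: lt_le_trans AD.
have kD k : `|t - f| <= (A * 2 ^+ k) ^- 2 -> A * 2 ^+ k.+1 <= D.
  move=> tf; rewrite -lee_fin; apply: le_trans sD.
  rewrite /singular (big_rem f)//=; apply: le_trans (leeDr _ _); last by rewrite lee_fin ltW.
  apply: le_trans (leeDl _ _); last first.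
    by apply: sume_ge0 => g _; apply: nneseries_ge0 => j _ _; exact: term_ge0.
  apply: le_trans (nneseries_lim_ge k.+1 _); last by move=> *; exact: term_ge0.
  rewrite big_nat_recr//= tf mulr1 leeDr//; apply: sume_ge0 => j _; exact: term_ge0.
have inv2 (x z : R) : 0 < x -> x <= z -> z ^- 2 <= x ^- 2.
  move=> x0 xz; have z0 := lt_le_trans x0 xz.
  by rewrite lef_pV2 ?posrE ?exprn_gt0// ler_pXn2r ?nnegrE ?(ltW x0) ?(ltW z0).
have [K hK] : exists k, (A * 2 ^+ k) ^- 2 < `|t - f|.
  exists (Num.bound (D / A)); rewrite ltNge; apply/negP => /kD; apply/negP; rewrite -ltNge.
  rewrite mulrC -ltr_pdivrMr//; apply: lt_le_trans (upper_nthrootP (leqnn _)) _.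
  by rewrite exprS ler_peMl ?exprn_ge0// ler1n.
case: (@ex_minnP (fun k => (A * 2 ^+ k) ^- 2 < `|t - f|) (ex_intro _ K hK)) => -[|k] hk kmin.
  apply: ltW; apply: le_lt_trans hk; rewrite expr0 mulr1.
  exact: inv2.
have tk : `|t - f| <= (A * 2 ^+ k) ^- 2.
  by rewrite leNgt; apply/negP => /kmin; rewrite ltnn.
have Ak := kD _ tk.
apply: ltW; apply: le_lt_trans hk.
by apply: inv2; rewrite ?mulr_gt0 ?exprn_gt0.
Qed.

Let measurable_term A (f : R) (k : nat) :
  measurable_fun setT (fun t : R => (A * 2 ^+ k.+1 * (`|t - f| <= (A * 2 ^+ k) ^- 2)%R%:R)%:E).
Proof.
rewrite (_ : (fun t => _) = (fun t => (A * 2 ^+ k.+1 * \1_`[f - (A * 2 ^+ k) ^- 2, f + (A *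
    2 ^+ k) ^- 2]%classic t)%:E)).
  by apply/measurable_EFinP; apply: measurable_funM => //; exact: measurable_indic.
apply/funext => t; rewrite indicE mem_setE in_itv/=; congr ((_ * (nat_of_bool _)%:R)%:E).
by rewrite ler_distl.
Qed.

Let measurable_series A (f : R) : 0 < A -> measurable_fun setT
  (fun t : R => (\sum_(k <oo) (A * 2 ^+ k.+1 * (`|t - f| <= (A * 2 ^+ k) ^- 2)%R%:R)%:E)%E).
Proof.
move=> A0; apply: ge0_emeasurable_sum => [k t _ _|k _]; first exact: term_ge0.
exact: measurable_term.
Qed.

Lemma measurable_singular F A : 0 < A -> measurable_fun setT (singular F A).
Proof.
move=> A0; apply: emeasurable_funD => //; apply: emeasurable_sum => f.
exact: measurable_series.
Qed.

Lemma integral_singular F (A a b : R) : 0 < A -> a <= b ->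
  (\int[mu]_(t in `[a, b]) singular F A t <= (A * (b - a) + (size F)%:R * (8 / A))%:E)%E.
Proof.
move=> A0 ab; have mab : measurable (`[a, b]%classic : set R) by exact: measurable_itv.
have s0 (t f : R) : (0 <= \sum_(k <oo) (A * 2 ^+ k.+1 * (`|t - f| <= (A * 2 ^+ k) ^- 2)%R%:R)%:E)%E.
  by apply: nneseries_ge0 => k _ _; exact: term_ge0.
rewrite ge0_integralD//; last 3 first.
- by move=> t _; rewrite lee_fin ltW.
- by move=> t _; apply: sume_ge0 => f _; exact: s0.
- by apply: measurable_funTS; apply: emeasurable_sum => f; exact: measurable_series.
rewrite EFinD; apply: leeD.
  rewrite integral_cst// [X in (_ * X)%E]lebesgue_measure_itv/= lte_fin.
  case: ifP => _; first by rewrite -EFinB -EFinM.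
  by rewrite mule0 lee_fin mulr_ge0 ?subr_ge0// ltW.
rewrite ge0_integral_sum//; last first.
  by move=> f; apply: measurable_funTS; exact: measurable_series.
have one f : (\int[mu]_(t in `[a, b]) \sum_(k <oo) (A * 2 ^+ k.+1 * (`|t - f| <= (A * 2 ^+
    k) ^- 2)%R%:R)%:E <= (8 / A)%:E)%E.
  rewrite integral_nneseries//; last 2 first.
  - by move=> k; apply: measurable_funTS; exact: measurable_term.
  - by move=> k t _; exact: term_ge0.
  (* The k-th term integrates to at most A 2^(k + 1) * 2 (A 2^k)^-2 = (8 / A) / 2^(k + 1). *)
  apply: le_trans (epsilon_trick0 xpredT _); last by rewrite divr_ge0// ltW.
  apply: lee_nneseries => [k *|k *]; first by apply: integral_ge0 => t _; exact: term_ge0.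
  set r := (A * 2 ^+ k) ^- 2.
  have r0 : 0 < r by rewrite invr_gt0 exprn_gt0// mulr_gt0 ?exprn_gt0.
  apply: (@le_trans _ _ (\int[mu]_(t in `[a, b]) ((A * 2 ^+ k.+1)%:E * (\1_`[f - r, f + r]%classic t)%:E))%E).
    apply: ge0_le_integral => //.
    - by move=> t _; exact: term_ge0.
    - by apply: measurable_funTS; exact: measurable_term.
    - by apply/measurable_EFinP; apply: measurable_funM => //; apply: measurable_funTS;
        exact: measurable_indic.
    - by move=> t _; rewrite -EFinM indicE mem_setE in_itv/= ler_distl.
  rewrite ge0_integralZl//; last 2 first.
  - by apply/measurable_EFinP; apply: measurable_funTS; exact: measurable_indic.
  - by rewrite lee_fin mulr_ge0 ?exprn_ge0// ltW.
  rewrite integral_indic//.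
  apply: (@le_trans _ _ ((A * 2 ^+ k.+1)%:E * mu (`[f - r, f + r]%classic)%R)%E).
    apply: lee_wpmul2l; first by rewrite lee_fin mulr_ge0 ?exprn_ge0// ltW.
    by apply: le_measure; rewrite ?inE//; exact: measurableI.
  rewrite [X in (_ * X)%E]lebesgue_measure_itv/= lte_fin ifT; last by lra.
  rewrite -EFinB -EFinM lee_fin /r natrX exprS.
  have : 0 < (2 : R) ^+ k by rewrite exprn_gt0.
  move: (2 ^+ k) => z z0.
  by rewrite le_eqVlt; apply/orP; left; apply/eqP; field; rewrite !gt_eqF.
elim: F => [|f F IH]; first by rewrite big_nil mul0r.
have -> : (size (f :: F))%:R * (8 / A) = 8 / A + (size F)%:R * (8 / A).
  by rewrite /= -[(size F).+1%:R]natr1 mulrDl mul1r addrC.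
by rewrite big_cons EFinD leeD.
Qed.

End singular.

(** * The cost of inserting one more interval *)

Section mark_mass.
Context (R : realType).
Implicit Types (y : seq (R * R * R)).
Local Notation mu := (@lebesgue_measure R).

Lemma measurable_covar_incr d (X : measurableType d) y (a b c e : X -> R) :
  measurable_fun setT a -> measurable_fun setT b ->
  measurable_fun setT c -> measurable_fun setT e ->
  measurable_fun setT (fun x => covar y (incr (a x) (b x)) (incr (c x) (e x))).
Proof.
elim: y a b c e => [|p y IH] a b c e ma mb mc me.
  rewrite (_ : (fun x => _) = fun x => Num.max (a x) (e x) + Num.max (b x) (c x) -
    Num.max (a x) (c x) - Num.max (b x) (e x)); last by apply/funext => x; exact: ip_incr.
  by apply: measurable_funB; [apply: measurable_funB; [apply: measurable_funD|]|];
    apply: measurable_maxr.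
apply: measurable_funB; first exact: IH.
apply: measurable_funM => //; apply: measurable_funM; first apply: measurable_funM => //.
  exact: IH.
exact: IH.
Qed.

Variables (alpha T : R).

Definition intensity_density (p : R * R) : \bar R :=
  (if [&& - T <= p.1, p.1 < p.2 & p.2 <= T]
     then alpha * expR (- (p.2 - p.1)) else 0)%:E.

Lemma measurable_intensity_density : measurable_fun setT intensity_density.
Proof.
apply/measurable_EFinP; apply: measurable_fun_ifT => //.
  apply: measurable_and; first by apply: measurable_fun_ler => //.
  by apply: measurable_and; [apply: measurable_fun_ltr|apply: measurable_fun_ler].
apply: measurable_funM => //; apply: measurableT_comp => //; apply: measurableT_comp => //.
exact: measurable_funB.
Qed.

Hypotheses (alpha0 : 0 < alpha) (T0 : 0 < T).

Lemma intensity_density_ge0 p : (0 <= intensity_density p)%E.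
Proof. by rewrite lee_fin; case: ifP => // _; rewrite mulr_ge0 ?expR_ge0// ltW. Qed.

(** By definition the same set function as [polaron_intensity], now with the structure of a
    measure. *)
Definition intensity := density_measure
  (lebesgue_measure \x lebesgue_measure)%E measurable_intensity_density intensity_density_ge0.

Definition mark_cst : R := Num.sqrt (2 / pi).

Definition endpoints y : seq R := flatten [seq [:: p.1.1; p.1.2] | p <- y].

Lemma size_endpoints y : size (endpoints y) = (size y).*2.
Proof. by elim: y => //= p y ->. Qed.

Lemma mem_endpoints y p : p \in y -> p.1.1 \in endpoints y /\ p.1.2 \in endpoints y.
Proof.
move=> py; split; apply/flattenP; exists [:: p.1.1; p.1.2]; rewrite ?inE ?eqxx ?orbT//;
  by apply/mapP; exists p.
Qed.

Let aux (z : R) : 8 * (2 * z - 1) <= 16 * z. Proof. lra. Qed.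

Let cst : R := mark_cst * (pi / 2) * Num.sqrt 2.

Let mark_cst_gt0 : 0 < mark_cst. Proof. by rewrite sqrtr_gt0 divr_gt0// pi_gt0. Qed.

Let cst_gt0 : 0 < cst.
Proof. apply: mulr_gt0; last by rewrite sqrtr_gt0.
by apply: mulr_gt0 => //; rewrite divr_gt0// pi_gt0. Qed.

Lemma mark_mass_ge0 y q u : (0 <= (mark_cst * tilt_norm ((q, u) :: y) ^+ 3)%:E)%E.
Proof. by rewrite lee_fin mulr_ge0 ?exprn_ge0 ?sqrtr_ge0// ltW// tilt_norm_gt0. Qed.

Lemma measurable_mark_mass_integrand y d (X : measurableType d) (q : X -> R * R) (u : X -> R) :
  measurable_fun setT q -> measurable_fun setT u ->
  measurable_fun setT (fun x => (mark_cst * tilt_norm ((q x, u x) :: y) ^+ 3)%:E).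
Proof.
move=> mq mu'; apply/measurable_EFinP; apply: measurable_funM => //; apply: measurable_funX.
apply: measurable_funM => //.
(* The arguments are at least one, so the maximum changes nothing and makes the inverse root
   continuous everywhere. *)
pose phi (v : R) := (Num.sqrt (Num.max 1 v))^-1.
have cphi : continuous phi.
  move=> v; apply: cvgV; first by rewrite gt_eqF// sqrtr_gt0 lt_max ltr01.
  apply: continuous_comp; last exact: sqrt_continuous.
  by apply: continuous_max; [exact: cvg_cst|exact: cvg_id].
have q1 := measurableT_comp measurable_fst mq; have q2 := measurableT_comp measurable_snd mq.
rewrite (_ : (fun x => _) = phi \o (fun x => 1 + u x ^+ 2 * covar y (incr (q x).1 (q x).2)
    (incr (q x).1 (q x).2))).
  apply: measurableT_comp; first exact: continuous_measurable_fun.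
  apply: measurable_funD => //; apply: measurable_funM; first exact: measurable_funX.
  exact: measurable_covar_incr.
apply/funext => x; rewrite /phi /= max_r// lerDl mulr_ge0 ?sqr_ge0// covar_ge0//.
by have [] := represents_incr (q x).1 (q x).2.
Qed.

Lemma measurable_mark_mass y : measurable_fun setT (fun q : R * R =>
  (\int[mu]_(u in `]0%R, +oo[) (mark_cst * tilt_norm ((q, u) :: y) ^+ 3)%:E)%E).
Proof.
apply: (@measurable_fun_integral_param _ _ _ _ _ mu _
  (fun z => (mark_cst * tilt_norm ((z.1, z.2) :: y) ^+ 3)%:E)) => //.
  exact: measurable_mark_mass_integrand.
by move=> z; exact: mark_mass_ge0.
Qed.

Let measurable_inv1sqr (w : R) : measurable_fun setT (fun u : R => (1 + (u * w) ^+ 2)^-1).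
Proof.
apply: continuous_measurable_fun => u; apply: cvgV; first by rewrite gt_eqF// ltr_pwDl// sqr_ge0.
apply: cvgD; first exact: cvg_cst.
by apply: (cvg_comp (fun u => u * w) (fun x => x ^+ 2)); [apply: cvgMl; exact:
    cvg_id|exact: exprn_continuous].
Qed.

(** If the majorant has the finite value [D], all relevant points are at distance at least D^-2 from
    [t], so the variance V is at least D^-2 / 2. Then (1 + u^2 V)^(- 3 / 2) <= (1 + u^2 V)^-1, whose
    integral pi / (2 sqrt V) is at most (pi / 2) sqrt 2 D. *)
Let mark_mass_singular y (s t A : R) : 0 < A -> s < t ->
  (\int[mu]_(u in `]0%R, +oo[) (mark_cst * tilt_norm ((s, t, u) :: y) ^+ 3)%:E <=
   (cst * tilt_norm y ^+ 3)%:E * singular (s :: endpoints y) A t)%E.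
Proof.
move=> A0 st; set N := tilt_norm y.
have N0 : 0 < N by exact: tilt_norm_gt0.
have cN : 0 < cst * N ^+ 3 by apply: mulr_gt0; rewrite ?exprn_gt0 ?cst_gt0.
have AS : (A%:E <= singular (s :: endpoints y) A t)%E by exact: singular_ge.
case SE : (singular _ A t) AS => [D| |] // AD; last by rewrite gt0_muley ?lte_fin// leey.
have D0 : 0 < D by apply: lt_le_trans A0 _; rewrite -lee_fin.
have far f : f \in s :: endpoints y -> D ^- 2 <= `|t - f|.
  by apply: singular_dist A0 _; rewrite SE.
set V := covar y (incr s t) (incr s t).
have dV : D ^- 2 / 2 <= V.
  apply: covar_gap; first by rewrite invr_gt0 exprn_gt0.
    by have := far s (mem_head _ _); rewrite gtr0_norm ?subr_gt0//; lra.
  by move=> p /mem_endpoints[p1 p2]; rewrite !far// inE ?p1 ?p2 orbT.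
have V0 : 0 < V by apply: lt_le_trans dV; rewrite divr_gt0// invr_gt0 exprn_gt0.
apply: (@le_trans _ _ (\int[mu]_(u in `]0%R, +oo[) ((mark_cst * N ^+ 3)%:E * ((1 + (u *
    Num.sqrt V) ^+ 2)^-1)%:E))%E).
  apply: ge0_le_integral => //.
  - by move=> u _; exact: mark_mass_ge0.
  - apply: measurable_funTS.
    exact: (@measurable_mark_mass_integrand y _ _ (fun=> (s, t)) id).
  - by apply/measurable_EFinP; apply: measurable_funM => //; apply: measurable_funTS;
      exact: measurable_inv1sqr.
  - move=> u _; rewrite -EFinM lee_fin -mulrA ler_pM2l//= -/N -/V.
    have q1 : 1 <= 1 + u ^+ 2 * V by rewrite lerDl mulr_ge0 ?sqr_ge0// ltW.
    have q0 : 0 < 1 + u ^+ 2 * V by lra.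
    rewrite exprMn exprVn ler_pM2l ?exprn_gt0// exprMn (sqr_sqrtr (ltW V0)).
    rewrite lef_pV2 ?posrE ?exprn_gt0 ?sqrtr_gt0// [Num.sqrt _ ^+ 3]exprSr (sqr_sqrtr (ltW q0)).
    by rewrite ler_peMr ?(ltW q0)// -[leLHS]sqrtr1 ler_wsqrtr.
rewrite ge0_integralZl//; last 3 first.
- by apply/measurable_EFinP; apply: measurable_funTS; exact: measurable_inv1sqr.
- by move=> u _; rewrite lee_fin invr_ge0 addr_ge0 ?sqr_ge0.
- by rewrite lee_fin mulr_ge0 ?exprn_ge0// ltW.
rewrite integral_inv1sqr ?sqrtr_gt0// -!EFinM lee_fin /cst.
have -> : mark_cst * N ^+ 3 * (pi / 2 / Num.sqrt V) = mark_cst * (pi / 2) * N ^+ 3 * (Num.sqrt V)^-1 by ring.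
have -> : mark_cst * (pi / 2) * Num.sqrt 2 * N ^+ 3 * D = mark_cst * (pi / 2) * N ^+ 3 *
    (Num.sqrt 2 * D) by ring.
rewrite ler_wpM2l//; first by rewrite !mulr_ge0 ?exprn_ge0// ltW// ?divr_gt0// pi_gt0.
rewrite -[leRHS]invrK lef_pV2 ?posrE ?invr_gt0 ?mulr_gt0 ?sqrtr_gt0//.
rewrite -[leLHS]ger0_norm ?invr_ge0 ?mulr_ge0 ?sqrtr_ge0 ?(ltW D0)// -sqrtr_sqr ler_wsqrtr//.
by rewrite exprVn exprMn sqr_sqrtr// invfM mulrC.
Qed.

(** The free parameter [A] of the majorant is chosen as the root of n + 1, with n the size of [y].
    This balances the two terms 2 T A and 8 (2 n + 1) / A <= 16 A, the number of points being 2 n +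
    1. The outer factor 2 T in the constant comes from the integral over [s]. *)
Lemma mark_mass_bound : exists2 b : R, 0 <= b & forall y,
  (\int[intensity]_q \int[mu]_(u in `]0%R, +oo[)
     (mark_cst * tilt_norm ((q, u) :: y) ^+ 3)%:E <=
   (b * Num.sqrt (size y).+1%:R * tilt_norm y ^+ 3)%:E)%E.
Proof.
exists (2 * T * (alpha * cst * (2 * T + 16))).
  have := cst_gt0 => c0; apply: mulr_ge0; first by rewrite mulr_ge0// ltW.
  have k0 : 0 <= 2 * T + 16 by rewrite addr_ge0// mulr_ge0// ltW.
  by apply: mulr_ge0 k0; apply: mulr_ge0; exact: ltW.
have TT : - T < T by exact: gtrN.
move=> y; set N := tilt_norm y.
have N0 : 0 < N by exact: tilt_norm_gt0.
pose I q := (\int[mu]_(u in `]0%R, +oo[) (mark_cst * tilt_norm ((q, u) :: y) ^+ 3)%:E)%E.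
have I0 q : (0 <= I q)%E by apply: integral_ge0 => u _; exact: mark_mass_ge0.
have mI : measurable_fun setT I by exact: measurable_mark_mass.
pose A := Num.sqrt (size y).+1%:R : R.
have A2 : A ^+ 2 = (size y).+1%:R by rewrite sqr_sqrtr.
have A1 : 1 <= A by rewrite -[leLHS]sqrtr1 ler_wsqrtr// ler1n.
have A0 : 0 < A by exact: lt_le_trans A1.
set c := cst * N ^+ 3; have c0 : 0 < c by apply: mulr_gt0; rewrite ?exprn_gt0 ?cst_gt0.
rewrite [leLHS]ge0_integral_density//.
rewrite [leLHS]fubini_tonelli1//; last 2 first.
- by apply: emeasurable_funM => //; exact: measurable_intensity_density.
- by move=> q; apply: mule_ge0; [exact: I0|exact: intensity_density_ge0].
pose B := alpha * c * ((2 * T + 16) * A).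
have k0 : 0 <= 2 * T + 16 by rewrite addr_ge0// mulr_ge0// ltW.
have B0 : 0 <= B := mulr_ge0 (mulr_ge0 (ltW alpha0) (ltW c0)) (mulr_ge0 k0 (ltW A0)).
have inner s : (\int[mu]_t (I (s, t) * intensity_density (s, t)) <=
    (B * \1_`[- T, T]%classic s)%:E)%E.
  have [sT|sT] := boolP (s \in `[- T, T]); last first.
    have Bs : 0 <= B * \1_`[- T, T]%classic s by apply: mulr_ge0.
    rewrite integral0_eq ?lee_fin// => t _.
    rewrite /intensity_density ifF ?mule0//=; apply/negbTE; apply: contra sT => /and3P[s1 s2 s3].
    by rewrite in_itv/= s1 (le_trans (ltW s2) s3).
  rewrite indicE mem_setE sT mulr1.
  apply: (@le_trans _ _ (\int[mu]_(t in `[(- T)%R, T]) ((alpha * c)%:E * singular (s :: endpoints y) A t))%E).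
    rewrite [leRHS]integral_mkcond; apply: ge0_le_integral => //.
    - by move=> t _; rewrite mule_ge0// intensity_density_ge0.
    - apply: emeasurable_funM.
        exact: (measurableT_comp mI (pair1_measurable s)).
      exact: (measurableT_comp measurable_intensity_density (pair1_measurable s)).
    - apply/(measurable_restrictT _ _).1 => //.
      by apply: measurable_funTS; apply: emeasurable_funM => //; exact: measurable_singular.
    - move=> t _; rewrite patchE /intensity_density.
      have S0 : (0 <= singular (s :: endpoints y) A t)%E.
        by apply: le_trans (singular_ge _ _ A0); rewrite lee_fin ltW.
      case: ifPn => [/and3P[/= s1 s2 s3]|_]; last first.
        by rewrite mule0; case: ifP => // _; rewrite mule_ge0// lee_fin mulr_ge0// ltW.
      rewrite mem_setE in_itv/= (le_trans s1 (ltW s2)) s3 /= muleC [(alpha * c)%:E]EFinM -muleA.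
      apply: lee_pmul => //; first by rewrite lee_fin mulr_ge0 ?expR_ge0// ltW.
        rewrite lee_fin -[leRHS]mulr1 ler_pM2l// -[leRHS]expR0 ler_expR; lra.
      exact: mark_mass_singular.
  rewrite ge0_integralZl//; last 3 first.
  - by apply: measurable_funTS; exact: measurable_singular.
  - by move=> t _; apply: le_trans (singular_ge _ _ A0); rewrite lee_fin ltW.
  - by rewrite lee_fin mulr_ge0// ltW.
  apply: (@le_trans _ _ ((alpha * c)%:E * (A * (T - - T) + (size (s :: endpoints y))%:R * (8 / A))%:E)%E).
    apply: lee_wpmul2l; first by rewrite lee_fin mulr_ge0// ltW.
    by apply: integral_singular => //; exact: ltW.
  have ac : 0 < alpha * c := mulr_gt0 alpha0 c0.
  rewrite -EFinM lee_fin /B (ler_pM2l ac) /= size_endpoints.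
  have -> : A * (T - - T) + (size y).*2.+1%:R * (8 / A) = 2 * T * A + (8 * (2 * A ^+ 2 - 1)) / A.
    by rewrite A2 -!natr1 -muln2 natrM; field; rewrite gt_eqF.
  by rewrite [leRHS]mulrDl lerD2l ler_pdivrMr// -mulrA -expr2 aux.
apply: (@le_trans _ _ (\int[mu]_s (B * \1_`[- T, T]%classic s)%:E)%E).
  apply: ge0_le_integral => //.
  - move=> s _; apply: integral_ge0 => t _.
    by apply: mule_ge0; [exact: I0|exact: intensity_density_ge0].
  - apply: measurable_fun_fubini_tonelli_F => [|q].
      by apply: emeasurable_funM => //; exact: measurable_intensity_density.
    by apply: mule_ge0; [exact: I0|exact: intensity_density_ge0].
  - by apply/measurable_EFinP; apply: measurable_funM => //; exact: measurable_indic.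
  - by move=> s _; exact: inner.
under eq_integral do rewrite EFinM.
rewrite ge0_integralZl//; last by apply/measurable_EFinP; exact: measurable_indic.
rewrite integral_indic// setIT [X in (_ * X)%E]lebesgue_measure_itv/= lte_fin TT.
by rewrite -EFinB -EFinM lee_fin /B /c /A le_eqVlt; apply/orP; left; apply/eqP; ring.
Qed.

End mark_mass.

(** * The pair energy as an integral over marks *)

Section mark_weight.
Context (R : realType).
Local Notation mu := (@lebesgue_measure R).
Local Notation mark := (R * R * R)%type.

Definition mark_weight (w : path3 R) (p : mark) : R :=
  expR (- (p.2 ^+ 2 * enorm (w p.1.2 - w p.1.1) ^+ 2 / 2)).

Lemma enorm_ge0 (x : 'rV[R]_3) : 0 <= enorm x. Proof. exact: sqrtr_ge0. Qed.

Lemma enormN (x : 'rV[R]_3) : enorm (- x) = enorm x.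
Proof. by congr Num.sqrt; apply: eq_bigr => i _; rewrite mxE sqrrN. Qed.

Lemma tilt3_mark_weight y w : tilt3 (fun=> y) w = \prod_(p <- y) mark_weight w p.
Proof.
rewrite tilt3_phi mulr_sumr expR_sum; apply: eq_bigr => p _; congr expR.
by field.
Qed.

(** With variable times an increment is not a generator of the sigma-field. It is a limit of
    combinations of grid increments whose coefficients are measurable in the times. *)
Lemma measurable_joint_increment (i : 'I_3) : measurable_fun setT
  (fun z : path3 R * (R * R) => coordinate i z.1 z.2.2 - coordinate i z.1 z.2.1).
Proof.
apply: (@measurable_fun_cvg _ _ _ _ (fun n (z : path3 R * (R * R)) =>
    stieltjes_sum (incr z.2.1 z.2.2) (coordinate i z.1) n)); last first.
  move=> z _; have [_ h] := represents_incr z.2.1 z.2.2.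
  by apply: h; exact: cts_fun.
move=> n; apply: measurable_sum => k; apply: measurable_funM; last first.
  exact: (measurableT_comp (measurable_coordinate_increment i _ _)).
have ind (f : path3 R * (R * R) -> R) c : measurable_fun setT f ->
    measurable_fun setT (fun z => (f z <= c)%R%:R : R).
  move=> mf; rewrite (_ : (fun z => _) = fun z => if f z <= c then 1 else 0).
    by apply: measurable_fun_ifT => //; exact: measurable_fun_ler.
  by apply/funext => z; case: (f z <= c).
by apply: measurable_funB; apply: ind; [exact: (measurableT_comp measurable_fst measurable_snd)
  |exact: (measurableT_comp measurable_snd measurable_snd)].
Qed.

Lemma measurable_mark_weight : measurable_fun setT
  (fun z : path3 R * mark => mark_weight z.1 z.2).
Proof.
apply: measurableT_comp => //; apply: measurableT_comp => //; apply: measurable_funM => //.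
apply: measurable_funM.
  by apply: measurable_funX; exact: (measurableT_comp measurable_snd measurable_snd).
rewrite (_ : (fun z => _) = fun z : path3 R * mark => \sum_i
    (coordinate i z.1 z.2.1.2 - coordinate i z.1 z.2.1.1) ^+ 2).
  apply: measurable_sum => i; apply: measurable_funX.
  have mp : measurable_fun setT (fun z : path3 R * mark => (z.1, z.2.1)).
    by apply: measurable_fun_pair => //; exact: (measurableT_comp measurable_fst measurable_snd).
  exact: (measurableT_comp (measurable_joint_increment i) mp).
apply/funext => z; rewrite sqr_sqrtr; last by apply: sumr_ge0 => i _; exact: sqr_ge0.
by apply: eq_bigr => i _; rewrite !mxE.
Qed.

Lemma mark_weight_ge0 w p : 0 <= mark_weight w p. Proof. exact: expR_ge0. Qed.

Lemma measurable_mark_weight_comp d (X : measurableType d) (w : X -> path3 R) (p : X -> mark) :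
  measurable_fun setT w -> measurable_fun setT p ->
  measurable_fun setT (fun x => mark_weight (w x) (p x)).
Proof.
move=> mw mp; have h := measurableT_comp measurable_mark_weight (measurable_fun_pair mw mp).
exact: h.
Qed.

(** The inverse is that of the extended reals: the energy is infinite where the increment
    vanishes. *)
Definition pair_energy (w : path3 R) (q : R * R) : \bar R :=
  ((enorm (w q.2 - w q.1))%:E^-1)%E.

Lemma pair_energyE w q : pair_energy w q =
  (\int[mu]_(u in `]0%R, +oo[) (mark_cst R * mark_weight w (q, u))%:E)%E.
Proof. by rewrite /pair_energy -inv_mixture// enorm_ge0. Qed.

Lemma pair_energyC w s t : pair_energy w (s, t) = pair_energy w (t, s).
Proof. by rewrite /pair_energy/= -enormN opprB. Qed.

Lemma pair_energy_ge0 w q : (0 <= pair_energy w q)%E.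
Proof. by rewrite inve_ge0 lee_fin enorm_ge0. Qed.

Lemma mark_term_ge0 w p : (0 <= (mark_cst R * mark_weight w p)%:E)%E.
Proof. by rewrite lee_fin mulr_ge0 ?mark_weight_ge0// sqrtr_ge0. Qed.

Lemma measurable_mark_term d (X : measurableType d) (w : X -> path3 R) (p : X -> mark) :
  measurable_fun setT w -> measurable_fun setT p ->
  measurable_fun setT (fun x => (mark_cst R * mark_weight (w x) (p x))%:E).
Proof.
by move=> mw mp; apply/measurable_EFinP; apply: measurable_funM => //; exact: measurable_mark_weight_comp.
Qed.

Lemma measurable_pair_energy : measurable_fun setT
  (fun z : path3 R * (R * R) => pair_energy z.1 z.2).
Proof.
under eq_fun do rewrite pair_energyE.
apply: (@measurable_fun_integral_param _ _ (path3 R * (R * R))%type _ R mu _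
  (fun z => (mark_cst R * mark_weight z.1.1 (z.1.2, z.2))%:E)) => //.
- apply: measurable_mark_term; first exact: (measurableT_comp measurable_fst measurable_fst).
  by apply: measurable_fun_pair => //; exact: (measurableT_comp measurable_snd measurable_fst).
- by move=> z; exact: mark_term_ge0.
Qed.

Lemma measurable_pair_energy_section w : measurable_fun setT (pair_energy w).
Proof.
have h := measurableT_comp measurable_pair_energy (@pair1_measurable _ _ (path3 R) (R * R)%type w).
exact: h.
Qed.

End mark_weight.

Lemma half_mul_double (R : realType) (a : R) (x y : \bar R) : 0 < a -> (0 <= y)%E -> x = y ->
  ((a / 2)%:E * (x + y) = a%:E * y)%E.
Proof.
move=> a0 y0 ->; have a2 : (0 <= (a / 2)%:E)%E by rewrite lee_fin divr_ge0// ltW.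
rewrite (ge0_muleDr _ y0 y0) -(ge0_muleDl _ a2 a2) -EFinD.
by congr (_%:E * _)%E; field.
Qed.

(** * The exponent of the polaron weight as an integral over the intensity *)

Section action.
Context (R : realType) (alpha T : R) (alpha0 : 0 < alpha).
Local Notation mu := (@lebesgue_measure R).
Local Notation gamma := (intensity T alpha0).

HB.instance Definition _ := Measure.on gamma.

Let gammaT : (gamma setT < +oo)%E.
Proof.
rewrite /intensity /density_measure.
apply: (@le_lt_trans _ _ (\int[mu \x mu]_q (alpha * \1_(`[- T, T]%classic `*` `[- T, T]%classic) q)%:E)%E).
  apply: ge0_le_integral => //.
  - by move=> q _; exact: intensity_density_ge0.
  - exact: measurable_intensity_density.
  - apply/measurable_EFinP; apply: measurable_funM => //; apply: measurable_indic.
    exact: measurableX.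
  - move=> q _; rewrite lee_fin; case: ifPn => [/and3P[s1 s2 s3]|_]; last by rewrite mulr_ge0// ltW.
    rewrite indicE mem_set ?mulr1.
      rewrite -[leRHS]mulr1 ler_pM2l// -[leRHS]expR0 ler_expR; lra.
    by split; rewrite /= in_itv/=; apply/andP; split => //; lra.
under eq_integral do rewrite EFinM.
have mX : measurable (`[- T, T]%classic `*` `[- T, T]%classic : set (R * R)) by exact: measurableX.
rewrite ge0_integralZl//; last 2 first.
- by apply/measurable_EFinP; exact: measurable_indic.
- by rewrite lee_fin ltW.
rewrite integral_indic// setIT [X in (_ * X)%E](product_measure1E mu mu)//.
have mI : (mu `[(- T)%R, T]%classic < +oo)%E.
  by rewrite lebesgue_measure_itv/=; case: ifP => _; rewrite -?EFinB ltry.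
by rewrite lte_mul_pinfty ?lee_fin ?(ltW alpha0)// lte_mul_pinfty// ge0_fin_numE.
Qed.

HB.instance Definition _ := Measure_isFinite.Build _ _ _ gamma (lty_fin_num_fun gammaT).

Definition action (w : path3 R) : \bar R := (\int[gamma]_q pair_energy w q)%E.

Lemma action_ge0 w : (0 <= action w)%E.
Proof. by apply: integral_ge0 => q _; exact: pair_energy_ge0. Qed.

Lemma measurable_action : measurable_fun setT action.
Proof.
apply: (@measurable_fun_integral_param _ _ (path3 R) _ R gamma setT
  (fun z => pair_energy z.1 z.2)) => //; first exact: measurable_pair_energy.
by move=> z; exact: pair_energy_ge0.
Qed.

(** The integrand is symmetric in the two times, so the square splits into two triangles with equal
    integrals and [alpha / 2] becomes [alpha]. *)
Lemma polaron_weight_action w : polaron_weight alpha T w = expeR (action w).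
Proof.
rewrite /polaron_weight; congr expeR.
pose E (z : R * R) : \bar R := ((expR (- `|z.1 - z.2|))%:E * pair_energy w z)%E.
pose H (z : R * R) : \bar R := if [&& - T <= z.1, z.1 < z.2 & z.2 <= T] then E z else 0%E.
have E0 z : (0 <= E z)%E.
  by apply: mule_ge0; [rewrite lee_fin expR_ge0|exact: pair_energy_ge0].
have H0 z : (0 <= H z)%E.
  by rewrite /H; case: ifP => _; [exact: E0|exact: lexx].
have mE : measurable_fun setT E.
  apply: emeasurable_funM; last exact: measurable_pair_energy_section.
  apply/measurable_EFinP; apply: measurableT_comp => //; apply: measurableT_comp => //.
  by apply: measurableT_comp => //; exact: measurable_funB.
have mH : measurable_fun setT H.
  apply: measurable_fun_ifT => //.
    apply: measurable_and; first by apply: measurable_fun_ler.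
    by apply: measurable_and; [apply: measurable_fun_ltr|apply: measurable_fun_ler].
have mswap : measurable_fun setT (fun z : R * R => H (z.2, z.1)).
  exact: (measurableT_comp mH (measurable_fun_pair measurable_snd measurable_fst)).
have -> : action w = (\int[mu]_s \int[mu]_t (alpha%:E * H (s, t)))%E.
  rewrite /action [LHS]ge0_integral_density; last 2 first.
  - exact: measurable_pair_energy_section.
  - exact: pair_energy_ge0.
  transitivity (\int[mu \x mu]_z (alpha%:E * H z))%E; last first.
    apply: fubini_tonelli1; first exact: emeasurable_funM.
    by move=> z; rewrite mule_ge0// lee_fin ltW.
  apply: eq_integral => z _; rewrite /intensity_density /H /E.
  case: ifPn => [/and3P[s1 s2 s3]|_]; last by rewrite !mule0.
  by rewrite muleC EFinM muleA distrC ger0_norm// subr_ge0 ltW.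
have sw : (\int[mu]_t \int[mu]_s H (s, t) = \int[mu]_s \int[mu]_t H (s, t))%E.
  exact: (esym (@fubini_tonelli _ _ _ _ _ mu mu H mH H0)).
have mF : measurable_fun setT (fun s => \int[mu]_t H (s, t))%E.
  exact: (@measurable_fun_fubini_tonelli_F _ _ _ _ _ mu _ mH H0).
have mG : measurable_fun setT (fun t => \int[mu]_s H (s, t))%E.
  exact: (@measurable_fun_fubini_tonelli_G _ _ _ _ _ mu _ mH H0).
have al0 : (0 <= alpha%:E)%E by rewrite lee_fin ltW.
have F0 s : (0 <= \int[mu]_t H (s, t))%E by exact: integral_ge0.
have -> : (\int[mu]_s \int[mu]_t (alpha%:E * H (s, t)) = alpha%:E * \int[mu]_s \int[mu]_t H (s, t))%E.
  apply: etrans _ (ge0_integralZl mu measurableT mF (fun s _ => F0 s) al0).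
  apply: eq_integral => s _.
  exact: (ge0_integralZl mu measurableT (measurableT_comp mH (pair1_measurable s)) (fun t _
      => H0 (s, t)) al0).
have msec t : measurable_fun setT (fun s => H (s, t)) by exact: (measurableT_comp mH (pair2_measurable t)).
have msec' t : measurable_fun setT (fun s => H (t, s)) by exact: (measurableT_comp mH (pair1_measurable t)).
have -> : (\int[mu]_(t in `[(- T)%R, T]) \int[mu]_(s in `[(- T)%R, T])
    ((expR (- `|t - s|))%:E / (enorm (w t - w s))%:E) =
    \int[mu]_t (\int[mu]_s H (s, t) + \int[mu]_s H (t, s)))%E.
  rewrite integral_mkcond; apply: eq_integral => t _; rewrite patchE.
  have Et s : ((expR (- `|t - s|))%:E / (enorm (w t - w s))%:E = E (s, t))%E by rewrite /E
      /pair_energy/= distrC.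
  apply: etrans _ (ge0_integralD mu measurableT (fun s _ => H0 (s, t)) (msec t) (fun s _ =>
      H0 (t, s)) (msec' t)).
  case: ifPn => [tI|tI].
    rewrite [LHS]integral_mkcond; apply: (@ge0_ae_eq_integral _ _ _ mu setT).
    - exact: measurableT.
    - have mI : measurable (`[(- T)%R, T]%classic : set R) by exact: measurable_itv.
      apply: (iffLR (measurable_restrictT _ mI)); apply: measurable_funTS.
      rewrite (_ : (fun s => _) = (fun s => E (s, t))); last by apply/funext => s; exact: Et.
      exact: (measurableT_comp mE (pair2_measurable t)).
    - exact: emeasurable_funD (msec t) (msec' t).
    - move=> s _; rewrite patchE; case: ifP => _; last exact: lexx.
      by rewrite (Et s); exact: E0.
    - by move=> s _; exact: adde_ge0 (H0 _) (H0 _).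
    (* The two triangles miss the diagonal, whose section is a single point. *)
    exists [set t]; split; [exact: measurable_set1|exact: lebesgue_measure_set1|].
    move=> s /= /not_implyP[_]; apply: contra_notP => /eqP st.
    move: tI; rewrite mem_setE in_itv/= => /andP[t1 t2].
    rewrite patchE mem_setE in_itv/= (Et s) /H /=.
    have [lt|lt|eq] := ltgtP s t; last by rewrite eq eqxx in st.
    - rewrite andbF adde0 t2 andbT (le_trans (ltW lt) t2) andbT.
      by case: ifP.
    - rewrite andbF add0e t1 (le_trans t1 (ltW lt)) andTb; case: ifP => _; last by [].
      by rewrite /E/= distrC pair_energyC.
  have HH s : (H (s, t) + H (t, s) = 0)%E.
    have n1 : [&& - T <= s, s < t & t <= T] = false.
      apply/negbTE; apply: contra tI => /and3P[a1 a2 a3].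
      by rewrite mem_setE in_itv/= a3 (le_trans a1 (ltW a2)).
    have n2 : [&& - T <= t, t < s & s <= T] = false.
      apply/negbTE; apply: contra tI => /and3P[a1 a2 a3].
      by rewrite mem_setE in_itv/= a1 (le_trans (ltW a2)).
    by rewrite /H/= n1 n2 adde0.
  by apply: esym; apply: integral0_eq => s _; exact: HH.
have G0 t : setT t -> (0 <= \int[mu]_s H (s, t))%E by move=> _; exact: integral_ge0.
rewrite (ge0_integralD mu measurableT G0 mG (fun t _ => F0 t) mF).
have J0 : (0 <= \int[mu]_s \int[mu]_t H (s, t))%E by apply: integral_ge0 => s _; exact: F0.
exact: (half_mul_double alpha0 J0 sw).
Qed.

End action.

(** * Exponential series with extended real values *)

Section expeR_series.
Context (R : realType).
Local Open Scope ereal_scope.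

Lemma expeR_nneseries (a : \bar R) : 0 <= a ->
  expeR a = \sum_(n <oo) ((n`!%:R^-1)%R%:E * a ^+ n).
Proof.
case: a => [r| |] // r0.
  rewrite /= /expR; transitivity (limn (EFin \o series (exp_coeff r))).
    by apply: esym; apply: EFin_lim; exact: is_cvg_series_exp_coeff.
  apply/congr_lim/funext => n; rewrite /= /series/= -sumEFin; apply: eq_bigr => k _.
  by rewrite -EFin_expe -EFinM /exp_coeff mulrC.
apply: esym; apply: (@nneseries_pinfty _ _ _ 1%N) => //.
  by move=> n _; rewrite mule_ge0 ?lee_fin ?invr_ge0// expe_ge0.
by rewrite expeS expe0 mule1 gt0_muley// lte_fin invr_gt0 ltr0n.
Qed.

Lemma measurable_expeR d (X : measurableType d) (f : X -> \bar R) :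
  measurable_fun setT f -> (forall x, 0 <= f x) -> measurable_fun setT (fun x => expeR (f x)).
Proof.
move=> mf f0; rewrite (_ : (fun x => _) = fun x => \sum_(n <oo) ((n`!%:R^-1)%R%:E * f x ^+ n)); last first.
  by apply/funext => x; exact: expeR_nneseries.
apply: ge0_emeasurable_sum => [n x _ _|n _].
  by rewrite mule_ge0 ?expe_ge0// lee_fin invr_ge0.
apply: emeasurable_funM => //; elim: n => [|n IH]; first exact: measurable_cst.
by under eq_fun do rewrite expeS; exact: emeasurable_funM.
Qed.

(** The general term b^n / sqrt (n!) is the geometric mean of (2 b^2)^n / n! and 2^-n, hence at most
    half their sum: an exponential and a geometric series. *)
Lemma sqrt_fact_series (b : R) : (0 <= b)%R ->
  \sum_(n <oo) ((n`!%:R)^-1 * (b ^+ n * Num.sqrt n`!%:R))%R%:E < +oo.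
Proof.
move=> b0; have half n : ((n`!%:R)^-1 * (b ^+ n * Num.sqrt n`!%:R) <=
    2^-1 * ((n`!%:R)^-1 * (2 * b ^+ 2) ^+ n + (2 ^+ n)^-1) :> R)%R.
  have f0 : (0 < n`!%:R :> R)%R by rewrite ltr0n fact_gt0.
  set s := Num.sqrt n`!%:R; have s0 : (0 < s)%R by rewrite sqrtr_gt0.
  have fs : (n`!%:R = s ^+ 2 :> R)%R by rewrite sqr_sqrtr// ltW.
  rewrite fs exprMn -exprM mulnC exprM.
  have z0 : (0 < 2 ^+ n :> R)%R by rewrite exprn_gt0.
  move: (2 ^+ n)%R (b ^+ n)%R z0 => z c z0.
  have := sqr_ge0 (z * (c / s) - 1)%R => h.
  rewrite -subr_ge0 (_ : (_ - _ = (z * (c / s) - 1) ^+ 2 / (2 * z))%R); last first.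
    by field; rewrite !gt_eqF.
  by rewrite divr_ge0// mulr_ge0// ltW.
have b2 : (0 <= (2 * b ^+ 2)%:E)%E by rewrite lee_fin mulr_ge0// sqr_ge0.
have e0 n : (0 <= (n`!%:R^-1)%:E * (2 * b ^+ 2)%:E ^+ n)%E.
  by rewrite mule_ge0 ?lee_fin ?invr_ge0// expe_ge0.
apply: (@le_lt_trans _ _ (\sum_(n <oo) ((n`!%:R^-1)%:E * (2 * b ^+ 2)%:E ^+ n + (2 / (2 ^ n.+1)%:R)%:E))%E).
  apply: lee_nneseries => [n *|n *].
    by rewrite lee_fin mulr_ge0 ?invr_ge0// mulr_ge0 ?sqrtr_ge0// exprn_ge0.
  rewrite -EFin_expe -EFinM -EFinD lee_fin; apply: le_trans (half n) _.
  have -> : (2 / (2 ^ n.+1)%:R = (2 ^+ n)^-1 :> R)%R by rewrite natrX exprS invfM mulrA divff// mul1r.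
  rewrite -exprVn ler_piMl//.
    by rewrite addr_ge0 ?exprn_ge0// mulr_ge0 ?invr_ge0// exprn_ge0// mulr_ge0// sqr_ge0.
  by rewrite invf_le1// ler1n.
have p0 (n : nat) : (0 <= (2 / (2 ^ n.+1)%:R : R)%:E)%E by rewrite lee_fin divr_ge0.
rewrite nneseriesD; [|by move=> *; exact: e0|by move=> *; exact: p0].
rewrite -expeR_nneseries//; apply: lte_add_pinfty; first exact: ltry.
by apply: le_lt_trans (epsilon_trick0 xpredT _) _; rewrite ?ltry.
Qed.

End expeR_series.

(** * Moments of the action *)

Section partition_function.
Context (R : realType) (alpha T : R) (alpha0 : 0 < alpha) (T0 : 0 < T).
Variable P : probability (path3 R) R.
Hypothesis BP : brownian_law P.
Local Notation mu := (@lebesgue_measure R).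
Local Notation gamma := (intensity T alpha0).
Local Notation action := (action T alpha0).
Local Open Scope ereal_scope.

(** Under the unnormalized tilted law, so that the recursion involves no division. *)
Definition action_moment n (y : seq (R * R * R)) : \bar R :=
  \int[P]_w ((tilt3 (fun=> y) w)%:E * action w ^+ n).

Let tilt_E0 (y : seq (R * R * R)) (w : path3 R) : 0 <= (tilt3 (fun=> y) w)%:E.
Proof. by rewrite lee_fin ltW// tilt3_gt0. Qed.

Let measurable_action_exp n : measurable_fun setT (fun w => action w ^+ n).
Proof.
elim: n => [|n IH]; first exact: measurable_cst.
by under eq_fun do rewrite expeS; apply: emeasurable_funM => //; exact: measurable_action.
Qed.

Let measurable_moment n y :
  measurable_fun setT (fun w => (tilt3 (fun=> y) w)%:E * action w ^+ n).
Proof.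
apply: emeasurable_funM; last exact: measurable_action_exp.
by apply/measurable_EFinP; exact: measurable_tilt3.
Qed.

Let exp0 n w : 0 <= action w ^+ n.
Proof. by apply: expe_ge0; exact: action_ge0. Qed.

Let moment_ge0 n y w : 0 <= (tilt3 (fun=> y) w)%:E * action w ^+ n.
Proof. exact: mule_ge0. Qed.

(** One factor of the action is an integral of mark weights over [q] and [u], and multiplication by
    a mark weight appends [(q, u)] to the listing of the tilt. *)
Lemma action_momentS n y : action_moment n.+1 y =
  \int[gamma]_q \int[mu]_(u in `]0%R, +oo[) ((mark_cst R)%:E * action_moment n ((q, u) :: y)).
Proof.
have c0 : 0 <= (mark_cst R)%:E by rewrite lee_fin sqrtr_ge0.
pose g w := (tilt3 (fun=> y) w)%:E * action w ^+ n.
have g0 w : 0 <= g w by exact: moment_ge0.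
have mg : measurable_fun setT g by exact: measurable_moment.
pose F (z : (path3 R * (R * R)) * R) := g z.1.1 * (mark_cst R * mark_weight z.1.1 (z.1.2, z.2))%:E.
have F0 z : 0 <= F z by apply: mule_ge0; [exact: g0|exact: mark_term_ge0].
have mF : measurable_fun setT F.
  apply: emeasurable_funM.
    exact: (measurableT_comp mg (measurableT_comp measurable_fst measurable_fst)).
  apply: measurable_mark_term; first exact: (measurableT_comp measurable_fst measurable_fst).
  by apply: measurable_fun_pair => //; exact: (measurableT_comp measurable_snd measurable_fst).
pose G (z : path3 R * (R * R)) := \int[mu]_(u in `]0%R, +oo[) F (z, u).
have mG : measurable_fun setT G.
  exact: (@measurable_fun_integral_param _ _ (path3 R * (R * R))%type _ R mu _ F _ mF F0).
have G0 z : 0 <= G z by apply: integral_ge0 => u _; exact: F0.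
have GE w q : G (w, q) = g w * pair_energy w q.
  rewrite pair_energyE; apply: (ge0_integralZl mu (measurable_itv _) _ _ (g0 w)).
    apply: measurable_funTS.
    apply: (@measurable_mark_term _ _ _ (fun=> w) (fun u => (q, u))) => //.
    exact: measurable_fun_pair.
  by move=> u _; exact: mark_term_ge0.
transitivity (\int[P]_(w in setT) \int[gamma]_(q in setT) G (w, q)).
  apply: eq_integral => w _; rewrite expeS muleCA muleC.
  under [RHS]eq_integral do rewrite GE.
  apply: esym; apply: (ge0_integralZl gamma measurableT _ _ (g0 w)).
    exact: measurable_pair_energy_section.
  by move=> q _; exact: pair_energy_ge0.
rewrite (@tonelli_in _ _ (path3 R) _ R P gamma setT setT G measurableT measurableT mG G0).
apply: eq_integral => q _.
transitivity (\int[P]_(w in setT) \int[mu]_(u in `]0%R, +oo[) F ((w, q), u)) => //.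
pose F' (z : path3 R * R) := F ((z.1, q), z.2).
have mF' : measurable_fun setT F'.
  have mp : measurable_fun setT (fun z : path3 R * R => ((z.1, q), z.2)).
    by apply: measurable_fun_pair => //; exact: measurable_fun_pair.
  exact: (measurableT_comp mF mp).
have F'0 z : 0 <= F' z by exact: F0.
have mI : measurable (`]0%R, +oo[%classic : set R) by exact: measurable_itv.
apply: etrans (@tonelli_in _ _ (path3 R) _ R P mu setT _ F' measurableT mI mF' F'0) _.
apply: eq_integral => u _.
rewrite /action_moment.
apply: etrans _ (ge0_integralZl P measurableT (measurable_moment n _) (fun w _ => moment_ge0 n _ w) c0).
apply: eq_integral => w _; rewrite /F' /F /g/= !tilt3_mark_weight big_cons !EFinM.
by rewrite muleCA -[in RHS]muleA; congr (_ * _); rewrite muleC.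
Qed.

Lemma action_moment0 y : action_moment 0 y = (tilt_norm y ^+ 3)%:E.
Proof.
rewrite -(Phi_tilt_norm BP y); apply: eq_integral => w _.
by rewrite expe0 mule1 tilt3_phi.
Qed.

Let measurable_moment_cons n y :
  measurable_fun setT (fun p : R * R * R => action_moment n (p :: y)).
Proof.
pose F (z : (R * R * R) * path3 R) := (tilt3 (fun=> z.1 :: y) z.2)%:E * action z.2 ^+ n.
apply: (@measurable_fun_integral_param _ _ (R * R * R)%type (path3 R) R P setT F) => //.
- apply: emeasurable_funM; last exact: (measurableT_comp (measurable_action_exp n) measurable_snd).
  apply/measurable_EFinP.
  rewrite (_ : (fun z => _) = fun z : (R * R * R) * path3 R =>
    (mark_weight z.2 z.1 * tilt3 (fun=> y) z.2)%R); last first.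
    by apply/funext => z; rewrite !tilt3_mark_weight big_cons.
  apply: measurable_funM; last exact: (measurableT_comp (measurable_tilt3 _) measurable_snd).
  exact: measurable_mark_weight_comp.
- by move=> z; exact: moment_ge0.
Qed.

Lemma action_moment_ge0 n y : 0 <= action_moment n y.
Proof. by apply: integral_ge0 => w _; exact: moment_ge0. Qed.

(** The induction runs over all listings [y], since each step lengthens [y] by one; this is why the
    roots of consecutive integers appear. *)
Lemma action_moment_bound (b : R) : (0 <= b)%R ->
  (forall y, \int[gamma]_q \int[mu]_(u in `]0%R, +oo[)
     (mark_cst R * tilt_norm ((q, u) :: y) ^+ 3)%:E <=
   (b * Num.sqrt (size y).+1%:R * tilt_norm y ^+ 3)%:E) ->
  forall n y, action_moment n y <=
    (b ^+ n * (\prod_(m < n) Num.sqrt (size y + m).+1%:R) * tilt_norm y ^+ 3)%:E.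
Proof.
move=> b0 hb; elim=> [|n IH] y.
  by rewrite big_ord0 expr0 !mul1r action_moment0.
rewrite action_momentS.
pose C := (b ^+ n * \prod_(m < n) Num.sqrt ((size y).+1 + m).+1%:R)%R.
have C0 : (0 <= C)%R by rewrite mulr_ge0 ?exprn_ge0// prodr_ge0// => m _; exact: sqrtr_ge0.
have c0 : 0 <= (mark_cst R)%:E by rewrite lee_fin sqrtr_ge0.
have mI : measurable (`]0%R, +oo[%classic : set R) by exact: measurable_itv.
pose K (z : R * R * R) := (mark_cst R)%:E * action_moment n ((z.1, z.2) :: y).
have K0 z : 0 <= K z by apply: mule_ge0 c0 _; exact: action_moment_ge0.
have mK : measurable_fun setT K.
  apply: emeasurable_funM => //.
  rewrite (_ : (fun z => _) = fun z => action_moment n (z :: y)); first exact: measurable_moment_cons.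
  by apply/funext => -[].
pose h q := \int[mu]_(u in `]0%R, +oo[) (mark_cst R * tilt_norm ((q, u) :: y) ^+ 3)%:E.
have h0 q : 0 <= h q by apply: integral_ge0 => u _; exact: mark_mass_ge0.
have mh : measurable_fun setT h by exact: measurable_mark_mass.
apply: (@le_trans _ _ (\int[gamma]_q (C%:E * h q))).
  apply: ge0_le_integral.
  - exact: measurableT.
  - by move=> q _; apply: integral_ge0 => u _; apply: mule_ge0 c0 _; exact: action_moment_ge0.
  - exact: (@measurable_fun_integral_param _ _ (R * R)%type _ R mu _ _ mI mK K0).
  - exact: emeasurable_funM.
  - move=> q _; rewrite /h -(ge0_integralZl mu mI); last 3 first.
    + apply: measurable_funTS.
      exact: (@measurable_mark_mass_integrand _ y _ _ (fun=> q) id).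
    + by move=> u _; exact: mark_mass_ge0.
    + by rewrite lee_fin.
    apply: ge0_le_integral.
    + exact: mI.
    + by move=> u _; exact: (K0 (q, u)).
    + by apply: measurable_funTS; exact: (measurableT_comp mK (pair1_measurable q)).
    + apply: measurable_funTS; apply: emeasurable_funM => //.
      exact: (@measurable_mark_mass_integrand _ y _ _ (fun=> q) id).
    + move=> u _; apply: (@le_trans _ _ ((mark_cst R)%:E * (C * tilt_norm ((q, u) :: y) ^+ 3)%:E)).
        by apply: lee_wpmul2l => //; exact: IH.
      by rewrite -!EFinM mulrCA.
rewrite (ge0_integralZl gamma measurableT mh (fun q _ => h0 q)) ?lee_fin//.
apply: (@le_trans _ _ (C%:E * (b * Num.sqrt (size y).+1%:R * tilt_norm y ^+ 3)%:E)).
  by apply: lee_wpmul2l; rewrite ?lee_fin//; exact: hb.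
rewrite -EFinM lee_fin le_eqVlt; apply/orP; left; apply/eqP.
rewrite big_ord_recl/= addn0 [(b ^+ n.+1)%R]exprS /C.
under [in RHS]eq_bigr do rewrite /bump/= add1n addnS -addSn.
ring.
Qed.

Lemma polaron_Z_lty : polaron_Z alpha T P < +oo.
Proof.
have [b b0 hb] := mark_mass_bound alpha0 T0.
have -> : polaron_Z alpha T P = \int[P]_w \sum_(n <oo) ((n`!%:R^-1)%R%:E * action w ^+ n).
  apply: eq_integral => w _; rewrite polaron_weight_action.
  by apply: expeR_nneseries; exact: action_ge0.
have f0 n w : 0 <= (n`!%:R^-1)%R%:E * action w ^+ n.
  by rewrite mule_ge0// lee_fin invr_ge0.
rewrite integral_nneseries; last 3 first.
- exact: measurableT.
- by move=> n; exact: emeasurable_funM (measurable_cst _) (measurable_action_exp n).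
- by move=> n w _; exact: f0.
apply: le_lt_trans (sqrt_fact_series b0).
apply: lee_nneseries => [n *|n *]; first by apply: integral_ge0 => w _; exact: f0.
rewrite (ge0_integralZl P measurableT (measurable_action_exp n) (fun w _ => exp0 n w)); last first.
  by rewrite lee_fin invr_ge0.
rewrite EFinM; apply: lee_wpmul2l; first by rewrite lee_fin invr_ge0.
have := action_moment_bound b0 hb n [::].
rewrite /action_moment /= expr1n mulr1.
under eq_integral do rewrite tilt3_mark_weight big_nil mul1e.
move=> /le_trans; apply; rewrite lee_fin ler_wpM2l ?exprn_ge0//.
(* From the empty listing the roots multiply to sqrt (n!). *)
rewrite le_eqVlt; apply/orP; left; apply/eqP; elim: n => [|n IH].
  by rewrite big_ord0 fact0 sqrtr1.
by rewrite big_ord_recr/= IH add0n factS mulnC natrM sqrtrM.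
Qed.

Lemma measurable_polaron_weight : measurable_fun setT (polaron_weight alpha T).
Proof.
rewrite (_ : polaron_weight alpha T = fun w => expeR (action w)).
  by apply: measurable_expeR; [exact: measurable_action|exact: action_ge0].
by apply/funext => w; exact: polaron_weight_action.
Qed.

Lemma polaron_Z_gt0 : 0 < polaron_Z alpha T P.
Proof.
apply: (@lt_le_trans _ _ (\int[P]_w 1)).
  rewrite integral_cst; last exact: measurableT.
  by rewrite mul1e [ltRHS]probability_setT.
apply: ge0_le_integral.
- exact: measurableT.
- by [].
- exact: measurable_cst.
- exact: measurable_polaron_weight.
- move=> w _; rewrite polaron_weight_action.
  by case: (action w) (action_ge0 T alpha0 w) => [r| |] //=; rewrite ?leey// lee_fin => r0;
    rewrite lee_fin -expR0 ler_expR.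
Qed.

End partition_function.

(** * The mixing measure *)

Section mixed_integral.
Context (R : realType).
Local Notation mark := (R * R * R)%type.
Local Notation mu := (@lebesgue_measure R).
Local Open Scope ereal_scope.
Implicit Types (f g : config mark -> \bar R) (xi : seq (R * R)).

(** Only listings over [xi] with positive marks are evaluated; this places the mixing law on
    [marked_collections]. *)
Lemma eq_mark_integral xi f g :
  (forall y : seq mark, [seq p.1 | p <- y] = xi -> (forall p, p \in y -> 0 < p.2)%R -> f y = g y) ->
  mark_integral xi f = mark_integral xi g.
Proof.
elim: xi f g => [|q xi IH] f g fg /=; first exact: fg.
apply: eq_integral => u; rewrite inE/= in_itv/= andbT => u0.
apply: IH => y yxi y0; apply: fg; first by rewrite /= yxi.
by move=> p; rewrite inE => /predU1P[->//|]; exact: y0.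
Qed.

Variable Gamma : probability (config (R * R)%type) R.

Definition mixed_integral f : \bar R := \int[Gamma]_xi mark_integral xi f.

Lemma mixed_integral_ge0 f : (forall y, 0 <= f y) -> 0 <= mixed_integral f.
Proof. by move=> f0; apply: integral_ge0 => xi _; exact: mark_integral_ge0. Qed.

Lemma mixed_integral_sum (I : Type) (s : seq I) (f_ : I -> config mark -> \bar R) :
  (forall i, measurable_fun setT (f_ i)) -> (forall i y, 0 <= f_ i y) ->
  mixed_integral (fun y => \sum_(i <- s) f_ i y) = \sum_(i <- s) mixed_integral (f_ i).
Proof.
move=> mf f0; rewrite /mixed_integral.
under eq_integral do rewrite mark_integral_sum//.
rewrite ge0_integral_sum//.
- by move=> i; exact: measurable_mark_integral.
- by move=> i xi _; exact: mark_integral_ge0.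
Qed.

Lemma mixed_integralD f g : measurable_fun setT f -> measurable_fun setT g ->
  (forall y, 0 <= f y) -> (forall y, 0 <= g y) ->
  mixed_integral (fun y => f y + g y) = mixed_integral f + mixed_integral g.
Proof.
move=> mf mg f0 g0; rewrite /mixed_integral.
under eq_integral do rewrite mark_integralD//.
apply: ge0_integralD => //.
- by move=> xi _; exact: mark_integral_ge0.
- exact: measurable_mark_integral.
- by move=> xi _; exact: mark_integral_ge0.
- exact: measurable_mark_integral.
Qed.

Lemma mixed_integralZl k f : 0 <= k -> measurable_fun setT f -> (forall y, 0 <= f y) ->
  mixed_integral (fun y => k * f y) = k * mixed_integral f.
Proof.
move=> k0 mf f0; rewrite /mixed_integral.
under eq_integral do rewrite mark_integralZl//.
apply: ge0_integralZl => //; first exact: measurable_mark_integral.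
by move=> xi _; exact: mark_integral_ge0.
Qed.

Lemma mixed_integral_lim (f_ : (config mark -> \bar R)^nat) :
  (forall n, measurable_fun setT (f_ n)) -> (forall n y, 0 <= f_ n y) ->
  (forall y, nondecreasing_seq (f_ ^~ y)) ->
  mixed_integral (fun y => limn (f_ ^~ y)) = limn (fun n => mixed_integral (f_ n)).
Proof.
move=> mf f0 ndf; rewrite /mixed_integral.
under eq_integral do rewrite mark_integral_lim//.
rewrite -monotone_convergence//.
- by move=> n; exact: measurable_mark_integral.
- by move=> n xi _; exact: mark_integral_ge0.
- by move=> xi _ m n mn; apply: le_mark_integral => // y; exact: ndf.
Qed.

Variable W : config mark -> \bar R.
Hypotheses (mW : measurable_fun setT W) (W0 : forall y, 0 <= W y).

Let mWI (B : set (config mark)) : measurable B ->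
  measurable_fun setT (fun y => W y * (\1_B y)%:E).
Proof.
move=> mB; apply: emeasurable_funM => //; apply/measurable_EFinP.
exact: measurable_indic.
Qed.

Let WI0 (B : set (config mark)) y : 0 <= W y * (\1_B y)%:E.
Proof. by rewrite mule_ge0// lee_fin. Qed.

Definition mixture of measurable_fun setT W & (forall y, 0 <= W y) :
    set (config mark) -> \bar R :=
  fun B => mixed_integral (fun y => W y * (\1_B y)%:E).

Let m := mixture mW W0.

Let m0 : m set0 = 0.
Proof.
rewrite /m /mixture /mixed_integral; apply: integral0_eq => xi _.
rewrite (_ : (fun y => _) = (fun y => 0 * (fun=> 0) y)); last first.
  by apply/funext => y; rewrite indic0 !mule0.
by rewrite mark_integralZl// mul0e.
Qed.

Let m_ge0 B : 0 <= m B. Proof. exact: mixed_integral_ge0. Qed.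

Let m_sigma_additive : semi_sigma_additive m.
Proof.
move=> F mF tF mUF.
have -> : m (\bigcup_n F n) = limn (fun n => \sum_(0 <= k < n) m (F k)).
  pose f_ n y := \sum_(0 <= k < n) W y * (\1_(F k) y)%:E.
  have mf n : measurable_fun setT (f_ n) by apply: emeasurable_sum => k; exact: mWI.
  have f0 n y : 0 <= f_ n y by apply: sume_ge0.
  have ndf y : nondecreasing_seq (f_ ^~ y).
    by apply: ereal_nondecreasing_series.
  transitivity (mixed_integral (fun y => limn (f_ ^~ y))).
    congr mixed_integral; apply/funext => y.
    (* The indicator of [B] at [y] is the Dirac mass at [y] of [B], whose additivity in [B] is
       known. *)
    have cd : \sum_(0 <= k < n) @dirac _ _ y R (F k) @[n --> \oo] --> @dirac _ _ y R (\bigcup_n F n).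
      exact: measure_semi_sigma_additive.
    have dE A : (\1_A y)%:E = @dirac _ _ y R A by rewrite /dirac.
    rewrite muleC dE -(cvg_lim _ cd)// -nondecreasing_limeMr//.
      apply/congr_lim/funext => n; rewrite ge0_sume_distrl//.
      by apply: eq_bigr => k _; rewrite muleC dE.
    + by move=> n; apply: sume_ge0.
    + by apply: ereal_nondecreasing_series.
  rewrite mixed_integral_lim//; apply/congr_lim/funext => n.
  by rewrite mixed_integral_sum// => k; exact: mWI.
by apply: is_cvg_nneseries => n _ _; exact: m_ge0.
Qed.

HB.instance Definition _ := isMeasure.Build _ _ _ m m0 m_ge0 m_sigma_additive.

Lemma ge0_integral_mixture g : measurable_fun setT g -> (forall y, 0 <= g y) ->
  \int[m]_y g y = mixed_integral (fun y => W y * g y).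
Proof.
move: g; apply: ge0_measurable_ind.
- by move=> A mA; rewrite integral_indic// setIT.
- move=> k f k0 mf f0 IH; rewrite ge0_integralZl//.
  rewrite IH -mixed_integralZl//; last by move=> y; rewrite mule_ge0.
    by congr mixed_integral; apply/funext => y; rewrite muleCA.
  exact: emeasurable_funM.
- move=> f g mf mg f0 g0 IHf IHg; rewrite ge0_integralD// IHf IHg -mixed_integralD//; last 4 first.
  + exact: emeasurable_funM.
  + exact: emeasurable_funM.
  + by move=> y; rewrite mule_ge0.
  + by move=> y; rewrite mule_ge0.
  by congr mixed_integral; apply/funext => y; rewrite ge0_muleDr.
- move=> f_ mf f0 ndf IH; rewrite monotone_convergence//.
  transitivity (limn (fun n => mixed_integral (fun y => W y * f_ n y))).
    by apply/congr_lim/funext => n; exact: IH.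
  rewrite -mixed_integral_lim//.
  + congr mixed_integral; apply/funext => y; rewrite muleC.
    rewrite -nondecreasing_limeMr//.
    by apply/congr_lim/funext => n; rewrite muleC.
  + by move=> n; exact: emeasurable_funM.
  + by move=> n y; rewrite mule_ge0.
  + by move=> y n k nk; apply: lee_wpmul2l => //; exact: ndf.
Qed.

End mixed_integral.

Lemma le_expeR (R : realType) (x y : \bar R) : (x <= y)%E -> (expeR x <= expeR y)%E.
Proof. by case: x y => [r| |] [s| |] //=; rewrite ?lee_fin ?ler_expR// ?leey// expR_ge0. Qed.

Lemma expeR_limn (R : realType) (a : (\bar R)^nat) : (forall n, 0 <= a n)%E ->
  nondecreasing_seq a -> expeR (limn a) = limn (fun n => expeR (a n)).
Proof.
move=> a0 nda; have ca := ereal_nondecreasing_is_cvgn nda.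
have nde : nondecreasing_seq (fun n => expeR (a n)) by move=> n k nk; apply: le_expeR; exact: nda.
have ce := ereal_nondecreasing_is_cvgn nde.
have an n : (a n <= limn a)%E by rewrite (cvg_lim _ (ereal_nondecreasing_cvgn nda))//;
    apply: ereal_sup_ubound; exists n.
case lE : (limn a) => [r| |].
- have afin n : a n = (fine (a n))%:E.
    by rewrite fineK// ge0_fin_numE// (le_lt_trans (an n))// lE ltry.
  have cr : fine (a n) @[n --> \oo] --> r.
    by apply: fine_cvg; rewrite -lE.
  apply: esym; apply: cvg_lim => //.
  rewrite (_ : (fun n => _) = (fun n => (expR (fine (a n)))%:E)).
    apply: cvg_EFin; first exact: nearW.
    by apply: continuous_cvg => //; exact: continuous_expR.
  by apply/funext => n; rewrite [in LHS]afin.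
- apply/esym/eqP; rewrite -leye_eq -lE; apply: lee_lim => //.
  by apply: nearW => n; apply: le_trans (expeR_ge1Dx _); rewrite leeDr.
- have := an 0%N; rewrite lE leeNy_eq => /eqP a0E; have := a0 0%N.
  by rewrite a0E.
Qed.

(** * The polaron weight as a mixture of tilts *)

Section polaron_mass.
Context (R : realType) (alpha T : R) (alpha0 : 0 < alpha).
Variables (P : probability (path3 R) R) (Gamma : probability (config (R * R)%type) R).
Hypothesis GP : poisson_process_law (polaron_intensity alpha T) Gamma.
Local Notation mark := (R * R * R)%type.
Local Notation mu := (@lebesgue_measure R).
Local Notation gamma := (intensity T alpha0).
Local Notation action := (action T alpha0).
Local Open Scope ereal_scope.

(** For Brownian [P] and measurable [A], the tilted law of [A] multiplied by [Phi P y]. *)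
Definition tilt_mass (A : set (path3 R)) (y : config mark) : \bar R :=
  \int[P]_(w in A) (tilt3 (fun=> y) w)%:E.

Lemma tilt_mass_ge0 A y : 0 <= tilt_mass A y.
Proof. by apply: integral_ge0 => w _; rewrite lee_fin ltW// tilt3_gt0. Qed.

Let measurable_prod_weight (h : path3 R -> mark -> R) :
  measurable_fun setT (fun z : path3 R * mark => h z.1 z.2) -> (forall w p, 0 <= h w p)%R ->
  measurable_fun setT (fun z : path3 R * config mark => (\prod_(p <- z.2) h z.1 p)%:E).
Proof.
move=> mh h0; apply/measurable_EFinP.
exact: (@measurable_prod_section _ mark _ (path3 R) R (fun z => h z.1 z.2) mh (fun z => h0 z.1 z.2)).
Qed.

Lemma measurable_tilt_mass A : measurable A -> measurable_fun setT (tilt_mass A).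
Proof.
move=> mA.
apply: (@measurable_fun_integral_param _ _ (config mark) (path3 R) R P A
  (fun z => (tilt3 (fun=> z.1) z.2)%:E)) => //; last first.
  by move=> z; rewrite lee_fin ltW// tilt3_gt0.
have h := measurable_prod_weight (@measurable_mark_weight R) (@mark_weight_ge0 R).
have h' := measurableT_comp h (measurable_fun_pair measurable_snd measurable_fst).
rewrite (_ : (fun z => _) = (fun z : config mark * path3 R => (\prod_(p <- z.1) mark_weight
    z.2 p)%:E)); first exact: h'.
by apply/funext => z; rewrite tilt3_mark_weight.
Qed.

(** Discarding the marks above [n] makes the energy of every pair finite and bounded, as
    [poisson_functional] requires. *)
Definition truncation (n : nat) (p : mark) : R := (mark_cst R * (p.2 <= n%:R)%R%:R)%R.

Lemma truncation_ge0 n p : (0 <= truncation n p)%R.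
Proof. by rewrite mulr_ge0// sqrtr_ge0. Qed.

Lemma measurable_truncation n : measurable_fun setT (truncation n).
Proof.
apply: measurable_funM => //.
rewrite (_ : (fun p => _) = fun p : mark => if (p.2 <= n%:R)%R then 1%R else 0%R).
  by apply: measurable_fun_ifT => //; apply: measurable_fun_ler.
by apply/funext => p; case: (p.2 <= n%:R)%R.
Qed.

Lemma truncation_nd p : nondecreasing_seq (truncation ^~ p).
Proof.
move=> n k nk; rewrite ler_wpM2l ?sqrtr_ge0// ler_nat.
case: (leP p.2 n%:R) => // pn; rewrite (le_trans pn)//.
by rewrite ler_nat.
Qed.

Let wt n w p := (mark_weight w p * truncation n p)%R.

Let wt0 n w p : (0 <= wt n w p)%R.
Proof. by rewrite mulr_ge0 ?mark_weight_ge0 ?truncation_ge0. Qed.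

Let mwt n : measurable_fun setT (fun z : path3 R * mark => wt n z.1 z.2).
Proof.
apply: measurable_funM; first exact: measurable_mark_weight.
exact: (measurableT_comp (measurable_truncation n) measurable_snd).
Qed.

Let mwt_section n w : measurable_fun setT (wt n w).
Proof.
have h := measurableT_comp (mwt n) (@pair1_measurable _ _ (path3 R) mark w).
exact: h.
Qed.

Let mark_weight_le1 (w : path3 R) (p : mark) : (mark_weight w p <= 1)%R.
Proof.
rewrite -[leRHS]expR0 ler_expR oppr_le0.
by rewrite divr_ge0// mulr_ge0 ?sqr_ge0.
Qed.

Let wt_le n w p : (wt n w p <= mark_cst R * (p.2 <= n%:R)%R%:R)%R.
Proof. by rewrite ler_piMl ?truncation_ge0. Qed.

Let wt_bounded n w : bounded_weight (wt n w).
Proof. by split; [exact: mwt_section|exact: wt0|exists (mark_cst R), n; exact: wt_le]. Qed.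

Let truncated_energy n w q := \int[mu]_(u in `]0%R, +oo[) (wt n w (q, u))%:E.

Let truncated_energy_fin n w q : truncated_energy n w q = (fine (truncated_energy n w q))%:E.
Proof.
have /andP[h0 hy] := integral_bounded_weight (wt_bounded n w) q.
by rewrite fineK// ge0_fin_numE.
Qed.

Let truncated_energy_ge0 n w q : 0 <= truncated_energy n w q.
Proof. by apply: integral_ge0 => u _; rewrite lee_fin. Qed.

Let truncated_energy_le n w q : truncated_energy n w q <= (mark_cst R * n%:R)%:E.
Proof.
have c0 : 0 <= (mark_cst R)%:E by rewrite lee_fin sqrtr_ge0.
have mI : measurable (`[0%R, n%:R]%classic : set R) by exact: measurable_itv.
apply: (@le_trans _ _ (\int[mu]_(u in `]0%R, +oo[) ((mark_cst R)%:E * (\1_`[0%R, n%:R]%classic u)%:E))).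
  apply: ge0_le_integral.
  - exact: measurable_itv.
  - by move=> u _; rewrite lee_fin.
  - apply: measurable_funTS; apply/measurable_EFinP.
    have h := measurableT_comp (mwt_section n w) (@pair1_measurable _ _ (R * R)%type R q).
    exact: h.
  - apply: measurable_funTS; apply: emeasurable_funM => //.
    by apply/measurable_EFinP; exact: measurable_indic.
  - move=> u; rewrite /= in_itv/= andbT => u0; rewrite -EFinM lee_fin indicE mem_setE in_itv/= (ltW u0).
    exact: wt_le.
rewrite ge0_integralZl//; last first.
  by apply: measurable_funTS; apply/measurable_EFinP; exact: measurable_indic.
rewrite integral_indic//.
rewrite EFinM; apply: lee_wpmul2l => //.
apply: (@le_trans _ _ (mu `[0%R, n%:R]%classic)).
  apply: le_measure; rewrite ?inE//.
  by apply: measurableI => //; exact: measurable_itv.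
by rewrite lebesgue_measure_itv/= lte_fin; case: ifP => _; rewrite ?sube0 ?lee_fin.
Qed.

Let menergy n : measurable_fun setT (fun z : path3 R * (R * R) => truncated_energy n z.1 z.2).
Proof.
apply: (@measurable_fun_integral_param _ _ (path3 R * (R * R))%type _ R mu _
  (fun z => (wt n z.1.1 (z.1.2, z.2))%:E)) => //; last by move=> z; rewrite lee_fin.
apply/measurable_EFinP; apply: measurable_funM.
  apply: measurable_mark_weight_comp; first exact: (measurableT_comp measurable_fst measurable_fst).
  by apply: measurable_fun_pair => //; exact: (measurableT_comp measurable_snd measurable_fst).
have mp : measurable_fun setT (fun z : (path3 R * (R * R)) * R => (z.1.2, z.2)).
  by apply: measurable_fun_pair => //; exact: (measurableT_comp measurable_snd measurable_fst).
exact: (measurableT_comp (measurable_truncation n) mp).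
Qed.

Let menergy_section n w : measurable_fun setT (truncated_energy n w).
Proof.
have h := measurableT_comp (menergy n) (@pair1_measurable _ _ (path3 R) (R * R)%type w).
exact: h.
Qed.

Let normalization : R := expR (fine (gamma setT)).

(** [poisson_functional] for the truncated energies, which are at most [mark_cst R * n%:R];
    [normalization] compensates the total mass in its exponent. *)
Let truncated_action n w : expeR (\int[gamma]_q truncated_energy n w q) =
  normalization%:E * \int[Gamma]_xi (\prod_(q <- xi) fine (truncated_energy n w q))%:E.
Proof.
have gT : gamma setT < +oo by rewrite -ge0_fin_numE ?measure_ge0// fin_num_measure.
have b q : (0 <= fine (truncated_energy n w q) <= mark_cst R * n%:R)%R.
  by rewrite fine_ge0//= -lee_fin -truncated_energy_fin truncated_energy_le.
have mf : measurable_fun setT (fun q => fine (truncated_energy n w q)) by exact: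
    measurableT_comp (menergy_section n w).
rewrite (poisson_functional gT GP mf b) /normalization -EFinM -expRD addrC subrK.
have -> : (fun q => (fine (truncated_energy n w q))%:E) = truncated_energy n w by
    apply/funext => q; rewrite -truncated_energy_fin.
have : (\int[gamma]_q truncated_energy n w q) \is a fin_num.
  rewrite ge0_fin_numE; last by apply: integral_ge0 => q _; exact: truncated_energy_ge0.
  apply: (@le_lt_trans _ _ (\int[gamma]_q (mark_cst R * n%:R)%:E)).
    apply: ge0_le_integral.
    - exact: measurableT.
    - by move=> q _; exact: truncated_energy_ge0.
    - exact: menergy_section.
    - exact: measurable_cst.
    - by move=> q _; exact: truncated_energy_le.
  rewrite integral_cst; last exact: measurableT.
  by rewrite ltey_eq fin_numM// ge0_fin_numE ?measure_ge0.
by move=> /fineK {1}<-.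
Qed.

(** The path integral is exchanged with that over configurations and then with that over marks; in
    between, the product of the truncated energies becomes a mark integral of a product of mark
    weights, which is the tilt. *)
Let truncated_mass n A : measurable A ->
  \int[P]_(w in A) expeR (\int[gamma]_q truncated_energy n w q) =
  normalization%:E * mixed_integral Gamma (fun y => (\prod_(p <- y) truncation n p)%:E * tilt_mass A y).
Proof.
move=> mA.
have N0 : 0 <= normalization%:E by rewrite lee_fin expR_ge0.
pose F (z : path3 R * config (R * R)%type) := (\prod_(q <- z.2) fine (truncated_energy n z.1 q))%:E.
have fe0 w q : (0 <= fine (truncated_energy n w q))%R by rewrite fine_ge0.
have F0 z : 0 <= F z by rewrite lee_fin prodr_ge0.
have mfe : measurable_fun setT (fun z : path3 R * (R * R) => fine (truncated_energy n z.1 z.2)).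
  by apply: (measurableT_comp _ (menergy n)).
have mF : measurable_fun setT F.
  apply/measurable_EFinP.
  exact: (@measurable_prod_section _ (R * R)%type _ (path3 R) R (fun z => fine (truncated_energy n z.1 z.2))
    mfe (fun z => fe0 z.1 z.2)).
transitivity (normalization%:E * \int[P]_(w in A) \int[Gamma]_(xi in setT) F (w, xi)).
  have mFG : measurable_fun setT (fun w => \int[Gamma]_xi F (w, xi)).
    exact: (@measurable_fun_integral_param _ _ (path3 R) (config (R * R)%type) R Gamma setT
        F measurableT mF F0).
  apply: etrans _ (ge0_integralZl P mA (measurable_funTS mFG) _ N0).
    by apply: eq_integral => w _; exact: truncated_action.
  by move=> w _; apply: integral_ge0 => xi _; exact: F0.
congr (_ * _).
rewrite (@tonelli_in _ _ (path3 R) (config (R * R)%type) R P Gamma A setT F mA measurableT mF F0).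
apply: eq_integral => xi _.
pose G (z : path3 R * config mark) := (\prod_(p <- z.2) wt n z.1 p)%:E.
have mG : measurable_fun setT G by exact: measurable_prod_weight.
have G0 z : 0 <= G z by rewrite lee_fin prodr_ge0.
transitivity (\int[P]_(w in A) mark_integral xi (fun y => G (w, y))).
  by apply: eq_integral => w _; rewrite /F /G (mark_integral_bounded_weight xi (wt_bounded n w)).
rewrite mark_integral_tonelli//; congr mark_integral; apply/funext => y.
rewrite /tilt_mass -ge0_integralZl//; last 3 first.
- by apply: measurable_funTS; apply/measurable_EFinP; exact: measurable_tilt3.
- by move=> w _; rewrite lee_fin ltW// tilt3_gt0.
- by rewrite lee_fin prodr_ge0// => p _; exact: truncation_ge0.
apply: eq_integral => w _; rewrite /G /= tilt3_mark_weight -EFinM -big_split/=.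
by congr (_%:E); apply: eq_bigr => p _; rewrite mulrC.
Qed.

Let truncation_near (p : mark) : \forall n \near \oo, truncation n p = mark_cst R.
Proof.
near=> n; rewrite /truncation (_ : (p.2 <= n%:R)%R = true) ?mulr1//.
by near: n; exact: nbhs_infty_ger.
Unshelve. all: by end_near. Qed.

Let prod_truncation_near (y : seq mark) :
  \forall n \near \oo, (\prod_(p <- y) truncation n p = mark_cst R ^+ size y)%R.
Proof.
elim: y => [|p y IH]; first by apply: nearW => n; rewrite big_nil.
near=> n; rewrite big_cons exprS; congr (_ * _)%R; near: n; last exact: IH.
exact: truncation_near.
Unshelve. all: by end_near. Qed.

Let prod_truncation_nd (y : seq mark) : nondecreasing_seq (fun n => \prod_(p <- y) truncation n p)%R.
Proof.
move=> n k nk; apply: ler_prod => p _; rewrite truncation_ge0/=; exact: truncation_nd.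
Qed.

Let truncated_energy_lim w q : limn (fun n => truncated_energy n w q) = pair_energy w q.
Proof.
rewrite pair_energyE /truncated_energy -monotone_convergence.
- apply: eq_integral => u _; apply: lim_near_cst => //.
  near=> n; congr (_%:E); rewrite /wt mulrC; congr (_ * _)%R.
  by near: n; exact: truncation_near.
- exact: measurable_itv.
- move=> n; apply: measurable_funTS; apply/measurable_EFinP.
  have h := measurableT_comp (mwt_section n w) (@pair1_measurable _ _ (R * R)%type R q).
  exact: h.
- by move=> n u _; rewrite lee_fin.
- by move=> u _ n k nk; rewrite lee_fin ler_wpM2l ?mark_weight_ge0//; exact: truncation_nd.
Unshelve. all: by end_near. Qed.

Let truncated_energy_nd w q : nondecreasing_seq (fun n => truncated_energy n w q).
Proof.
move=> n k nk; apply: ge0_le_integral.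
- exact: measurable_itv.
- by move=> u _; rewrite lee_fin.
- apply: measurable_funTS; apply/measurable_EFinP.
  have h := measurableT_comp (mwt_section n w) (@pair1_measurable _ _ (R * R)%type R q).
  exact: h.
- apply: measurable_funTS; apply/measurable_EFinP.
  have h := measurableT_comp (mwt_section k w) (@pair1_measurable _ _ (R * R)%type R q).
  exact: h.
- by move=> u _; rewrite lee_fin ler_wpM2l ?mark_weight_ge0//; exact: truncation_nd.
Qed.

Let action_nd w : nondecreasing_seq (fun n => \int[gamma]_q truncated_energy n w q).
Proof.
move=> n k nk; apply: ge0_le_integral.
- exact: measurableT.
- by move=> q _; exact: truncated_energy_ge0.
- exact: menergy_section.
- exact: menergy_section.
- by move=> q _; exact: truncated_energy_nd.
Qed.

Let action_lim w : limn (fun n => \int[gamma]_q truncated_energy n w q) = action w.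
Proof.
rewrite /action -monotone_convergence.
- by apply: eq_integral => q _; exact: truncated_energy_lim.
- exact: measurableT.
- by move=> n; exact: menergy_section.
- by move=> n q _; exact: truncated_energy_ge0.
- by move=> q _; exact: truncated_energy_nd.
Qed.

(** Monotone convergence in the cutoff on both sides. On a fixed listing the product of truncations
    is eventually [mark_cst R ^+ size y]. *)
Lemma polaron_mass A : measurable A ->
  \int[P]_(w in A) polaron_weight alpha T w =
  normalization%:E * mixed_integral Gamma (fun y => (mark_cst R ^+ size y)%:E * tilt_mass A y).
Proof.
move=> mA.
have N0 : 0 <= normalization%:E by rewrite lee_fin expR_ge0.
have a0 w n : 0 <= \int[gamma]_q truncated_energy n w q by apply: integral_ge0 => q _;
    exact: truncated_energy_ge0.
pose f n (y : config mark) := (\prod_(p <- y) truncation n p)%:E * tilt_mass A y.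
have f0 n y : 0 <= f n y.
  by apply: mule_ge0 (tilt_mass_ge0 _ _); rewrite lee_fin prodr_ge0// => p _; exact: truncation_ge0.
have mf n : measurable_fun setT (f n).
  apply: emeasurable_funM; last exact: measurable_tilt_mass.
  by apply/measurable_EFinP; apply: measurable_prod_config => //; [exact:
      measurable_truncation|exact: truncation_ge0].
have ndf y : nondecreasing_seq (f ^~ y).
  by move=> n k nk; apply: lee_wpmul2r; [exact: tilt_mass_ge0|rewrite lee_fin; exact: prod_truncation_nd].
have -> : (fun y => (mark_cst R ^+ size y)%:E * tilt_mass A y) = (fun y => limn (f ^~ y)).
  apply/funext => y; apply: esym; apply: lim_near_cst => //.
  near=> n; congr (_%:E * _); near: n; exact: prod_truncation_near.
rewrite mixed_integral_lim// muleC -nondecreasing_limeMr//; last 2 first.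
- by move=> n; exact: mixed_integral_ge0.
- move=> n k nk; apply: ge0_le_integral.
  + exact: measurableT.
  + by move=> xi _; exact: mark_integral_ge0.
  + exact: measurable_mark_integral.
  + exact: measurable_mark_integral.
  + by move=> xi _; apply: le_mark_integral => // y; exact: ndf.
transitivity (limn (fun n => \int[P]_(w in A) expeR (\int[gamma]_q truncated_energy n w q))); last first.
  by apply/congr_lim/funext => n; rewrite truncated_mass// muleC.
rewrite -monotone_convergence//.
- apply: eq_integral => w _; rewrite (polaron_weight_action T alpha0) -action_lim.
  exact: expeR_limn.
- move=> n; apply: measurable_funTS; apply: measurable_expeR => //.
  exact: (@measurable_fun_integral_param _ _ (path3 R) _ R gamma setT (fun z => truncated_energy n z.1 z.2)
    measurableT (menergy n) (fun z => truncated_energy_ge0 n z.1 z.2)).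
- by move=> n w _; exact: expeR_ge0.
- by move=> w _ n k nk; apply: le_expeR; exact: action_nd.
Unshelve. all: by end_near. Qed.

End polaron_mass.

(** * The points of the Poisson process are genuine intervals *)

Section poisson_support.
Context (R : realType) (alpha T : R) (alpha0 : 0 < alpha).
Variable Gamma : probability (config (R * R)%type) R.
Hypothesis GP : poisson_process_law (polaron_intensity alpha T) Gamma.
Local Open Scope ereal_scope.

Let bad : set (R * R) := [set q | (q.2 <= q.1)%R].

Let mbad : measurable bad.
Proof.
have h : measurable_fun setT (fun q : R * R => (q.2 <= q.1)%R) by exact: measurable_fun_ler.
have := h measurableT [set true] _; rewrite setTI.
move=> /(_ _); rewrite (_ : _ @^-1` _ = bad); first by apply.
by apply/seteqP; split.
Qed.

(** The pairs with [q.2 <= q.1] have intensity zero, so their number follows [poisson_prob] of rate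
    zero, the Dirac mass at 0. *)
Lemma poisson_ordered : {ae Gamma, forall xi : config (R * R)%type,
  forall q, q \in (xi : seq (R * R)) -> (q.1 < q.2)%R}.
Proof.
have GP1 := @GP 1%N (fun=> bad) (fun=> 0%N) (fun=> mbad).
have tr : trivIset [set: 'I_1] (fun=> bad).
  by apply/trivIsetP => i j _ _; rewrite !ord1 eqxx.
have bad0 : polaron_intensity alpha T bad = 0.
  rewrite /polaron_intensity; apply: integral0_eq => q /= qbad.
  by rewrite ltNge qbad andbF.
have G0 : Gamma [set xi : config (R * R)%type | npoints bad xi = 0%N] = 1.
  move: (GP1 tr); rewrite big_ord1 bad0 /= /poisson_prob ltxx diracE mem_set//= => <-.
  congr (Gamma _); apply/seteqP; split => [xi h i|xi h]; [exact: h|exact: (h ord0)].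
have mG : measurable [set xi : config (R * R)%type | npoints bad xi = 0%N].
  exact: measurable_npoints_set.
exists (~` [set xi : config (R * R)%type | npoints bad xi = 0%N]); split.
- exact: measurableC.
- rewrite probability_setC// G0 subee//.
- apply: subsetC => xi /= xi0 q qxi; rewrite ltNge; apply/negP => qb.
  have : has (mem bad) xi by apply/hasP; exists q => //; apply/mem_set.
  by rewrite has_count -/(npoints bad xi) xi0.
Qed.

End poisson_support.

Lemma mnormalizeE d (X : measurableType d) (R : realType) (mu : {measure set X -> \bar R})
    (Q : probability X R) (r : R) B : 0 < r -> mu setT = r%:E ->
  mnormalize mu Q B = (mu B * (r^-1)%:E)%E.
Proof. by move=> r0 h; rewrite /mnormalize h eqe gt_eqF. Qed.

(** * The mixing law and the mixture formula *)

Section mixing_measure.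
Context (R : realType) (alpha T : R) (alpha0 : 0 < alpha) (T0 : 0 < T).
Variables (P : probability (path3 R) R) (Gamma : probability (config (R * R)%type) R).
Hypotheses (BP : brownian_law P) (GP : poisson_process_law (polaron_intensity alpha T) Gamma).
Local Notation mark := (R * R * R)%type.
Local Open Scope ereal_scope.

Let e : R := expR (fine (polaron_intensity alpha T setT)).
Let Z := polaron_Z alpha T P.

Let e0 : (0 < e)%R. Proof. exact: expR_gt0. Qed.

Let Z_fin : Z = (fine Z)%:E.
Proof. by rewrite fineK// ge0_fin_numE ?ltW ?polaron_Z_gt0// polaron_Z_lty. Qed.

Let z0 : (0 < fine Z)%R.
Proof. by rewrite -lte_fin -Z_fin polaron_Z_gt0. Qed.

Let tilt_mass_setT y : tilt_mass P setT y = Phi P y.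
Proof. by apply: eq_integral => w _; rewrite tilt3_phi. Qed.

Let mPhi : measurable_fun setT (Phi P : config mark -> \bar R).
Proof.
rewrite (_ : Phi P = tilt_mass P setT); last by apply/funext => y; rewrite tilt_mass_setT.
exact: measurable_tilt_mass.
Qed.

Let mcst : measurable_fun setT (fun y : config mark => (mark_cst R ^+ size y)%:E).
Proof.
rewrite (_ : (fun y => _) = fun y : config mark => (\prod_(p <- y) mark_cst R)%:E).
  by apply/measurable_EFinP; apply: measurable_prod_config => // p; exact: sqrtr_ge0.
by apply/funext => y; rewrite big_const_seq count_predT iter_mulr_1.
Qed.

Let W (y : config mark) := (mark_cst R ^+ size y)%:E * Phi P y.

Let mW : measurable_fun setT W.
Proof. by apply: emeasurable_funM; [exact: mcst|exact: mPhi]. Qed.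

Let W0 y : 0 <= W y.
Proof.
apply: mule_ge0; first by rewrite lee_fin exprn_ge0// sqrtr_ge0.
by rewrite -tilt_mass_setT tilt_mass_ge0.
Qed.

Let m := mixture Gamma mW W0.

Let mass_mixture (A : set (path3 R)) : measurable A ->
  \int[P]_(w in A) polaron_weight alpha T w =
  e%:E * mixed_integral Gamma (fun y => (mark_cst R ^+ size y)%:E * tilt_mass P A y).
Proof. exact: (polaron_mass alpha0 P GP). Qed.

Let m_setT : m setT = (fine Z / e)%:E.
Proof.
have h := mass_mixture measurableT.
have mE : m setT = mixed_integral Gamma (fun y => (mark_cst R ^+ size y)%:E * tilt_mass P setT y).
  by congr mixed_integral; apply/funext => y; rewrite indicT mule1 tilt_mass_setT.
have ZE : Z = e%:E * m setT by rewrite mE -h.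
have e1 : (e^-1)%:E * e%:E = 1 :> \bar R by rewrite -EFinM mulVf ?gt_eqF.
by rewrite mulrC EFinM -Z_fin ZE muleA e1 mul1e.
Qed.

(** Normalization yields a probability by construction; the Dirac mass is the value in the
    degenerate cases, which [m_setT] excludes since [m] has the positive finite mass
    [fine Z / e]. *)
Definition mixing_law : probability (config mark) R :=
  mnormalize m (@dirac _ _ ([::] : config mark) R).

Lemma mixing_lawE B : mixing_law B = (e%:E / Z) * m B.
Proof.
apply: etrans (mnormalizeE _ _ (divr_gt0 z0 e0) m_setT) _; rewrite muleC Z_fin inver gt_eqF// -EFinM.
by rewrite invf_div.
Qed.

Lemma mixing_law_polaron_mixing B : mixing_law B = polaron_mixing alpha T P Gamma B.
Proof. exact: mixing_lawE. Qed.

Lemma measurable_marked : measurable (@marked_collections R : set (config mark)).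
Proof.
pose bad : set mark := [set p | ~ (p.1.1 < p.1.2 /\ 0 < p.2)%R].
have mbad : measurable bad.
  have -> : bad = (fun p => ~~ ((p.1.1 < p.1.2) && (0 < p.2))%R) @^-1` [set true].
    apply/seteqP; split => p /=.
      by move=> h; apply/negP => /andP.
    by move=> /negP h /andP.
  rewrite -[X in measurable X]setTI.
  have mb : measurable_fun setT (fun p : mark => ~~ ((p.1.1 < p.1.2) && (0 < p.2))%R).
    apply: measurable_neg; apply: measurable_and.
      apply: measurable_fun_ltr; first exact: (measurableT_comp measurable_fst measurable_fst).
      exact: (measurableT_comp measurable_snd measurable_fst).
    by apply: measurable_fun_ltr.
  exact: mb.
rewrite (_ : @marked_collections R = [set y : config mark | npoints bad y = 0%N]).
  exact: measurable_npoints_set.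
apply/seteqP; split => y /=.
  move=> yM; apply/eqP; rewrite -leqn0 leqNgt -has_count; apply/hasPn => p py.
  by apply/negP => /set_mem; apply; exact: yM.
move=> y0 p py; apply: contrapT => pb.
have : has (mem bad) y by apply/hasP; exists p => //; apply/mem_set.
by rewrite has_count -/(npoints bad y) y0.
Qed.

Lemma mixing_law_marked : mixing_law (@marked_collections R) = 1.
Proof.
have -> : mixing_law (@marked_collections R) = mixing_law setT; last exact: probability_setT.
rewrite !mixing_lawE; congr (_ * _); rewrite /m /mixture /mixed_integral.
have mf (B : set (config mark)) : measurable B -> measurable_fun setT (fun y => W y * (\1_B y)%:E).
  move=> mB; apply: emeasurable_funM => //; apply/measurable_EFinP; exact: measurable_indic.
have f0 (B : set (config mark)) y : 0 <= W y * (\1_B y)%:E by rewrite mule_ge0// lee_fin.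
apply: ge0_ae_eq_integral.
- exact: measurableT.
- by apply: measurable_mark_integral => //; apply: mf; exact: measurable_marked.
- by apply: measurable_mark_integral => //; exact: mf.
- by move=> xi _; apply: mark_integral_ge0.
- by move=> xi _; apply: mark_integral_ge0.
move: (poisson_ordered GP); rewrite /ae_eq; apply: filterS => xi ordered _.
apply: eq_mark_integral => y yxi y0; congr (_ * _%:E).
rewrite indicT indicE mem_set// => p py; split; last exact: y0.
by apply: ordered; rewrite -yxi; apply/mapP; exists p.
Qed.

Let bP (y : config mark) : probability (path3 R) R := tilted_law y BP.

Let bPE y A : measurable A -> bP y A = tilt_mass P A y * ((tilt_norm y ^+ 3)^-1)%:E.
Proof.
move=> mA; apply: etrans (tilted_lawE BP y A) _; rewrite /tilt_mass /tilt_density.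
under eq_integral do rewrite EFinM.
apply: ge0_integralZr => //.
- by apply: measurable_funTS; apply/measurable_EFinP; exact: measurable_tilt3.
- by move=> w _; rewrite lee_fin ltW// tilt3_gt0.
- by rewrite lee_fin invr_ge0 exprn_ge0// ltW// tilt_norm_gt0.
Qed.

Let mbP A : measurable A -> measurable_fun setT (fun y => bP y A).
Proof.
move=> mA.
(* [tilt_norm] is computed along the listing; its cube is [Phi], already known to be measurable on
   configurations. *)
rewrite (_ : (fun y => _) = fun y : config mark => tilt_mass P A y * ((fine (Phi P y)) `^ (-1))%:E).
  apply: emeasurable_funM; first exact: measurable_tilt_mass.
  apply/measurable_EFinP.
  apply: (measurableT_comp (@measurable_powR R (-1))).
  exact: measurableT_comp.
apply/funext => y; rewrite bPE// (Phi_tilt_norm BP) powR_inv1//= exprn_ge0//.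
by rewrite ltW// tilt_norm_gt0.
Qed.

(** The factor [Phi] in the density of the mixing law cancels the normalization of the tilted law,
    leaving the unnormalized mixture of [polaron_mass]. *)
Lemma polaron_mixture A : measurable A -> polaron alpha T P A =
  \int[mixing_law]_(y in @marked_collections R) tilted_law y BP A.
Proof.
move=> mA.
have bP0 y : 0 <= bP y A by exact: measure_ge0.
transitivity (\int[mixing_law]_y bP y A); last first.
  (* The mixing law charges only [marked_collections], so the integral may be taken over all
     configurations. *)
  have N0 : mixing_law (~` (@marked_collections R)) = 0.
    rewrite probability_setC; last exact: measurable_marked.
    by rewrite [X in 1 - X]mixing_law_marked subee.
  rewrite (@ge0_negligible_integral _ _ _ mixing_law setT _ _ (measurableC
      measurable_marked) measurableT (mbP mA) _ N0)//.
  by rewrite setTD setCK.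
have k0 : (0 <= e / fine Z)%R by rewrite divr_ge0// ltW.
have kZ : (e / fine Z)%:E = e%:E / Z by rewrite EFinM {2}Z_fin inver gt_eqF.
transitivity (\int[mscale (NngNum k0) [the {measure set _ -> \bar R} of m]]_y bP y A); last first.
  apply: eq_measure_integral => B mB _; apply: etrans (esym _) (esym (mixing_lawE B)); rewrite /mscale/=.
  by rewrite -kZ.
rewrite ge0_integral_mscale//; last exact: mbP.
rewrite [X in _ * X](ge0_integral_mixture Gamma mW W0 (mbP mA) bP0) /=.
have -> : (fun y => W y * bP y A) = (fun y => (mark_cst R ^+ size y)%:E * tilt_mass P A y).
  apply/funext => y; rewrite bPE// /W (Phi_tilt_norm BP) -muleA; congr (_ * _).
  rewrite muleCA -EFinM divff ?mule1//.
  by rewrite gt_eqF// exprn_gt0// tilt_norm_gt0.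
rewrite /polaron mass_mixture// -/Z Z_fin inver gt_eqF// muleA -EFinM mulrC.
by [].
Qed.

End mixing_measure.

Theorem theorem3p1 (R : realType) (alpha T : R)
    (P : probability (path3 R) R) (Gamma : probability (config (R * R)%type) R)
    (alpha_gt0 : 0 < alpha) (T_gt0 : 0 < T)
    (P_brownian : brownian_law P)
    (Gamma_poisson : poisson_process_law (polaron_intensity alpha T) Gamma) :
  exists hTheta : probability (config (R * R * R)%type) R,
    [/\ hTheta (@marked_collections R) = 1%E,
        (forall B : set (config (R * R * R)%type), measurable B ->
          hTheta B = polaron_mixing alpha T P Gamma B) &
        exists bP : config (R * R * R)%type -> probability (path3 R) R,
          (forall y, marked_collections y -> gaussian_law3 y (bP y)) /\
          (forall A : set (path3 R),
            <<s increment_events3 `[- T, T]%classic >> A ->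
            polaron alpha T P A =
              (\int[hTheta]_(y in @marked_collections R) bP y A)%E)].
Proof.
exists (mixing_law P Gamma); split.
- exact: (mixing_law_marked alpha_gt0 T_gt0 P_brownian Gamma_poisson).
- by move=> B _; exact: (mixing_law_polaron_mixing alpha_gt0 T_gt0 P_brownian Gamma_poisson).
- exists (fun y => tilted_law y P_brownian); split.
    by move=> y _; exact: gaussian_law3_tilted.
  move=> A sA; apply: (polaron_mixture alpha_gt0 T_gt0 P_brownian Gamma_poisson).
  (* The mixture formula holds on the sigma-field of all increments, which contains that of the
     increments over [[- T, T]]. *)
  suff : <<s increment_events3 [set: R] >> A by [].
  apply: (sub_smallest2r _ _ sA); first exact: smallest_sigma_algebra.
  move=> _ [i [_ [s [t [B [_ _ st mB ->]]]] ->]].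
  by exists i; exists [set w : continuousType R R | B (w t - w s)] => //; exists s, t, B; split.
Qed.
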